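(* Let $R$ be a polygonal region with a rhombus tiling $\mathbb T$, with data $N$, $B_1,\dots,B_N$, $v_1,\dots,v_{2N}$, $\Lambda^R$, $\tau_R$, $f^{\rm elec}_R$ as in the context, and let $\theta\in\mathbb R^{2N}$ be an $f^{\rm elec}_R$-admissible tuple with $v_p=\exp(-2i\theta_p)$ for all $p\in[2N]$. Let $X=\mathrm{Meas}(f^{\rm elec}_R,\theta)\in\mathrm{Gr}_{\ge0}(N+1,2N)$ and $O=\{1,3,\dots,2N-1\}$. Then there is a constant $c\ne0$ such that for all $p\ne q\in[N]$, $\Delta_{O\cup\{2p\}}(X)=c$ and $\Delta_{(O\setminus\{2q-1\})\cup\{2p-2,2p\}}(X)=c\,\Lambda^R_{p,q}$, where $2p-2$ is read modulo $2N$ (so it equals $2N$ when $p=1$). (That is, $X$ is the image of $\Lambda^R$ under Lam's embedding of response matrices into $\mathrm{Gr}_{\ge0}(N+1,2N)$.)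
   Context: Rhombus tilings and electrical networks: $R$ is a polygonal region in the plane tiled by a rhombus tiling $\mathbb T$ with all sides of length 1; the vertices of $\mathbb T$ are colored black and white bipartitely. $G_{\mathbb T}$ is the graph whose vertices are the black vertices of $\mathbb T$ and whose edges are the diagonals $AC$ of rhombi $ABCD$ with $A,C$ black; this edge is a resistor of resistance $|AC|/|BD|$. The black vertices on the boundary of $R$ are $B_1,\dots,B_N$ in clockwise order, and $v_1,\dots,v_{2N}\in\mathbb C$ are the unit vectors traversing the sides of $R$ in clockwise order, labeled so that $B_p$ is incident to the sides $v_{2p-1},v_{2p}$. Applying voltage 1 at $B_p$ and 0 at the other boundary vertices, and solving by Ohm's and Kirchhoff's laws, $\Lambda^R_{p,q}$ is the current flowing out of the network at $B_q$ (so $\Lambda^R_{p,q}\ge0$ for $p\ne q$); $\Lambda^R$ depends only on $R$. Pairing: for $p\in[2N]$, take the rhombus containing side $v_p$, its opposite side, the other rhombus containing that side, its opposite side, etc.; this chain of parallel segments ends at a boundary side $v_q$, and $\tau_R(p):=q$ (a fixed-point-free involution of $[2N]$). $f^{\rm elec}_R$ is the unique loopless $(N+1,2N)$-bounded affine permutation with $\bar f^{\rm elec}_R(p)\equiv\tau_R(p+1)\pmod{2N}$ ($p+1$ read mod $2N$). General definitions: $\mathrm{Gr}(k,n)$, Plücker coordinates $\Delta_I$ (up to common scalar), $\mathrm{Gr}_{\ge0}(k,n)$ as usual. A $(k,n)$-bounded affine permutation is a bijection $f:\mathbb Z\to\mathbb Z$ with $f(j+n)=f(j)+n$, $j\le f(j)\le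 j+n$, $\sum_{j=1}^n(f(j)-j)=kn$; loopless if $f(p)>p$; $\bar f(p)\equiv f(p)$ mod $n$; $\ell(f)=\#\{(s,t)\in[n]\times\mathbb Z: s<t, f(s)>f(t)\}$. Reduced graphs: planar bipartite graph $G$ in a disk with black degree-1 boundary vertices $b_1,\dots,b_n$ clockwise, having an almost perfect matching (edges covering each interior vertex once and some boundary vertices), each component containing a boundary vertex, interior leaves adjacent to the boundary. Strands turn maximally right at black and left at white vertices; if the strand from $b_p$ ends at $b_{p'}$, $f_G(p)$ is the integer in $\{p+1,\dots,p+n\}$ congruent to $p'$, extended $n$-periodically; $k$ is the common number of boundary vertices used by almost perfect matchings; $G$ is reduced if it has $k(n-k)+1-\ell(f_G)$ faces; $\mathcal G_{\rm red}(f)$ the reduced graphs with $f_G=f$. Edge $e$ is labeled $\{p,q\}$ if the strands through it end at $b_p,b_q$. $\Delta_I(G,\mathrm{wt})=\sum_{A:\ \text{used boundary set}=I}\prod_{e\in A}\mathrm{wt}(e)$; $\mathrm{Meas}(G,\mathrm{wt})$ the point with these coordinates. Strand diagram: $b_1,\dots,b_n$ clockwise on a circle, $p^-$ just before and $p^+$ just after $b_p$; arrows $S_p:s^+\to p^-$ with $s=\bar f^{-1}(p)$; $p,q$ form an $f$-crossing if $S_p,S_q$ intersect; $\theta$ is $f$-admissible if $\theta_p<\theta_q<\theta_p+\pi$ for all $f$-crossing $p<q$. $\mathrm{wt}_\theta(e)=\sin(\theta_q-\theta_p)$ for $e$ labeled $\{p,q\}$, $p<q$, not incident to the boundary, and 1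 for boundary edges; for $f$-admissible $\theta$, $\mathrm{Meas}(f,\theta):=\mathrm{Meas}(G,\mathrm{wt}_\theta)\in\mathrm{Gr}_{\ge0}(k,n)$ is independent of $G\in\mathcal G_{\rm red}(f)$. *)

(* Defs.v *)
From HB Require Import structures.
From mathcomp Require Import all_boot all_order all_algebra.
From mathcomp Require Import all_classical all_reals all_analysis.
Set Implicit Arguments. Unset Strict Implicit. Unset Printing Implicit Defensive.
Import Order.TTheory GRing.Theory Num.Theory numFieldNormedType.Exports.
Local Open Scope ring_scope.
Local Open Scope classical_set_scope.

(* Part 1. Plane geometry: points of C = R^2 are pairs (Re z, Im z).      *)
Section Geometry.
Variable R : realType.

Local Notation pt := (R * R)%type.
Definition padd (x y : pt) : pt := (x.1 + y.1, x.2 + y.2).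
Definition psub (x y : pt) : pt := (x.1 - y.1, x.2 - y.2).
Definition pscale (s : R) (x : pt) : pt := (s * x.1, s * x.2).
Definition pnorm (x : pt) : R := Num.sqrt (x.1 ^+ 2 + x.2 ^+ 2).
Definition pcross (x y : pt) : R := x.1 * y.2 - x.2 * y.1.

Definition segment (x y : pt) : set pt :=
  [set z | exists s : R, 0 <= s <= 1 /\ z = padd x (pscale s (psub y x))].

Definition tboundary (A : set pt) : set pt := closure A `\` interior A.

(* A rhombus tile (P, a, b): corners P, P+a, P+a+b, P+b (a, b unit vectors). *)
Definition tile := (pt * pt * pt)%type.
Definition tP (t : tile) : pt := t.1.1.
Definition ta (t : tile) : pt := t.1.2.
Definition tb (t : tile) : pt := t.2.
Definition corner0 t := tP t.
Definition corner1 t := padd (tP t) (ta t).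
Definition corner2 t := padd (tP t) (padd (ta t) (tb t)).
Definition corner3 t := padd (tP t) (tb t).
Definition is_corner t (x : pt) :=
  [|| x == corner0 t, x == corner1 t, x == corner2 t | x == corner3 t].

Definition rhombus_set (t : tile) : set pt :=
  [set z | exists s u : R, 0 <= s <= 1 /\ 0 <= u <= 1 /\
     z = padd (tP t) (padd (pscale s (ta t)) (pscale u (tb t)))].

(* boundary polygon: w_0 = z0, w_k = w_{k-1} + v_k  (v indexed from 1) *)
Fixpoint wpt (z0 : pt) (v : nat -> pt) (k : nat) : pt :=
  if k is k'.+1 then padd (wpt z0 v k') (v k) else z0.

Definition side z0 v (p : nat) : pt * pt := (wpt z0 v p.-1, wpt z0 v p).

(* B_p = w_{2p-1}: the endpoint of v_{2p-1} and start of v_{2p} *)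
Definition Bvert z0 v (p : nat) : pt := wpt z0 v (2 * p).-1.

(* A rhombus tiling (with all sides of length 1) of the polygonal region whose
   boundary is traversed clockwise by the unit vectors v_1, ..., v_{2N}
   starting at z0, together with a bipartite colouring (true = black) in which
   B_1, ..., B_N are black. The region R is the union of the tiles. *)
Definition rhombus_tiling (N : nat) (z0 : pt) (v : nat -> pt)
    (nT : nat) (tiles : 'I_nT -> tile) (col : pt -> bool) : Prop :=
  let n := (2 * N)%N in
  [/\
      (forall p, (1 <= p <= n)%N -> pnorm (v p) = 1),
      wpt z0 v n = z0,
      (forall k l, (1 <= k)%N -> (k < l)%N -> (l <= n)%N ->
         if (l == k.+1) then
           segment (wpt z0 v k.-1) (wpt z0 v k) `&` segment (wpt z0 v l.-1) (wpt z0 v l)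
             = [set wpt z0 v k]
         else if (k == 1%N) && (l == n) then
           segment (wpt z0 v k.-1) (wpt z0 v k) `&` segment (wpt z0 v l.-1) (wpt z0 v l)
             = [set wpt z0 v 0]
         else
           segment (wpt z0 v k.-1) (wpt z0 v k) `&` segment (wpt z0 v l.-1) (wpt z0 v l)
             = set0),
      (* clockwise orientation: negative signed area *)
      \sum_(1 <= k < n.+1) pcross (wpt z0 v k.-1) (wpt z0 v k) < 0 &
   [/\
      (forall i, pnorm (ta (tiles i)) = 1 /\ pnorm (tb (tiles i)) = 1 /\
                 pcross (ta (tiles i)) (tb (tiles i)) != 0),
      (forall i j, i != j ->
         interior (rhombus_set (tiles i)) `&` interior (rhombus_set (tiles j)) = set0),
      tboundary (\bigcup_(i in [set: 'I_nT]) rhombus_set (tiles i))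
        = \bigcup_(k in [set k : nat | (1 <= k <= n)%N])
            segment (wpt z0 v k.-1) (wpt z0 v k),
      (forall i, let t := tiles i in
         [/\ col (corner0 t) = col (corner2 t), col (corner1 t) = col (corner3 t)
           & col (corner0 t) != col (corner1 t)]) &
      (forall p, (1 <= p <= N)%N -> col (Bvert z0 v p))]].

Definition bdiag (col : pt -> bool) (t : tile) : pt * pt :=
  if col (corner0 t) then (corner0 t, corner2 t) else (corner1 t, corner3 t).
(* conductance = 1 / resistance = |BD| / |AC| *)
Definition conductance (col : pt -> bool) (t : tile) : R :=
  if col (corner0 t) then pnorm (psub (ta t) (tb t)) / pnorm (padd (ta t) (tb t))
  else pnorm (padd (ta t) (tb t)) / pnorm (psub (ta t) (tb t)).

Definition inflow nT (tiles : 'I_nT -> tile) col (u : pt -> R) (x : pt) : R :=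
  \sum_(i < nT | (bdiag col (tiles i)).1 == x)
      conductance col (tiles i) * (u (bdiag col (tiles i)).2 - u x)
  + \sum_(i < nT | (bdiag col (tiles i)).2 == x)
      conductance col (tiles i) * (u (bdiag col (tiles i)).1 - u x).

Definition potential (N : nat) (z0 : pt) (v : nat -> pt) nT (tiles : 'I_nT -> tile) (col : pt -> bool) (p : nat) (u : pt -> R) :=
  (forall q, (1 <= q <= N)%N -> u (Bvert z0 v q) = (q == p)%:R) /\
  (forall x, (exists i, is_corner (tiles i) x) -> col x ->
     (forall q, (1 <= q <= N)%N -> x != Bvert z0 v q) ->
     inflow tiles col u x = 0).

Definition current_out (z0 : pt) (v : nat -> pt) nT (tiles : 'I_nT -> tile) (col : pt -> bool) (u : pt -> R) (q : nat) :=
  inflow tiles col u (Bvert z0 v q).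

Definition seg_eq (s s' : pt * pt) : bool := (s == s') || (s == (s'.2, s'.1)).

Definition opp_sides (t : tile) (s s' : pt * pt) : bool :=
  let s1 := (corner0 t, corner1 t) in let s1' := (corner3 t, corner2 t) in
  let s2 := (corner0 t, corner3 t) in let s2' := (corner1 t, corner2 t) in
  [|| seg_eq s s1 && seg_eq s' s1', seg_eq s s1' && seg_eq s' s1,
      seg_eq s s2 && seg_eq s' s2' | seg_eq s s2' && seg_eq s' s2].

Definition chain_pairs (z0 : pt) (v : nat -> pt) nT (tiles : 'I_nT -> tile) (p q : nat) : Prop :=
  exists (m : nat) (tt : nat -> 'I_nT) (ss : nat -> pt * pt),
    [/\ (0 < m)%N, ss 0%N = side z0 v p,
        (forall i, (i < m)%N -> opp_sides (tiles (tt i)) (ss i) (ss i.+1)),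
        (forall i, (i.+1 < m)%N -> tt i != tt i.+1) &
        seg_eq (ss m) (side z0 v q)].

Definition is_pairing (N : nat) (z0 : pt) (v : nat -> pt) nT (tiles : 'I_nT -> tile) (tau : nat -> nat) : Prop :=
  forall p, (1 <= p <= 2 * N)%N ->
    (1 <= tau p <= 2 * N)%N /\ chain_pairs z0 v tiles p (tau p).

End Geometry.

(* From an endpoint map g : [n] -> [n] (1-based, g p = the residue of f(p)),
   the loopless bounded affine permutation f with f(p) in {p+1,...,p+n},
   f(p) = g(p) mod n, extended n-periodically (for j >= 1). *)
Definition aff_of (n : nat) (g : nat -> nat) (j : nat) : nat :=
  let p := (j.-1 %% n).+1 in let m := (j.-1 %/ n)%N in
  ((if (p < g p)%N then g p else g p + n) + m * n)%N.

(* ell(f) = #{(s,t) in [n] x Z : s < t, f(s) > f(t)}; only t < s+n contribute *)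
Definition aff_length (n : nat) (f : nat -> nat) : nat :=
  (\sum_(1 <= s < n.+1) \sum_(s.+1 <= t < s + n) (f t < f s : nat))%N.

(* positions on the circle of the points p^- , b_p, p^+  (modulo 3n) *)
Definition pos_minus (n p : nat) : nat := (3 * p).-1.
Definition pos_plus (n p : nat) : nat := ((3 * p).+1 %% (3 * n))%N.
Definition cbetween (n a b x : nat) : bool :=
  (((x + 3 * n - a) %% (3 * n)) < ((b + 3 * n - a) %% (3 * n)))%N.
Definition chords_cross (n a b c d : nat) : bool :=
  cbetween n a b c != cbetween n a b d.

(* p, q form an f-crossing: the arrows S_p : s^+ -> p^- (with g s = p) and
   S_q : s'^+ -> q^- (with g s' = q) intersect *)
Definition f_crossing (n : nat) (g : nat -> nat) (p q : nat) : Prop :=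
  exists s s', [/\ (1 <= s <= n)%N, (1 <= s' <= n)%N, g s = p, g s' = q &
     chords_cross n (pos_plus n s) (pos_minus n p) (pos_plus n s') (pos_minus n q)].

Definition admissible (R : realType) (n : nat) (g : nat -> nat) (theta : nat -> R) :=
  forall p q, (1 <= p)%N -> (p < q)%N -> (q <= n)%N -> f_crossing n g p q ->
    theta p < theta q < theta p + pi.

(* Every edge joins a black endpoint peB e and a white endpoint peW e.
   prB e (resp. prW e) is the next edge clockwise around peB e (resp. peW e).
   pbnd i is the boundary vertex b_(i+1); pbedge i is its unique edge.     *)
Record plabic (n : nat) := Plabic {
  pV : finType; pE : finType;
  pblack : pV -> bool;
  pbnd : 'I_n -> pV;
  pbedge : 'I_n -> pE;
  peB : pE -> pV; peW : pE -> pV;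
  prB : pE -> pE; prW : pE -> pE }.

Section Plabic.
Variables (n : nat) (G : plabic n).

Definition is_bnd (x : pV G) : bool := [exists i, pbnd G i == x].
Definition incident (x : pV G) (e : pE G) : bool := (peB e == x) || (peW e == x).
Definition adjacent : rel (pV G) :=
  fun x y => [exists e, ((peB e == x) && (peW e == y)) || ((peW e == x) && (peB e == y))].

(* A covers every interior vertex exactly once (boundary vertices, having
   degree 1, are automatically covered at most once) *)
Definition almost_perfect (A : {set pE G}) : bool :=
  [forall x, ~~ is_bnd x ==> (#|[set e in A | incident x e]| == 1%N)].

Definition used_bnd (A : {set pE G}) : {set 'I_n} := [set i | pbedge G i \in A].

(* darts of G together with the boundary circle: graph darts (e, true) from
   black to white, (e, false) from white to black; arc darts (i, true) from
   b_(i+1) to b_(i+2), (i, false) reversed (indices mod n). *)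
Definition dart := ((pE G * bool) + ('I_n * bool))%type.

Definition bnd_index (x : pV G) : option 'I_n := [pick i | pbnd G i == x].

(* clockwise rotation of darts around their tail *)
Definition dsigma (d : dart) : dart :=
  match d with
  | inl (e, true) =>
      if bnd_index (peB e) is Some i then inr (ord_pred i, false)
      else inl (prB e, true)
  | inl (e, false) => inl (prW e, false)
  | inr (i, true) => inl (pbedge G i, true)
  | inr (i, false) => inr (ordS i, true)
  end.
Definition dalpha (d : dart) : dart :=
  match d with inl (e, b) => inl (e, ~~ b) | inr (i, b) => inr (i, ~~ b) end.
Definition dphi (d : dart) : dart := dsigma (dalpha d).

Definition sphere_faces : nat := fcard dphi (mem predT).
(* faces of G in the disk (the outer face of the boundary circle removed) *)
Definition nfaces : nat := (sphere_faces).-1.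

Definition plabic_ok : Prop :=
  [/\ (0 < n)%N,
      (forall e : pE G, pblack (peB e) /\ ~~ pblack (peW e)),
      injective (pbnd G) /\ (forall i, pblack (pbnd G i)) &
      (forall i e, (peB e == pbnd G i) = (e == pbedge G i))] /\
  [/\ (injective (@prB n G) /\ (forall e : pE G, peB (prB e) = peB e) /\
       forall e e' : pE G, peB e = peB e' -> exists k, iter k (@prB n G) e = e'),
      (injective (@prW n G) /\ (forall e : pE G, peW (prW e) = peW e) /\
       forall e e' : pE G, peW e = peW e' -> exists k, iter k (@prW n G) e = e') &
      (forall x, ~~ is_bnd x -> #|[set e | incident x e]| = 1%N ->
         forall y, adjacent x y -> is_bnd y)] /\
  [/\
      (forall x, exists i, connect adjacent x (pbnd G i)),
      (exists A, almost_perfect A) &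
      (* planarity in the disk: Euler's formula for graph + boundary circle *)
      (#|pV G| + sphere_faces = #|pE G| + n + 2)%N].

(* strands: from an edge e traversed black -> white, go to prW e (turn
   maximally left at the white vertex), traversed white -> black; at the black
   vertex turn maximally right: the next edge counterclockwise *)
Definition snext (e : pE G) : pE G := finv (@prB n G) (prW e).
Definition sedge (s : 'I_n) (j : nat) : pE G := iter j snext (pbedge G s).
Definition not_ended (s : 'I_n) (j : nat) : Prop :=
  forall i, (i < j)%N -> ~~ is_bnd (peB (prW (sedge s i))).

Definition strand_end (s q : 'I_n) : Prop :=
  exists j, not_ended s j /\ peB (prW (sedge s j)) = pbnd G q.

Definition through_bw (e : pE G) (q : 'I_n) : Prop :=
  exists s j, [/\ not_ended s j, e = sedge s j & strand_end s q].
Definition through_wb (e : pE G) (q : 'I_n) : Prop :=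
  exists s j, [/\ not_ended s j, e = prW (sedge s j) & strand_end s q].

(* G is reduced, with k boundary vertices used by almost perfect matchings,
   and strand permutation f *)
Definition reduced (k : nat) (f : nat -> nat) : Prop :=
  (forall A, almost_perfect A -> #|used_bnd A| = k) /\
  (nfaces%:Z = (k * (n - k))%N%:Z + 1 - (aff_length n f)%:Z)%R.

(* the edge weights wt_theta (labels 1-based: b_(i+1) has label i+1) *)
Definition wt_theta (R : realType) (theta : nat -> R) (wt : pE G -> R) : Prop :=
  forall e : pE G,
    (is_bnd (peB e) -> wt e = 1) /\
    (~~ is_bnd (peB e) -> forall p q : 'I_n, through_bw e p -> through_wb e q ->
       wt e = sin (theta (maxn p q).+1 - theta (minn p q).+1)).

Definition Delta (R : realType) (wt : pE G -> R) (I : {set 'I_n}) : R :=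
  \sum_(A : {set pE G} | almost_perfect A && (used_bnd A == I)) \prod_(e in A) wt e.

End Plabic.

Definition lset (n : nat) (P : nat -> bool) : {set 'I_n} := [set i : 'I_n | P i.+1].

(* Main.v *)
(* The strand labels of G give kernel vectors with entries prod sin(phi - theta_p)
   of a signed Kasteleyn matrix, hence linear relations between the Plucker
   coordinates. On the tiling, the same products are discrete holomorphic functions
   for the conductances tan(theta_p - theta_q), so their boundary values at the
   black vertices are voltages with known currents. After perturbing theta so that
   N+1 of these functions are independent, they determine both sides up to a common
   factor, and the perturbation tends to 0; the factor is nonzero because every
   coordinate is bounded by a multiple of the one at O together with 2p. *)
Require Import Defs.
From HB Require Import structures.
From mathcomp Require Import all_boot all_order all_algebra.
From mathcomp Require Import all_classical all_reals all_analysis.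
From mathcomp Require Import fingroup perm.
From mathcomp Require Import ring lra zify.
Set Implicit Arguments. Unset Strict Implicit. Unset Printing Implicit Defensive.
Import Order.TTheory GRing.Theory Num.Theory.
Local Open Scope ring_scope.

(** It enters as Euler's formula, which makes a cellular complex exact, so that a conserved flow on
    edges is a difference of values on faces. Reducedness is only a count of faces; comparing it
    with the signed number of strand crossings forces the labels to increase cyclically around every
    interior vertex, and this local form yields the Kasteleyn signs. The tiling is only a set of
    rhombi whose union has the polygon as boundary, so edge-to-edge contact and simple connectivity
    must be derived. The latter uses the plabic graph: its boundary angles are at most pi, and this
    turns Euler's inequality for the tiling into an equality. The vectors v_p fix theta only modulo
    pi; admissibility and the interlacing of chains pin the difference for paired sides to exactly
    pi/2. The perturbation moves theta but not the tiling, of which only the combinatorics of chains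
    is kept, with tangents as conductances. Since the perturbed voltages are not shown to converge,
    the limit is controlled through Green's identity for two different networks. *)

Local Notation bnde e := (is_bnd (peB e)).
Local Notation ind b := ((b%N : nat)%:Z).
Local Notation pair_defect f := (\sum_(r < _) \sum_(s < _) ind (r < s) * (ind (f r < f s) - ind (r < f s) + 1 - ind (f r < s))).

(** * Linear algebra of a cellular complex and its Euler characteristic *)

Section ChainComplex.
Variables (K : fieldType) (V E F : finType).
Variables (s t : E -> V) (l r : E -> F).

(** Rank-nullity: the kernel lies in the line of constant rows. *)
Lemma rank_of_const_kernel (m p : nat) (B : 'M[K]_(m, p)) :
  (forall u : 'rV[K]_p, u *m B^T = 0 -> exists c, u = const_mx c) ->
  (p <= \rank B + 1)%N.
Proof.
move=> H.
have h : (kermx B^T <= (const_mx 1 : 'rV[K]_p))%MS.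
  apply/row_subP => i; have [c ->] : exists c, row i (kermx B^T) = const_mx c.
    by apply: H; rewrite -row_mul mulmx_ker row0.
  rewrite (_ : const_mx c = c *: const_mx 1) ?scalemx_sub //; apply/rowP => j; by rewrite !mxE mulr1.
have := mxrankS h; rewrite mxrank_ker mxrank_tr => h1.
have := leq_trans h1 (rank_leq_row _); lia.
Qed.

(** This and [edge_vertex] are the two boundary maps of a cellular complex, acting on row vectors;
    [l] and [r] are the faces on the two sides of an edge. *)
Definition face_edge : 'M[K]_(#|F|, #|E|) :=
  \matrix_(i, j) ((l (enum_val j) == enum_val i)%:R - (r (enum_val j) == enum_val i)%:R).
Definition edge_vertex : 'M[K]_(#|E|, #|V|) :=
  \matrix_(j, x) ((t (enum_val j) == enum_val x)%:R - (s (enum_val j) == enum_val x)%:R).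

Lemma sum_pick (T : finType) (f : T -> K) (x : T) : \sum_y f y * (x == y)%:R = f x.
Proof.
rewrite (bigD1 x) //= eqxx mulr1 big1 ?addr0 // => y /negPf h.
by rewrite eq_sym h mulr0.
Qed.

Lemma sum_enum_val (T : finType) (f : T -> K) : \sum_(i < #|T|) f (enum_val i) = \sum_y f y.
Proof.
rewrite [RHS](reindex (@enum_val T (mem T))) //.
by exists enum_rank => x _; rewrite ?enum_valK ?enum_rankK.
Qed.

(** Connectivity in dual form. It serves vertices and faces alike and feeds directly into a bound on
    a rank. *)
Definition connected_by (T U : finType) (a b : U -> T) :=
  forall f : T -> K, (forall e, f (a e) = f (b e)) -> forall x y, f x = f y.

Lemma rank_edge_vertex : connected_by s t -> (#|V| <= \rank edge_vertex + 1)%N.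
Proof.
move=> H; apply: rank_of_const_kernel => u Hu.
have [x0|] := pickP (fun x : V => true); last first.
  by move=> h; exists 0; apply/rowP => j; have := h (enum_val j).
exists (u 0 (enum_rank x0)); apply/rowP => j; rewrite mxE.
rewrite -[j]enum_valK.
apply: (H (fun x => u 0 (enum_rank x))) => e.
have /rowP /(_ (enum_rank e)) := Hu; rewrite !mxE.
under eq_bigr => y _ do rewrite !mxE enum_rankK.
have -> : \sum_(j < #|V|) u 0 j * ((t e == enum_val j)%:R - (s e == enum_val j)%:R) =
  \sum_y u 0 (enum_rank y) * ((t e == y)%:R - (s e == y)%:R).
  rewrite -[RHS]sum_enum_val; by apply: eq_bigr => z _; rewrite enum_valK.
under eq_bigr => y _ do rewrite mulrBr.
rewrite sumrB !(sum_pick (fun y => u 0 (enum_rank y))) => /eqP.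
by rewrite subr_eq0 => /eqP.
Qed.

Lemma rank_face_edge : connected_by l r -> (#|F| <= \rank face_edge + 1)%N.
Proof.
move=> H; rewrite -mxrank_tr; apply: rank_of_const_kernel => u; rewrite trmxK => Hu.
have [x0|] := pickP (fun x : F => true); last first.
  by move=> h; exists 0; apply/rowP => j; have := h (enum_val j).
exists (u 0 (enum_rank x0)); apply/rowP => j; rewrite mxE.
rewrite -[j]enum_valK.
apply: (H (fun x => u 0 (enum_rank x))) => e.
have /rowP /(_ (enum_rank e)) := Hu; rewrite !mxE.
under eq_bigr => y _ do rewrite !mxE enum_rankK.
have -> : \sum_(j < #|F|) u 0 j * ((l e == enum_val j)%:R - (r e == enum_val j)%:R) =
  \sum_y u 0 (enum_rank y) * ((l e == y)%:R - (r e == y)%:R).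
  rewrite -[RHS]sum_enum_val; by apply: eq_bigr => z _; rewrite enum_valK.
under eq_bigr => y _ do rewrite mulrBr.
rewrite sumrB !(sum_pick (fun y => u 0 (enum_rank y))) => /eqP.
by rewrite subr_eq0 => /eqP.
Qed.

Lemma card_connected : connected_by s t -> (#|V| <= #|E| + 1)%N.
Proof. by move=> /rank_edge_vertex h; have := rank_leq_row edge_vertex; lia. Qed.
Definition is_complex := forall c x,
  \sum_e ((l e == c)%:R - (r e == c)%:R) * ((t e == x)%:R - (s e == x)%:R) = 0 :> K.

Hypotheses (HC : is_complex) (HV : connected_by s t) (HF : connected_by l r).

Lemma face_edge_vertex : face_edge *m edge_vertex = 0.
Proof.
apply/matrixP => i x; rewrite !mxE; transitivity (0 : K) => //.
rewrite -[RHS](HC (enum_val i) (enum_val x)) -[RHS]sum_enum_val.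
by apply: eq_bigr => j _; rewrite !mxE.
Qed.

(** The two boundary maps have ranks at least |F| - 1 and |V| - 1, and their composite vanishes, so
    the ranks sum to at most |E|. Connectivity alone gives this half of Euler's formula. *)
Lemma euler_le : (#|V| + #|F| <= #|E| + 2)%N.
Proof.
have := mulmx0_rank_max face_edge_vertex.
have := rank_edge_vertex HV; have := rank_face_edge HF; lia.
Qed.

Hypothesis euler : (#|V| + #|F| = #|E| + 2)%N.

(** Equality in Euler's formula leaves no room between the row space of [face_edge] and the kernel
    of [edge_vertex]: first homology vanishes. This is the discrete form of simple connectivity. *)
Lemma vertex_cycle_is_boundary (w : E -> K) :
  (forall x, \sum_(e | t e == x) w e = \sum_(e | s e == x) w e) ->
  exists h : F -> K, forall e, w e = h (l e) - h (r e).
Proof.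
move=> Hw; pose u : 'rV[K]_#|E| := \row_j w (enum_val j).
have hk : (u <= kermx edge_vertex)%MS.
  apply/sub_kermxP/rowP => x; rewrite !mxE.
  have -> : \sum_j u 0 j * edge_vertex j x =
     \sum_e w e * ((t e == enum_val x)%:R - (s e == enum_val x)%:R).
    by rewrite -[RHS]sum_enum_val; apply: eq_bigr => j _; rewrite !mxE.
  under eq_bigr => y _ do rewrite mulrBr !mulr_natr !mulrb.
  by rewrite sumrB -!big_mkcond Hw subrr.
have hA : (face_edge <= kermx edge_vertex)%MS by apply/sub_kermxP/face_edge_vertex.
have heq : (kermx edge_vertex <= face_edge)%MS.
  rewrite -(mxrank_leqif_sup hA).2.
  have := rank_edge_vertex HV; have := rank_face_edge HF; have := mxrankS hA.
  rewrite mxrank_ker; have := rank_leq_row edge_vertex; lia.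
have /submxP [D hD] := submx_trans hk heq.
exists (fun c => D 0 (enum_rank c)) => e.
have /rowP /(_ (enum_rank e)) := hD; rewrite !mxE enum_rankK => ->.
have -> : \sum_j D 0 j * face_edge j (enum_rank e) =
   \sum_c D 0 (enum_rank c) * ((l e == c)%:R - (r e == c)%:R).
  by rewrite -[RHS]sum_enum_val; apply: eq_bigr => j _; rewrite !mxE enum_rankK enum_valK.
by under eq_bigr => y _ do rewrite mulrBr; rewrite sumrB !(sum_pick (fun y => D 0 (enum_rank y))).
Qed.

(** The same dimension count for the transposed complex. It will integrate a function on tile sides
    to a function on tile corners. *)
Lemma face_cocycle_is_coboundary (w : E -> K) :
  (forall c, \sum_(e | l e == c) w e = \sum_(e | r e == c) w e) ->
  exists f : V -> K, forall e, w e = f (t e) - f (s e).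
Proof.
move=> Hw; pose u : 'rV[K]_#|E| := \row_j w (enum_val j).
have hk : (u <= kermx face_edge^T)%MS.
  apply/sub_kermxP/rowP => x; rewrite !mxE.
  have -> : \sum_j u 0 j * face_edge^T j x =
     \sum_e w e * ((l e == enum_val x)%:R - (r e == enum_val x)%:R).
    by rewrite -[RHS]sum_enum_val; apply: eq_bigr => j _; rewrite !mxE.
  under eq_bigr => y _ do rewrite mulrBr !mulr_natr !mulrb.
  by rewrite sumrB -!big_mkcond Hw subrr.
have hA : (edge_vertex^T <= kermx face_edge^T)%MS.
  by apply/sub_kermxP; rewrite -trmx_mul face_edge_vertex trmx0.
have heq : (kermx face_edge^T <= edge_vertex^T)%MS.
  rewrite -(mxrank_leqif_sup hA).2.
  have := rank_edge_vertex HV; have := rank_face_edge HF; have := mxrankS hA.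
  rewrite mxrank_ker !mxrank_tr; have := rank_leq_col face_edge; lia.
have /submxP [D hD] := submx_trans hk heq.
exists (fun c => D 0 (enum_rank c)) => e.
have /rowP /(_ (enum_rank e)) := hD; rewrite !mxE enum_rankK => ->.
have -> : \sum_j D 0 j * edge_vertex^T j (enum_rank e) =
   \sum_c D 0 (enum_rank c) * ((t e == c)%:R - (s e == c)%:R).
  by rewrite -[RHS]sum_enum_val; apply: eq_bigr => j _; rewrite !mxE enum_rankK enum_valK.
by under eq_bigr => y _ do rewrite mulrBr; rewrite sumrB !(sum_pick (fun y => D 0 (enum_rank y))).
Qed.

End ChainComplex.

(** * Length of a bounded affine permutation as a sum over pairs *)

Section PermutationLength.
Variables (n : nat) (f : 'I_n -> 'I_n).
Hypotheses (finj : injective f) (fnofix : forall s, f s != s).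

Let drop (s : 'I_n) : nat := (f s < s)%N.
Let k : nat := (\sum_s drop s)%N.

Lemma sum_ord_lt (m : nat) : (m <= n)%N -> \sum_(s < n) ind (s < m) = m%:Z.
Proof.
move=> hm; rewrite -(big_mkord xpredT (fun s => ind (s < m))).
rewrite (big_cat_nat (leq0n m) hm) /= big_nat (eq_bigr (fun=> 1)) ?[X in _ + X]big_nat; last first.
  by move=> i /andP[_ ->].
rewrite [X in _ + X]big1 ?addr0; last by move=> i /andP[h _]; rewrite ltnNge h.
by rewrite -big_nat sumr_const_nat subn0 natz.
Qed.

Lemma sum_pair_swap (F : 'I_n -> 'I_n -> int) : \sum_r \sum_s F r s = \sum_r \sum_s F s r.
Proof. exact: exchange_big. Qed.
Let S2 (F : 'I_n -> 'I_n -> int) := \sum_r \sum_s F r s.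

Lemma S2D F G : S2 (fun r s : 'I_n => F r s + G r s) = S2 F + S2 G.
Proof. by rewrite /S2 -big_split; apply: eq_bigr => r _; rewrite -big_split. Qed.
Lemma S2N F : S2 (fun r s : 'I_n => - F r s) = - S2 F.
Proof. by rewrite /S2 -sumrN; apply: eq_bigr => r _; rewrite -sumrN. Qed.
Lemma eq_S2 F G : (forall r s, F r s = G r s) -> S2 F = S2 G.
Proof. by move=> h; apply: eq_bigr => r _; apply: eq_bigr => s _. Qed.

Lemma fne (s : 'I_n) : f s != s :> nat.
Proof. exact: fnofix. Qed.

Lemma fval_neq (r s : 'I_n) : r != s :> nat -> f r != f s :> nat.
Proof.
by move=> h; apply/eqP => h1; move/eqP: h; apply; congr (val _); apply: finj; apply: val_inj.
Qed.

Lemma displacement_up :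
  S2 (fun r s : 'I_n => ind [&& (r < s)%N & (s <= f r)%N]) = \sum_(r < n) ind (r < f r) * ((f r)%:Z - r%:Z).
Proof.
apply: eq_bigr => r _.
have h1 := sum_ord_lt (ltn_ord (f r)); have h2 := sum_ord_lt (ltn_ord r).
case: (ltnP r (f r)) => h.
  rewrite mul1r; transitivity ((f r).+1%:Z - r.+1%:Z); last by lia.
  rewrite -h1 -h2 -sumrB; apply: eq_bigr => s _; lia.
by rewrite mul0r big1 // => s _; lia.
Qed.

Lemma displacement_down :
  S2 (fun r s : 'I_n => ind [&& (r < s)%N & (f s <= r)%N]) = \sum_(r < n) ind (f r < r) * (r%:Z - (f r)%:Z).
Proof.
rewrite /S2 exchange_big; apply: eq_bigr => r _ /=.
have h1 := sum_ord_lt (ltnW (ltn_ord (f r))); have h2 := sum_ord_lt (ltnW (ltn_ord r)).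
case: (ltnP (f r) r) => h.
  rewrite mul1r -h1 -h2 -sumrB; apply: eq_bigr => s _; lia.
by rewrite mul0r big1 // => s _; lia.
Qed.

Lemma displacement_balance :
  \sum_(r < n) ind (r < f r) * ((f r)%:Z - r%:Z) = \sum_(r < n) ind (f r < r) * (r%:Z - (f r)%:Z).
Proof.
have h : \sum_(r < n) ((f r)%:Z - r%:Z) = 0 by rewrite sumrB [X in _ - X](reindex_inj finj) subrr.
apply/eqP; rewrite -subr_eq0 -sumrB; apply/eqP; apply: etrans _ h; apply: eq_bigr => r _.
have := fne r; lia.
Qed.

(** Exactly [f r] values lie below [f r]; splitting them by position relates the inversions to the
    right of [r] to those on its left. Summed over ascents [r], inversions between two ascents
    cancel, and those between an ascent and a drop remain. *)
Lemma crossing_displacement :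
  S2 (fun r s : 'I_n => ind [&& (r < s)%N, (r < f r)%N, (f s < s)%N & (f s < f r)%N]) =
  \sum_(r < n) ind (r < f r) * ((f r)%:Z - r%:Z).
Proof.
have key (r : 'I_n) : \sum_(s < n) ind [&& (r < s)%N & (f s < f r)%N] =
    (f r)%:Z - r%:Z + \sum_(s < n) ind [&& (s < r)%N & (f r < f s)%N].
  have h1 := sum_ord_lt (ltnW (ltn_ord (f r))); rewrite (reindex_inj finj) /= in h1.
  have h2 := sum_ord_lt (ltnW (ltn_ord r)).
  rewrite -h1 -h2 -sumrB -big_split /=; apply: eq_bigr => s _.
  have [h|hn] := eqVneq (s : nat) r; first by rewrite (val_inj h); lia.
  have := fval_neq hn; lia.
have -> : \sum_(r < n) ind (r < f r) * ((f r)%:Z - r%:Z) =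
   S2 (fun r s : 'I_n => ind [&& (r < f r)%N, (r < s)%N & (f s < f r)%N]) -
   S2 (fun r s : 'I_n => ind [&& (r < f r)%N, (s < r)%N & (f r < f s)%N]).
  rewrite -S2N -S2D; apply: eq_bigr => r _.
  have := key r; case: (r < f r)%N => /=; last by move=> _; rewrite mul0r big1.
  by move=> h; rewrite mul1r big_split /= sumrN h addrK.
rewrite [X in _ = _ - X]/S2 sum_pair_swap -/(S2 _) -S2N -S2D; apply: eq_S2 => r s /=.
have := fne s; have := fne r; lia.
Qed.

Lemma kk : (k * (n - k))%:Z = S2 (fun r s : 'I_n => ((r < s)%N && (drop r != drop s) : nat)%:Z).
Proof.
have hk : (k <= n)%N.
  rewrite /k -[n in (_ <= n)%N]card_ord -sum1_card; apply: leq_sum => s _; rewrite /drop; lia.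
have -> : (k * (n - k))%:Z = S2 (fun r s : 'I_n => (drop r)%:Z * (1 - (drop s)%:Z)).
  have hK : k%:Z = \sum_s (drop s)%:Z by rewrite /k (big_morph Posz PoszD (erefl _)).
  have hs : \sum_s (1 - (drop s)%:Z) = (n - k)%:Z by rewrite sumrB sumr_const card_ord -subzn // hK natz.
  by rewrite /S2 PoszM hK mulr_suml; apply: eq_bigr => r _; rewrite -hs mulr_sumr.
have -> : S2 (fun r s : 'I_n => (drop r)%:Z * (1 - (drop s)%:Z)) =
   S2 (fun r s : 'I_n => ind (r < s) * ((drop r)%:Z * (1 - (drop s)%:Z))) +
   S2 (fun r s : 'I_n => ind (s < r) * ((drop r)%:Z * (1 - (drop s)%:Z))).
  rewrite -S2D; apply: eq_S2 => r s; rewrite /drop.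
  by case: (ltngtP r s) => h; rewrite ?mul1r ?mul0r ?addr0 ?add0r // (val_inj h); case: (_ < _)%N.
rewrite [X in _ + X]/S2 sum_pair_swap -/(S2 _) -S2D; apply: eq_S2 => r s.
by rewrite /drop; case: (f r < r)%N; case: (f s < s)%N; case: (r < s)%N.
Qed.

(** The right side is the signed crossing number that the labels of a plabic graph produce, which
    makes the two counts comparable. The identity holds only after summation, since the total
    displacement upwards equals the total downwards. *)
Lemma length_identity :
  (k * (n - k))%:Z -
  S2 (fun r s : 'I_n => ind (r < s) * (ind (f s + n * drop s < f r + n * drop r)
         + ind (f r + n * drop r + n < f s + n * drop s))) =
  S2 (fun r s : 'I_n => ind (r < s) * (ind (f r < f s) - ind (r < f s)
        + 1 - ind (f r < s))).
Proof.
have h1 := crossing_displacement; have h2 := displacement_up.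
have h3 := displacement_down; have h4 := displacement_balance.
(* Both sides equal twice the total upward displacement; adding this relation makes the remaining
   identity true pair by pair. *)
have h : S2 (fun r s : 'I_n => ind [&& (r < s)%N & (s <= f r)%N]) +
   S2 (fun r s : 'I_n => ind [&& (r < s)%N & (f s <= r)%N]) =
   S2 (fun r s : 'I_n => ind [&& (r < s)%N, (r < f r)%N, (f s < s)%N & (f s < f r)%N]) +
   S2 (fun r s : 'I_n => ind [&& (r < s)%N, (r < f r)%N, (f s < s)%N & (f s < f r)%N]) by rewrite h1 h2 h3 h4.
apply/eqP; rewrite -subr_eq0 kk -!S2N -!S2D; apply/eqP.
move/esym/eqP: h; rewrite -subr_eq0 -!S2D -S2N -S2D => /eqP h.
apply: etrans _ (h); apply: eq_S2 => r s.
case: (ltnP r s) => hrs /=; last by rewrite !mul0r.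
have hn : r != s :> nat by rewrite neq_ltn hrs.
have := fne s; have := fne r; have := fval_neq hn.
have := ltn_ord (f r); have := ltn_ord (f s); have := ltn_ord r; have := ltn_ord s.
rewrite /drop !mul1r.
case: (ltnP (f r) r) => hr; case: (ltnP (f s) s) => hs /=; rewrite ?muln0 ?muln1 ?addn0; lia.
Qed.

End PermutationLength.

(** * The plabic graph as a map on the sphere: darts, faces, face functions *)

Section PlabicMap.
Variables (n : nat) (G : plabic n).
Hypothesis HG : plabic_ok G.
Local Notation E := (pE G).
Local Notation be := (pbedge G).

Lemma plabic_n_gt0 : (0 < n)%N. Proof. by case: HG => [[]]. Qed.
Lemma peB_black (e : E) : pblack (peB e).
Proof. by case: HG => [[_ h _ _] _]; case: (h e). Qed.
Lemma peW_white (e : E) : ~~ pblack (peW e).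
Proof. by case: HG => [[_ h _ _] _]; case: (h e). Qed.
Lemma pbnd_inj : injective (pbnd G).
Proof. by case: HG => [[_ _ [h _] _] _]. Qed.
Lemma pbnd_black i : pblack (pbnd G i).
Proof. by case: HG => [[_ _ [_ h] _] _]. Qed.
Lemma peB_pbnd i (e : E) : (peB e == pbnd G i) = (e == be i).
Proof. by case: HG => [[_ _ _ h] _]. Qed.
Lemma prB_inj : injective (@prB n G).
Proof. by case: HG => [_ [[[h _] _ _] _]]. Qed.
Lemma peB_prB (e : E) : peB (prB e) = peB e.
Proof. by case: HG => [_ [[[_ [h _]] _ _] _]]. Qed.
Lemma prB_trans (e e' : E) : peB e = peB e' -> exists k, iter k (@prB n G) e = e'.
Proof. by case: HG => [_ [[[_ [_ h]] _ _] _]]; apply: h. Qed.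
Lemma prW_inj : injective (@prW n G).
Proof. by case: HG => [_ [[_ [h _] _] _]]. Qed.
Lemma peW_prW (e : E) : peW (prW e) = peW e.
Proof. by case: HG => [_ [[_ [_ [h _]] _] _]]. Qed.
Lemma prW_trans (e e' : E) : peW e = peW e' -> exists k, iter k (@prW n G) e = e'.
Proof. by case: HG => [_ [[_ [_ [_ h]] _] _]]; apply: h. Qed.
Lemma interior_leaf (x : pV G) : ~~ is_bnd x -> #|[pred e | incident x e]| = 1%N ->
  forall y : pV G, @Defs.adjacent n G x y -> is_bnd y.
Proof.
move=> h1 h2; case: HG => [_ [[_ _ h] _]]; apply: (h x h1).
by rewrite -h2; apply: eq_card => e; apply/idP/idP => [/set_mem|h3]; last apply: mem_set.
Qed.
Lemma connect_bnd (x : pV G) : exists i, connect (@Defs.adjacent n G) x (pbnd G i).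
Proof. by case: HG => [_ [_ [h _ _]]]. Qed.
Lemma exists_matching : exists A, @almost_perfect n G A.
Proof. by case: HG => [_ [_ [_ h _]]]. Qed.
Lemma plabic_euler : (#|pV G| + sphere_faces G = #|E| + n + 2)%N.
Proof. by case: HG => [_ [_ [_ _ h]]]. Qed.

Lemma peB_be i : peB (be i) = pbnd G i.
Proof. by apply/eqP; rewrite peB_pbnd. Qed.
Lemma be_inj : injective be.
Proof. by move=> i j h; apply: pbnd_inj; rewrite -!peB_be h. Qed.
Lemma bnde_be i : bnde (be i).
Proof. by apply/existsP; exists i; rewrite peB_be. Qed.
Lemma bndeP (e : E) : reflect (exists i, e = be i) (bnde e).
Proof.
apply: (iffP existsP) => -[i h]; exists i; last by rewrite h peB_be.
by apply/eqP; rewrite -peB_pbnd eq_sym.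
Qed.
Lemma bnde_prB (e : E) : bnde (prB e) = bnde e. Proof. by rewrite peB_prB. Qed.
Lemma prB_be i : prB (be i) = be i.
Proof. by apply/eqP; rewrite -peB_pbnd peB_prB peB_be. Qed.
Lemma bnd_pbnd i : is_bnd (pbnd G i).
Proof. by apply/existsP; exists i. Qed.
Lemma peW_int (e : E) : ~~ is_bnd (peW e).
Proof. by apply/existsP => -[i /eqP h]; have := peW_white e; rewrite -h pbnd_black. Qed.
Lemma bnd_index_be i : bnd_index (pbnd G i) = Some i.
Proof.
rewrite /bnd_index; case: pickP => [j /eqP /pbnd_inj -> //|/(_ i)]; by rewrite eqxx.
Qed.
Lemma bnd_index_int (x : pV G) : ~~ is_bnd x -> bnd_index x = None.
Proof.
move=> h; rewrite /bnd_index; case: pickP => // i /eqP h1; by move: h; rewrite -h1 bnd_pbnd.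
Qed.

Lemma dphi_bw (e : E) : dphi (inl (e, true) : dart G) = inl (prW e, false). Proof. by []. Qed.
Lemma dphi_wb (e : E) : ~~ bnde e -> dphi (inl (e, false) : dart G) = inl (prB e, true).
Proof. by move=> h; rewrite /dphi /= bnd_index_int. Qed.
Lemma dphi_be i : dphi (inl (be i, false) : dart G) = inr (ord_pred i, false).
Proof. by rewrite /dphi /= peB_be bnd_index_be. Qed.
Lemma dphi_inner i : dphi (inr (i, false) : dart G) = inl (be i, true). Proof. by []. Qed.
Lemma dphi_outer i : dphi (inr (i, true) : dart G) = inr (ordS i, true). Proof. by []. Qed.

Variant dart_spec : dart G -> dart G -> Type :=
| DartBW e : dart_spec (inl (e, true)) (inl (prW e, false))
| DartWB e of ~~ bnde e : dart_spec (inl (e, false)) (inl (prB e, true))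
| DartBnd i : dart_spec (inl (be i, false)) (inr (ord_pred i, false))
| DartInner i : dart_spec (inr (i, false)) (inl (be i, true))
| DartOuter i : dart_spec (inr (i, true)) (inr (ordS i, true)).

Lemma dphiP d : dart_spec d (dphi d).
Proof.
case: d => [[e []]|[i []]]; try by constructor.
have [/bndeP/cid[i ->]|h] := boolP (bnde e); first by rewrite dphi_be; constructor.
by rewrite dphi_wb //; constructor.
Qed.

Lemma dphi_inj : injective (@dphi n G).
Proof.
move=> d d'; case: (dphiP d) => [e|e he|i|i|i]; case: (dphiP d') => [e'|e' he'|j|j|j] //.
- by move=> [/prW_inj ->].
- by move=> [/prB_inj ->].
- by move=> [h]; move: he; rewrite -bnde_prB h bnde_be.
- move=> /(congr1 (fun d : dart G => if d is inr (k, _) then k else i)) h.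
  by rewrite (can_inj (@ord_predK n) h).
- by move=> [h]; move: he'; rewrite -bnde_prB -h bnde_be.
- by move=> [/be_inj ->].
- move=> /(congr1 (fun d : dart G => if d is inr (k, _) then k else i)) h.
  by rewrite (can_inj (@ordSK n) h).
Qed.

Lemma sum_dart (U : nmodType) (F : dart G -> U) :
  \sum_d F d = \sum_e (F (inl (e, true)) + F (inl (e, false)))
             + \sum_i (F (inr (i, true)) + F (inr (i, false))).
Proof.
rewrite big_sumType /=; congr (_ + _).
  transitivity (\sum_e \sum_b F (inl (e, b))); first by rewrite pair_bigA; apply: eq_bigr => -[].
  by apply: eq_bigr => e _; rewrite big_bool.
transitivity (\sum_e \sum_b F (inr (e, b))); first by rewrite pair_bigA; apply: eq_bigr => -[].
by apply: eq_bigr => e _; rewrite big_bool.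
Qed.

Definition dtail (d : dart G) : pV G :=
  match d with
  | inl (e, b) => if b then peB e else peW e
  | inr (i, b) => if b then pbnd G i else pbnd G (ordS i)
  end.

Lemma dtail_dphi d : dtail (dphi d) = dtail (dalpha d).
Proof.
case: (dphiP d) => [e|e he|i|i|i] /=; rewrite ?peW_prW ?peB_prB ?peB_be ?ord_predK //.
Qed.

Definition face := {d : dart G | d \in froots (@dphi n G)}.
Lemma face_subproof d : froot (@dphi n G) d \in froots (@dphi n G).
Proof. exact: (roots_root (fconnect_sym dphi_inj)). Qed.
Definition face_of d : face := Sub (froot (@dphi n G) d) (face_subproof d).

Lemma face_of_dphi d : face_of (dphi d) = face_of d.
Proof.
apply: val_inj => /=; apply/eqP; rewrite (root_connect (fconnect_sym dphi_inj)).
by rewrite (fconnect_sym dphi_inj) fconnect1.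
Qed.
Lemma face_of_val (c : face) : face_of (val c) = c.
Proof. by apply: val_inj => /=; have := valP c; rewrite inE => /eqP. Qed.

Lemma face_of_invariant (T : Type) (g : dart G -> T) : (forall d, g (dphi d) = g d) ->
  forall d d', face_of d = face_of d' -> g d = g d'.
Proof.
move=> hg; have h d : g (val (face_of d)) = g d.
  have /iter_findex <- : fconnect (@dphi n G) d (val (face_of d)) by apply: connect_root.
  by elim: (findex _ _ _) => //= m IH; rewrite hg IH.
by move=> d d' hd; rewrite -h hd h.
Qed.

Lemma card_face : #|{: face}| = sphere_faces G.
Proof.
rewrite card_sig /sphere_faces; apply: eq_card => d; by rewrite !inE andbT.
Qed.

(** The boundary circle is cut into [n] arcs that count as edges, so that the disk becomes a sphere
    with one outer face and Euler's formula applies. *)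
Definition edge_or_arc := (E + 'I_n)%type.
Definition ea_dart (b : bool) (e : edge_or_arc) : dart G :=
  match e with inl e => inl (e, b) | inr i => inr (i, b) end.
Definition ea_tail e := dtail (ea_dart true e).
Definition ea_head e := dtail (ea_dart false e).
Definition ea_left e := face_of (ea_dart true e).
Definition ea_right e := face_of (ea_dart false e).

Lemma card_edge_or_arc : #|{: edge_or_arc}| = (#|E| + n)%N.
Proof. by rewrite card_sum card_ord. Qed.

(** The dart [dphi d] has the face of [d] and starts where [d] ends, so heads and tails cancel after
    reindexing by [dphi]. *)
Lemma map_is_complex (K : fieldType) : @is_complex K _ _ _ ea_tail ea_head ea_left ea_right.
Proof.
move=> c x; pose g d : K := (face_of d == c)%:R * ((dtail (dalpha d) == x)%:R - (dtail d == x)%:R).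
transitivity (\sum_d g d).
  by rewrite sum_dart big_sumType /=; congr (_ + _); apply: eq_bigr => e _;
    rewrite /g /ea_left /ea_right /ea_head /ea_tail /=; ring.
rewrite /g; under eq_bigr => d _ do rewrite mulrBr.
rewrite sumrB [X in _ - X](reindex_inj dphi_inj) -sumrB big1 // => d _ /=.
by rewrite face_of_dphi dtail_dphi subrr.
Qed.

Lemma ord_cyclic_const (T : Type) (f : 'I_n -> T) : (forall i, f (ordS i) = f i) -> forall i j, f i = f j.
Proof.
move=> h; have i0 : 'I_n := Ordinal plabic_n_gt0.
suff H i : f i = f (Ordinal plabic_n_gt0) by move=> i j; rewrite !H.
have [m] := ubnP i; elim: m i => // m IH [[|i] hi] /=; first by move=> _; congr f; apply: val_inj.
move=> him; have hi' : (i < n)%N by lia.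
rewrite -(IH (Ordinal hi')) // -[RHS]h; congr f; apply: val_inj => /=.
by rewrite modn_small.
Qed.

Lemma vertex_connected (T : Type) (f : pV G -> T) :
  (forall e : E, f (peB e) = f (peW e)) -> (forall i, f (pbnd G (ordS i)) = f (pbnd G i)) ->
  forall x y, f x = f y.
Proof.
move=> he hi; have hb := ord_cyclic_const hi.
have H x : f x = f (pbnd G (Ordinal plabic_n_gt0)).
  have [i /connectP[p hp hl]] := connect_bnd x.
  rewrite -(hb i) hl; elim: p x hp {hl} => //= y p IH x /andP[hxy hp].
  rewrite -(IH _ hp); case/existsP: hxy => e /orP[] /andP[/eqP <- /eqP <-] //.
by move=> x y; rewrite !H.
Qed.

Lemma map_connected (K : fieldType) : connected_by K ea_tail ea_head.
Proof.
move=> f hf; apply: vertex_connected => [e|i]; first exact: (hf (inl e)).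
by rewrite -(hf (inr i)).
Qed.

(** Edges at a common vertex share faces in rotation order, hence carry one value; this spreads
    along a path to the boundary circle, where consecutive arcs are compared. *)
Lemma dual_connected (T : Type) (g : dart G -> T) :
  (forall d, g (dphi d) = g d) -> (forall d, g (dalpha d) = g d) -> forall d d', g d = g d'.
Proof.
move=> h1 h2.
have hW (e : E) : g (inl (prW e, true)) = g (inl (e, true)) by rewrite -(h1 (inl (e, true))) dphi_bw -(h2 (inl (prW e, false))).
have hB (e : E) : g (inl (prB e, true)) = g (inl (e, true)).
  have [/bndeP[i ->]|h] := boolP (bnde e); first by rewrite prB_be.
  by rewrite -(dphi_wb h) h1 -(h2 (inl (e, true))).
have hWs (e e' : E) : peW e = peW e' -> g (inl (e, true)) = g (inl (e', true)).
  by move=> /prW_trans[m <-]; elim: m => //= m IH; rewrite hW.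
have hBs (e e' : E) : peB e = peB e' -> g (inl (e, true)) = g (inl (e', true)).
  by move=> /prB_trans[m <-]; elim: m => //= m IH; rewrite hB.
have ha i : g (inr (ord_pred i, false)) = g (inl (be i, true)) by rewrite -dphi_be h1 -(h2 (inl (be i, true))).
have hc i : g (inr (ordS i, false)) = g (inr (i, false)).
  have h := ha (ordS i); rewrite ordSK in h.
  by rewrite h -dphi_inner h1.
have ho (b : bool) (i j : 'I_n) : g (inr (i, b)) = g (inr (j, false)).
  have -> : g (inr (i, b)) = g (inr (i, false)) by case: b => //; rewrite -(h2 (inr (i, false))).
  exact: (@ord_cyclic_const _ (fun i => g (inr (i, false)))).
have i0 : 'I_n := Ordinal plabic_n_gt0.
have hx (x : pV G) : forall e, incident x e -> g (inl (e, true)) = g (inr (i0, false)).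
  have [i /connectP[p hp hl]] := connect_bnd x.
  elim: p x hp hl => [|y p IH] x /=.
    move=> _ <- e /orP[]; last by move=> /eqP h; have := peW_int e; rewrite h bnd_pbnd.
    by rewrite peB_pbnd => /eqP ->; rewrite -ha; apply: ho.
  move=> /andP[/existsP[e0 h0] hp] hl e he.
  have <- : g (inl (e0, true)) = g (inr (i0, false)).
    by apply: (IH y hp hl); case/orP: h0 => /andP[_ h]; rewrite /incident h ?orbT.
  have hbw : peB e <> peW e0 by move=> h; have := peW_white e0; rewrite -h peB_black.
  have hwb : peW e <> peB e0 by move=> h; have := peW_white e; rewrite h peB_black.
  case/orP: h0 => /andP[/eqP hx0 _]; case/orP: he => /eqP hx1.
  - by apply: hBs; rewrite hx1.
  - by case: hwb; rewrite hx1.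
  - by case: hbw; rewrite hx1.
  - by apply: hWs; rewrite hx1.
have H d : g d = g (inr (i0, false)).
  case: d => [[e b]|[i b]]; last exact: ho.
  have -> : g (inl (e, b)) = g (inl (e, true)) by case: b => //; rewrite -(h2 (inl (e, true))).
  by apply: (hx (peB e)); rewrite /incident eqxx.
by move=> d d'; rewrite !H.
Qed.

Lemma map_dual_connected (K : fieldType) : connected_by K ea_left ea_right.
Proof.
move=> h hh c c'.
rewrite -(face_of_val c) -(face_of_val c').
apply: (@dual_connected _ (fun d => h (face_of d))) => d; first by rewrite face_of_dphi.
by case: d => [[e []]|[i []]] /=; first [exact: (esym (hh (inl e))) | exact: (hh (inl e)) | exact: (esym (hh (inr i))) | exact: (hh (inr i))].
Qed.

(** [N] and [S] are the values on the left and on the right of an edge traversed from black to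
    white; [b i] is the value on the inner side of the arc that follows the boundary vertex [i]. *)
Definition face_function (T : Type) (N S : E -> T) (b : 'I_n -> T) :=
  [/\ forall e, S (prW e) = N e, forall e, ~~ bnde e -> N (prB e) = S e,
      forall i, N (be i) = b i & forall i, S (be i) = b (ord_pred i)].

Definition dart_value (T : Type) (N S : E -> T) (b : 'I_n -> T) (o : T) (d : dart G) : T :=
  match d with
  | inl (e, c) => if c then N e else S e
  | inr (i, c) => if c then o else b i
  end.

Lemma dart_value_dphi (T : Type) (N S : E -> T) b o : face_function N S b ->
  forall d, dart_value N S b o (dphi d) = dart_value N S b o d.
Proof.
move=> [h1 h2 h3 h4] d; case: (dphiP d) => [e|e he|i|i|i] //=; by rewrite ?h2.
Qed.

Lemma face_function_const (T : Type) (N S : E -> T) b o : face_function N S b ->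
  (forall e, N e = S e) -> (forall i, b i = o) ->
  [/\ forall e, N e = o, forall e, S e = o & forall i, b i = o].
Proof.
move=> hf h1 h2.
have H d d' : dart_value N S b o d = dart_value N S b o d'.
  apply: dual_connected => {}d; first exact: dart_value_dphi.
  by case: d => [[e []]|[i []]] /=.
have i0 : 'I_n := Ordinal plabic_n_gt0.
by split=> [e|e|i]; [exact: (H (inl (e, true)) (inr (i0, true)))
  |exact: (H (inl (e, false)) (inr (i0, true)))|exact: (H (inr (i, false)) (inr (i0, true)))].
Qed.

Lemma sum_bnd_zero (K : fieldType) (m : E -> K) :
  (forall x, \sum_(e | peW e == x) m e = 0) ->
  (forall x, ~~ is_bnd x -> \sum_(e | peB e == x) m e = 0) ->
  \sum_i m (be i) = 0.
Proof.
move=> hW hB; have h1 : \sum_e m e = 0.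
  by rewrite (partition_big (@peW n G) xpredT) //= big1.
move: h1; rewrite (bigID (fun e => bnde e)) /= [X in _ + X](_ : _ = 0) ?addr0 => [h2|]; last first.
  rewrite (partition_big (@peB n G) (fun x => ~~ is_bnd x)) //= big1 // => x hx.
  by rewrite -[RHS](hB x hx); apply: eq_bigl => e; case: eqP => [->|]; rewrite ?hx ?andbF.
apply: etrans _ h2; rewrite [RHS](reindex_onto be (fun e => odflt (Ordinal plabic_n_gt0) (bnd_index (peB e)))).
  by apply: eq_bigl => i; rewrite bnde_be peB_be bnd_index_be /= eqxx.
by move=> e /bndeP[i ->]; rewrite peB_be bnd_index_be.
Qed.

(** The flow leaving through boundary vertices is returned along the arcs of the circle, which makes
    it a cycle on the sphere; exactness writes it as a difference across edges. Subtracting the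
    value on the outer face normalises that value to 0. *)
Lemma flow_is_boundary (K : fieldType) (m : E -> K) :
  (forall x, \sum_(e | peW e == x) m e = 0) ->
  (forall x, ~~ is_bnd x -> \sum_(e | peB e == x) m e = 0) ->
  exists N S b, [/\ face_function N S b, forall e, N e - S e = m e
    & forall i : 'I_n, b i = \sum_(r < n | (r <= i)%N) m (be r)].
Proof.
move=> hW hB; pose bb (i : 'I_n) := \sum_(r < n | (r <= i)%N) m (be r).
(* For [i = 0] the predecessor is the last index, where the partial sum is the full sum and
   vanishes. *)
have hbb i : bb i = bb (ord_pred i) + m (be i).
  rewrite /bb; case: i => [[|i] hi] /=.
    rewrite (bigD1 (Ordinal hi)) //= [X in _ + X]big1 ?addr0; last first.
      by move=> r /andP[h1 /eqP h2]; exfalso; apply: h2; apply: val_inj => /=; lia.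
    rewrite [X in X + _](_ : _ = 0) ?add0r // -[RHS](sum_bnd_zero hW hB).
    by apply: eq_bigl => r; have := ltn_ord r; rewrite modn_small; lia.
  rewrite (bigD1 (Ordinal hi)) //= addrC; congr (_ + _); apply: eq_bigl => r.
  rewrite -val_eqE /= modnDr modn_small; [|lia]; lia.
pose w (e : edge_or_arc) := match e with inl e => m e | inr i => - bb i end.
have heu : (#|pV G| + #|{: face}| = #|{: edge_or_arc}| + 2)%N by rewrite card_face card_edge_or_arc plabic_euler.
have [|h hh] := @vertex_cycle_is_boundary K _ _ _ _ _ _ _ (@map_is_complex K)
  (@map_connected K) (@map_dual_connected K) heu w.
  move=> x; rewrite !big_sumType /= /ea_head /ea_tail /=.
  have [/existsP[i /eqP hi]|hx] := boolP (is_bnd x).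
    rewrite big1 ?add0r; last first.
      by move=> e /eqP h; have := peW_white e; rewrite h -hi pbnd_black.
    rewrite (big_pred1 (be i)); last by move=> e /=; rewrite -hi peB_pbnd.
    rewrite (big_pred1 (ord_pred i)); last first.
      by move=> j /=; rewrite -hi (inj_eq pbnd_inj) (can2_eq (@ordSK n) (@ord_predK n)).
    rewrite (big_pred1 i); last by move=> j /=; rewrite -hi (inj_eq pbnd_inj).
    by rewrite (hbb i) opprD addrCA subrr addr0.
  have hj (j : 'I_n) : (pbnd G j == x) = false.
    by apply/negP => /eqP h; move: hx; rewrite -h bnd_pbnd.
  by rewrite hW hB // !big_pred0 //.
have ho i j : face_of (inr (i, true)) = face_of (inr (j, true)).
  apply: (@ord_cyclic_const _ (fun i => face_of (inr (i, true)))) => k.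
  by rewrite -dphi_outer face_of_dphi.
have i0 : 'I_n := Ordinal plabic_n_gt0.
pose o := h (face_of (inr (i0, true))).
have hb i : h (face_of (inr (i, false))) - o = bb i.
  have := hh (inr i); rewrite /ea_left /ea_right /= (ho i i0) -/o => hbi.
  by rewrite -[bb i]opprK hbi opprB.
exists (fun e => h (face_of (inl (e, true))) - o), (fun e => h (face_of (inl (e, false))) - o), bb.
split=> //; last by move=> e; have := hh (inl e); rewrite /= /ea_left /ea_right /= => ->; ring.
split=> [e|e he|i|i].
- by rewrite -dphi_bw face_of_dphi.
- by rewrite -dphi_wb // face_of_dphi.
- by rewrite -dphi_inner face_of_dphi hb.
- by rewrite -face_of_dphi dphi_be hb.
Qed.

End PlabicMap.

(** * Sums over incident edges, and propagation to the boundary *)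

Section IncidenceSums.
Variables (n : nat) (G : plabic n).
Hypothesis HG : plabic_ok G.
Local Notation E := (pE G).
Local Notation be := (pbedge G).

Lemma sum_incident_at (U : nmodType) (F : E -> U) (x : pV G) :
  \sum_(e | incident x e) F e = \sum_(e | peB e == x) F e + \sum_(e | peW e == x) F e.
Proof.
rewrite (bigID (fun e => peB e == x)) /=; congr (_ + _); apply: eq_bigl => e.
  by rewrite /incident; case: (peB e == x); rewrite ?andbF ?andbT.
rewrite /incident; case: eqP => [<-|] /=; last by rewrite andbT.
by apply/esym/negbTE/eqP => h; have := peW_white HG e; rewrite h (peB_black HG).
Qed.

Lemma sum_incident (U : nmodType) (F : E -> U) :
  \sum_x \sum_(e | incident x e) F e = \sum_e F e + \sum_e F e.
Proof.
under eq_bigr => x _ do rewrite sum_incident_at.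
rewrite big_split /=; congr (_ + _).
  by rewrite [RHS](partition_big (@peB n G) xpredT).
by rewrite [RHS](partition_big (@peW n G) xpredT).
Qed.

Lemma sum_bnde (U : nmodType) (F : E -> U) : \sum_(e | bnde e) F e = \sum_i F (be i).
Proof.
rewrite (reindex_onto be (fun e => odflt (Ordinal (plabic_n_gt0 HG)) (bnd_index (peB e)))).
  by apply: eq_bigl => i; rewrite (bnde_be HG) (peB_be HG) (bnd_index_be HG) /= eqxx.
by move=> e /(bndeP HG)[i ->]; rewrite (peB_be HG) (bnd_index_be HG).
Qed.

Lemma sum_bnd_vertex (U : nmodType) (F : pV G -> U) :
  \sum_(x | is_bnd x) F x = \sum_i F (pbnd G i).
Proof.
rewrite (reindex_onto (pbnd G) (fun x => odflt (Ordinal (plabic_n_gt0 HG)) (bnd_index x))).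
  by apply: eq_bigl => i; rewrite bnd_pbnd (bnd_index_be HG) /= eqxx.
by move=> e /existsP[i /eqP <-]; rewrite (bnd_index_be HG).
Qed.

Lemma incident_pbnd (i : 'I_n) (e : E) : incident (pbnd G i) e = (e == be i).
Proof.
rewrite /incident (peB_pbnd HG); case: eqP => //= h.
by apply/negbTE/eqP => h1; have := peW_int HG e; rewrite h1 bnd_pbnd.
Qed.

Lemma sum_incident_int (U : nmodType) (F : E -> U) :
  \sum_(x | ~~ is_bnd x) \sum_(e | incident x e) F e + \sum_i F (be i) = \sum_e F e + \sum_e F e.
Proof.
rewrite -sum_incident [RHS](bigID (@is_bnd n G)) /= addrC; congr (_ + _).
rewrite sum_bnd_vertex; apply: eq_bigr => i _; rewrite (big_pred1 (be i)) // => e /=.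
exact: incident_pbnd.
Qed.

Lemma sum_prW (U : nmodType) (F : E -> U) (x : pV G) :
  \sum_(e | peW e == x) F (prW e) = \sum_(e | peW e == x) F e.
Proof.
by rewrite [RHS](reindex_inj (prW_inj HG)); apply: eq_bigl => e; rewrite (peW_prW HG).
Qed.
Lemma sum_prB (U : nmodType) (F : E -> U) (x : pV G) :
  \sum_(e | peB e == x) F (prB e) = \sum_(e | peB e == x) F e.
Proof.
by rewrite [RHS](reindex_inj (prB_inj HG)); apply: eq_bigl => e; rewrite (peB_prB HG).
Qed.
Lemma sum_prB_int (U : nmodType) (F : E -> U) :
  \sum_(e | ~~ bnde e) F (prB e) = \sum_(e | ~~ bnde e) F e.
Proof.
by rewrite [RHS](reindex_inj (prB_inj HG)); apply: eq_bigl => e; rewrite (peB_prB HG).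
Qed.

Lemma adjacent_edge (e : E) : @Defs.adjacent n G (peB e) (peW e).
Proof. by apply/existsP; exists e; rewrite !eqxx. Qed.

(** Each component contains a boundary vertex. This serves to refute interior configurations that
    would spread over a whole component. *)
Lemma adjacent_closed (P : pV G -> Prop) x0 : P x0 ->
  (forall e : E, P (peB e) -> P (peW e)) -> (forall e : E, P (peW e) -> P (peB e)) ->
  exists i, P (pbnd G i).
Proof.
move=> h0 hBW hWB; have [i /connectP[p hp hl]] := connect_bnd HG x0; exists i; rewrite hl.
elim: p x0 h0 hp {hl} => //= y p IH x hx /andP[/existsP[e he] hp]; apply: IH => //.
case/orP: he => /andP[/eqP h1 /eqP <-]; rewrite -h1 in hx; [exact: hBW|exact: hWB].
Qed.

Lemma interior_has_edge (x : pV G) : ~~ is_bnd x -> exists e, incident x e.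
Proof.
move=> hx; have [i /connectP[[|y p] /= hp hl]] := connect_bnd HG x.
  by move: hx; rewrite -hl bnd_pbnd.
case/andP: hp => /existsP[e he] _; exists e; rewrite /incident.
by case/orP: he => /andP[-> _]; rewrite ?orbT.
Qed.

End IncidenceSums.

(** * Signed count of strand crossings *)

Section Labelling.
Variables (n : nat) (G : plabic n).
Hypothesis HG : plabic_ok G.
Local Notation E := (pE G).
Local Notation be := (pbedge G).
Variables (f : 'I_n -> 'I_n) (B W : E -> nat).

(* [B e] and [W e] label the strands traversing [e] from black to white and
   from white to black; boundary labels are odd, so that even values remain
   free for closed strands. *)
Definition strand_labelling :=
  [/\ forall e, W (prW e) = B e, forall e, ~~ bnde e -> W (prB e) = B e,
      forall i, W (be i) = (2 * i).+1 & forall i, B (be i) = (2 * f i).+1].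

Hypotheses (finj : injective f) (fnofix : forall s, f s != s) (HL : strand_labelling).

Lemma flow_white (U : nmodType) (F : nat -> U) (x : pV G) :
  \sum_(e | peW e == x) F (B e) = \sum_(e | peW e == x) F (W e).
Proof.
case: HL => h _ _ _; rewrite -[RHS](sum_prW HG); by apply: eq_bigr => e _; rewrite h.
Qed.

Lemma flow_black (U : nmodType) (F : nat -> U) (x : pV G) : ~~ is_bnd x ->
  \sum_(e | peB e == x) F (B e) = \sum_(e | peB e == x) F (W e).
Proof.
case: HL => _ h _ _ hx; rewrite -[RHS](sum_prB HG); apply: eq_bigr => e /eqP he.
by rewrite h // he.
Qed.

(** Around a vertex the incoming labels are a permutation of the outgoing ones, so any function of
    the labels gives a flow. *)
Lemma label_flow (K : fieldType) (F : nat -> K) :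
  exists N S b, [/\ face_function N S b, forall e, N e - S e = F (B e) - F (W e)
    & forall i : 'I_n, b i = \sum_(r < n | (r <= i)%N) (F (2 * f r).+1 - F (2 * r).+1)].
Proof.
have [x|x hx|N [S [b [h1 h2 h3]]]] := @flow_is_boundary _ _ HG K (fun e => F (B e) - F (W e)).
- by rewrite sumrB flow_white subrr.
- by rewrite sumrB flow_black ?subrr.
- exists N, S, b; split=> // i; rewrite h3; apply: eq_bigr => r _.
  by case: HL => _ _ -> ->.
Qed.

Lemma label_flow_pred (K : fieldType) (F : nat -> K) N S b :
  face_function N S b -> (forall e, N e - S e = F (B e) - F (W e)) ->
  (forall i : 'I_n, b i = \sum_(r < n | (r <= i)%N) (F (2 * f r).+1 - F (2 * r).+1)) ->
  forall i : 'I_n, b (ord_pred i) = \sum_(r < n | (r < i)%N) (F (2 * f r).+1 - F (2 * r).+1).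
Proof.
move=> [_ _ h3 h4] h5 h6 i; have := h5 (be i); rewrite h3 h4 h6 (bigD1 i) //=.
case: HL => _ _ -> -> /eqP; rewrite -subr_eq0 => /eqP h.
have -> : b (ord_pred i) = \sum_(r < n | (r <= i)%N && (r != i)) (F (2 * f r).+1 - F (2 * r).+1).
  apply/eqP; rewrite -subr_eq0 -oppr_eq0; apply/eqP; rewrite -[RHS]h; ring.
by apply: eq_bigl => r; rewrite ltn_neqAle andbC.
Qed.

Definition asc e := (W e < B e)%N.
Definition desc e := (B e < W e)%N.
Let bq (b : bool) : rat := b%:R.

(** For each threshold [x], the labels below [x] form a flow with a face function. Taken at [x]
    equal to the label of a strand and followed along that strand, this function keeps its value
    from one edge to the next, so the sum over all edges collapses to the boundary. *)
Lemma signed_crossings_rat :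
  \sum_e (bq (desc e) - bq (asc e)) =
  \sum_(i < n) (\sum_(r < n | (r <= i)%N) (bq (f r < i)%N - bq (r < i)%N)
     - \sum_(r < n | (r < i)%N) (bq (f r < f i)%N - bq (r < f i)%N)).
Proof.
pose P (x : nat) (q : (E -> rat) * (E -> rat) * ('I_n -> rat)) :=
  [/\ face_function q.1.1 q.1.2 q.2,
      forall e, q.1.1 e - q.1.2 e = bq (B e < x)%N - bq (W e < x)%N
    & forall i : 'I_n, q.2 i =
        \sum_(r < n | (r <= i)%N) (bq ((2 * f r).+1 < x)%N - bq ((2 * r).+1 < x)%N)].
have [|Q HQ] := @choice _ _ P.
  move=> x; have [N [S [b [h1 h2 h3]]]] := label_flow (fun y => bq (y < x)%N).
  by exists (N, S, b).
case: (HL) => hW hB hbW hbB.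
pose N x := (Q x).1.1; pose S x := (Q x).1.2; pose b x := (Q x).2.
transitivity (\sum_e ((N (B e) e - S (B e) e) + (N (W e) e - S (W e) e))).
  apply: eq_bigr => e _; have [_ h1 _] := HQ (B e); have [_ h2 _] := HQ (W e).
  by rewrite /N /S h1 h2 !ltnn; ring.
have e1 : \sum_e N (B e) e = \sum_e S (W e) e.
  rewrite [RHS](reindex_inj (prW_inj HG)) /=; apply: eq_bigr => e _.
  by rewrite hW; have [[h _ _ _] _ _] := HQ (B e); rewrite /S h.
have e2 : \sum_(e | ~~ bnde e) N (W e) e = \sum_(e | ~~ bnde e) S (B e) e.
  rewrite -[LHS](sum_prB_int HG) /=; apply: eq_bigr => e he.
  by rewrite hB //; have [[_ h _ _] _ _] := HQ (B e); rewrite /N h.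
have rg (a1 a2 a3 : rat) : a1 - a2 + (a3 - a1) = a3 - a2 by ring.
rewrite big_split /= !sumrB e1 rg.
rewrite [X in X - _](bigID (fun e => bnde e)) [X in _ - X](bigID (fun e => bnde e)) /= e2.
rewrite opprD addrACA subrr addr0 !(sum_bnde HG) -[LHS]sumrB -[RHS]sumrB; apply: eq_bigr => i _.
rewrite hbW hbB; have [[_ _ h3 _] _ h4] := HQ (2 * i).+1.
have [hf h5 h6] := HQ (2 * f i).+1; have [_ _ _ h7] := hf.
rewrite /N h3 h4 /S h7 (@label_flow_pred rat (fun y => bq (y < (2 * f i).+1)%N) _ _ _ hf h5 h6 i).
by congr (_ - _); apply: eq_bigr => r _; rewrite !ltnS !ltn_mul2l.
Qed.

Let drops : nat := (\sum_s (f s < s)%N)%N.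

Lemma signed_crossings :
  #|[pred e | asc e]|%:Z - #|[pred e | desc e]|%:Z + drops%:Z =
  pair_defect f.
Proof.
apply: (@intr_inj rat); have := signed_crossings_rat.
rewrite sumrB.
have hc (P : pred E) : \sum_e bq (P e) = #|P|%:R.
  by rewrite -sum1_card natr_sum [RHS]big_mkcond; apply: eq_bigr => e _; rewrite /bq unfold_in; case: (P e).
rewrite !hc => h.
have hz (m : nat) : (m%:Z)%:~R = m%:R :> rat by rewrite pmulrn.
rewrite rmorphD rmorphB /= !hz.
have {h} -> : #|[pred e | asc e]|%:R - #|[pred e | desc e]|%:R =
  - \sum_(i < n) (\sum_(r < n | (r <= i)%N) (bq (f r < i)%N - bq (r < i)%N)
     - \sum_(r < n | (r < i)%N) (bq (f r < f i)%N - bq (r < f i)%N)) by rewrite -h opprB.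
rewrite exchange_big /drops natr_sum -sumrN -big_split /= rmorph_sum; apply: eq_bigr => i _ /=.
rewrite rmorph_sum /=.
have h1 : \sum_(r < n | (r <= i)%N) (bq (f r < i)%N - bq (r < i)%N) =
    (f i < i)%N%:R + \sum_(r < n | (r < i)%N) (bq (f r < i)%N - bq (r < i)%N).
  rewrite (bigD1 i) //= ltnn /bq /= subr0; congr (_ + _); apply: eq_bigl => r.
  by rewrite ltn_neqAle andbC.
rewrite h1; set u := \sum_(_ < n | _) _; set v := \sum_(_ < n | _) _.
have -> : - ((f i < i)%N%:R + u - v) + (f i < i)%N%:R = v - u by ring.
rewrite /u /v -sumrB big_mkcond /=; apply: eq_bigr => r _; rewrite /bq.
case: (r < i)%N; last by rewrite mul0r.
by rewrite mul1r /= !rmorphD /= !rmorphN /= !hz; ring.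
Qed.

End Labelling.

(** * Reducedness as a local condition on labels; absence of closed strands *)

Section Reducedness.
Variables (n : nat) (G : plabic n).
Hypothesis HG : plabic_ok G.
Local Notation E := (pE G).
Local Notation be := (pbedge G).
Variable (f : 'I_n -> 'I_n).
Hypotheses (finj : injective f) (fnofix : forall s, f s != s).

(* The face count of a reduced graph, with the length of the bounded affine
   permutation already rewritten as a sum over pairs. *)
Hypothesis Hcount : #|E|%:Z - #|[pred x : pV G | ~~ is_bnd x]|%:Z =
  pair_defect f.

Section OneLabelling.
Variables (B W : E -> nat).
Hypothesis HL : strand_labelling f B W.

Lemma vertex_balance (x : pV G) : ~~ is_bnd x ->
  (\sum_(e | incident x e) B e = \sum_(e | incident x e) W e)%N.
Proof.
move=> hx; rewrite !(sum_incident_at HG).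
by rewrite (flow_white HG HL id) (flow_black HG HL id).
Qed.

Lemma bnd_label_neq i : B (be i) != W (be i).
Proof.
case: HL => _ _ -> ->; have := fnofix i; rewrite -val_eqE /=; lia.
Qed.

(** A white leaf hangs on a boundary vertex, and its strand would return at once, giving a fixed
    point of [f]. *)
Lemma prW_neq (e : E) : prW e != e.
Proof.
apply/eqP => h.
have hB : is_bnd (peB e).
  apply: (@interior_leaf _ _ HG (peW e)); first exact: peW_int.
    rewrite (@fintype.eq_card1 _ e) // => e'; rewrite !inE /incident.
    have -> : (peB e' == peW e) = false.
      by apply/eqP => h1; have := peW_white HG e; rewrite -h1 (peB_black HG).
    apply/eqP/eqP => [/esym/(prW_trans HG)[m <-]|-> //].
    by elim: m => //= m ->.
  by apply/existsP; exists e; rewrite !eqxx orbT.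
have [i hi] := bndeP HG e hB.
case: HL => hW _ _ _; have := bnd_label_neq i; by rewrite -hi -hW h eqxx.
Qed.

Lemma prB_neq (e : E) : ~~ bnde e -> prB e != e.
Proof.
move=> he; apply/eqP => h.
suff : is_bnd (peW e) by apply/negP; exact: peW_int.
apply: (@interior_leaf _ _ HG (peB e)) => //; last exact: adjacent_edge.
rewrite (@fintype.eq_card1 _ e) // => e'; rewrite !inE /incident orbC.
have -> : (peW e' == peB e) = false.
  by apply/eqP => h1; have := peW_white HG e'; rewrite h1 (peB_black HG).
apply/eqP/eqP => [/esym/(prB_trans HG)[m <-]|-> //].
by elim: m => //= m ->.
Qed.

Lemma interior_deg2 (x : pV G) : ~~ is_bnd x -> (2 <= \sum_(e | incident x e) 1)%N.
Proof.
move=> hx; have [e he] := interior_has_edge HG hx.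
have [e' he' hn] : exists2 e', incident x e' & e' != e.
  case/orP: (he) => /eqP h.
    by exists (prB e); [rewrite /incident (peB_prB HG) h eqxx|apply: prB_neq; rewrite h].
  by exists (prW e); [rewrite /incident (peW_prW HG) h eqxx orbT|apply: prW_neq].
by rewrite (bigD1 e) //= (bigD1 e') ?he' //= addnA leq_addr.
Qed.

Let D (x : pV G) : nat := (\sum_(e | incident x e) desc B W e)%N.
Let slf (e : E) : bool := B e == W e.
Let mono (x : pV G) := ~~ is_bnd x && [forall e, incident x e ==> slf e].

(** Without a descent all labels would rise weakly and one strictly, against [vertex_balance]. *)
Lemma D_mono (x : pV G) : ~~ is_bnd x -> ~~ mono x -> (1 <= D x)%N.
Proof.
move=> hx; rewrite /mono hx /= => /forallPn[e]; rewrite negb_imply => /andP[he hne].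
rewrite lt0n; apply/eqP => /eqP; rewrite sum_nat_eq0 => /forallP h0.
have h e' : incident x e' -> (W e' <= B e')%N.
  by move=> he'; have := h0 e'; rewrite he' /desc /= eqb0 -leqNgt.
have hb := vertex_balance hx.
have : (\sum_(e | incident x e) W e < \sum_(e | incident x e) B e)%N.
  rewrite (bigD1 e) //= [X in (_ < X)%N](bigD1 e) //=.
  have h1 : (W e < B e)%N by have := h e he; rewrite /slf in hne; lia.
  have h2 : (\sum_(i | incident x i && (i != e)) W i <= \sum_(i | incident x i && (i != e)) B i)%N.
    by apply: leq_sum => i /andP[hi _]; exact: h.
  lia.
by rewrite hb ltnn.
Qed.

Let nint := (\sum_(x : pV G | ~~ is_bnd x) 1)%N.
Let slfs := (\sum_e slf e)%N.

(** An edge is seen from both its ends, a boundary edge from one interior end only; with this,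
    [Hcount] combined with the signed crossing number becomes a count of descents. The lower bound
    in [D_mono] will meet it with equality. *)
Lemma D_self_sum : (\sum_(x | ~~ is_bnd x) D x + slfs = nint)%N.
Proof.
have h1 : (\sum_(x | ~~ is_bnd x) D x + \sum_i desc B W (be i) =
    \sum_e desc B W e + \sum_e desc B W e)%N by exact: (sum_incident_int HG).
have h2 := signed_crossings HG HL; rewrite -Hcount in h2.
have h3 : (\sum_i (desc B W (be i) : nat) = \sum_(s < n) (f s < s)%N)%N.
  by apply: eq_bigr => i _; case: HL => _ _ h3 h4; rewrite /desc h3 h4 ltnS ltn_mul2l.
have hc (P : pred E) : #|P| = (\sum_e P e)%N.
  by rewrite -sum1_card big_mkcond; apply: eq_bigr => e _; rewrite unfold_in; case: (P e).
have hn : #|[pred x : pV G | ~~ is_bnd x]| = nint by rewrite -sum1_card.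
rewrite hn (hc (asc B W)) (hc (desc B W)) /= in h2.
have h4 : #|E| = (\sum_e asc B W e + \sum_e desc B W e + slfs)%N.
  rewrite -sum1_card -!big_split; apply: eq_bigr => e _ /=.
  by rewrite /asc /desc /slf; case: ltngtP.
rewrite h3 in h1; move: h1 h2 h4.
set a := (\sum_(s < n) _)%N; set b := (\sum_(x | _) _)%N; set c := (\sum_e desc _ _ _)%N.
set d := (\sum_e asc _ _ _)%N; clearbody a b c d; clearbody slfs nint.
clear; move=> h1 h2 h3; move: h1 h2; rewrite h3; clear h3; lia.
Qed.

Lemma self_le_mono : (slfs <= \sum_x mono x)%N.
Proof.
have h := D_self_sum.
have : (nint <= \sum_(x | ~~ is_bnd x) D x + \sum_x mono x)%N.
  rewrite [X in (_ <= _ + X)%N](bigID (fun x => ~~ is_bnd x)) /= addnA.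
  apply: leq_trans (leq_addr _ _); rewrite -big_split /=; apply: leq_sum => x hx.
  have [hm|hm] := boolP (mono x); first by rewrite addn1.
  by rewrite addn0; apply: D_mono.
lia.
Qed.

Let sdeg (x : pV G) : nat := (\sum_(e | incident x e) slf e)%N.

Lemma sdeg_mono x : mono x -> (2 <= sdeg x)%N.
Proof.
move=> /andP[hx /forallP hm]; apply: (leq_trans (interior_deg2 hx)).
by apply: leq_sum => e he; have := hm e; rewrite he /= => ->.
Qed.

(** A vertex whose edges are all self-crossings has at least two of them, while [self_le_mono]
    allows on average one such edge per such vertex. Counting ends of edges leaves no self-crossing
    at any other vertex. *)
Lemma sdeg_not_mono x : ~~ mono x -> sdeg x = 0%N.
Proof.
move=> hx; have h1 := self_le_mono.
have h2 : (\sum_x sdeg x = slfs + slfs)%N by exact: (sum_incident HG).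
have h3 : (2 * (\sum_x mono x) <= \sum_(x | mono x) sdeg x)%N.
  rewrite [X in (_ * X)%N](_ : _ = \sum_(x | mono x) 1)%N; last by rewrite [RHS]big_mkcond; apply: eq_bigr => y _; case: (mono y).
  by rewrite big_distrr /=; apply: leq_sum => y hy; rewrite muln1; exact: sdeg_mono.
move: h2; rewrite (bigID mono) /= => h2.
have : (\sum_(x | ~~ mono x) sdeg x = 0)%N by lia.
by move=> /eqP; rewrite sum_nat_eq0 => /forallP/(_ x); rewrite hx => /eqP.
Qed.

(** A self-crossing edge makes all edges at both its ends self-crossings, and this spreads to a
    boundary vertex, where it is impossible. *)
Lemma label_neq e : B e != W e.
Proof.
apply/negP => he.
have hs x e' : incident x e' -> slf e' -> mono x.
  move=> h1 h2; apply/negPn/negP => /sdeg_not_mono /eqP.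
  by rewrite sum_nat_eq0 => /forallP/(_ e'); rewrite h1 h2.
have [i] : exists i, mono (pbnd G i); last by rewrite /mono bnd_pbnd.
apply: (adjacent_closed HG (P := fun x => mono x) (x0 := peW e)).
- by apply: hs he; rewrite /incident eqxx orbT.
- move=> e' /andP[_ /forallP /(_ e')]; rewrite /incident eqxx /= => h.
  by apply: hs h; rewrite /incident eqxx orbT.
- move=> e' /andP[_ /forallP /(_ e')]; rewrite /incident eqxx orbT /= => h.
  by apply: hs h; rewrite /incident eqxx.
Qed.

(** Once self-crossings are excluded, [D_self_sum] says that the average of [D] is 1, and every term
    is at least 1. *)
Lemma desc_unique (x : pV G) : ~~ is_bnd x ->
  (\sum_(e | incident x e) desc B W e = 1)%N.
Proof.
have hm y : ~~ mono y.
  apply/negP => hy; have hh := hy; case/andP: hh => hb /forallP h.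
  have [e he] := interior_has_edge HG hb.
  by have := h e; rewrite he /slf (negbTE (label_neq e)).
have h1 := D_self_sum.
have h2 : slfs = 0%N by apply: big1 => e _; rewrite /slf (negbTE (label_neq e)).
have h3 (y : pV G) : ~~ is_bnd y -> (1 <= D y)%N by move=> hy; apply: D_mono.
move=> hx; move: h1; rewrite h2 addn0 /nint (bigD1 x) //= [X in _ = X](bigD1 x) //=.
have : (\sum_(i | ~~ is_bnd i && (i != x)) 1 <= \sum_(i | ~~ is_bnd i && (i != x)) D i)%N.
  by apply: leq_sum => y /andP[hy _]; exact: h3.
have := h3 x hx; rewrite -/(D x); lia.
Qed.

End OneLabelling.

Section ClosedStrands.
Variables (B W : E -> nat).
Hypothesis HL : strand_labelling f B W.

(** Even labels belong to closed strands and are not prescribed anywhere, so one arbitrary constant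
    may replace them all; the choice of this constant is the whole argument. *)
Let rl (c m : nat) := if odd m then m else c.

Lemma relabel (c : nat) : strand_labelling f (rl c \o B) (rl c \o W).
Proof.
case: HL => h1 h2 h3 h4; split=> [e|e he|i|i] /=; rewrite ?h1 ?h2 ?h3 ?h4 // /rl /= oddM //.
Qed.

(** With the closed label set just below the open label [W e], the edge [e] is the unique descent
    and drops by 1. Balance then allows a total rise of 1, already spent by the edge that continues
    the closed strand, so the vertex has degree 2. *)
Lemma closed_vertex (x : pV G) e : incident x e -> ~~ odd (B e) ->
  forall g, incident x g -> g = e \/ (~~ odd (W g)).
Proof.
move=> hx hB g hg.
have hxi : ~~ is_bnd x.
  apply/negP => /existsP[i /eqP hi]; move: hx; rewrite -hi (incident_pbnd HG) => /eqP he.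
  by case: HL => _ _ _ h4; move: hB; rewrite he h4 /= oddM.
have hW : odd (W e).
  have := label_neq (relabel 0) e; rewrite /= /rl (negbTE hB).
  by case: (odd (W e)) => //; rewrite eqxx.
have hWB : (0 < W e)%N by case: (W e) hW.
pose c := (W e).-1.
have hc : ~~ odd c by rewrite /c; case: (W e) hW => //= m; rewrite negbK.
have hd := desc_unique (relabel c) hxi; have hb := vertex_balance (relabel c) hxi.
have hn := label_neq (relabel c).
rewrite (bigD1 e) //= {1}/desc /= /rl (negbTE hB) hW in hd.
have hlt : (c < W e)%N by rewrite /c; lia.
rewrite /= hlt in hd.
have {}hd : (\sum_(i | incident x i && (i != e)) desc (rl c \o B) (rl c \o W) i = 0)%N.
  exact: (congr1 predn hd).
have hasc i : incident x i -> i != e -> (rl c (W i) < rl c (B i))%N.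
  move=> hi hie; have := hn i; move/eqP: hd; rewrite sum_nat_eq0 => /forallP/(_ i).
  by rewrite hi hie /desc /= eqb0; case: ltngtP.
pose e' : E := if peB e == x then prB e else prW e.
have [he'x he'e he'W] : [/\ incident x e', e' != e & W e' = B e].
  case: (HL) => h1 h2 _ _; rewrite /e'; have [h|h] := eqVneq (peB e) x.
    split; [by rewrite /incident (peB_prB HG) h eqxx|by apply: prB_neq; rewrite h|by rewrite h2 // h].
  split; [|exact: (prW_neq HL)|by rewrite h1].
  by rewrite /incident (peW_prW HG); move: hx; rewrite /incident (negbTE h) /= => ->; rewrite orbT.
have [->|hge] := eqVneq g e; [by left|right].
have [->|hge'] := eqVneq g e'; first by rewrite he'W.
exfalso.
rewrite (bigD1 e) //= [in RHS](bigD1 e) //= in hb.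
rewrite (bigD1 e') /= ?he'x // [in RHS](bigD1 e') /= ?he'x // in hb.
rewrite (bigD1 g) /= ?hg ?hge // [in RHS](bigD1 g) /= ?hg ?hge // in hb.
have h1 := hasc e' he'x he'e; have h2 := hasc g hg hge.
have h3 : (\sum_(i | [&& incident x i, i != e, i != e' & i != g]) rl c (W i) <=
           \sum_(i | [&& incident x i, i != e, i != e' & i != g]) rl c (B i))%N.
  by apply: leq_sum => i /and4P[a1 a2 _ _]; apply: ltnW; apply: hasc.
move: hb; rewrite (eq_bigl (fun i => [&& incident x i, i != e, i != e' & i != g])); last first.
  by move=> i; rewrite -!andbA.
rewrite [in RHS](eq_bigl (fun i => [&& incident x i, i != e, i != e' & i != g])); last first.
  by move=> i; rewrite -!andbA.
move: h3 h1 h2; rewrite he'W /rl (negbTE hB) hW; rewrite /c; lia.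
Qed.

(** By [closed_vertex], a closed strand at a vertex is also present at all its neighbours, and so
    reaches the boundary, where labels are odd. *)
Lemma all_strands_open e : odd (B e).
Proof.
apply/negPn/negP => he.
pose P (x : pV G) := exists2 e, incident x e & ~~ odd (B e).
have hP : P (peW e) by exists e => //; rewrite /incident eqxx orbT.
have [i [e0]] : exists i, P (pbnd G i); last first.
  by rewrite (incident_pbnd HG) => /eqP ->; case: HL => _ _ _ ->; rewrite /= oddM.
apply: (adjacent_closed HG hP) => g [e0 h0 hB0].
- have hg : incident (peB g) g by rewrite /incident eqxx.
  have [hge|hWg] := closed_vertex h0 hB0 hg.
    by exists g; rewrite ?hge //; rewrite /incident -hge eqxx orbT.
  have [e1 h1] : exists e1, prW e1 = g by exists (finv (@prW n G) g); rewrite (f_finv (prW_inj HG)).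
  exists e1; first by rewrite /incident -h1 (peW_prW HG) eqxx orbT.
  by case: HL => h _ _ _; rewrite -h h1.
- have hg : incident (peW g) g by rewrite /incident eqxx orbT.
  have [hge|hWg] := closed_vertex h0 hB0 hg.
    by exists g; rewrite ?hge //; rewrite /incident -hge eqxx.
  have [e1 h1] : exists e1, prB e1 = g by exists (finv (@prB n G) g); rewrite (f_finv (prB_inj HG)).
  have hb : ~~ bnde e1.
    rewrite -(bnde_prB HG) h1; apply/negP => /(bndeP HG)[i hi].
    by case: HL => _ _ h _; move: hWg; rewrite hi h /= oddM.
  exists e1; first by rewrite /incident -h1 (peB_prB HG) eqxx.
  by case: HL => _ h _ _; rewrite -h // h1.
Qed.

End ClosedStrands.

End Reducedness.

(** * Orbits of an injection on a finite set, followed up to a stopping point *)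

Section FirstStop.
Variables (D : finType) (I : Type) (g : D -> D) (stop : D -> option I).
Hypothesis ginj : injective g.

Definition ends_at (d : D) (q : I) :=
  exists j, (forall i, (i < j)%N -> stop (iter i g d) = None) /\ stop (iter j g d) = Some q.

Lemma ends_at_unique d q q' : ends_at d q -> ends_at d q' -> q = q'.
Proof.
move=> [j [h1 h2]] [j' [h1' h2']].
have [h|h|h] := ltngtP j j'.
- by rewrite h1' in h2.
- by rewrite h1 in h2'.
- by move: h2'; rewrite -h h2 => -[].
Qed.

Lemma ends_at_stop d q : stop d = Some q -> ends_at d q.
Proof. by exists 0%N. Qed.

Lemma ends_at_next d q : stop d = None -> ends_at (g d) q <-> ends_at d q.
Proof.
move=> hd; split=> -[j [h1 h2]].
  exists j.+1; split; last by rewrite iterSr.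
  by move=> [|i] hi //; rewrite iterSr h1.
case: j h1 h2 => [|j] h1 h2; first by rewrite /= hd in h2.
exists j; split; last by rewrite -iterSr.
by move=> i hi; rewrite -iterSr h1.
Qed.

Lemma ends_at_iter d j q : (forall i, (i < j)%N -> stop (iter i g d) = None) ->
  ends_at (iter j g d) q <-> ends_at d q.
Proof.
elim: j => [|j IH] h //=; rewrite ends_at_next ?h //; apply: IH => i hi; apply: h; lia.
Qed.

(** The orbit is a cycle, so a stopping point ahead is also one behind; the least number of backward
    steps gives the last one before [d]. *)
Lemma previous_stop d q : ends_at d q ->
  exists d0 s i, [/\ stop d0 = Some s, d = iter i g (g d0)
    & forall j, (j < i)%N -> stop (iter j g (g d0)) = None].
Proof.
move=> [j [h1 h2]]; pose r := fingraph.order g d.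
have hr : iter r g d = d by exact: iter_order.
have hrm m : iter (m * r) g d = d by elim: m => //= m IH; rewrite mulSn iterD IH hr.
have hr0 : (0 < r)%N by exact: fingraph.order_gt0.
(* A multiple of the period that exceeds [j]: going back by at most [M] steps is going forward by
   [M - i], and the known stop is among these points. *)
pose M := (j.+1 * r)%N; have hM : (j < M)%N by rewrite /M; nia.
pose P i := [&& (0 < i)%N, (i <= M)%N & stop (iter (M - i) g d)].
have hP : exists i, P i by exists (M - j)%N; rewrite /P subn_gt0 hM leq_subr subKn ?h2 // ltnW.
case: (ex_minnP hP) => i /and3P[hi0 hiM his] hmin.
case hs : (stop _) his => [s|] // _.
exists (iter (M - i) g d), s, i.-1; split => //.
  by rewrite -iterS -iterD -[LHS](hrm j.+1); congr iter; rewrite -/M; lia.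
move=> k hk; rewrite -iterS -iterD; case hc : (stop _) => [c|] //.
have := hmin (i - k.+1)%N; rewrite /P.
have -> : (M - (i - k.+1) = k + (M - i).+1)%N by lia.
rewrite hc /=; lia.
Qed.

(** [None] stands for an orbit that never stops. *)
Definition end_of (d : D) : option I :=
  match pselect (exists q, ends_at d q) with left h => Some (projT1 (cid h)) | right _ => None end.

Lemma end_ofP d q : end_of d = Some q <-> ends_at d q.
Proof.
rewrite /end_of; case: pselect => [h|h]; last by split => // hq; case: h; exists q.
case: (cid h) => q' /= hq'; split; first by case=> <-.
by move=> hq; congr Some; apply: ends_at_unique hq.
Qed.

Lemma end_of_next d : stop d = None -> end_of (g d) = end_of d.
Proof.
move=> hd; case h : (end_of d) => [q|].
  by apply/end_ofP/ends_at_next => //; apply/end_ofP.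
by case h' : (end_of (g d)) => [q|] //; move/end_ofP/(ends_at_next _ hd)/end_ofP: h'; rewrite h.
Qed.

Lemma end_of_stop d q : stop d = Some q -> end_of d = Some q.
Proof. by move=> h; apply/end_ofP/ends_at_stop. Qed.

End FirstStop.

(** * Labelling of edges by the endpoints of strands *)

Section StrandLabels.
Variables (n : nat) (G : plabic n).
Hypothesis HG : plabic_ok G.
Local Notation E := (pE G).
Local Notation be := (pbedge G).
Variable (f : 'I_n -> 'I_n).
Hypothesis Hf : forall s, strand_end G s (f s).

Definition strand_stop (e : E) : option 'I_n := bnd_index (peB (prW e)).

Lemma snext_inj : injective (@snext n G).
Proof.
by move=> e e' /(can_inj (f_finv (prB_inj HG))) /(prW_inj HG).
Qed.

Lemma strand_stop_be (e : E) i : prW e = be i -> strand_stop e = Some i.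
Proof. by rewrite /strand_stop => ->; rewrite (peB_be HG) (bnd_index_be HG). Qed.
Lemma strand_stop_int (e : E) : ~~ bnde (prW e) -> strand_stop e = None.
Proof. exact: bnd_index_int. Qed.
Lemma strand_stopP (e : E) i : strand_stop e = Some i -> prW e = be i.
Proof.
have [/(bndeP HG)[j hj]|h] := boolP (bnde (prW e)); last by rewrite strand_stop_int.
by rewrite (strand_stop_be hj) hj => -[->].
Qed.
Lemma strand_stop_none (e : E) : strand_stop e = None -> ~~ bnde (prW e).
Proof. by move=> h; apply/negP => /(bndeP HG)[j /strand_stop_be]; rewrite h. Qed.

Lemma snext_stop (e : E) i : prW e = be i -> snext e = be i.
Proof. by rewrite /snext => ->; rewrite -{1}(prB_be HG i) (finv_f (prB_inj HG)). Qed.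

Lemma ends_at_be s : ends_at (@snext n G) strand_stop (be s) (f s).
Proof.
have [j [h1 h2]] := Hf s; exists j; split.
  by move=> i hi; apply: strand_stop_int; exact: h1.
by apply: strand_stop_be; apply/eqP; rewrite -(peB_pbnd HG); apply/eqP.
Qed.

(** Endpoints become odd numbers and closed strands get 0, as the parity convention of
    [strand_labelling] requires. *)
Definition label0 (e : E) : nat :=
  if end_of (@snext n G) strand_stop e is Some q then (2 * q).+1 else 0.

Lemma label0_labelling : strand_labelling f label0 (label0 \o finv (@prW n G)).
Proof.
split=> [e|e he|i|i] /=; first by rewrite (finv_f (prW_inj HG)).
- set e' := finv _ _; have h : prW e' = prB e by rewrite (f_finv (prW_inj HG)).
  have hs : snext e' = e by rewrite /snext h (finv_f (prB_inj HG)).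
  rewrite -[in RHS]hs /label0 end_of_next //; apply: strand_stop_int; by rewrite h (bnde_prB HG).
- set e' := finv _ _; have h : prW e' = be i by rewrite (f_finv (prW_inj HG)).
  by rewrite /label0 (end_of_stop _ (strand_stop_be h)).
- by rewrite /label0 (iffRL (end_ofP _ _ _ _) (ends_at_be i)).
Qed.

Hypothesis Hopen : forall e, odd (label0 e).

Lemma label_exists e : exists q, ends_at (@snext n G) strand_stop e q.
Proof.
have := Hopen e; rewrite /label0; case h : (end_of _ _ _) => [q|] // _.
by exists q; apply/end_ofP.
Qed.

Definition labB (e : E) : 'I_n := projT1 (cid (label_exists e)).
Definition labW (e : E) : 'I_n := labB (finv (@prW n G) e).
Lemma labB_spec e : ends_at (@snext n G) strand_stop e (labB e).
Proof. by rewrite /labB; case: cid. Qed.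
Lemma label0E e : label0 e = (2 * labB e).+1.
Proof. by rewrite /label0 (iffRL (end_ofP _ _ _ _) (labB_spec e)). Qed.
Lemma labW_prW e : labW (prW e) = labB e.
Proof. by rewrite /labW (finv_f (prW_inj HG)). Qed.

Lemma labW_prB e : ~~ bnde e -> labW (prB e) = labB e.
Proof.
move=> he; case: label0_labelling => _ h _ _; have := h e he; rewrite /= !label0E => -[hh].
by apply: val_inj => /=; rewrite /labW; lia.
Qed.
Lemma labW_be i : labW (be i) = i.
Proof.
case: label0_labelling => _ _ h _; have := h i; rewrite /= !label0E => -[hh].
by apply: val_inj => /=; rewrite /labW; lia.
Qed.
Lemma labB_be i : labB (be i) = f i.
Proof.
case: label0_labelling => _ _ _ h; have := h i; rewrite /= !label0E => -[hh].
by apply: val_inj => /=; lia.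
Qed.

(** [previous_stop] traces the strand back to the boundary edge where it starts; from there it ends
    at [f s], and endpoints are unique. *)
Lemma through_bw_lab e : through_bw e (labB e).
Proof.
have [e0 [s [i [h1 h2 h3]]]] := previous_stop snext_inj (labB_spec e).
have he0 := snext_stop (strand_stopP h1); rewrite he0 in h2 h3.
exists s, i; split; first by move=> j hj; apply: strand_stop_none; exact: h3.
  exact: h2.
have -> : labB e = f s; last exact: Hf.
apply: (ends_at_unique (labB_spec e)); rewrite h2; apply/ends_at_iter => //.
exact: ends_at_be.
Qed.

Lemma through_wb_lab e : through_wb e (labW e).
Proof.
have [s [j [h1 h2 h3]]] := through_bw_lab (finv (@prW n G) e).
by exists s, j; split => //; rewrite -h2 (f_finv (prW_inj HG)).
Qed.

End StrandLabels.

(** * The length of [aff_of] over one period *)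

Section AffineLength.
Variables (n : nat) (f : 'I_n -> 'I_n) (g : nat -> nat).
Hypotheses (fnofix : forall s, f s != s) (Hg : forall s : 'I_n, g s.+1 = (f s).+1).

Let h (s : 'I_n) : nat := (f s + n * (f s < s)%N)%N.

Lemma aff_of_low (s : 'I_n) : aff_of n g s.+1 = (h s).+1.
Proof.
rewrite /aff_of /= modn_small // divn_small // mul0n addn0 Hg /h.
have := fnofix s; rewrite -val_eqE /= => hs.
case: ltnP => h1; first by rewrite ltnNge ltnW ?muln0 ?addn0.
by rewrite (_ : (f s < s)%N) ?muln1 ?addSn //; lia.
Qed.

Lemma aff_of_high (s : 'I_n) : aff_of n g (n + s).+1 = (h s + n).+1.
Proof.
have hn : (0 < n)%N := leq_ltn_trans (leq0n s) (ltn_ord s).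
have := aff_of_low s; rewrite /aff_of /= modnDl modn_small // divnDl ?dvdnn // divnn hn.
by rewrite (divn_small (ltn_ord s)) mul0n addn0 /= addn0 mul1n => ->; rewrite addSn.
Qed.

(** The range of [t] splits at [n]; in the upper half [t] is a translate by [n], and the pair is
    read in the opposite order. *)
Lemma aff_length_sum : (aff_length n (aff_of n g))%:Z =
  \sum_(r < n) \sum_(s < n) ind (r < s) * (ind (h s < h r) + ind (h r + n < h s)).
Proof.
rewrite /aff_length big_add1 /= big_mkord.
have inner (a : 'I_n) : (\sum_(a.+2 <= t < a.+1 + n) (aff_of n g t < aff_of n g a.+1) =
    \sum_(b < n) (a < b) * (h b < h a) + \sum_(c < n) (c < a) * (h c + n < h a))%N.
  rewrite addSn big_add1 /= (@big_cat_nat _ _ _ n) /=; [|exact: ltn_ord|by rewrite leq_addl].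
  congr (_ + _)%N.
    rewrite big_geq_mkord big_mkcond; apply: eq_bigr => b _; rewrite !aff_of_low ltnS.
    by case: (a < b)%N; rewrite ?mul1n ?mul0n.
  transitivity (\sum_(0 + n <= i < a + n) (aff_of n g i.+1 < aff_of n g a.+1))%N => //.
  rewrite big_addn addnK big_mkord.
  rewrite (big_ord_widen n (fun i => nat_of_bool (aff_of n g (i + n).+1 < aff_of n g a.+1)%N) (ltnW (ltn_ord a))).
  rewrite big_mkcond; apply: eq_bigr => c _ /=; rewrite addnC aff_of_high aff_of_low ltnS.
  by case: (c < a)%N; rewrite ?mul1n ?mul0n.
rewrite (eq_bigr _ (fun a _ => inner a)).
rewrite big_split PoszD /= [X in _ + X%:Z]exchange_big /=.
rewrite !(big_morph Posz PoszD (erefl _)) -big_split; apply: eq_bigr => r _ /=.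
rewrite !(big_morph Posz PoszD (erefl _)) -big_split; apply: eq_bigr => s _ /=.
by rewrite !PoszM mulrDr.
Qed.

End AffineLength.

(** * The face count of a reduced graph *)

Section ReducedCount.
Variables (n : nat) (G : plabic n).
Hypothesis HG : plabic_ok G.
Local Notation E := (pE G).
Variables (f : 'I_n -> 'I_n) (g : nat -> nat) (k : nat).
Hypotheses (finj : injective f) (fnofix : forall s, f s != s).
Hypotheses (Hg : forall s : 'I_n, g s.+1 = (f s).+1).
Hypotheses (Hred : reduced G k (aff_of n g)) (Hk : k = (\sum_s (f s < s)%N)%N).

(** Euler's formula trades faces for edges and vertices, and [length_identity] rewrites what
    remains. *)
Lemma reduced_count : #|E|%:Z - #|[pred x : pV G | ~~ is_bnd x]|%:Z =
  pair_defect f.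
Proof.
rewrite -(length_identity finj fnofix) -(aff_length_sum fnofix Hg) -Hk.
case: Hred => _; rewrite /nfaces => h1.
have h2 : (0 < sphere_faces G)%N.
  rewrite -card_face; apply/card_gt0P.
  by exists (face_of HG (inr (Ordinal (plabic_n_gt0 HG), true))).
have h3 : #|pV G| = (#|[pred x : pV G | ~~ is_bnd x]| + n)%N.
  rewrite -(cardC [pred x : pV G | ~~ is_bnd x]); congr (_ + _)%N.
  rewrite -sum1_card (eq_bigl (fun x : pV G => is_bnd x)).
    by rewrite (sum_bnd_vertex HG) sum1_card card_ord.
  by move=> x; rewrite !inE negbK.
have h4 := plabic_euler HG.
move: h1 h2 h4; rewrite h3.
set a := sphere_faces G; set b := #|_|; set c := aff_length _ _; set d := (k * _)%N; set e := #|E|.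
clearbody a b c d e; clear; lia.
Qed.

End ReducedCount.

Section ReducedLabelling.
Variables (n : nat) (G : plabic n) (f : 'I_n -> 'I_n) (b w : pE G -> 'I_n).

(* Around every interior vertex the labels increase cyclically: exactly one
   edge is a descent. *)
Definition reduced_labelling :=
  [/\ forall e, w (prW e) = b e, forall e, ~~ is_bnd (peB e) -> w (prB e) = b e,
      forall i, w (pbedge G i) = i & forall i, b (pbedge G i) = f i] /\
  [/\ forall e : pE G, prW e != e, forall e : pE G, ~~ is_bnd (peB e) -> prB e != e,
      forall e, b e != w e
    & forall x : pV G, ~~ is_bnd x -> (\sum_(e | incident x e) (b e < w e)%N = 1)%N].

End ReducedLabelling.

Lemma reduced_labelling_exists (n : nat) (G : plabic n) (HG : plabic_ok G)
  (f : 'I_n -> 'I_n) (g : nat -> nat) (k : nat)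
  (finj : injective f) (fnofix : forall s, f s != s)
  (Hf : forall s, strand_end G s (f s))
  (Hg : forall s : 'I_n, g s.+1 = (f s).+1)
  (Hred : reduced G k (aff_of n g)) (Hk : k = (\sum_s (f s < s)%N)%N) :
  exists b w : pE G -> 'I_n, reduced_labelling f b w /\
    forall e, through_bw e (b e) /\ through_wb e (w e).
Proof.
have Hc := reduced_count HG finj fnofix Hg Hred Hk.
have HL := label0_labelling HG Hf.
have Ho := all_strands_open HG fnofix Hc HL.
exists (labB Ho), (labW Ho); split; last first.
  by move=> e; split; [exact: through_bw_lab|exact: through_wb_lab].
have hd e : (labB Ho e < labW Ho e)%N = desc (label0 (G := G)) (label0 (G := G) \o finv (@prW n G)) e.
  by rewrite /desc /= !(label0E Ho) /labW !ltnS ltn_mul2l.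
split; split.
- exact: labW_prW.
- exact: (labW_prB HG Hf).
- exact: (labW_be HG Hf).
- exact: (labB_be HG Hf).
- exact: (prW_neq HG fnofix Hc HL).
- exact: prB_neq.
- move=> e; apply/eqP => h; have := label_neq HG fnofix Hc HL e.
  by rewrite /= !(label0E Ho) -/(labW Ho e) h eqxx.
- by move=> x hx; rewrite -(desc_unique HG fnofix Hc HL hx); apply: eq_bigr => e _; rewrite hd.
Qed.

(** * The Kasteleyn sign condition at every inner face *)

Section Faces.
Variables (n : nat) (G : plabic n).
Hypothesis HG : plabic_ok G.
Local Notation E := (pE G).
Local Notation be := (pbedge G).
Variables (f : 'I_n -> 'I_n) (b w : E -> 'I_n).
Hypothesis HL : reduced_labelling f b w.

Definition dsc e : int := ind (b e < w e).
(** The residue of [b e - w e] modulo [n], between 1 and [n - 1]. It is the angle of the edge for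
    equally spaced parameters, in units of [pi / n]. *)
Definition step e : int := (b e)%:Z - (w e)%:Z + n%:Z * dsc e.

Lemma step_gt0 e : 1 <= step e.
Proof.
case: HL => _ [_ _ h _]; have := h e; have := ltn_ord (b e); have := ltn_ord (w e).
rewrite -val_eqE /step /dsc /=; case: (ltngtP (b e) (w e)) => //= h1 h2 h3 _; lia.
Qed.

Lemma step_ltn e : step e <= n%:Z - 1.
Proof.
case: HL => _ [_ _ h _]; have := h e; have := ltn_ord (b e); have := ltn_ord (w e).
rewrite -val_eqE /step /dsc /=; case: (ltngtP (b e) (w e)) => //= h1 h2 h3 _; lia.
Qed.

Lemma sum_lab_white (U : nmodType) (F : 'I_n -> U) (x : pV G) :
  \sum_(e | peW e == x) F (b e) = \sum_(e | peW e == x) F (w e).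
Proof.
case: HL => [[h _ _ _] _]; rewrite -[RHS](sum_prW HG); by apply: eq_bigr => e _; rewrite h.
Qed.

Lemma sum_lab_black (U : nmodType) (F : 'I_n -> U) (x : pV G) : ~~ is_bnd x ->
  \sum_(e | peB e == x) F (b e) = \sum_(e | peB e == x) F (w e).
Proof.
case: HL => [[_ h _ _] _] hx; rewrite -[RHS](sum_prB HG); apply: eq_bigr => e /eqP he.
by rewrite h // he.
Qed.

Lemma sum_dsc (x : pV G) : ~~ is_bnd x -> \sum_(e | incident x e) dsc e = 1.
Proof.
by case: HL => _ [_ _ _ h] hx; rewrite -[RHS]/(1%N%:Z) -(h x hx) (big_morph Posz PoszD (erefl _)).
Qed.

(** The labels cancel around the vertex, and its unique descent contributes [n]. *)
Lemma sum_step (x : pV G) : ~~ is_bnd x -> \sum_(e | incident x e) step e = n%:Z.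
Proof.
move=> hx; rewrite /step big_split /= -mulr_sumr sum_dsc // mulr1 sumrB !(sum_incident_at HG).
by rewrite (sum_lab_white (fun i => i%:Z)) (sum_lab_black (fun i => i%:Z)) // subrr add0r.
Qed.

Lemma step_pair (x : pV G) e e' : ~~ is_bnd x -> incident x e -> incident x e' -> e != e' ->
  step e + step e' <= n%:Z /\
  (step e + step e' = n%:Z -> forall g, incident x g -> g = e \/ g = e').
Proof.
move=> hx he he' hn; have hs := sum_step hx.
rewrite (bigD1 e) //= (bigD1 e') ?he' 1?eq_sym //= addrA in hs.
split.
  rewrite -hs lerDl sumr_ge0 // => i _; have := step_gt0 i; lia.
move=> h g hg; have [->|h1] := eqVneq g e; first by left.
have [->|h2] := eqVneq g e'; first by right.
exfalso; move: hs; rewrite h (bigD1 g) /=; last by rewrite hg h1 h2.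
have := step_gt0 g; set u := \sum_(_ | _) _.
have : 0 <= u by rewrite /u sumr_ge0 // => i _; have := step_gt0 i; lia.
clearbody u; lia.
Qed.

Lemma incident_peB (e : E) : incident (peB e) e.
Proof. by rewrite /incident eqxx. Qed.
Lemma incident_peW (e : E) : incident (peW e) e.
Proof. by rewrite /incident eqxx orbT. Qed.
Lemma incident_prB (e : E) : incident (peB e) (prB e).
Proof. by rewrite /incident (peB_prB HG) eqxx. Qed.
Lemma incident_prW (e : E) : incident (peW e) (prW e).
Proof. by rewrite /incident (peW_prW HG) eqxx orbT. Qed.
Lemma eq_sym_neq (T : eqType) (x y : T) : x != y -> y != x.
Proof. by rewrite eq_sym. Qed.

(** The room left by [step_pair] at a corner. At an interior vertex it vanishes only for degree 2;
    at the boundary it is set to 0. *)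
Definition slack (d : dart G) : int :=
  match d with
  | inl (e, true) => n%:Z - step e - step (prW e)
  | inl (e, false) => if bnde e then 0 else n%:Z - step e - step (prB e)
  | inr _ => 0
  end.

Lemma slack_ge0 d : 0 <= slack d.
Proof.
case: HL => _ [hW hB _ _].
case: d => [[e []]|] //=.
  have [h _] := step_pair (peW_int HG e) (incident_peW e) (incident_prW e) (eq_sym_neq (hW e)).
  lia.
case: ifPn => // he.
have [h _] := step_pair he (incident_peB e) (incident_prB e) (eq_sym_neq (hB e he)).
lia.
Qed.

(** The correction at the last index compensates the jump of [ordS] from [n - 1] to 0. *)
Definition arc_wrap (i : 'I_n) : int := ind (f i < i) - ((i.+1 == n) : nat)%:Z.

(* The number of white corners of a face minus its number of descents, the
   boundary arcs being counted by [arc_wrap]. *)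
Definition excess (d : dart G) : int :=
  match d with
  | inl (e, c) => (c : nat)%:Z - ((~~ bnde e : bool) : nat)%:Z * dsc e
  | inr (i, c) => if c then 0 else - arc_wrap i
  end.

Definition is_inner (d : dart G) : bool := if d is inr (_, false) then true else false.
Definition inner_defect (d : dart G) : int :=
  if d is inr (i, false) then n%:Z + 2 - step (be i) + step (be (ordS i)) else 0.

(** Chosen so that its increment along [dphi] is the difference between [slack] and
    [2 n excess - inner_defect]; the sums of these over a face then agree. *)
Definition face_potential (d : dart G) : int :=
  match d with
  | inl (e, true) => if bnde e then step e - 2 * (b e)%:Z else - step e - 2 * (w e)%:Z
  | inl (e, false) => - step e - 2 * (w e)%:Z - n%:Z
  | inr (i, false) => - step (be (ordS i)) - 2 * (ordS i)%:Z - n%:Z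
  | inr (i, true) => 0
  end.

Lemma step_be i : step (be i) = (f i)%:Z - i%:Z + n%:Z * ind (f i < i).
Proof. by case: HL => [[_ _ h1 h2] _]; rewrite /step /dsc h1 h2. Qed.

Lemma slack_excess d : slack d - (2 * n%:Z * excess d - inner_defect d) =
  face_potential (dphi d) - face_potential d.
Proof.
case: (HL) => [[hW hB hwb hbb] _].
have hd e : n%:Z * dsc e = step e - (b e)%:Z + (w e)%:Z by rewrite /step; ring.
have hwr i : n%:Z * arc_wrap i = step (be i) - 1 - (f i)%:Z + (ordS i)%:Z.
  rewrite step_be /arc_wrap mulrBr; set t := n%:Z * _; rewrite /=; have hi := ltn_ord i.
  have [hn|hn] := eqVneq i.+1 n.
    by rewrite [X in modn X _]hn modnn mulr1; clearbody t; lia.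
  by rewrite modn_small ?mulr0; [clearbody t; lia|lia].
case: (dphiP HG d) => [e|e he|i|i|i] /=.
- rewrite hW; case: ifP => hbe /=; first by ring.
  apply/eqP; rewrite -subr_eq0; apply/eqP.
  by transitivity (2 * (n%:Z * dsc e - (step e - (b e)%:Z + (w e)%:Z))); [ring|rewrite hd subrr mulr0].
- rewrite (negbTE he) /= (bnde_prB HG) (negbTE he) hB //.
  apply/eqP; rewrite -subr_eq0; apply/eqP.
  by transitivity (2 * (n%:Z * dsc e - (step e - (b e)%:Z + (w e)%:Z))); [ring|rewrite hd subrr mulr0].
- have /= hv := congr1 val (ord_predK i).
  by rewrite (bnde_be HG) ord_predK hwb hv /=; ring.
- rewrite (bnde_be HG) hbb; apply/eqP; rewrite -subr_eq0; apply/eqP.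
  transitivity (2 * (n%:Z * arc_wrap i - (step (be i) - 1 - (f i)%:Z + (ordS i)%:Z))); first by ring.
  by rewrite hwr subrr mulr0.
- by rewrite !mulr0 !subr0.
Qed.

Lemma sum_face_shift (U : zmodType) (F : dart G -> U) (c : face G) :
  \sum_(d | face_of HG d == c) (F (dphi d) - F d) = 0.
Proof.
rewrite sumrB [X in _ - X](reindex_inj (dphi_inj HG)) /=.
rewrite (eq_bigl (fun d => face_of HG (dphi d) == c)) ?subrr // => d.
by rewrite face_of_dphi.
Qed.

Definition face_excess (c : face G) : int := \sum_(d | face_of HG d == c) excess d.

Lemma face_slack c : 2 * n%:Z * face_excess c =
  \sum_(d | face_of HG d == c) slack d + \sum_(d | face_of HG d == c) inner_defect d.
Proof.
have := sum_face_shift face_potential c.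
rewrite -(eq_bigr _ (fun d _ => slack_excess d)) sumrB => /eqP; rewrite subr_eq0 => /eqP ->.
by rewrite sumrB -mulr_sumr subrK.
Qed.

Lemma inner_defect_ge d : (4 * (is_inner d : nat)%:Z <= inner_defect d).
Proof.
case: d => [[e c]|[i []]] //=.
have := step_gt0 (be (ordS i)); have := step_ltn (be i); lia.
Qed.

Definition outer_face : face G := face_of HG (inr (Ordinal (plabic_n_gt0 HG), true)).

Lemma face_of_outer i : face_of HG (inr (i, true)) = outer_face.
Proof.
apply: (@ord_cyclic_const _ _ HG _ (fun i => face_of HG (inr (i, true)))) => k.
by rewrite -dphi_outer face_of_dphi.
Qed.

Lemma outer_face_dart d : face_of HG d = outer_face -> exists i, d = inr (i, true).
Proof.
pose g (d : dart G) : bool := if d is inr (_, true) then true else false.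
move=> h; have : g d = true.
  rewrite (@face_of_invariant _ _ HG _ g _ _ _ h) // => {h} {}d.
  by case: (dphiP HG d).
by case: d {h} => [[e c]|[i []]] // _; exists i.
Qed.

(** Zero slack forces degree 2 at every vertex of the face, so the vertices of the face form a whole
    component, yet no boundary vertex is among them. *)
Lemma slack_closed_face c : (forall d, face_of HG d = c -> slack d = 0) ->
  (forall i a, face_of HG (inr (i, a)) != c) -> False.
Proof.
case: (HL) => _ [hpW hpB _ _] h0 hna.
have hpre d : face_of HG d = c -> exists2 d', face_of HG d' = c & dphi d' = d.
  move=> h; exists (finv (@dphi n G) d); last by rewrite (f_finv (dphi_inj HG)).
  by rewrite -face_of_dphi (f_finv (dphi_inj HG)).
pose Q (x : pV G) := exists2 d, face_of HG d = c & dtail d = x.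
have hQ x : Q x -> forall g, incident x g -> Q (peB g) /\ Q (peW g).
  move=> [d hd hx] g hg; have [d' hd' hdd] := hpre d hd.
  have hd2 : face_of HG (dphi d) = c by rewrite face_of_dphi.
  have hnar i a : d <> inr (i, a) by move=> hh; have := hna i a; rewrite -hh hd eqxx.
  have hs := h0 _ hd'; move: hdd hs hd' hd hx hd2 hnar.
  case: (dphiP HG d') => [e|e he|i|i|i].
  - move=> <- hs hd' hd /= hx hd2 hnar.
    have he2 : ~~ bnde (prW e).
      apply/negP => /(bndeP HG)[i hi]; move: hd2; rewrite hi dphi_be // => hh.
      by have := hna (ord_pred i) false; rewrite hh eqxx.
    have [_ hall] := step_pair (peW_int HG e) (incident_peW e) (incident_prW e) (eq_sym_neq (hpW e)).
    have hg' : incident (peW e) g by rewrite -(peW_prW HG e) hx.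
    have [|->|->] := hall _ g hg'; first by move: hs => /=; lia.
      split; last by exists (inl (prW e, false)); rewrite //= (peW_prW HG).
      by exists (inl (e, true)).
    split; last by exists (inl (prW e, false)).
    by exists (dphi (inl (prW e, false))) => //; rewrite dphi_wb //= (peB_prB HG).
  - move=> <- hs hd' hd /= hx hd2 hnar.
    have [_ hall] := step_pair he (incident_peB e) (incident_prB e) (eq_sym_neq (hpB e he)).
    have hg' : incident (peB e) g by rewrite -(peB_prB HG e) hx.
    have [|->|->] := hall _ g hg'; first by move: hs; rewrite /= (negbTE he); lia.
      split; last by exists (inl (e, false)).
      by exists (inl (prB e, true)); rewrite //= (peB_prB HG).
    split; first by exists (inl (prB e, true)).
    by exists (dphi (inl (prB e, true))) => //=; rewrite (peW_prW HG).
  - by move=> <- _ _ _ _ _ /(_ (ord_pred i) false).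
  - by move=> _ _ hd'; have := hna i false; rewrite hd' eqxx.
  - by move=> <- _ _ _ _ _ /(_ (ordS i) true).
have [i [d hd hx]] : exists i, Q (pbnd G i).
  apply: (adjacent_closed HG (P := Q) (x0 := dtail (val c))).
  - by exists (val c) => //; exact: face_of_val.
  - by move=> e he; apply: (hQ _ he _ _).2; rewrite /incident eqxx.
  - by move=> e he; apply: (hQ _ he _ _).1; rewrite /incident eqxx orbT.
have [d' hd' hdd] := hpre d hd; move: hdd hd' hd hx.
case: (dphiP HG d') => [e|e he|j|j|j] <- hd' hd /= hx.
- by have := peW_int HG (prW e); rewrite hx bnd_pbnd.
- by move: he; rewrite -(bnde_prB HG) hx bnd_pbnd.
- by have := hna (ord_pred j) false; rewrite hd eqxx.
- by have := hna j false; rewrite hd' eqxx.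
- by have := hna (ordS j) true; rewrite hd eqxx.
Qed.

(** By [face_slack] the excess is an integer that, up to a positive factor, is a sum of nonnegative
    terms. An inner arc contributes at least 4, and without arcs [slack_closed_face] excludes the
    value 0. *)
Lemma face_excess_gt0 c : c != outer_face -> 1 <= face_excess c.
Proof.
move=> hc; have n0 := plabic_n_gt0 HG; have hs := face_slack c.
have h1 : 0 <= \sum_(d | face_of HG d == c) slack d by rewrite sumr_ge0 // => d _; exact: slack_ge0.
have h2 : 0 <= \sum_(d | face_of HG d == c) inner_defect d.
  by rewrite sumr_ge0 // => d _; apply: le_trans (inner_defect_ge d); case: is_inner.
suff : 0 < \sum_(d | face_of HG d == c) slack d + \sum_(d | face_of HG d == c) inner_defect d.
  by rewrite -hs; nia.
rewrite lt0r addr_ge0 // andbT; apply/negP => /eqP h0.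
have hs0 : \sum_(d | face_of HG d == c) slack d = 0.
  by move: h0 h1 h2; set u := \sum_(_ | _) _; set v := \sum_(_ | _) _; clearbody u v; lia.
have hi0 : \sum_(d | face_of HG d == c) inner_defect d = 0 by rewrite hs0 add0r in h0.
apply: (@slack_closed_face c) => [d hd|i a].
  apply/eqP; move/eqP: hs0; rewrite psumr_eq0 => [/allP/(_ d)|d' _]; last exact: slack_ge0.
  by rewrite mem_index_enum hd eqxx => /(_ isT).
case: a; first by rewrite face_of_outer eq_sym.
apply/negP => hd; move/eqP: hi0; rewrite psumr_eq0 => [/allP/(_ (inr (i, false)))|d' _]; last first.
  by apply: le_trans (inner_defect_ge d'); case: is_inner.
rewrite mem_index_enum hd => /(_ isT) /=.
by have := inner_defect_ge (inr (i, false)) => /= + /eqP h; rewrite h.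
Qed.

Lemma sum_arc_wrap : \sum_i arc_wrap i = \sum_i dsc (be i) - 1.
Proof.
rewrite /arc_wrap sumrB; congr (_ - _).
  by apply: eq_bigr => i _; case: (HL) => [[_ _ h1 h2] _]; rewrite /dsc h1 h2.
have n0 := plabic_n_gt0 HG; have hn : (n.-1 < n)%N by lia.
rewrite (bigD1 (Ordinal hn)) //= big1 ?addr0; first by rewrite prednK // eqxx.
move=> i; rewrite -val_eqE /=; case: eqP => //= h; lia.
Qed.

(** By Euler's formula the excesses sum to the number of faces other than the outer one, and each is
    at least 1. White corners minus descents being 1 is the condition that makes the signed
    adjacency matrix a Kasteleyn matrix. *)
Theorem face_excess1 c : c != outer_face -> face_excess c = 1.
Proof.
have htot : \sum_c face_excess c = #|E|%:Z - #|[pred x : pV G | ~~ is_bnd x]|%:Z + 1.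
  transitivity (\sum_d excess d); first by rewrite [RHS](partition_big (face_of HG) xpredT).
  rewrite sum_dart /=.
  under [X in _ + X]eq_bigr => i _ do rewrite add0r.
  rewrite sumrN sum_arc_wrap.
  under eq_bigr => e _ do rewrite add0r -addrA -opprD.
  rewrite sumrB /= big_split /=.
  have h1 : \sum_e ((~~ bnde e : bool) : nat)%:Z * dsc e = \sum_e dsc e - \sum_i dsc (be i).
    rewrite -(sum_bnde HG) [in RHS](bigID (fun e => bnde e)) /= addrAC subrr add0r.
    by rewrite [RHS]big_mkcond; apply: eq_bigr => e _; case: (bnde e); rewrite ?mul1r ?mul0r.
  have h2 := sum_incident_int HG dsc.
  rewrite (eq_bigr (fun=> 1)) in h2; last by move=> x hx; exact: sum_dsc.
  have h3 : \sum_(x : pV G | ~~ is_bnd x) (1 : int) = #|[pred x : pV G | ~~ is_bnd x]|%:Z by rewrite sumr_const natz.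
  have h4 : \sum_(e : E) (1 : int) = #|E|%:Z by rewrite sumr_const natz.
  rewrite h1; move: h2; rewrite h3 h4.
  set u := \sum_e _; set v := \sum_i _; clearbody u v.
  by move=> /(canRL (addrK _)) ->; ring.
have hout : face_excess outer_face = 0.
  apply: big1 => d /eqP h; by have [i ->] := outer_face_dart h.
rewrite (bigD1 outer_face) //= hout add0r in htot.
have hcard : #|{: face G}|%:Z = #|E|%:Z - #|[pred x : pV G | ~~ is_bnd x]|%:Z + 2.
  have h4 := plabic_euler HG; rewrite -card_face in h4.
  have h3 : #|pV G| = (#|[pred x : pV G | ~~ is_bnd x]| + n)%N.
    rewrite -(cardC [pred x : pV G | ~~ is_bnd x]); congr (_ + _)%N.
    rewrite -sum1_card (eq_bigl (fun x : pV G => is_bnd x)).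
      by rewrite (sum_bnd_vertex HG) sum1_card card_ord.
    by move=> x; rewrite !inE negbK.
  move: h4; rewrite h3; set a := #|_|; set a' := #|_|; set a'' := #|_|; clearbody a a' a''; lia.
move=> hc; apply/eqP; rewrite eq_le face_excess_gt0 // andbT leNgt; apply/negP => hlt.
have : \sum_(c | c != outer_face) (1 : int) < \sum_(c | c != outer_face) face_excess c.
  rewrite (bigD1 c) //= [X in _ < X](bigD1 c) //= ltr_leD //.
  by apply: ler_sum => c' /andP[h _]; exact: face_excess_gt0.
have hv : \sum_(c | c != outer_face) (1 : int) = #|{: face G}|%:Z - 1.
  have : \sum_(c : face G) (1 : int) = #|{: face G}|%:Z by rewrite sumr_const natz.
  by rewrite (bigD1 outer_face) //= => <-; rewrite addrC addrK.
by rewrite hv htot hcard -addrA ltxx.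
Qed.

End Faces.

Lemma sum_sigma (U : nmodType) (T : finType) (P : pred T) (F : T -> U) :
  \sum_(x : {x | P x}) F (val x) = \sum_(x | P x) F x.
Proof.
rewrite [RHS](reindex_omap (fun x : {x | P x} => val x) insub) /=.
  by apply: eq_bigl => x; rewrite (valP x) valK eqxx.
by move=> x hx; rewrite insubT.
Qed.

(** * Euler's inequality for a union of faces *)

Section RegionEuler.
Variables (n : nat) (G : plabic n).
Hypothesis HG : plabic_ok G.
Local Notation ea := (edge_or_arc G).
Variable s : dart G -> bool.
Hypothesis s_dphi : forall d, s (dphi d) = s d.

Definition reg_vertex (x : pV G) : bool := [forall d, (dtail d == x) ==> s d].
Definition reg_edge (e : ea) : bool := s (ea_dart true e) && s (ea_dart false e).
Definition reg_face (c : face G) : bool := s (val c).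

Lemma reg_face_of d : reg_face (face_of HG d) = s d.
Proof.
by apply: (@face_of_invariant _ _ HG _ s s_dphi); rewrite face_of_val.
Qed.

Definition region_connected := forall u : dart G -> rat, (forall d, u (dphi d) = u d) ->
  (forall d, s d -> s (dalpha d) -> u (dalpha d) = u d) ->
  forall d d', s d -> s d' -> u d = u d'.

(** All vertices not interior to the region are collapsed to one extra vertex [None]. The result is
    again a connected complex with connected dual, so [euler_le] applies with one vertex more. *)
Lemma region_euler_le : region_connected -> (exists x, ~~ reg_vertex x) ->
  (#|[pred x | reg_vertex x]| + #|[pred c | reg_face c]| <= #|[pred e | reg_edge e]| + 1)%N.
Proof.
move=> hconn [x0 hx0].
pose V' := option {x : pV G | reg_vertex x}.
pose E' := {e : ea | reg_edge e}.
pose F' := {c : face G | reg_face c}.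
pose s' (e : E') : V' := insub (ea_tail (val e)).
pose t' (e : E') : V' := insub (ea_head (val e)).
have hl (e : E') : reg_face (ea_left HG (val e)) by rewrite reg_face_of; have /andP[] := valP e.
have hr (e : E') : reg_face (ea_right HG (val e)) by rewrite reg_face_of; have /andP[] := valP e.
pose l' (e : E') : F' := Sub (ea_left HG (val e)) (hl e).
pose r' (e : E') : F' := Sub (ea_right HG (val e)) (hr e).
have ins (y : {x : pV G | reg_vertex x}) z : ((insub z : V') == Some y) = (z == val y).
  apply/eqP/eqP => [|->]; last by rewrite valK.
  by case: insubP => // u _ <- [->].
(* The indicator of the extra vertex is 1 minus the indicators of all others, so its boundary
   relation follows from theirs. *)
have insN z : ((insub z : V') == None)%:R = 1 - \sum_(y : {x : pV G | reg_vertex x}) (z == val y)%:R :> rat.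
  rewrite (sum_sigma _ (fun x => (z == x)%:R)) big_mkcond /=.
  rewrite (eq_bigr (fun x => (reg_vertex x)%:R * (z == x)%:R)); last first.
    by move=> x _; case: reg_vertex; rewrite ?mul1r ?mul0r.
  by rewrite (sum_pick (fun x => (reg_vertex x)%:R)); case: insubP => [u -> _|/negbTE ->] /=; rewrite ?subrr ?subr0.
have hS (y : {x : pV G | reg_vertex x}) c :
    \sum_(e : E') ((l' e == c)%:R - (r' e == c)%:R) *
      ((ea_head (val e) == val y)%:R - (ea_tail (val e) == val y)%:R) = 0 :> rat.
  pose F (e : ea) : rat := ((ea_left HG e == val c)%:R - (ea_right HG e == val c)%:R) *
      ((ea_head e == val y)%:R - (ea_tail e == val y)%:R).
  rewrite (eq_bigr (fun e : E' => F (val e))) // (sum_sigma _ F).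
  rewrite -[RHS](@map_is_complex _ _ HG rat (val c) (val y)) [RHS](bigID reg_edge) /=.
  rewrite [X in _ = _ + X]big1 ?addr0 // => e he.
  have hno a : (dtail (ea_dart a e) == val y) = false.
    apply/negP => h; have /forallP hy := valP y.
    have := hy (ea_dart a e); rewrite h /= => hsa.
    have := hy (dphi (ea_dart (~~ a) e)); rewrite (dtail_dphi HG) s_dphi.
    have -> : dalpha (ea_dart (~~ a) e) = ea_dart a e by case: (e) => x /=; rewrite negbK.
    rewrite h /= => hsb; move: he; rewrite /reg_edge.
    by case: a hsa hsb {h} => /= -> ->.
  by rewrite /ea_head /ea_tail !hno subrr mulr0.
have := @euler_le rat V' E' F' s' t' l' r'.
rewrite card_option !card_sig => H.
suff h : (#|[pred x | reg_vertex x]|.+1 + #|[pred c | reg_face c]| <= #|[pred e | reg_edge e]| + 2)%N by rewrite -ltnS -[X in (_ <= X)%N]addnS -addSn.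
apply: H.
- move=> c [y|].
    by rewrite -[RHS](hS y c); apply: eq_bigr => e _; rewrite /t' /s' !ins.
  rewrite (eq_bigr (fun e : E' => - \sum_(y : {x : pV G | reg_vertex x}) ((l' e == c)%:R - (r' e == c)%:R) *
      ((ea_head (val e) == val y)%:R - (ea_tail (val e) == val y)%:R))); last first.
    by move=> e _; rewrite /t' /s' !insN -mulr_sumr sumrB; ring.
  by rewrite sumrN exchange_big big1 ?oppr0 // => y _; exact: hS.
- move=> u hu.
  have hc : forall x y, u (insub x) = u (insub y).
    apply: (@map_connected _ _ HG rat (fun x => u (insub x))) => e.
    have [he|he] := boolP (reg_edge e).
      by have := hu (Sub e he); rewrite /s' /t' /= /ea_tail /ea_head.
    have hn a : ~~ reg_vertex (dtail (ea_dart a e)).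
      apply/negP => /forallP hy.
      have := hy (ea_dart a e); rewrite eqxx /= => hsa.
      have := hy (dphi (ea_dart (~~ a) e)); rewrite (dtail_dphi HG) s_dphi.
      have -> : dalpha (ea_dart (~~ a) e) = ea_dart a e by case: (e) => x /=; rewrite negbK.
      rewrite eqxx /= => hsb; move: he; rewrite /reg_edge.
      by case: a hsa hsb {hy} => /= -> ->.
    rewrite insubN; last exact: (hn true).
    by rewrite insubN //; exact: (hn false).
  have hx (v : V') : u v = u (insub x0).
    case: v => [y|]; first by rewrite -(hc (val y)) valK.
    by rewrite insubN.
  by move=> x y; rewrite !hx.
- move=> u hu c c'.
  pose g (d : dart G) : rat := if insub (face_of HG d) is Some c0 then u c0 else 0.
  have hg (c0 : F') : g (val (val c0)) = u c0 by rewrite /g face_of_val valK.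
  rewrite -!hg; apply: hconn; [|..].
  - by move=> d; rewrite /g face_of_dphi.
  - have hgd d (hd : reg_face (face_of HG d)) : g d = u (Sub (face_of HG d) hd) by rewrite /g insubT.
    have hm (e : ea) : reg_edge e -> g (ea_dart true e) = g (ea_dart false e).
      move=> he; have := hu (Sub e he).
      by rewrite (hgd _ (hl (Sub e he))) (hgd _ (hr (Sub e he))).
    move=> d hd hd'; case: d hd hd' => [[e []]|[i []]] hd hd'.
    + by rewrite -(hm (inl e)) // /reg_edge /= hd.
    + by rewrite (hm (inl e)) // /reg_edge /= hd andbT.
    + by rewrite -(hm (inr i)) // /reg_edge /= hd.
    + by rewrite (hm (inr i)) // /reg_edge /= hd andbT.
  - exact: (valP c).
  - exact: (valP c').
Qed.

End RegionEuler.

(** If a face function changes only across [e1] and [e2] at a vertex, rotating from [e1] to [e2]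
    passes edges that leave the value alone. *)
Lemma rotate (D : eqType) (X : Type) (pr : D -> D) (N S : D -> X) e1 e2 k :
  iter k pr e1 = e2 -> e1 != e2 ->
  (forall j, S (pr (iter j pr e1)) = N (iter j pr e1)) ->
  (forall j, iter j pr e1 != e1 -> iter j pr e1 != e2 -> N (iter j pr e1) = S (iter j pr e1)) ->
  N e1 = S e2.
Proof.
move=> hk hne h1 h2.
have hP : exists k, iter k pr e1 == e2 by exists k; rewrite hk.
case: (ex_minnP hP) => m /eqP hm hmin.
have hm0 : (0 < m)%N by case: m hm {hmin} => // h; rewrite -h eqxx in hne.
have H j : (0 < j <= m)%N -> S (iter j pr e1) = N e1.
  elim: j => // -[|j] IH hj; first by rewrite /= (h1 0%N).
  rewrite -(IH _); last by lia.
  rewrite [LHS](h1 j.+1); apply: h2.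
    apply/eqP => he; have := hmin (m - j.+1)%N.
    have -> : iter (m - j.+1) pr e1 = e2.
      by rewrite -[e1 in LHS]he -iterD subnK ?hm //; lia.
    by rewrite eqxx => /(_ isT); lia.
  by apply/negP => /hmin; lia.
by rewrite -hm H // hm0 leqnn.
Qed.

(** * The cycles in the union of two matchings, and the two sides of a cycle *)

Section TwoCovers.
Variables (n : nat) (G : plabic n).
Hypothesis HG : plabic_ok G.
Local Notation E := (pE G).
Local Notation be := (pbedge G).
Variables (T : finType) (tN : T) (wv : T -> pV G).

(* The extra row [tN] stands for a white vertex outside the disk joined to the boundary vertices. *)
Definition column (a : 'I_n) (e : T -> E) (t : T) : pV G :=
  if t == tN then pbnd G a else peB (e t).
Definition star_cover (a : 'I_n) (e : T -> E) :=
  (forall t, t != tN -> peW (e t) = wv t) /\ injective (column a e).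

Hypothesis wv_inj : forall t t', t != tN -> t' != tN -> wv t = wv t' -> t = t'.
Variables (a c : 'I_n) (e e' : T -> E) (r : {perm T}).
Hypotheses (Hc : star_cover a e) (Hc' : star_cover c e').
Hypothesis Hr : forall t, column a e (r t) = column c e' t.

Variable t0 : T.
Let O := porbit r t0.

Lemma porbit_stable t : (r t \in O) = (t \in O).
Proof. by have := porbit_perm r 1 t; rewrite expg1 /O -!eq_porbit_mem => ->. Qed.

Hypothesis Hnt : forall t, t \in O -> t != tN -> e t != e' t.
Hypothesis HntN : tN \in O -> a != c.

Let row t := (t \in O) && (t != tN).
(** The unit flow along one cycle of the symmetric difference, +1 on edges of [e'] and -1 on edges
    of [e]. If the orbit contains [tN], the cycle is a path through the disk between two boundary
    vertices. *)
Definition cflow (g : E) : rat :=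
  \sum_(t | row t) ((e' t == g)%:R - (e t == g)%:R).

Lemma e_inj t t' : t != tN -> t' != tN -> e t = e t' -> t = t'.
Proof. by move=> h h' he; apply: wv_inj => //; case: Hc => hh _; rewrite -!hh ?he. Qed.
Lemma e'_inj t t' : t != tN -> t' != tN -> e' t = e' t' -> t = t'.
Proof. by move=> h h' he; apply: wv_inj => //; case: Hc' => hh _; rewrite -!hh ?he. Qed.
Lemma e_e' t t' : row t -> t' != tN -> e t = e' t' -> False.
Proof.
move=> /andP[h1 h2] h3 he; have htt : t = t'.
  by apply: wv_inj => //; case: Hc => hh _; case: Hc' => hh' _; rewrite -hh // -hh' // he.
by have := Hnt h1 h2; rewrite he htt eqxx.
Qed.
Lemma e'_e t t' : row t -> t' != tN -> e' t = e t' -> False.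
Proof.
move=> /andP[h1 h2] h3 he; have htt : t = t'.
  by apply: wv_inj => //; case: Hc => hh _; case: Hc' => hh' _; rewrite -(hh' t) // -(hh t') // he.
by have := Hnt h1 h2; rewrite he htt eqxx.
Qed.

Lemma cflow0 g : (forall t, row t -> e t != g /\ e' t != g) -> cflow g = 0.
Proof. by move=> h; apply: big1 => t /h[/negbTE -> /negbTE ->]; rewrite subrr. Qed.

Lemma cflow_e t : row t -> cflow (e t) = -1.
Proof.
move=> ht; case/andP: (ht) => h4 h5; rewrite /cflow (bigD1 t) //= eqxx big1 ?addr0.
  by case: eqP => [h|_]; [case: (e_e' ht h5 (esym h))|rewrite sub0r].
move=> t' /andP[/andP[h1 h2] h3].
case: eqP => [h|_]; first by case: (e_e' ht h2 (esym h)).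
by case: eqP => [/(e_inj h2 h5) h|]; [rewrite h eqxx in h3|rewrite subrr].
Qed.
Lemma cflow_e' t : row t -> cflow (e' t) = 1.
Proof.
move=> ht; case/andP: (ht) => h4 h5; rewrite /cflow (bigD1 t) //= eqxx big1 ?addr0.
  by case: eqP => [h|_]; [case: (e_e' ht h5 h)|rewrite subr0].
move=> t' /andP[/andP[h1 h2] h3].
case: eqP => [/(e'_inj h2 h5) h|_]; first by rewrite h eqxx in h3.
by case: eqP => [h|_]; [case: (e'_e ht h2 (esym h))|rewrite subrr].
Qed.

Lemma cflow_supp g : cflow g != 0 -> exists2 t, row t & g = e t \/ g = e' t.
Proof.
move=> hg; apply: contrapT => hn; move/eqP: hg; apply; apply: cflow0 => t ht.
by split; apply/eqP => h; apply: hn; exists t => //; [left|right].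
Qed.

Lemma sum_indicator (P : pred E) (g : E) : \sum_(x | P x) (g == x)%:R = (P g)%:R :> rat.
Proof.
rewrite big_mkcond (bigD1 g) //= eqxx big1 ?addr0; first by case: (P g).
by move=> x /negbTE hx; rewrite eq_sym hx; case: (P x).
Qed.

Lemma col_sum x : ~~ is_bnd x ->
  \sum_(t | row t) ((peB (e' t) == x)%:R - (peB (e t) == x)%:R) = 0 :> rat.
Proof.
move=> hx; have hp (i : 'I_n) : (pbnd G i == x) = false.
  by apply/eqP => h; move: hx; rewrite -h bnd_pbnd.
rewrite sumrB.
have h1 : \sum_(t | row t) (peB (e' t) == x)%:R = \sum_(t in O) (column c e' t == x)%:R :> rat.
  rewrite [RHS](bigID (fun t => t != tN)) /= [X in _ = _ + X]big1 ?addr0.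
    by apply: eq_bigr => t /andP[_ /negbTE h]; rewrite /column h.
  by move=> t /andP[_]; rewrite negbK /column => ->; rewrite hp.
have h2 : \sum_(t | row t) (peB (e t) == x)%:R = \sum_(t in O) (column a e t == x)%:R :> rat.
  rewrite [RHS](bigID (fun t => t != tN)) /= [X in _ = _ + X]big1 ?addr0.
    by apply: eq_bigr => t /andP[_ /negbTE h]; rewrite /column h.
  by move=> t /andP[_]; rewrite negbK /column => ->; rewrite hp.
rewrite h1 h2 [X in _ - X](reindex_inj (@perm_inj _ r)) /=.
rewrite [X in _ - X](eq_bigl (mem O)); last by move=> t; rewrite /= porbit_stable.
by under [X in _ - X]eq_bigr => t _ do rewrite Hr; rewrite subrr.
Qed.

Lemma cflow_cons : (forall x, \sum_(g | peW g == x) cflow g = 0) /\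
  (forall x, ~~ is_bnd x -> \sum_(g | peB g == x) cflow g = 0).
Proof.
split=> x; last move=> hx; rewrite /cflow exchange_big /=.
  apply: big1 => t /andP[_ ht]; rewrite sumrB !sum_indicator.
  by case: Hc => h _; case: Hc' => h' _; rewrite h // h' // subrr.
rewrite -[RHS](col_sum hx); apply: eq_bigr => t _.
by rewrite sumrB !sum_indicator.
Qed.

Section Chain.
Variables (X : Type) (uN uS : E -> X) (ub : 'I_n -> X).
Hypotheses (Hu : face_function uN uS ub) (Hum : forall g, cflow g = 0 -> uN g = uS g).

Lemma chain_white t : row t -> uN (e' t) = uS (e t) /\ uN (e t) = uS (e' t).
Proof.
move=> ht; case/andP: (ht) => h1 h2; case: Hu => hW _ _ _.
have hx : peW (e t) = wv t by case: Hc => h _; exact: h.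
have hx' : peW (e' t) = wv t by case: Hc' => h _; exact: h.
have h0 g : peW g = wv t -> g != e t -> g != e' t -> uN g = uS g.
  move=> hg hg1 hg2; apply: Hum; apply: cflow0 => t' /andP[h3 h4].
  split; apply/eqP => h.
    have htt : t' = t by apply: wv_inj => //; case: Hc => hh _; rewrite -(hh t') // h.
    by rewrite -h htt eqxx in hg1.
  have htt : t' = t by apply: wv_inj => //; case: Hc' => hh _; rewrite -(hh t') // h.
  by rewrite -h htt eqxx in hg2.
have hit g j : peW (iter j (@prW n G) g) = peW g by elim: j => //= j <-; rewrite (peW_prW HG).
have hne := Hnt h1 h2.
split.
  have [k hk] : exists k, iter k (@prW n G) (e' t) = e t by apply: (prW_trans HG); rewrite hx hx'.
  apply: (rotate hk) => //; first by rewrite eq_sym.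
  by move=> j hj1 hj2; apply: h0 => //; rewrite hit.
have [k hk] : exists k, iter k (@prW n G) (e t) = e' t by apply: (prW_trans HG); rewrite hx hx'.
apply: (rotate hk) => //.
by move=> j hj1 hj2; apply: h0 => //; rewrite hit.
Qed.

Lemma peB_e_r t : row t -> r t != tN -> peB (e (r t)) = peB (e' t).
Proof.
move=> /andP[_ h2] hrt; have := Hr t.
by rewrite /column (negbTE h2) (negbTE hrt).
Qed.

Lemma chain_black t : row t -> r t != tN ->
  [/\ ~~ bnde (e' t), uS (e (r t)) = uN (e' t) & uN (e (r t)) = uS (e' t)].
Proof.
move=> ht hrt; case/andP: (ht) => h1 h2; case: Hu => _ hB _ _.
have hx := peB_e_r ht hrt.
have hne : e (r t) != e' t by apply/eqP => h; exact: (e'_e ht hrt (esym h)).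
have hb : ~~ bnde (e' t).
  apply/negP => /(bndeP HG)[j hj]; move: hx hne; rewrite hj (peB_be HG) => /eqP.
  by rewrite (peB_pbnd HG) => ->.
have hcol' : column c e' t = peB (e' t) by rewrite /column (negbTE h2).
have hcol : column a e (r t) = peB (e' t) by rewrite Hr.
have h0 g : peB g = peB (e' t) -> g != e (r t) -> g != e' t -> uN g = uS g.
  move=> hg hg1 hg2; apply: Hum; apply: cflow0 => t' /andP[h3 h4].
  split; apply/eqP => h.
    have htt : t' = r t by case: Hc => _ hh; apply: hh; rewrite hcol /column (negbTE h4) h.
    by rewrite -h htt eqxx in hg1.
  have htt : t' = t by case: Hc' => _ hh; apply: hh; rewrite hcol' /column (negbTE h4) h.
  by rewrite -h htt eqxx in hg2.
have hit g j : peB (iter j (@prB n G) g) = peB g by elim: j => //= j <-; rewrite (peB_prB HG).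
split=> //.
  have [k hk] : exists k, iter k (@prB n G) (e (r t)) = e' t by apply: (prB_trans HG).
  apply: (rotate (N := uS) (S := uN) hk) => //.
    by move=> j; apply: hB; rewrite hit hx.
  by move=> j hj1 hj2; symmetry; apply: h0 => //; rewrite hit.
have [k hk] : exists k, iter k (@prB n G) (e' t) = e (r t) by apply: (prB_trans HG); rewrite hx.
symmetry; apply: (rotate (N := uS) (S := uN) hk) => //; first by rewrite eq_sym.
  by move=> j; apply: hB; rewrite hit.
by move=> j hj1 hj2; symmetry; apply: h0 => //; rewrite hit.
Qed.

(** An orbit through [tN] is a path and has to be followed from the row just after [tN]; on a closed
    cycle any row will do. *)
Definition base := if tN \in O then r tN else t0.

Lemma r_tN : tN \in O -> r tN != tN.
Proof.
move=> h; apply/eqP => h1; have := Hr tN; rewrite h1 /column eqxx => /(pbnd_inj HG) h2.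
by have := HntN h; rewrite h2 eqxx.
Qed.

Lemma row_base : row base.
Proof.
rewrite /base /row; case: ifP => h; first by rewrite porbit_stable h r_tN.
by rewrite porbit_id /=; apply/eqP => h1; rewrite -h1 porbit_id in h.
Qed.

Lemma from_base t : t \in O -> exists k, t = iter k r base.
Proof.
move=> ht; have hb : base \in O by case/andP: row_base.
have : t \in porbit r base by move: hb ht; rewrite /O -!eq_porbit_mem => /eqP -> /eqP ->.
by move/porbitP => [k ->]; exists k; rewrite permX.
Qed.

(** White and black vertices alternate along the cycle, and at each of them [rotate] carries both
    values over, so each side of the cycle keeps one value. *)
Lemma chain_const t : row t ->
  [/\ uS (e t) = uS (e base), uN (e' t) = uS (e base),
      uN (e t) = uN (e base) & uS (e' t) = uN (e base)].
Proof.
suff H : row t -> uS (e t) = uS (e base) /\ uN (e t) = uN (e base).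
  move=> ht; have [h1 h2] := H ht; have [h3 h4] := chain_white ht.
  by split=> //; rewrite ?h3 ?h1 // -h4.
move=> ht; have [k hk] := from_base (proj1 (andP ht)); rewrite {t}hk in ht *.
elim/ltn_ind: k ht => -[|k] IH ht //.
have [hk|hk] := eqVneq (iter k r base) tN.
  have hN : tN \in O by case/andP: ht => [+ _]; rewrite /= porbit_stable hk.
  by rewrite /= hk /base hN.
have hrow : row (iter k r base).
  by rewrite /row hk andbT; case/andP: ht => [+ _]; rewrite /= porbit_stable.
have [h1 h2] := IH k (ltnSn k) hrow.
have hrt : r (iter k r base) != tN by case/andP: ht.
have [_ h3 h4] := chain_black hrow hrt; have [h5 h6] := chain_white hrow.
by split=> /=; rewrite ?h3 ?h4 ?h5 -?h6.
Qed.

End Chain.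

Lemma e_rtN : tN \in O -> e (r tN) = be c.
Proof.
move=> h; have := Hr tN; rewrite /column eqxx (negbTE (r_tN h)) => /eqP.
by rewrite (peB_pbnd HG) => /eqP.
Qed.

Lemma e'_last : tN \in O -> exists2 t, row t & e' t = be a.
Proof.
move=> h; exists ((r^-1)%g tN).
  have h1 : (r^-1)%g tN \in O by rewrite -porbit_stable permKV.
  rewrite /row h1 /=; apply/eqP => h2; have := r_tN h; by rewrite -{1}h2 permKV eqxx.
have h2 : (r^-1)%g tN != tN.
  by apply/eqP => h2; have := r_tN h; rewrite -{1}h2 permKV eqxx.
have := Hr ((r^-1)%g tN); rewrite permKV /column eqxx (negbTE h2) => /esym/eqP.
by rewrite (peB_pbnd HG) => /eqP.
Qed.

Lemma row_rtN : tN \in O -> row (r tN).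
Proof. by move=> h; rewrite /row porbit_stable h r_tN. Qed.

Lemma cflow_be j : cflow (be j) = (tN \in O)%:R * ((j == a)%:R - (j == c)%:R).
Proof.
have hsupp t : row t -> (e t = be j -> tN \in O /\ j = c) /\ (e' t = be j -> tN \in O /\ j = a).
  move=> ht; case/andP: (ht) => h1 h2; split => he.
    pose t' := (r^-1)%g t; have hrt' : r t' = t by rewrite permKV.
    have ht' : t' \in O by rewrite -porbit_stable hrt'.
    have := Hr t'; rewrite hrt' /column (negbTE h2) he (peB_be HG).
    case: eqP => [h3 /(pbnd_inj HG) ->|/eqP h3 /esym/eqP]; first by rewrite -h3.
    by rewrite (peB_pbnd HG) -he => /eqP h4; case: (e_e' ht h3 (esym h4)).
  have := Hr t; rewrite /column (negbTE h2) he (peB_be HG).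
  case: eqP => [h3 /(pbnd_inj HG) ->|/eqP h3 /eqP]; first by rewrite -h3 porbit_stable.
  by rewrite (peB_pbnd HG) -he => /eqP h4; case: (e'_e ht h3 (esym h4)).
have [hN|hN] := boolP (tN \in O); last first.
  rewrite mul0r; apply: cflow0 => t ht; have [h1 h2] := hsupp t ht.
  by split; apply/eqP => h; [have [h3 _] := h1 h|have [h3 _] := h2 h]; rewrite h3 in hN.
rewrite mul1r; have hac := HntN hN.
have [->|hja] := eqVneq j a.
  by have [t ht <-] := e'_last hN; rewrite cflow_e' // (negbTE hac) subr0.
have [->|hjc] := eqVneq j c.
  by rewrite -(e_rtN hN) cflow_e ?sub0r // row_rtN.
rewrite subrr; apply: cflow0 => t ht; have [h1 h2] := hsupp t ht.
split; apply/eqP => h.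
  by have [_ h3] := h1 h; rewrite h3 eqxx in hjc.
by have [_ h3] := h2 h; rewrite h3 eqxx in hja.
Qed.


Lemma dart_face_function (X : Type) (u : dart G -> X) : (forall d, u (dphi d) = u d) ->
  face_function (fun g => u (inl (g, true))) (fun g => u (inl (g, false))) (fun i => u (inr (i, false))).
Proof.
move=> h; split=> [g|g hg|i|i].
- by rewrite -[RHS]h.
- by rewrite -[RHS]h (dphi_wb hg).
- by rewrite -[RHS]h.
- by rewrite -[LHS]h (dphi_be HG).
Qed.

Lemma sum_supp (U : nmodType) (F : E -> U) : (forall g, cflow g = 0 -> F g = 0) ->
  \sum_g F g = \sum_(t | row t) (F (e t) + F (e' t)).
Proof.
move=> h0; rewrite big_split /=.
have h1 : \sum_(t | row t) F (e t) = \sum_(g | cflow g == -1) F g.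
  transitivity (\sum_(t in [set t | row t]) F (e t)); first by apply: eq_bigl => t; rewrite inE.
  rewrite -(@big_imset _ _ _ _ _ e (mem [set t | row t]) F) /=.
    apply: eq_bigl => g; apply/imsetP/eqP => [[t]|h].
      by rewrite inE => ht ->; exact: cflow_e.
    have [|t ht [->|hg]] := @cflow_supp g; first by rewrite h.
      by exists t; rewrite ?inE.
    by move: h; rewrite hg cflow_e'.
  by move=> t t'; rewrite !inE => /andP[_ h1] /andP[_ h2]; exact: e_inj.
have h2 : \sum_(t | row t) F (e' t) = \sum_(g | cflow g == 1) F g.
  transitivity (\sum_(t in [set t | row t]) F (e' t)); first by apply: eq_bigl => t; rewrite inE.
  rewrite -(@big_imset _ _ _ _ _ e' (mem [set t | row t]) F) /=.
    apply: eq_bigl => g; apply/imsetP/eqP => [[t]|h].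
      by rewrite inE => ht ->; exact: cflow_e'.
    have [|t ht [hg|->]] := @cflow_supp g; first by rewrite h.
      by move: h; rewrite hg cflow_e.
    by exists t; rewrite ?inE.
  by move=> t t'; rewrite !inE => /andP[_ h1'] /andP[_ h2]; exact: e'_inj.
rewrite h1 h2.
rewrite (bigID (fun g => cflow g == -1)) /=; congr (_ + _).
rewrite (bigID (fun g => cflow g == 1)) /= [X in _ + X]big1 ?addr0.
  by apply: eq_bigl => g; case: eqP => //= ->.
move=> g /andP[/eqP hg1 /eqP hg2]; apply: h0; apply: contrapT => /eqP hg.
have [t ht [h|h]] := cflow_supp hg; first by apply: hg1; rewrite h cflow_e.
by apply: hg2; rewrite h cflow_e'.
Qed.

Section Region.
Variables (f : 'I_n -> 'I_n) (b w : E -> 'I_n).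
Hypothesis HL : reduced_labelling f b w.
Variables (N S : E -> rat) (bf : 'I_n -> rat).
Hypotheses (Hf : face_function N S bf) (Hcf : forall g, N g - S g = cflow g)
  (Hbf : forall i : 'I_n, bf i = \sum_(j < n | (j <= i)%N) cflow (be j)).

Lemma NS0 g : cflow g = 0 -> N g = S g.
Proof. by rewrite -Hcf => /eqP; rewrite subr_eq0 => /eqP. Qed.

Lemma bfE i : bf i = (tN \in O)%:R * ((a <= i)%N%:R - (c <= i)%N%:R).
Proof.
rewrite Hbf; under eq_bigr => j _ do rewrite cflow_be.
rewrite -mulr_sumr sumrB; congr (_ * (_ - _)).
  rewrite big_mkcond (bigD1 a) //= eqxx big1 ?addr0; first by case: ifP.
  by move=> j /negbTE ->; case: ifP.
rewrite big_mkcond (bigD1 c) //= eqxx big1 ?addr0; first by case: ifP.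
by move=> j /negbTE ->; case: ifP.
Qed.

Definition lo := if (a <= c)%N then a else c.
Definition hi := if (a <= c)%N then c else a.

Lemma lo_hi : tN \in O -> (lo < hi)%N.
Proof.
move=> /HntN; rewrite -val_eqE /= /lo /hi; case: (ltngtP a c) => //.
Qed.

Lemma bf_neq0 i : (bf i != 0) = (tN \in O) && (lo <= i < hi)%N.
Proof.
rewrite bfE /lo /hi; case: (tN \in O); rewrite ?mul0r ?eqxx //= mul1r.
by case: (leqP a c) => h; case: (leqP a i) => h1; case: (leqP c i) => h2 //=; exfalso; lia.
Qed.

Lemma bf_pred_lo : tN \in O -> bf (ord_pred lo) = 0.
Proof.
move=> h; apply/eqP/negPn; rewrite bf_neq0 h /=; have := lo_hi h; have := ltn_ord hi.
case: (lo) => [[|m] hm] /=; first by rewrite add0n modn_small; lia.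
by rewrite modnDr modn_small; lia.
Qed.

Local Notation A0 := (S (e base)).
Local Notation A1 := (N (e base)).
Let Hd := dart_value N S bf 0.

Lemma A1E : A1 = A0 - 1.
Proof. have := Hcf (e base); rewrite (cflow_e row_base) => h; lra. Qed.

Lemma A_path : tN \in O -> A0 = (a <= c)%N%:R.
Proof.
move=> h; have h1 : A1 = bf c.
  by case: Hf => _ _ h2 _; rewrite /base h (e_rtN h) h2.
by move: h1; rewrite A1E bfE h leqnn mul1r => /addIr.
Qed.

Lemma chain_A t : row t -> [/\ S (e t) = A0, N (e' t) = A0, N (e t) = A1 & S (e' t) = A1].
Proof. exact: (chain_const Hf NS0). Qed.
Let zz (x : rat) := (x == A0) || (x == A1).

Lemma zz_bf i : tN \in O -> zz (bf i) /\ zz 0.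
Proof.
move=> h; rewrite /zz A1E (A_path h) bfE h mul1r.
by case: (leqP a c) => h1; case: (leqP a i) => h2; case: (leqP c i) => h3; split; rewrite ?subr0 ?sub0r ?subrr ?eqxx ?orbT //; exfalso; lia.
Qed.

(** Membership in the set of the two values is itself a face function; it does not change across any
    edge and is therefore constant. *)
Lemma zz_Hd d : zz (Hd d).
Proof.
have [|||h1 h2 h3] := @face_function_const _ _ HG _ (zz \o N) (zz \o S) (zz \o bf) (zz 0).
- by case: Hf => h1 h2 h3 h4; split=> [g|g hg|i|i] /=; rewrite ?h1 ?h2 ?h3 ?h4.
- move=> g /=; have [/NS0 -> //|hg] := eqVneq (cflow g) 0.
  have [t ht [->|->]] := cflow_supp hg; have [k1 k2 k3 k4] := chain_A ht;
  by rewrite /zz ?k1 ?k2 ?k3 ?k4 !eqxx orbT.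
- move=> i /=; have [h|h] := boolP (tN \in O); first by have [-> ->] := zz_bf i h.
  by rewrite bfE (negbTE h) mul0r.
have h0 : zz 0 by have /= <- := h1 (e base); rewrite /zz eqxx orbT.
by case: d => [[g []]|[i []]]; rewrite /Hd /=; [have /= -> := h1 g|have /= -> := h2 g|exact: h0|have /= -> := h3 i].
Qed.

Lemma Hd_dphi d : Hd (dphi d) = Hd d.
Proof. exact: dart_value_dphi. Qed.
Lemma A_neq : A0 != A1.
Proof. by rewrite A1E eq_sym -subr_eq0 addrAC subrr. Qed.

(** A function on one side is extended to the other by the constant [kappa] that it takes along the
    cycle. The extension respects all edges, so [dual_connected] applies. This is the connectedness
    part of the Jordan curve theorem. *)
Lemma region_conn zeta : zz zeta -> region_connected (fun d => Hd d == zeta).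
Proof.
move=> hzeta u hu hua d1 d2 hd1 hd2.
pose us d := if Hd d == zeta then u d else 0.
have hus d : us (dphi d) = us d by rewrite /us Hd_dphi hu.
have hff := dart_face_function hus.
have hum g : cflow g = 0 -> us (inl (g, true)) = us (inl (g, false)).
  move=> hg; have hg' : Hd (inl (g, true)) = Hd (inl (g, false)) by exact: NS0.
  rewrite /us hg'; case: ifP => // h.
  by apply: (hua (inl (g, false))) => //; change (Hd (inl (g, true)) == zeta); rewrite hg'.
have hch t (ht : row t) := chain_const hff hum ht.
pose kappa := if zeta == A1 then us (inl (e base, true)) else us (inl (e base, false)).
have hedge g k : Hd (inl (g, k)) == zeta -> Hd (inl (g, ~~ k)) != zeta -> u (inl (g, k)) = kappa.
  move=> h1 h2.
  have -> : u (inl (g, k)) = us (inl (g, k)) by rewrite /us h1.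
  have hg : cflow g != 0.
    by apply/eqP => /NS0 h; move: h1 h2; case: k => /= /eqP <-; rewrite h eqxx.
  have [t ht hgt] := cflow_supp hg; have [k1 k2 k3 k4] := chain_A ht.
  have [l1 l2 l3 l4] := hch t ht.
  rewrite /kappa -(eqP h1).
  case: hgt h1 => ->; case: k {h2} => /= _; rewrite ?k1 ?k2 ?k3 ?k4 ?eqxx ?(negbTE A_neq) ?l1 ?l2 ?l3 ?l4 //.
(* Along the arc that a path cuts off, values are followed back to the end [lo] of the path. *)
have harc i k : Hd (inr (i, k)) == zeta -> Hd (inr (i, ~~ k)) != zeta -> u (inr (i, k)) = kappa.
  case: Hf => _ _ hfN hfS.
  case: k => /= h1 h2.
    have hi0 : bf i != 0 by apply: contra_neq h2 => ->; exact/eqP.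
    move: hi0; rewrite bf_neq0 => /andP[hN hi].
    rewrite (@ord_cyclic_const _ _ HG _ (fun i => u (inr (i, true))) _ i (ord_pred lo)); last first.
      by move=> j; rewrite -[RHS]hu dphi_outer.
    have hb0 : bf (ord_pred lo) == zeta by rewrite bf_pred_lo.
    rewrite (hua (inr (ord_pred lo, false))) //= -(dphi_be HG) hu.
    apply: hedge => /=; first by rewrite hfS.
    rewrite hfN -(eqP h1) bf_neq0 hN leqnn lo_hi //.
  have hi0 : bf i != 0 by rewrite (eqP h1) eq_sym.
  have hne j : bf j != 0 -> bf j == zeta.
    have := zz_Hd (inr (j, false)); have := zz_Hd (inr (i, true)); move: hzeta h2.
    rewrite /zz /= => /orP[]/eqP hz /eqP hz0 /orP[]/eqP h0 /orP[]/eqP hj /eqP hj0; apply/eqP;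
    first [by rewrite hz hj | by case: hz0; rewrite hz h0 | by case: hj0; rewrite hj h0].
  move: (hi0); rewrite bf_neq0 => /andP[hN /andP[hi1 hi2]].
  have [m] : {m | i = m :> nat} by exists (i : nat).
  clear h1 hi0; elim: m i hi1 hi2 => [|m IH] i hi1 hi2 him.
    have hil : i = lo by apply: val_inj => /=; lia.
    rewrite -hu dphi_inner hil; apply: hedge => /=.
      by rewrite hfN; apply: hne; rewrite bf_neq0 hN leqnn lo_hi.
    by rewrite hfS bf_pred_lo.
  have [hil|hil] := eqVneq i lo.
    rewrite -hu dphi_inner hil; apply: hedge => /=.
      by rewrite hfN; apply: hne; rewrite bf_neq0 hN leqnn lo_hi.
    by rewrite hfS bf_pred_lo.
  have hp : ord_pred i = m :> nat by case: (i) him => k hk /= hkm; rewrite hkm /= modnDr modn_small //; rewrite hkm in hk; lia.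
  have hil' : (lo < i)%N by rewrite ltn_neqAle hi1 andbT eq_sym.
  rewrite -hu dphi_inner.
  have hbi : bf i == zeta by apply: hne; rewrite bf_neq0 hN hi1 hi2.
  have hbp : bf (ord_pred i) == zeta by apply: hne; rewrite bf_neq0 hN hp; lia.
  rewrite (hua (inl (be i, false))) /= ?hfN ?hfS // -hu dphi_be //.
  by apply: IH; rewrite ?hp //; lia.
pose U d := if Hd d == zeta then u d else kappa.
have hU : U d1 = U d2.
  apply: (dual_connected HG) => d; first by rewrite /U Hd_dphi hu.
  have hk (g : dart G) : Hd g == zeta -> Hd (dalpha g) != zeta -> u g = kappa.
    by case: g => [[g k]|[i k]]; [exact: hedge|exact: harc].
  rewrite /U; case: ifPn => h1; case: ifPn => h2 //; first by apply: hua.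
    by apply: hk => //; case: (d) h2 => [[g []]|[i []]].
  by symmetry; exact: hk.
by move: hU; rewrite /U hd1 hd2.
Qed.

Lemma unmixed x : ~~ is_bnd x -> (forall g, incident x g -> cflow g = 0) ->
  forall d d', dtail d = x -> dtail d' = x -> Hd d = Hd d'.
Proof.
case: Hf => hW hB _ _ hx h0 [[g k]|[i k]] [[g' k']|[i' k']]; rewrite /Hd /=; first last.
- by move=> hxi; move: hx; rewrite -hxi; case: k {hxi}; rewrite bnd_pbnd.
- by move=> hxi; move: hx; rewrite -hxi; case: k {hxi}; rewrite bnd_pbnd.
- by move=> _ hxi; move: hx; rewrite -hxi; case: k' {hxi}; rewrite bnd_pbnd.
case: k k' => [] [] hd hd'.
- have [m <-] : exists m, iter m (@prB n G) g = g' by apply: (prB_trans HG); rewrite hd.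
  elim: m => //= m ->; have hm : peB (iter m (@prB n G) g) = x.
    by elim: m => //= m IH; rewrite (peB_prB HG).
  by rewrite (hB (iter m _ g)) ?hm // (NS0 (h0 _ _)) // /incident hm eqxx.
- by have := peB_black HG g; rewrite hd -hd' (negbTE (peW_white HG g')).
- by have := peB_black HG g'; rewrite hd' -hd (negbTE (peW_white HG g)).
- have [m <-] : exists m, iter m (@prW n G) g = g' by apply: (prW_trans HG); rewrite hd.
  elim: m => //= m ->; have hm : peW (iter m (@prW n G) g) = x.
    by elim: m => //= m IH; rewrite (peW_prW HG).
  by rewrite (hW (iter m _ g)) -(NS0 (h0 _ _)) // /incident hm eqxx orbT.
Qed.

Let zr (zeta : rat) d := Hd d == zeta.
Let card_zr (zeta : rat) := (#|[pred x | reg_vertex (zr zeta) x]|, #|[pred u | reg_face (zr zeta) u]|,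
  #|[pred g | reg_edge (zr zeta) g]|).
Lemma zr_dphi zeta d : zr zeta (dphi d) = zr zeta d.
Proof. by rewrite /zr Hd_dphi. Qed.
Lemma peW_e t : row t -> peW (e t) = wv t /\ peW (e' t) = wv t.
Proof. by move=> /andP[_ h]; case: Hc => h1 _; case: Hc' => h2 _; rewrite h1 ?h2. Qed.

Lemma region_le zeta : zz zeta ->
  ((card_zr zeta).1.1 + (card_zr zeta).1.2 <= (card_zr zeta).2 + 1)%N.
Proof.
move=> hz; apply: (region_euler_le HG (zr_dphi zeta) (region_conn hz)).
exists (wv base); apply/negP => /forallP h.
have [h1 h2] := peW_e row_base; have [_ _ _ h3] := chain_A row_base.
have := h (inl (e base, false)); have := h (inl (e' base, false)).
rewrite /= h1 h2 eqxx /zr /Hd /= h3 => /eqP <- /eqP h4; by have := A_neq; rewrite h4 eqxx.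
Qed.

Let L := #|[set t | row t]|.

Lemma card_rows_step : #|[set t | row t && (r t != tN)]| = (L - (tN \in O))%N.
Proof.
rewrite /L; have [h|h] := boolP (tN \in O); last first.
  rewrite subn0; apply: eq_card => t; rewrite !inE; case ht : (row t) => //=.
  apply/eqP => h1; move: h; rewrite -h1 porbit_stable; by case/andP: ht => ->.
rewrite (cardsD1 ((r^-1)%g tN) [set t | row t]) inE.
have -> : row ((r^-1)%g tN).
  rewrite /row -porbit_stable permKV h /=; apply/eqP => h2; have := r_tN h; by rewrite -{1}h2 permKV eqxx.
rewrite add1n subn1 /=; apply: eq_card => t; rewrite !inE andbC; congr (_ && _).
by congr (~~ _); apply/eqP/eqP => [<-|->]; rewrite ?permK ?permKV.
Qed.

Lemma mixed_bnd i : ~~ reg_vertex (zr 0) (pbnd G i) ->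
  i \in ([set j | bf j != 0%R] :|: (if tN \in O then [set hi] else finset.set0)).
Proof.
move=> h; rewrite !inE; apply/negPn/negP; rewrite negb_or => /andP[/negPn/eqP h1 h2].
have h3 : bf (ord_pred i) = 0.
  apply/eqP/negPn/negP; rewrite bf_neq0 => /andP[hN hi'].
  move: h2; rewrite hN inE; move: h1 => /eqP; rewrite -[_ == 0]negbK bf_neq0 hN /=.
  rewrite -val_eqE /=; move: hi'; have := ltn_ord hi.
  case: (i) => [[|m] hm] /=; first by rewrite add0n modn_small; lia.
  by rewrite modnDr modn_small; lia.
move/negP: h; apply; apply/forallP => d; apply/implyP => /eqP.
case: Hf => _ _ hfN hfS.
case: d => [[g []]|[j []]] /=; rewrite /zr /Hd /=.
- by move=> /eqP; rewrite (peB_pbnd HG) => /eqP ->; rewrite hfN h1.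
- by move=> hg; have := peW_white HG g; rewrite hg pbnd_black.
- by [].
- by move=> /(pbnd_inj HG) hj; rewrite -h3 -hj ordSK.
Qed.

(** A vertex interior to neither side is a white vertex of the cycle, a black vertex between two of
    its rows, or a boundary vertex on the closed arc that a path cuts off. *)
Lemma mixed_le : (#|[set x | ~~ reg_vertex (zr A0) x && ~~ reg_vertex (zr A1) x]| <=
  L + (L - (tN \in O)) + (#|[set i | bf i != 0%R]| + (tN \in O)))%N.
Proof.
have h0 : (zz 0) by exact: (zz_Hd (inr (a, true))).
pose X1 := [set wv t | t in [set t | row t]].
pose X2 := [set peB (e' t) | t in [set t | row t && (r t != tN)]].
pose X3 := [set pbnd G i | i in [set j | bf j != 0%R] :|: (if tN \in O then [set hi] else finset.set0)].
apply: (@leq_trans #|X1 :|: X2 :|: X3|); last first.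
  apply: (leq_trans (leq_card_setU _ _)); apply: leq_add.
    apply: (leq_trans (leq_card_setU _ _)); apply: leq_add; first exact: leq_imset_card.
    by rewrite -card_rows_step; exact: leq_imset_card.
  apply: (leq_trans (leq_imset_card _ _)); apply: (leq_trans (leq_card_setU _ _)).
  by rewrite leq_add2l; case: ifP => _; rewrite ?cards1 ?cards0.
apply: subset_leq_card; apply/fintype.subsetP => x; rewrite !inE => /andP[hx0 hx1].
have [/existsP[i /eqP hi]|hx] := boolP (is_bnd x).
  apply/orP; right; apply/imsetP; exists i => //; apply: mixed_bnd; rewrite hi.
  by case/orP: h0 => /eqP ->.
apply/orP; left.
have [g hg hgx] : exists2 g, incident x g & cflow g != 0.
  apply: contrapT => hno.
  have hall g : incident x g -> cflow g = 0.
    by move=> hg; apply: contrapT => /eqP hg'; apply: hno; exists g.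
  have hu := unmixed hx hall.
  have [g hg] := interior_has_edge HG hx.
  have [d hd] : exists d : dart G, dtail d = x.
    by case/orP: hg => /eqP hg; [exists (inl (g, true))|exists (inl (g, false))].
  have := zz_Hd d; rewrite /zz => /orP[]/eqP hv.
    by move/negP: hx0; apply; apply/forallP => d'; apply/implyP => /eqP hd'; rewrite /zr -hv (hu d' d).
  by move/negP: hx1; apply; apply/forallP => d'; apply/implyP => /eqP hd'; rewrite /zr -hv (hu d' d).
have [t ht hgt] := cflow_supp hgx; have [w1 w2] := peW_e ht.
have hWin : peW g = x -> x \in X1.
  by move=> <-; apply/imsetP; exists t; rewrite ?inE //; case: hgt => ->; rewrite ?w1 ?w2.
case/orP: hg => /eqP hg; last by rewrite hWin.
apply/orP; right; case/andP: (ht) => ht1 ht2.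
case: hgt => hgt; rewrite hgt in hg.
  pose t' := (r^-1)%g t; have hrt' : r t' = t by rewrite permKV.
  have := Hr t'; rewrite hrt' /column (negbTE ht2) hg.
  case: eqP => [_ hx'|/eqP h3 hx']; first by move: hx; rewrite hx' bnd_pbnd.
  apply/imsetP; exists t' => //; rewrite inE hrt' ht2 andbT /row h3 andbT.
  by rewrite -porbit_stable hrt'.
apply/imsetP; exists t => //; rewrite inE ht /=; apply/eqP => hrt.
have := Hr t; rewrite hrt /column eqxx (negbTE ht2) hg => hx'.
by move: hx; rewrite -hx' bnd_pbnd.
Qed.

Lemma card_support : #|[set g | cflow g != 0%R]| = (2 * L)%N.
Proof.
transitivity (\sum_g ((cflow g != 0%R) : nat))%N.
  by rewrite -sum1_card [RHS]big_mkcond [LHS]big_mkcond; apply: eq_bigr => g _; rewrite inE; case: (_ != _).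
rewrite (@sum_supp nat); last by move=> g ->; rewrite eqxx.
rewrite (eq_bigr (fun=> 2%N)); first by rewrite sum_nat_const /L cardsE mulnC.
by move=> t ht; rewrite cflow_e // cflow_e'.
Qed.

Lemma rows_gt : ((tN \in O) <= L)%N.
Proof.
rewrite /L; case: (boolP (tN \in O)) => // h.
by apply/card_gt0P; exists (r tN); rewrite inE row_rtN.
Qed.

(** The two inequalities of [region_le] and the bound [mixed_le] add up to Euler's formula for the
    whole map, so all three are equalities: each side is a disk. *)
Lemma face_count zeta : zz zeta ->
  ((card_zr zeta).1.1 + (card_zr zeta).1.2 = (card_zr zeta).2 + 1)%N.
Proof.
have hV : (#|pV G| <= (card_zr A0).1.1 + (card_zr A1).1.1 +
    #|[set x | ~~ reg_vertex (zr A0) x && ~~ reg_vertex (zr A1) x]|)%N.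
  rewrite /= -!sum1_card [in X in (_ <= X)%N]big_mkcond [X in (_ <= _ + X + _)%N]big_mkcond [X in (_ <= _ + X)%N]big_mkcond.
  rewrite -!big_split /=; apply: leq_sum => x _; rewrite !inE.
  by case: (reg_vertex (zr A0) x); case: (reg_vertex (zr A1) x).
have hF : #|{: face G}| = ((card_zr A0).1.2 + (card_zr A1).1.2)%N.
  rewrite /= -(cardC [pred u : face G | reg_face (zr A0) u]); congr (_ + _)%N.
  apply: eq_card => u; rewrite !inE /reg_face /zr.
  have := zz_Hd (val u); rewrite /zz; case: eqP => [->|_] //=.
  by rewrite (negbTE A_neq).
have htwo (x y p q : rat) : p != q -> (x == p) || (x == q) -> (y == p) || (y == q) ->
    (1 = (if (x == p) && (y == p) then 1 else 0) + (if (x == q) && (y == q) then 1 else 0) +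
      (if x != y then 1 else 0))%N.
  by move=> /negbTE hpq /orP[]/eqP -> /orP[]/eqP ->; rewrite ?eqxx ?(eq_sym q) ?hpq ?eqxx.
have hE : (#|{: edge_or_arc G}| = (card_zr A0).2 + (card_zr A1).2 + (#|[set g | cflow g != 0%R]| + #|[set i | bf i != 0%R]|))%N.
  rewrite /= -!sum1_card [LHS]big_mkcond [X in (_ = X + _ + _)%N]big_mkcond [X in (_ = _ + X + _)%N]big_mkcond.
  rewrite [X in (_ = _ + (X + _))%N]big_mkcond [X in (_ = _ + (_ + X))%N]big_mkcond.
  rewrite !big_sumType /= [X in (_ = X + _)%N]addnACA addnACA -!big_split /=; congr (_ + _)%N; apply: eq_bigr => g _.
    rewrite !inE /reg_edge /zr /Hd /= -Hcf subr_eq0.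
    by apply: htwo; [exact: A_neq|exact: (zz_Hd (inl (g, true)))|exact: (zz_Hd (inl (g, false)))].
  rewrite !inE /reg_edge /zr /Hd /= [bf g == 0]eq_sym.
  by apply: htwo; [exact: A_neq|exact: (zz_Hd (inr (g, true)))|exact: (zz_Hd (inr (g, false)))].
have hle0 : ((card_zr A0).1.1 + (card_zr A0).1.2 <= (card_zr A0).2 + 1)%N by apply: region_le; rewrite /zz eqxx.
have hle1 : ((card_zr A1).1.1 + (card_zr A1).1.2 <= (card_zr A1).2 + 1)%N by apply: region_le; rewrite /zz eqxx orbT.
have hmix := mixed_le; have heul := plabic_euler HG; have hr := rows_gt.
rewrite -card_face -addnA addnA -card_edge_or_arc hF hE card_support in heul.
have : ((card_zr A0).1.1 + (card_zr A0).1.2 = (card_zr A0).2 + 1)%N /\ ((card_zr A1).1.1 + (card_zr A1).1.2 = (card_zr A1).2 + 1)%N.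
  move: hV hle0 hle1 hmix heul hr; clear.
  move: (card_zr A0) (card_zr A1) => [[v0 f0] e0] [[v1 f1] e1] /=.
  set x1 := #|_|; set x2 := #|_|; set x3 := #|_|; set x4 := nat_of_bool _; clearbody x1 x2 x3 x4 L.
  lia.
by move=> [h1 h2] /orP[]/eqP ->.
Qed.

Hypothesis Hwhite : forall x : pV G, ~~ pblack x -> exists2 t, t != tN & wv t = x.
Hypothesis Hblack : forall x : pV G, pblack x -> ~~ is_bnd x -> exists t, column a e t = x.
Variable J : {set 'I_n}.
Hypothesis HJ : forall j, (j \in J) = [exists t, column a e t == pbnd G j].

Lemma off_orbit t : t != tN -> t \notin O ->
  (forall g, incident (wv t) g -> cflow g = 0) /\ (forall g, incident (peB (e t)) g -> cflow g = 0).
Proof.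
move=> h1 h2; have hwt : peW (e t) = wv t by case: Hc => h _; exact: h.
split=> g hg; apply: contrapT => /eqP hgx; have [t' ht' hgt] := cflow_supp hgx;
  have [w1 w2] := peW_e ht'; case/andP: (ht') => h3 h4; case/orP: hg => /eqP hg.
- by have := peB_black HG g; rewrite hg -hwt (negbTE (peW_white HG _)).
- have htt : t' = t by apply: wv_inj => //; case: hgt hg => ->; rewrite ?w1 ?w2.
  by rewrite -htt h3 in h2.
- case: hgt => hgt; rewrite hgt in hg.
    have htt : t' = t by case: Hc => _; apply; rewrite /column (negbTE h1) (negbTE h4).
    by rewrite -htt h3 in h2.
  have htt : r t' = t.
    by case: Hc => _; apply; rewrite Hr /column (negbTE h1) (negbTE h4).
  by rewrite -htt porbit_stable h3 in h2.
- by have := peB_black HG (e t); rewrite -hg (negbTE (peW_white HG _)).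
Qed.

Definition inner_desc g : nat := ~~ bnde g && (b g < w g)%N.

(** Euler's formula for the side away from the outer face, read modulo 2. The cover [e] pairs the
    vertices there up to those in [J] on the arc, each face has excess 1, and descents of edges
    inside the region count twice; only the cycle and the arc survive. *)
Lemma orbit_parity :
  ~~ odd (\sum_(t | row t) (inner_desc (e t) + inner_desc (e' t)) +
     #|[set j in J | (tN \in O) && (lo < j < hi)%N]| + \sum_(i < n | (tN \in O) && (lo <= i < hi)%N) (f i < i)%N
     + L + 1).
Proof.
(* The outer face has value 0, so the nonzero value marks the side away from it. *)
have [zeta [hz hz0 hzz]] : exists zeta, [/\ zz zeta, zeta != 0 & forall x, zz x -> x != 0 -> x = zeta].
  have := zz_Hd (inr (a, true)); rewrite {1}/zz {1 2}/Hd /= => /orP[]/eqP h0.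
    exists A1; split; first by rewrite /zz eqxx orbT.
      by rewrite h0 eq_sym A_neq.
    by move=> x /orP[/eqP ->|/eqP -> //]; rewrite -h0 eqxx.
  exists A0; split; first by rewrite /zz eqxx.
    by rewrite h0 A_neq.
  by move=> x /orP[/eqP -> //|/eqP ->]; rewrite -h0 eqxx.
pose s d := zr zeta d.
have hbz i : (bf i == zeta) = (tN \in O) && (lo <= i < hi)%N.
  rewrite -bf_neq0; apply/idP/idP => [/eqP -> //|h].
  by apply/eqP; apply: hzz => //; exact: (zz_Hd (inr (i, false))).
pose P := [set t | (t != tN) && (t \notin O) && (N (e t) == zeta)].
pose Q := [set t in P | ~~ bnde (e t)].
pose J' := [set j in J | (tN \in O) && (lo < j < hi)%N].
have hP t : t \in P -> [/\ t != tN, t \notin O, N (e t) = zeta & S (e t) = zeta].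
  rewrite inE => /andP[/andP[h1 h2] /eqP h3]; split=> //; rewrite -h3.
  by rewrite NS0 //; apply: (off_orbit h1 h2).1; case: Hc => h _; rewrite -(h t) // incident_peW.
have hwt t : t != tN -> peW (e t) = wv t by case: Hc => h _; exact: h.
have hregE x d : ~~ is_bnd x -> (forall g, incident x g -> cflow g = 0) -> dtail d = x ->
    reg_vertex s x = (Hd d == zeta).
  move=> h1 h2 h3; apply/forallP/idP => [/(_ d)|/eqP h d']; first by rewrite h3 eqxx.
  by apply/implyP => /eqP h4; rewrite /s /zr -h (unmixed h1 h2 h4 h3).
have hbndN i : ~~ reg_vertex s (pbnd G i).
  apply/negP => /forallP/(_ (inr (i, true))) /=; rewrite eqxx /s /zr /Hd /= => /eqP h.
  by rewrite h eqxx in hz0.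
have hVw : #|[set x | reg_vertex s x && ~~ pblack x]| = #|P|.
  rewrite -(card_in_imset (f := wv)); last first.
    by move=> t t' /hP[h1 _ _ _] /hP[h2 _ _ _]; exact: wv_inj.
  apply: eq_card => x; rewrite inE; apply/andP/imsetP => [[/forallP h1 h2]|[t ht ->]].
    have [t ht htx] := Hwhite h2; exists t => //; rewrite inE ht /=.
    have := h1 (inl (e t, false)); rewrite /= hwt // htx eqxx /= => hS.
    have htO : t \notin O.
      apply/negP => htO; have hrow : row t by rewrite /row htO.
      have [k1 k2 k3 k4] := chain_A hrow; have [_ w2] := peW_e hrow.
      have := h1 (inl (e' t, false)); rewrite /= w2 htx eqxx /= => hS'.
      move: hS hS'; rewrite /s /zr /Hd /= k1 k4 => /eqP h5 /eqP h6.
      by have := A_neq; rewrite h5 h6 eqxx.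
    rewrite htO /= NS0 //; apply: (off_orbit ht htO).1; by rewrite -(hwt t) // incident_peW.
  have [h1 h2 h3 h4] := hP t ht; rewrite -(hwt t) // (peW_white HG); split=> //.
  rewrite (hregE _ (inl (e t, false))) /Hd /= ?h4 ?(peW_int HG) // hwt //.
  exact: (off_orbit h1 h2).1.
have hVb : #|[set x | reg_vertex s x && pblack x]| = #|Q|.
  rewrite -(card_in_imset (f := fun t => peB (e t))); last first.
    move=> t t'; rewrite !inE => /andP[/andP[/andP[h1 _] _] _] /andP[/andP[/andP[h2 _] _] _] h.
    by case: Hc => _; apply; rewrite /column (negbTE h1) (negbTE h2).
  apply: eq_card => x; rewrite inE; apply/andP/imsetP => [[h1 h2]|[t + ->]].
    have hx : ~~ is_bnd x.
      by apply/negP => /existsP[i /eqP hi]; have := hbndN i; rewrite hi h1.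
    have [t htx] := Hblack h2 hx.
    have ht : t != tN.
      apply/negP => /eqP h; move: hx; rewrite -htx h /column eqxx bnd_pbnd //.
    have htx' : peB (e t) = x by rewrite -htx /column (negbTE ht).
    move/forallP: h1 => h1.
    exists t => //; rewrite !inE htx' hx ht /= andbT.
    have := h1 (inl (e t, true)); rewrite /= htx' eqxx /= => hN; rewrite /s /zr /Hd /= in hN.
    rewrite hN andbT; apply/negP => htO; have hrow : row t by rewrite /row htO.
    have [k1 k2 k3 k4] := chain_A hrow.
    pose t' := (r^-1)%g t; have hrt' : r t' = t by rewrite permKV.
    have h3 : t' != tN.
      apply/negP => /eqP h; move: hx; rewrite -htx -hrt' Hr h /column eqxx bnd_pbnd //.
    have hrow' : row t' by rewrite /row h3 andbT -porbit_stable hrt'.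
    have [l1 l2 l3 l4] := chain_A hrow'.
    have := h1 (inl (e' t', true)); rewrite /=.
    have -> : peB (e' t') = x by have := Hr t'; rewrite hrt' htx /column (negbTE h3).
    rewrite eqxx /s /zr /Hd /= l2; move: hN; rewrite k3 => /eqP h5 /eqP h6.
    by have := A_neq; rewrite h5 h6 eqxx.
  rewrite inE => /andP[ht hb]; have [h1 h2 h3 h4] := hP t ht; rewrite (peB_black HG); split=> //.
  rewrite (hregE _ (inl (e t, true))) /Hd /= ?h3 //.
  exact: (off_orbit h1 h2).2.
(* The cover matches a white vertex inside the region either to a black vertex inside or to a
   boundary vertex strictly between the ends of the arc. *)
have hPQ : #|P| = (#|Q| + #|J'|)%N.
  rewrite -(cardsID [set t | ~~ bnde (e t)] P); congr (_ + _)%N.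
    by apply: eq_card => t; rewrite !inE.
  pose PB := P :\: [set t | ~~ bnde (e t)].
  transitivity #|[set peB (e t) | t in PB]|.
    rewrite card_in_imset // => t t'; rewrite !inE negbK => /andP[_ /andP[/andP[h1 _] _]] /andP[_ /andP[/andP[h2 _] _]] h.
    by case: Hc => _; apply; rewrite /column (negbTE h1) (negbTE h2).
  rewrite -(card_imset _ (pbnd_inj HG)); apply: eq_card => x.
  apply/imsetP/imsetP => [[t + ->]|[j + ->]].
    rewrite finset.in_setD inE negbK => /andP[/(bndeP HG)[j hj] ht]; exists j; last by rewrite hj (peB_be HG).
    have [h1 h2 h3 h4] := hP t ht.
    have := hbz j; case: Hf => _ _ hfN hfS; rewrite -hfN -hj h3 eqxx => /esym/andP[hN /andP[h5 h6]].
    rewrite !inE HJ hN h6 andbT /=; apply/andP; split.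
      by apply/existsP; exists t; rewrite /column (negbTE h1) hj (peB_be HG).
    rewrite ltn_neqAle h5 andbT; apply/negP => /eqP h7.
    have : cflow (be j) = 0 by apply: (off_orbit h1 h2).2; rewrite -hj incident_peB.
    rewrite cflow_be hN mul1r => /eqP; rewrite subr_eq0.
    have -> : j = lo by apply: val_inj.
    have := HntN hN; rewrite /lo; case: ifP => _; first by rewrite eqxx => /negbTE ->.
    by rewrite eqxx eq_sym => /negbTE ->.
  rewrite !inE HJ => /andP[/existsP[t /eqP htj] /andP[hN /andP[h5 h6]]].
  have hja : j != a.
    by apply/negP => /eqP h; move: h5 h6; rewrite h /lo /hi; case: (leqP a c); lia.
  have hjc : j != c.
    by apply/negP => /eqP h; move: h5 h6; rewrite h /lo /hi; case: (leqP a c); lia.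
  have h1 : t != tN.
    apply/negP => /eqP h; move: htj; rewrite h /column eqxx => /(pbnd_inj HG) h'.
    by rewrite h' eqxx in hja.
  move: htj; rewrite /column (negbTE h1) => hj; move/eqP: (hj); rewrite (peB_pbnd HG) => /eqP hbe.
  have hcf : cflow (be j) = 0 by rewrite cflow_be (negbTE hja) (negbTE hjc) subrr mulr0.
  exists t => //; rewrite !inE negbK hbe (bnde_be HG) h1 /=; case: Hf => _ _ hfN hfS.
  rewrite hfN hbz hN h6 (ltnW h5) !andbT; apply/negP => htO.
  by have := cflow_e (t := t); rewrite /row htO h1 hbe hcf => /(_ isT).
have hV : (card_zr zeta).1.1 = (2 * #|Q| + #|J'|)%N.
  rewrite /= -(cardID (@pblack n G)) -/s.
  have -> : #|[predI [pred x | reg_vertex s x] & @pblack n G]| = #|Q|.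
    by rewrite -hVb; apply: eq_card => x; rewrite !inE.
  have -> : #|[predD [pred x | reg_vertex s x] & @pblack n G]| = #|P|.
    by rewrite -hVw; apply: eq_card => x; rewrite !inE andbC.
  by rewrite hPQ addnA addnn mul2n.
pose Et := [set g | (N g == zeta) && (S g == zeta)].
have hE : (card_zr zeta).2 = #|Et|.
  have hi0 i : reg_edge s (inr i) = false by rewrite /reg_edge /s /zr /Hd /= eq_sym (negbTE hz0).
  transitivity (\sum_(g : edge_or_arc G | reg_edge s g) 1)%N; first by rewrite sum1_card.
  rewrite big_mkcond big_sumType /= [X in (_ + X)%N]big1 ?addn0; last first.
    by move=> i _; rewrite hi0.
  by rewrite -big_mkcond /= sum1_card; apply: eq_card => g; rewrite !inE.
have hF : (card_zr zeta).1.2%:Z = \sum_(d | s d) excess f b w d.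
  have hso d : s d -> face_of HG d != outer_face HG.
    move=> hd; apply/negP => /eqP /outer_face_dart[i hi]; move: hd.
    by rewrite hi /s /zr /Hd /= eq_sym (negbTE hz0).
  rewrite (partition_big (face_of HG) (fun u : face G => reg_face s u)) /=; last first.
    by move=> d hd; rewrite (reg_face_of HG (zr_dphi zeta)).
  transitivity (\sum_(u : face G | reg_face s u) (1 : int)); first by rewrite sumr_const natz.
  apply: eq_bigr => u hu; rewrite -(face_excess1 HL (c := u)).
    rewrite /face_excess; apply: eq_bigl => d; case: eqP => [h|]; rewrite ?andbF // andbT.
    by rewrite -[s d]/(zr zeta d) -(reg_face_of HG (zr_dphi zeta)) h hu.
  by rewrite -(face_of_val HG u); exact: hso.
have hwr : \sum_(i | bf i == zeta) arc_wrap f i = (\sum_(i < n | (tN \in O) && (lo <= i < hi)%N) (f i < i)%N)%N%:Z.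
  rewrite (big_morph Posz PoszD (erefl _)); apply: eq_big => [i|i]; first exact: hbz.
  rewrite hbz => /andP[_ /andP[_ h]]; rewrite /arc_wrap; have := ltn_ord hi.
  by case: eqP => [h1|_] h2; [exfalso; lia|rewrite subr0].
have hD : \sum_(d | s d) excess f b w d = (\sum_g (N g == zeta))%N%:Z
   - (\sum_g ((N g == zeta) + (S g == zeta)) * inner_desc g)%N%:Z
   - (\sum_(i < n | (tN \in O) && (lo <= i < hi)%N) (f i < i)%N)%N%:Z.
  rewrite big_mkcond sum_dart -hwr !(big_morph Posz PoszD (erefl _)) -sumrB; congr (_ + _).
    apply: eq_bigr => g _; rewrite /s /zr /Hd /= /dsc /inner_desc.
    by case: (N g == zeta); case: (S g == zeta); case: (bnde g); case: (b g < w g)%N.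
  rewrite -sumrN [RHS]big_mkcond /=; apply: eq_bigr => i _.
  by rewrite /s /zr /Hd /= if_same add0r; case: ifP => _; rewrite ?oppr0.
(* Of the two cycle edges in each row exactly one has the region on its left. *)
have hN1 : (\sum_g (N g == zeta) = #|Et| + L)%N.
  have hz1 : (\sum_g ((N g == zeta) && (S g != zeta)) = L)%N.
    rewrite (@sum_supp nat); last by move=> g /NS0 ->; case: eqP.
    rewrite (eq_bigr (fun=> 1%N)); first by rewrite sum_nat_const muln1 /L cardsE.
    move=> t ht; have [-> -> -> ->] := chain_A ht.
    by case/orP: hz => /eqP ->; rewrite !eqxx ?(eq_sym A1) (negbTE A_neq).
  rewrite -hz1 -sum1_card [X in (_ = X + _)%N]big_mkcond -big_split /=; apply: eq_bigr => g _.
  by rewrite inE; case: (N g == zeta); case: (S g == zeta).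
have hD2 : (\sum_g ((N g == zeta) + (S g == zeta)) * inner_desc g =
    2 * (\sum_g ((N g == zeta) && (S g == zeta)) * inner_desc g) +
    \sum_(t | row t) (inner_desc (e t) + inner_desc (e' t)))%N.
  have <- : (\sum_g ((N g == zeta) (+) (S g == zeta)) * inner_desc g =
    \sum_(t | row t) (inner_desc (e t) + inner_desc (e' t)))%N.
    rewrite (@sum_supp nat); last by move=> g /NS0 ->; rewrite addbb.
    apply: eq_bigr => t ht; have [-> -> -> ->] := chain_A ht.
    by case/orP: hz => /eqP ->; rewrite !eqxx ?(eq_sym A1) (negbTE A_neq) !mul1n.
  rewrite big_distrr -big_split /=; apply: eq_bigr => g _.
  by move: (inner_desc g) => x; case: (N g == zeta); case: (S g == zeta) => /=; clear; lia.
have := face_count hz; rewrite -/J'; rewrite hV hE.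
move: hF; rewrite hD hN1 hD2; set F := (card_zr zeta).1.2.
set D1 := (\sum_g _)%N; set D := (\sum_(t | _) _)%N; set W := (\sum_(i < n | _) _)%N.
move: #|Q| #|J'| #|Et| => qq jj ee; clearbody L F D1 D W; clear.
move=> h1 h2; have h3 : (2 * qq + jj + L = 1 + (2 * D1 + D) + W)%N by lia.
by apply/negP => h; lia.
Qed.

End Region.
End TwoCovers.

(** * Sign of the permutation relating two matchings *)

Section CoverSign.
Variables (n : nat) (G : plabic n).
Hypothesis HG : plabic_ok G.
Local Notation E := (pE G).
Local Notation be := (pbedge G).
Variables (f : 'I_n -> 'I_n) (b w : E -> 'I_n).
Hypothesis HL : reduced_labelling f b w.
Variables (T : finType) (tN : T) (wv : T -> pV G).
Hypothesis wv_inj : forall t t', t != tN -> t' != tN -> wv t = wv t' -> t = t'.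
Hypothesis Hwhite : forall x : pV G, ~~ pblack x -> exists2 t, t != tN & wv t = x.
Variable J : {set 'I_n}.

(** Its parity is the sign given to the edge from the extra white vertex to the boundary vertex [a].
    The two terms account for the columns of [J] and for the descents on the arc that this edge cuts
    off. *)
Definition star_descent (a : 'I_n) : nat :=
  (#|[set i in J | (i < a)%N]| + \sum_(i < n | (i <= a)%N) (f i < i))%N.
Definition row_desc (a : 'I_n) (e : T -> E) (t : T) : nat :=
  if t == tN then star_descent a else (b (e t) < w (e t))%N.

Variables (a c : 'I_n) (e e' : T -> E) (r : {perm T}).
Hypotheses (Hc : star_cover tN wv a e) (Hc' : star_cover tN wv c e').
Hypothesis Hr : forall t, column tN a e (r t) = column tN c e' t.
Hypothesis Hblack : forall x : pV G, pblack x -> ~~ is_bnd x -> exists t, column tN a e t = x.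
Hypothesis HJ : forall j, (j \in J) = [exists t, column tN a e t == pbnd G j].

Lemma star_descent_lo_hi (l h : 'I_n) : l \in J -> (l < h)%N ->
  (star_descent h + (f l < l) = star_descent l + 1 + #|[set j in J | (l < j < h)%N]| +
     (\sum_(i < n | (l <= i < h)%N) (f i < i)) + (f h < h))%N.
Proof.
move=> hl hlh; rewrite /star_descent.
have -> : #|[set i in J | (i < h)%N]| = (#|[set i in J | (i < l)%N]| + (1 + #|[set j in J | (l < j < h)%N]|))%N.
  rewrite -(cardsID [set i : 'I_n | (i < l)%N]); congr (_ + _)%N.
    by apply: eq_card => i; rewrite !inE; case: (i \in J) => //=; lia.
  rewrite (cardsD1 l) !inE ltnn hl hlh /=; congr (_ + _)%N.
  apply: eq_card => i; rewrite !inE -val_eqE /=; case: (i \in J); rewrite ?andbF //=.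
  by case: (ltngtP i l); case: (ltngtP i h) => //=; lia.
rewrite (bigID (fun i : 'I_n => (i <= l)%N)) /= (eq_bigl (fun i : 'I_n => (i <= l)%N)); last by move=> i; lia.
rewrite [X in (_ + (_ + X) + _)%N](bigD1 h) /=; last by lia.
rewrite [X in (_ = _ + X + _)%N](bigD1 l) /=; last by lia.
rewrite [X in (_ + (_ + (_ + X)) + _ = _)%N](eq_bigl (fun i : 'I_n => (l < i < h)%N)); last by move=> i; rewrite -val_eqE /=; lia.
rewrite [X in (_ = _ + (_ + X) + _)%N](eq_bigl (fun i : 'I_n => (l < i < h)%N)); last by move=> i; rewrite -val_eqE /=; lia.
by move: #|_| #|_| (\sum_(i < n | _) _)%N (\sum_(i < n | _) _)%N => *; lia.
Qed.

(** Where the covers agree the orbit is a single row. Otherwise this is [orbit_parity], with the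
    descents of boundary edges and of the arc absorbed into [star_descent]. *)
Lemma orbit_sign t0 :
  odd (\sum_(t in porbit r t0) (row_desc a e t + row_desc c e' t + 1)).
Proof.
have [[t htO [ht hee]]|hnt] := pselect (exists2 t, t \in porbit r t0 & t != tN /\ e t = e' t).
  have hrt : r t = t by case: Hc => _; apply; rewrite Hr /column (negbTE ht) hee.
  have hO : porbit r t0 = [set t].
    rewrite -eq_porbit_mem in htO; rewrite -(eqP htO); apply/setP => x; rewrite inE.
    apply/porbitP/eqP => [[k ->]|->]; last by exists 0%N; rewrite expg0 perm1.
    by rewrite permX; elim: k => //= k ->.
  by rewrite hO big_set1 /row_desc (negbTE ht) hee; case: (_ < _)%N.
have Hnt t : t \in porbit r t0 -> t != tN -> e t != e' t.
  by move=> h1 h2; apply/negP => /eqP h3; apply: hnt; exists t.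
have [[hN hac]|hnt'] := pselect (tN \in porbit r t0 /\ a = c).
  have hrt : r tN = tN by case: Hc => _; apply; rewrite Hr /column eqxx hac.
  have hO : porbit r t0 = [set tN].
    rewrite -eq_porbit_mem in hN; rewrite -(eqP hN); apply/setP => x; rewrite inE.
    apply/porbitP/eqP => [[k ->]|->]; last by exists 0%N; rewrite expg0 perm1.
    by rewrite permX; elim: k => //= k ->.
  by rewrite hO big_set1 /row_desc eqxx hac oddD addnn odd_double.
have HntN : tN \in porbit r t0 -> a != c.
  by move=> h1; apply/negP => /eqP h3; apply: hnt'.
have [cW cB] := cflow_cons Hc Hc' Hr t0.
have [N [S [bf [Hf Hcf Hbf]]]] := flow_is_boundary HG cW cB.
have hpar := orbit_parity HG wv_inj Hc Hc' Hr Hnt HntN HL Hf Hcf Hbf Hwhite Hblack HJ.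
set O := porbit r t0 in Hnt HntN hpar *.
pose row t := (t \in O) && (t != tN).
pose bd g : nat := bnde g && (b g < w g)%N.
pose cf := cflow tN e e' r t0.
have hbd : (\sum_(t | row t) (bd (e t) + bd (e' t)) = (tN \in O) * ((f a < a) + (f c < c)))%N.
  have -> : (\sum_(t | row t) (bd (e t) + bd (e' t)) = \sum_g (if cf g != 0%R then bd g else 0))%N.
    rewrite (@sum_supp _ _ _ _ _ wv_inj _ _ _ _ _ Hc Hc' _ Hnt nat); last by rewrite /cf => g ->; rewrite eqxx.
    apply: eq_bigr => t ht; rewrite /cf (cflow_e wv_inj Hc Hc' Hnt ht) (cflow_e' wv_inj Hc Hc' Hnt ht).
    by rewrite oppr_eq0 oner_eq0.
  rewrite (bigID (fun g => bnde g)) /= [X in (_ + X)%N]big1 ?addn0; last first.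
    by move=> g /negbTE hg; rewrite /bd hg; case: ifP.
  rewrite (sum_bnde HG); case: (HL) => [[_ _ hw hb] _].
  have [hN|hN] := boolP (tN \in O); last first.
    by rewrite mul0n big1 // => i _; rewrite /cf (cflow_be HG wv_inj Hc Hc' Hr Hnt HntN) (negbTE hN) mul0r eqxx.
  have hne := HntN hN; rewrite mul1n (bigD1 a) //= (bigD1 c) 1?eq_sym //= big1 ?addn0; last first.
    move=> i /andP[/negbTE h1 /negbTE h2].
    by rewrite /cf (cflow_be HG wv_inj Hc Hc' Hr Hnt HntN) h1 h2 subrr mulr0 eqxx.
  have -> : cf (be a) = 1 by rewrite /cf (cflow_be HG wv_inj Hc Hc' Hr Hnt HntN) hN mul1r eqxx (negbTE hne) subr0.
  have -> : cf (be c) = -1 by rewrite /cf (cflow_be HG wv_inj Hc Hc' Hr Hnt HntN) hN mul1r eqxx (eq_sym c) (negbTE hne) sub0r.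
  by rewrite oppr_eq0 eq_sym oner_eq0 addr0 /= /bd !(bnde_be HG) !hw !hb.
have hA : (\sum_(t | row t) (row_desc a e t + row_desc c e' t) =
   \sum_(t | row t) (inner_desc b w (e t) + inner_desc b w (e' t)) + \sum_(t | row t) (bd (e t) + bd (e' t)))%N.
  rewrite -big_split /=; apply: eq_bigr => t /andP[_ /negbTE ht]; rewrite /row_desc ht /inner_desc /bd.
  by case: (bnde (e t)); case: (bnde (e' t)); rewrite /= ?addn0 ?add0n // addnC.
have hL : (\sum_(t | row t) 1 = #|[set t | row t]|)%N by rewrite sum1_card cardsE.
rewrite (bigID (fun t => t == tN)) /= addnC [X in (X + _)%N](_ : _ = \sum_(t | row t) (row_desc a e t + row_desc c e' t + 1))%N //.
rewrite [X in odd (X + _)]big_split /= hA hL hbd.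
move: hpar; rewrite -/row.
set A := (\sum_(t | _) (inner_desc _ _ _ + _))%N.
set L := #|[set t | row t]|.
have [hN|hN] := boolP (tN \in O); last first.
  rewrite [X in _ -> is_true (odd (_ + X)%N)]big1; last by move=> t /andP[h /eqP h']; rewrite -h' h in hN.
  rewrite /= (eq_card0 (A := [set j in J | _])); last by move=> j; rewrite !inE andbF.
  by rewrite big_pred0_eq !addn0 addn1 /= negbK.
rewrite [X in _ -> is_true (odd (_ + X)%N)](big_pred1 tN); last first.
  by move=> t; rewrite /=; case: eqP => [->|]; rewrite ?andbF ?hN.
rewrite /row_desc eqxx /= mul1n.
have haJ : a \in J by rewrite HJ; apply/existsP; exists tN; rewrite /column eqxx.
have hcJ : c \in J by rewrite HJ; apply/existsP; exists (r tN); rewrite Hr /column eqxx.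
have := lo_hi HntN hN; rewrite /lo /hi; case: (leqP a c) => hac hlt.
  have := star_descent_lo_hi haJ hlt.
  move: (star_descent a) (star_descent c) #|[set j in J | _]| (\sum_(i < n | _) _)%N A L => *; lia.
have := star_descent_lo_hi hcJ hlt.
move: (star_descent a) (star_descent c) #|[set j in J | _]| (\sum_(i < n | _) _)%N A L => *; lia.
Qed.

(** The parity of a permutation is the number of points minus the number of orbits, and [orbit_sign]
    makes the contribution of each orbit odd. *)
Theorem cover_sign : odd_perm r = odd (\sum_t (row_desc a e t + row_desc c e' t)).
Proof.
have h : odd (\sum_t (row_desc a e t + row_desc c e' t + 1)) = odd #|porbits r|.
  rewrite (partition_big (porbit r) (mem (porbits r))) /=; last by move=> t _; exact: imset_f.
  rewrite (big_morph odd oddD (erefl _)) -sum1_card (big_morph odd oddD (erefl _)).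
  apply: eq_bigr => O /imsetP[t0 _ ->].
  rewrite (eq_bigl (fun t => t \in porbit r t0)); last by move=> t; rewrite eq_porbit_mem.
  by rewrite orbit_sign.
move: h; rewrite big_split /= sum1_card oddD /odd_perm => <-.
by rewrite cardT -cardE addbC addbK.
Qed.

End CoverSign.

(** * A vanishing Kasteleyn determinant and the linear relation it gives *)

Section PluckerRelation.
Variables (n : nat) (G : plabic n).
Hypothesis HG : plabic_ok G.
Local Notation E := (pE G).
Local Notation be := (pbedge G).

Let whites := [pred x : pV G | ~~ pblack x].
Local Notation T := 'I_#|whites|.+1.
Local Notation tN := (ord0 : T).
Let white (t : T) : pV G :=
  if unlift ord0 t is Some i then enum_val i else pbnd G (Ordinal (plabic_n_gt0 HG)).

Lemma white_inj t t' : t != tN -> t' != tN -> white t = white t' -> t = t'.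
Proof.
rewrite /white; case: unliftP => [i ->|-> /eqP//]; case: unliftP => [j ->|-> _ /eqP//].
by move=> _ _ /enum_val_inj ->.
Qed.
Lemma white_surj (x : pV G) : ~~ pblack x -> exists2 t, t != tN & white t = x.
Proof.
move=> hx; have hx' : x \in whites by [].
exists (lift ord0 (enum_rank_in hx' x)); first by rewrite eq_sym neq_lift.
by rewrite /white liftK enum_rankK_in.
Qed.
Lemma white_white t : t != tN -> ~~ pblack (white t).
Proof.
rewrite /white; case: unliftP => [i ->|-> /eqP//] _.
exact: (enum_valP i).
Qed.

Variable J : {set 'I_n}.
Definition star_column (x : pV G) :=
  (pblack x && ~~ is_bnd x) || [exists j in J, pbnd G j == x].
(** Perfect matchings after adding one white vertex, the row [tN], joined to the boundary vertices
    in [J]; the other boundary vertices are deleted. *)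
Definition star_match (e : T -> E) :=
  [/\ forall t, t != tN -> peW (e t) = white t, exists2 j, j \in J & e tN = be j,
    injective (fun t => peB (e t)), forall x, star_column x -> exists t, peB (e t) = x
    & forall t, star_column (peB (e t))].

Lemma almost_perfect_unique (A : {set E}) x : almost_perfect A -> ~~ is_bnd x ->
  exists2 g, g \in A /\ incident x g & forall h, h \in A -> incident x h -> h = g.
Proof.
move=> /forallP/(_ x) + hx; rewrite hx => /cards1P[g hg].
have : g \in [set g] by rewrite inE.
rewrite -hg inE => /andP[h1 h2]; exists g => // h h3 h4.
by apply/eqP; rewrite -(finset.in_set1 h g) -hg inE h3.
Qed.

Lemma star_matching_edge e t j : star_match e -> peB (e t) = pbnd G j -> e t = be j.
Proof. by move=> _ /eqP; rewrite (peB_pbnd HG) => /eqP. Qed.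

Lemma star_column_bnd j : star_column (pbnd G j) = (j \in J).
Proof.
rewrite /star_column bnd_pbnd andbF /=; apply/existsP/idP => [[i /andP[h /eqP/(pbnd_inj HG) <-]] //|h].
by exists j; rewrite h eqxx.
Qed.

Definition matched (e : T -> E) : {set E} := e @: [set t | t != tN].

Lemma matched_ok (e : T -> E) a : star_match e -> e tN = be a ->
  almost_perfect (matched e) && (used_bnd (matched e) == J :\ a).
Proof.
move=> He hea; case: (He) => hW _ hinj hcov hcol; apply/andP; split.
  apply/forallP => x; apply/implyP => hx; apply/cards1P.
  have [hb|hw] := boolP (pblack x).
    have [t ht] : exists t, peB (e t) = x by apply: hcov; rewrite /star_column hb hx.
    have htN : t != tN.
      by apply/negP => /eqP h; move: hx; rewrite -ht h hea (peB_be HG) bnd_pbnd.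
    exists (e t); apply/setP => g; rewrite !inE; apply/andP/eqP => [[/imsetP[t' _ ->]]|->].
      case/orP => /eqP h; first by congr e; apply: hinj; rewrite h.
      by have := peW_white HG (e t'); rewrite h hb.
    by split; [apply: imset_f; rewrite inE|rewrite /incident ht eqxx].
  have [t htN ht] := white_surj hw; exists (e t); apply/setP => g; rewrite !inE.
  apply/andP/eqP => [[/imsetP[t' ht' ->]]|->].
    rewrite inE in ht'.
    case/orP => /eqP h; first by have := peB_black HG (e t'); rewrite h (negbTE hw).
    by congr e; apply: white_inj => //; rewrite -hW // h.
  by split; [apply: imset_f; rewrite inE|rewrite /incident hW // ht eqxx orbT].
apply/eqP/setP => i; rewrite !inE; apply/imsetP/andP => [[t]|[hia hiJ]].
  rewrite inE => ht hi; have hb : peB (e t) = pbnd G i by rewrite -hi (peB_be HG).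
  have := hcol t; rewrite hb star_column_bnd => ->; split=> //; apply/negP => /eqP h.
  move/negP: ht; apply; apply/eqP/hinj; by rewrite /= hb hea (peB_be HG) h.
have [t ht] : exists t, peB (e t) = pbnd G i by apply: hcov; rewrite star_column_bnd.
have het := star_matching_edge He ht; exists t => //; rewrite inE; apply/negP => /eqP h.
by move/negP: hia; apply; apply/eqP/(be_inj HG); rewrite -het h hea.
Qed.

Lemma matched_surj (A : {set E}) a : a \in J -> almost_perfect A -> used_bnd A = J :\ a ->
  exists e : {ffun T -> E}, [/\ star_match e, e tN = be a & A = matched e].
Proof.
move=> haJ hA hu.
have huA i : (be i \in A) = (i != a) && (i \in J) by have := congr1 (fun X : {set 'I_n} => i \in X) hu; rewrite !inE.
have /choice[e he] : forall t, exists g, (t == tN -> g = be a) /\ (t != tN -> g \in A /\ peW g = white t).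
  move=> t.
  have [->|ht] := eqVneq t tN; first by exists (be a).
  have hw := white_white ht.
  have hx : ~~ is_bnd (white t).
    by apply/negP => /existsP[i /eqP h]; move: hw; rewrite -h (pbnd_black HG).
  have [g [h1 h2] _] := almost_perfect_unique hA hx; exists g; split=> // _; split=> //.
  case/orP: h2 => /eqP // h; by have := peB_black HG g; rewrite h (negbTE hw).
have heN : e tN = be a by have [h _] := he tN; exact: h.
have heA t : t != tN -> e t \in A by move=> ht; have [_ /(_ ht)[]] := he t.
have heW t : t != tN -> peW (e t) = white t by move=> ht; have [_ /(_ ht)[]] := he t.
have hcover g : g \in A -> exists2 t, t != tN & e t = g.
  move=> hg; have [t ht hgt] := white_surj (peW_white HG g); exists t => //.
  have [g' _ h2] := almost_perfect_unique hA (peW_int HG g).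
  transitivity g'; last by symmetry; apply: h2 => //; exact: incident_peW.
  by apply: h2; [exact: heA|rewrite /incident heW // hgt eqxx orbT].
have hbndA g : g \in A -> peB g <> pbnd G a.
  by move=> hg /eqP; rewrite (peB_pbnd HG) => /eqP h; move: hg; rewrite h huA eqxx.
exists (finfun e); split; [split|by rewrite ffunE|].
- by move=> t ht; rewrite ffunE heW.
- by exists a => //; rewrite ffunE.
- have hii t t' : t != tN -> t' != tN -> peB (e t) = peB (e t') -> e t = e t' -> t = t'.
    by move=> h1 h2 _ h3; apply: white_inj => //; rewrite -!heW // h3.
  move=> t t'; rewrite /= !ffunE => h.
  have [ht|ht] := eqVneq t tN; have [ht'|ht'] := eqVneq t' tN; first by rewrite ht ht'.
  + by move: h; rewrite ht heN (peB_be HG) => /esym/(hbndA _ (heA _ ht')).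
  + by move: h; rewrite ht' heN (peB_be HG) => /(hbndA _ (heA _ ht)).
  + apply: hii => //; have [/bndeP-/(_ HG)[i hi]|hb] := boolP (bnde (e t)).
      by move: h; rewrite hi (peB_be HG) => /esym/eqP; rewrite (peB_pbnd HG) => /eqP.
    have [g _ h2] := almost_perfect_unique hA hb.
    by rewrite [LHS]h2 ?heA ?incident_peB //; symmetry; apply: h2; rewrite ?heA // /incident h eqxx.
- move=> x /orP[/andP[hb hx]|/existsP[j /andP[hj /eqP <-]]].
    have [g [h1 h2] _] := almost_perfect_unique hA hx; have [t _ ht] := hcover g h1.
    exists t; rewrite ffunE ht; case/orP: h2 => /eqP // h.
    by have := peW_white HG g; rewrite h hb.
  have [->|hja] := eqVneq j a; first by exists tN; rewrite ffunE heN (peB_be HG).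
  have [t _ ht] : exists2 t, t != tN & e t = be j by apply: hcover; rewrite huA hja.
  by exists t; rewrite ffunE ht (peB_be HG).
- move=> t; rewrite ffunE; have [/bndeP-/(_ HG)[i hi]|hb] := boolP (bnde (e t)); last first.
    by rewrite /star_column (peB_black HG) hb.
  rewrite hi (peB_be HG) star_column_bnd; have [ht|ht] := eqVneq t tN.
    by move: hi; rewrite ht heN => /(be_inj HG) <-.
  by have := heA t ht; rewrite hi huA => /andP[].
apply/setP => g; apply/idP/imsetP => [hg|[t + ->]].
  by have [t ht htg] := hcover g hg; exists t; rewrite ?inE ?ffunE.
by rewrite inE ffunE => ht; exact: heA.
Qed.

Variables (R : realType) (wt : E -> R).

(** Deleting the edge of the extra vertex turns a star matching through [a] into an almost perfect
    matching with boundary set [J] minus [a], bijectively. *)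
Lemma Delta_star_matching a : a \in J -> Delta wt (J :\ a) =
  \sum_(e : {ffun T -> E} | `[< star_match e >] && (e tN == be a)) \prod_(t | t != tN) wt (e t).
Proof.
move=> haJ; pose P := [set e : {ffun T -> E} | `[< star_match e >] && (e tN == be a)].
have hP (e : {ffun T -> E}) : e \in P -> star_match e /\ e tN = be a by rewrite inE => /andP[/asboolP h /eqP].
transitivity (\sum_(A in [set matched (e : {ffun T -> E}) | e : {ffun T -> E} in P]) \prod_(g in A) wt g).
  apply: eq_bigl => A; apply/andP/imsetP => [[h1 /eqP h2]|[e /hP[h1 h2] ->]].
    have [e [k1 k2 k3]] := matched_surj haJ h1 h2; exists e => //.
    by rewrite inE k2 eqxx andbT; apply/asboolP.
  by apply/andP; exact: matched_ok.
rewrite big_imset /=; last first.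
  move=> e e' /hP[[hW _ _ _ _] h2] /hP[[hW' _ _ _ _] h2'] he; apply/ffunP => t.
  have [->|ht] := eqVneq t tN; first by rewrite h2 h2'.
  have : e t \in matched e' by rewrite -he; apply: imset_f; rewrite inE.
  move=> /imsetP[t']; rewrite inE => ht' htt; rewrite htt; congr (e' _).
  by apply: white_inj => //; rewrite -(hW t) // -(hW' t') // htt.
apply: eq_big => [e|e /hP[[hW _ _ _ _] _]]; first by rewrite inE.
rewrite big_imset /=; first by apply: eq_bigl => t; rewrite inE.
move=> t t'; rewrite !inE => ht ht' htt; apply: white_inj => //; by rewrite -!hW // htt.
Qed.

Variables (f : 'I_n -> 'I_n) (b w : E -> 'I_n).
Hypothesis HL : reduced_labelling f b w.
Variable y : pV G -> R.
Hypothesis Hy : forall x, pblack x -> ~~ is_bnd x ->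
  \sum_(g | peB g == x) (-1) ^+ (b g < w g)%N * wt g * y (peW g) = 0.

Let K g : R := (-1) ^+ (b g < w g)%N * wt g.
Let dom (t : T) (g : E) := if t == tN then [exists j in J, g == be j] else peW g == white t.
(** The row of the extra vertex is designed as the combination of the white rows with coefficients
    [y]; by [Hy] that combination vanishes outside the boundary columns. *)
Let kap (t : T) (g : E) : R := if t == tN then K g * y (peW g) else K g.

(** By the choice of [kap], the vector with -1 at the extra row and [y] at the white rows lies in
    the left kernel. *)
Lemma star_det0 (e0 : T -> E) : star_match e0 ->
  \det (\matrix_(i, j) \sum_(g | dom i g && (peB g == peB (e0 j))) kap i g : 'M[R]_(#|whites|.+1)) = 0.
Proof.
move=> [hW _ hinj hcov hcol]; apply/eqP/det0P.
exists (\row_t (if t == tN then -1 else y (white t))).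
  by apply/eqP => /rowP/(_ tN); rewrite !mxE eqxx => /eqP; rewrite oppr_eq0 oner_eq0.
apply/rowP => j; rewrite !mxE (bigD1 tN) //= !mxE eqxx mulN1r.
set x := peB (e0 j).
have hrest : \sum_(t | t != tN) (\row_t (if t == tN then -1 else y (white t))) 0 t *
     (\matrix_(i, j) \sum_(g | dom i g && (peB g == peB (e0 j))) kap i g) t j =
     \sum_(g | peB g == x) K g * y (peW g).
  have hall (F : pV G -> R) : \sum_(t | t != tN) F (white t) = \sum_(u | ~~ pblack u) F u.
    transitivity (\sum_(t in [set t | t != tN]) F (white t)); first by apply: eq_bigl => t; rewrite inE.
    rewrite -(@big_imset _ _ _ _ _ white (mem [set t | t != tN]) F) /=; last first.
      by move=> t t'; rewrite !inE; exact: white_inj.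
    apply: eq_bigl => u; apply/imsetP/idP => [[t]|hu]; first by rewrite inE => ht ->; exact: white_white.
    by have [t ht htu] := white_surj hu; exists t; rewrite ?inE.
  transitivity (\sum_(t | t != tN) \sum_(g | (peB g == x) && (peW g == white t)) K g * y (peW g)).
    apply: eq_bigr => t ht; rewrite !mxE (negbTE ht) mulr_sumr /dom (negbTE ht).
    rewrite (eq_bigl (fun g => (peB g == x) && (peW g == white t))); last by move=> g; rewrite andbC.
    by apply: eq_bigr => g /andP[_ /eqP ->]; rewrite /kap (negbTE ht) mulrC.
  rewrite (hall (fun u => \sum_(g | (peB g == x) && (peW g == u)) K g * y (peW g))).
  rewrite [RHS](partition_big (@peW n G) (fun u => ~~ pblack u)) //=.
  by move=> g _; exact: peW_white.
rewrite hrest {hrest}; have := hcol j; rewrite -/x => /orP[/andP[hb hx]|/existsP[i /andP[hi /eqP hix]]].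
  rewrite Hy // big_pred0 ?oppr0 ?addr0 // => g; rewrite /dom eqxx; apply/negP => /andP[/existsP[i /andP[_ /eqP ->]]].
  by rewrite (peB_be HG) => /eqP h; move: hx; rewrite -h bnd_pbnd.
have -> : \sum_(g | dom ord0 g && (peB g == x)) kap ord0 g = K (be i) * y (peW (be i)).
  rewrite (big_pred1 (be i)) /kap ?eqxx // => g /=.
  rewrite /dom eqxx -hix (peB_pbnd HG) andbC; case: eqP => //= ->.
  by apply/existsP; exists i; rewrite hi eqxx.
have -> : \sum_(g | peB g == x) K g * y (peW g) = K (be i) * y (peW (be i)).
  by rewrite (big_pred1 (be i)) // => g /=; rewrite -hix (peB_pbnd HG).
by rewrite addNr.
Qed.

Lemma cover_colE (e : T -> E) a t : e tN = be a -> column tN a e t = peB (e t).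
Proof. by move=> h; rewrite /column; case: eqP => // ->; rewrite h (peB_be HG). Qed.
Let family_cond (e0 e : T -> E) (s : 'S_#|whites|.+1) :=
  [forall t, dom t (e t) && (peB (e t) == peB (e0 (s t)))].

Lemma star_matching_perm (e0 e : T -> E) : star_match e0 -> star_match e ->
  exists s0, forall s, family_cond e0 e s = (s == s0).
Proof.
move=> [hW _ hinj hcov hcol] [hW' [j hj hjN] hinj' hcov' hcol'].
have /choice[h hh] : forall t, exists t', peB (e t) = peB (e0 t').
  by move=> t; have [t' ht'] := hcov _ (hcol' t); exists t'.
have hi : injective h by move=> t t' htt; apply: hinj'; rewrite /= !hh htt.
exists (perm hi) => s; apply/forallP/eqP => [hs|-> t].
  by apply/permP => t; apply: hinj; rewrite permE /= -hh; have /andP[_ /eqP] := hs t.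
rewrite permE hh eqxx andbT /dom; case: eqP => [->|/eqP ht]; last by rewrite hW'.
by apply/existsP; exists j; rewrite hj hjN eqxx.
Qed.

Lemma family_star_matching (e0 e : T -> E) s : star_match e0 -> family_cond e0 e s -> star_match e.
Proof.
move=> [hW _ hinj hcov hcol] /forallP hs; split.
- by move=> t ht; have /andP[] := hs t; rewrite /dom (negbTE ht) => /eqP.
- have /andP[] := hs tN; rewrite /dom eqxx => /existsP[j /andP[h1 /eqP h2]] _; by exists j.
- move=> t t' /= htt; have /andP[_ /eqP h1] := hs t; have /andP[_ /eqP h2] := hs t'.
  by apply: (@perm_inj _ s); apply: hinj; rewrite /= -h1 -h2.
- move=> x /hcov[t ht]; exists ((s^-1)%g t); have /andP[_ /eqP ->] := hs ((s^-1)%g t).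
  by rewrite permKV.
- by move=> t; have /andP[_ /eqP ->] := hs t.
Qed.

Lemma star_matching_sign (e0 e : T -> E) a0 a s : star_match e0 -> e0 tN = be a0 ->
  star_match e -> e tN = be a -> family_cond e0 e s ->
  (-1) ^+ s = (-1) ^+ (\sum_t row_desc f b w tN J a0 e0 t) *
              (-1) ^+ (\sum_t row_desc f b w tN J a e t) :> R.
Proof.
move=> He0 h0 He ha /forallP hs.
have hsc (e' : T -> E) a' : star_match e' -> e' tN = be a' -> star_cover tN white a' e'.
  move=> [k1 _ k3 _ _] k2; split=> // t t'; rewrite !cover_colE //; exact: k3.
have hr t : column tN a0 e0 (s t) = column tN a e t.
  by rewrite !cover_colE //; have /andP[_ /eqP ->] := hs t.
have := cover_sign HG HL white_inj white_surj (J := J) (hsc _ _ He0 h0) (hsc _ _ He ha) hr.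
case: (He0) => _ _ _ hcov hcol.
move=> ->; first by rewrite signr_odd big_split exprD.
  by move=> x hx1 hx2; have [|t ht] := hcov x; [rewrite /star_column hx1 hx2|exists t; rewrite cover_colE].
move=> j; rewrite -star_column_bnd; apply/idP/existsP => [/hcov[t ht]|[t]].
  by exists t; rewrite cover_colE // ht.
by rewrite cover_colE // => /eqP <-.
Qed.

(** The descent of the boundary edge occurs in [K] and in the last summand of [star_descent]; the
    two cancel, which turns the condition [i <= a] into [i < a]. *)
Lemma star_matching_weight (e : T -> E) a : star_match e -> e tN = be a ->
  (-1) ^+ (\sum_t row_desc f b w tN J a e t) * \prod_t kap t (e t) =
  (-1) ^+ (#|[set i in J | (i < a)%N]| + \sum_(i < n | (i < a)%N) (f i < i))%N *
    y (peW (be a)) * wt (be a) * \prod_(t | t != tN) wt (e t).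
Proof.
move=> He ha; rewrite (bigD1 tN) //= exprD [\prod_t _](bigD1 tN) //=.
rewrite [row_desc _ _ _ _ _ _ _ ord0]/row_desc [kap ord0 _]/kap !eqxx ha.
have -> : \prod_(t | t != tN) (if t == tN then K (e t) * y (peW (e t)) else K (e t)) =
    (-1) ^+ (\sum_(t | t != tN) row_desc f b w tN J a e t) * \prod_(t | t != tN) wt (e t).
  rewrite (big_morph (fun k => (-1) ^+ k : R) (exprD _) (expr0 _)) -big_split /=.
  by apply: eq_bigr => t /negbTE ht; rewrite ht /K /row_desc ht.
have hsd : star_descent f J a = (#|[set i in J | (i < a)%N]| + \sum_(i < n | (i < a)%N) (f i < i) + (f a < a))%N.
  rewrite /star_descent (bigD1 a) //= [((f a < a) + _)%N]addnC addnA; congr (_ + _ + _)%N.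
  by apply: eq_bigl => i; rewrite -val_eqE /= ltn_neqAle andbC.
case: (HL) => [[_ _ hw hb] _]; rewrite hsd /K hw hb [in LHS]exprD.
set p := (\sum_(t | _) row_desc _ _ _ _ _ _ _ _)%N; set q := (_ + _)%N; set W := \prod_(t | _) _.
have hsq (k : nat) : (-1) ^+ k * (-1) ^+ k = 1 :> R by rewrite -expr2 sqrr_sign.
transitivity ((-1) ^+ q * y (peW (be a)) * wt (be a) * W * ((-1) ^+ p * (-1) ^+ p) * ((-1) ^+ (f a < a)%N * (-1) ^+ (f a < a)%N)).
  by ring.
by rewrite !hsq !mulr1.
Qed.

(** In the expanded determinant each star matching occurs with one permutation. By [cover_sign] its
    sign is that of a reference matching [e0] times its own descents, which are the signs of the
    entries, so all matchings through one boundary vertex add with a common sign. *)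
Theorem plucker_relation :
  \sum_(j in J) (-1) ^+ (#|[set i in J | (i < j)%N]| + \sum_(i < n | (i < j)%N) (f i < i))%N *
     y (peW (be j)) * wt (be j) * Delta wt (J :\ j) = 0.
Proof.
have [[e0 He0]|hno] := pselect (exists e0 : T -> E, star_match e0); last first.
  apply: big1 => j hj; have -> : Delta wt (J :\ j) = 0; last by rewrite mulr0.
  rewrite Delta_star_matching // big_pred0 // => e.
  by apply/negP => /andP[/asboolP h _]; apply: hno; exists e.
have [_ [a0 _ h0] _ _ _] := He0.
have := star_det0 He0; rewrite /determinant.
under eq_bigr => s _.
  under eq_bigr => i _ do rewrite mxE.
  rewrite bigA_distr_big_dep mulr_sumr.
  over.
rewrite (exchange_big_dep xpredT) //=.
rewrite (bigID (fun e : {ffun T -> E} => `[< star_match e >])) /= [X in _ + X]big1 ?addr0; last first.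
  move=> e /asboolP hne; apply: big_pred0 => s; apply/negP => /familyP h; apply: hne.
  by apply: (@family_star_matching e0 _ s) => //; apply/forallP => t; exact: (h t).
(* The sign of the reference matching, a common factor of all terms. *)
pose eps : R := (-1) ^+ (\sum_t row_desc f b w tN J a0 e0 t).
have hterm (e : {ffun T -> E}) a : star_match e -> e tN = be a ->
    \sum_(s : 'S_#|whites|.+1 | e \in family (fun i g => dom i g && (peB g == peB (e0 (s i))))) (-1) ^+ s * \prod_i kap i (e i) =
    eps * ((-1) ^+ (#|[set i in J | (i < a)%N]| + \sum_(i < n | (i < a)%N) (f i < i))%N *
    y (peW (be a)) * wt (be a) * \prod_(t | t != tN) wt (e t)).
  move=> He ha; have [s0 hs0] := star_matching_perm He0 He.
  rewrite (big_pred1 s0); last first.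
    move=> s; rewrite [RHS]/= -hs0; apply/familyP/forallP => h t; exact: (h t).
  by rewrite (star_matching_sign He0 h0 He ha) ?hs0 // -mulrA star_matching_weight.
move=> hdet; apply/eqP; rewrite -(mulrI_eq0 _ (lregX (n := \sum_t row_desc f b w tN J a0 e0 t) (lregN (@lreg1 R)))) -/eps mulr_sumr -[X in _ == X]hdet; apply/eqP.
transitivity (\sum_(j in J) \sum_(e : {ffun T -> E} | `[< star_match e >] && (e tN == be j))
  \sum_(s : 'S_#|whites|.+1 | e \in family (fun i g => dom i g && (peB g == peB (e0 (s i))))) (-1) ^+ s * \prod_i kap i (e i)).
  apply: eq_bigr => j hj; rewrite Delta_star_matching // !mulr_sumr; apply: eq_bigr => e /andP[/asboolP He /eqP ha].
  by rewrite (hterm _ _ He ha).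
rewrite (exchange_big_dep (fun e : {ffun T -> E} => `[< star_match e >])) /=; last by move=> j e _ /andP[].
apply: eq_bigr => e He; have [_ [a haJ ha] _ _ _] := asboolW He.
rewrite (big_pred1 a) // => j /=; rewrite He ha /= (inj_eq (be_inj HG)).
by rewrite eq_sym; case: eqP => [->|]; rewrite ?haJ ?andbF.
Qed.

End PluckerRelation.

(** * Integer potentials of strands and the kernel vectors built from them *)

Section LabelPotential.
Variables (n : nat) (G : plabic n).
Hypothesis HG : plabic_ok G.
Local Notation E := (pE G).
Local Notation be := (pbedge G).
Variables (f : 'I_n -> 'I_n) (b w : E -> 'I_n).
Hypotheses (finj : injective f) (HL : reduced_labelling f b w).
Local Notation src := (invF finj).

Lemma sum_ord_eq (U : nmodType) (P : pred 'I_n) (p : 'I_n) (x : U) :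
  \sum_(r < n | P r) (if r == p then x else 0) = if P p then x else 0.
Proof.
rewrite big_mkcond (bigD1 p) //= eqxx big1 ?addr0 // => r /negbTE ->.
by rewrite if_same.
Qed.

(** Exactness is available over a field; taking floors keeps integer differences, so the rational
    face function of the strand becomes integral. *)
Lemma label_potential (p : 'I_n) : exists (N S : E -> int) (bf : 'I_n -> int),
  [/\ face_function N S bf, forall e, N e - S e = (b e == p)%:R - (w e == p)%:R
    & forall i : 'I_n, bf i = (src p <= i)%N%:R - (p <= i)%N%:R].
Proof.
pose m e : rat := ((b e == p)%:R - (w e == p)%:R : int)%:~R.
have mE e : m e = (b e == p)%:R - (w e == p)%:R by rewrite /m rmorphB /= !mulrz_nat.
case: (HL) => [[hW hB hwi hbi] _].
have [||N [S [bf [[h1 h2 h3 h4] h5 h6]]]] := @flow_is_boundary _ _ HG rat m.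
- move=> x; rewrite (eq_bigr _ (fun e _ => mE e)) sumrB.
  by rewrite (sum_lab_white HG HL (fun i => (i == p)%:R)) subrr.
- move=> x hx; rewrite (eq_bigr _ (fun e _ => mE e)) sumrB.
  by rewrite (sum_lab_black HG HL (fun i => (i == p)%:R)) // subrr.
exists (Num.floor \o N), (Num.floor \o S), (Num.floor \o bf); split=> [|e|i] /=.
- by split=> [e|e he|i|i] /=; rewrite ?h1 ?h2 ?h3 ?h4.
- have -> : N e = S e + m e by rewrite -h5 addrC subrK.
  by rewrite floorDrz ?intr_int // /m intrKfloor addrAC subrr add0r.
- rewrite h6.
  have -> : \sum_(r < n | (r <= i)%N) m (be r) = ((src p <= i)%N%:R - (p <= i)%N%:R : int)%:~R.
    under eq_bigr => r _ do rewrite mE hwi hbi.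
    rewrite sumrB rmorphB /= !mulrz_nat; congr (_ - _).
      rewrite (eq_bigr (fun r => if r == src p then 1 else 0)).
        by rewrite sum_ord_eq; case: ifP.
      by move=> r _; rewrite -[p in LHS](f_invF finj) (inj_eq finj); case: eqP.
    rewrite (eq_bigr (fun r => if r == p then 1 else 0)).
      by rewrite sum_ord_eq; case: ifP.
    by move=> r _; case: eqP.
  by rewrite intrKfloor.
Qed.

(** Removing the jump across the outgoing strand makes the potential of [p] a function of the white
    vertex alone. Up to a shift it is the exponent of [sin (phi - theta p)] in the kernel vector. *)
Definition corner_exp (N : E -> int) (p : 'I_n) (e : E) : int := N e - (b e == p)%:R.

Section Exponents.
Variables (p : 'I_n) (N S : E -> int) (bf : 'I_n -> int).
Hypotheses (Hf : face_function N S bf) (Hm : forall e, N e - S e = (b e == p)%:R - (w e == p)%:R).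
Hypothesis Hbf : forall i : 'I_n, bf i = (src p <= i)%N%:R - (p <= i)%N%:R.

Lemma corner_exponentS e : corner_exp N p e = S e - (w e == p)%:R.
Proof.
by rewrite /corner_exp; have /eqP := Hm e; rewrite subr_eq => /eqP ->; rewrite addrAC addrC addrA addrAC; ring.
Qed.

Lemma corner_exponent_white e e' : peW e = peW e' -> corner_exp N p e = corner_exp N p e'.
Proof.
move/(prW_trans HG) => [k <-]; elim: k => //= k ->.
case: Hf => h1 _ _ _; case: HL => [[h2 _ _ _] _].
by rewrite [RHS]corner_exponentS h1 h2.
Qed.

Lemma corner_exponent_be (i : 'I_n) :
  corner_exp N p (be i) = (src p < i)%N%:R - (p <= i)%N%:R.
Proof.
case: Hf => _ _ h3 _; case: HL => [[_ _ _ hbi] _].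
rewrite /corner_exp h3 Hbf hbi.
have -> : (f i == p) = (i == src p) by rewrite -[p in LHS](f_invF finj) (inj_eq finj).
rewrite addrAC; congr (_ - _); rewrite -val_eqE /=.
by case: (ltngtP (src p) i); rewrite ?subr0 ?subrr.
Qed.

Lemma corner_exponent_deg2 e : ~~ bnde e -> prB (prB e) = e ->
  corner_exp N p (prB e) = corner_exp N p e.
Proof.
move=> he h; case: Hf => _ h1 _ _; case: HL => [[_ h2 _ _] _].
rewrite [RHS]corner_exponentS /corner_exp h1 //; congr (_ - (_ == _)%:R).
by rewrite -[in RHS]h h2 // (bnde_prB HG).
Qed.

(* Twice the signed number of crossings of two strands is read off from the values of the potential of one
   strand along the other. *)
Lemma pair_count (q : 'I_n) : q != p ->
  \sum_(e | (b e == p) && (w e == q)) 1 - \sum_(e | (b e == q) && (w e == p)) 1 =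
  (src p <= q)%N%:R - (p <= q)%N%:R - ((src p < src q)%N%:R - (p < src q)%N%:R) :> int.
Proof.
move=> hqp; case: (Hf) => h1 h2 h3 h4; case: (HL) => [[k1 k2 k3 k4] _].
have e1 : \sum_(e | b e == q) N e = \sum_(e | w e == q) S e.
  rewrite [RHS](reindex_inj (prW_inj HG)) /=; apply: eq_big => [e|e _]; first by rewrite k1.
  by rewrite h1.
have e2 : \sum_(e | (b e == q) && ~~ bnde e) S e = \sum_(e | (w e == q) && ~~ bnde e) N e.
  rewrite [RHS](reindex_inj (prB_inj HG)) /=; apply: eq_big => [e|e /andP[_ he]].
    by rewrite (bnde_prB HG); case: (boolP (bnde e)) => he; rewrite ?andbF // k2.
  by rewrite h2.
have e3 : \sum_(e | (b e == q) && bnde e) S e = (src p < src q)%N%:R - (p < src q)%N%:R.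
  have -> : \sum_(e | (b e == q) && bnde e) S e = S (be (src q)).
    apply: big_pred1 => e /=; apply/andP/eqP => [[/eqP hb /(bndeP HG)[i hi]]|->].
      by rewrite hi; congr be; apply: finj; rewrite f_invF -hb hi k4.
    by rewrite k4 f_invF eqxx (bnde_be HG).
  rewrite h4 Hbf; case: (src q) => [[|m] hm] /=.
    rewrite add0n modn_small; last by lia.
    have hle (r : 'I_n) : (r <= n.-1)%N by rewrite -ltnS prednK.
    by rewrite !hle !subrr.
  by rewrite modnDr modn_small ?ltnS //; lia.
have e4 : \sum_(e | (w e == q) && bnde e) N e = (src p <= q)%N%:R - (p <= q)%N%:R.
  have -> : \sum_(e | (w e == q) && bnde e) N e = N (be q).
    apply: big_pred1 => e /=; apply/andP/eqP => [[/eqP hb /(bndeP HG)[i hi]]|->].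
      by rewrite hi; congr be; rewrite -hb hi k3.
    by rewrite k3 eqxx (bnde_be HG).
  by rewrite h3 Hbf.
have e5 : \sum_(e | w e == q) (N e - S e) + \sum_(e | b e == q) (N e - S e) =
   (src p <= q)%N%:R - (p <= q)%N%:R - ((src p < src q)%N%:R - (p < src q)%N%:R).
  rewrite !sumrB e1 -e3 -e4 [\sum_(e | w e == q) N e](bigID (fun e => bnde e)) /=.
  rewrite [\sum_(e | b e == q) S e](bigID (fun e => bnde e)) /= e2.
  set x := \sum_(e | _) S e; set y := \sum_(e | _) N e; set z := \sum_(e | _) N e; set t := \sum_(e | _ && _) S e.
  by ring.
rewrite -e5; congr (_ + _).
  rewrite [LHS]big_mkcond [RHS]big_mkcond; apply: eq_bigr => e _; rewrite Hm.
  case: (eqVneq (w e) q) => [->|_]; rewrite ?andbF ?andbT // (negbTE hqp) subr0.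
  by case: (b e == p).
rewrite -sumrN [LHS]big_mkcond [RHS]big_mkcond; apply: eq_bigr => e _; rewrite Hm.
case: (eqVneq (b e) q) => [->|_] //=; rewrite (negbTE hqp) sub0r.
by case: (w e == p) => /=; rewrite ?oppr0.
Qed.

End Exponents.

Definition boundary_exponent (p i : 'I_n) : bool :=
  if (src p < p)%N then (src p < i < p)%N else (i < p)%N || (src p < i)%N.

(** By the addition formula each term at a black vertex is a difference of two products, one for
    each side of the edge. Consecutive edges share a side, so the sum around the vertex
    telescopes. *)
Lemma kernel_vector (R : realType) (theta : 'I_n -> R) (phi : R) :
  (forall p, sin (phi - theta p) != 0) -> (forall p, src p != p) ->
  exists y : pV G -> R,
    (forall x, pblack x -> ~~ is_bnd x ->
      \sum_(g | peB g == x) sin (theta (b g) - theta (w g)) * y (peW g) = 0) /\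
    forall i : 'I_n, y (peW (be i)) = \prod_p (if boundary_exponent p i then sin (phi - theta p) else 1).
Proof.
move=> hX hsrc; pose X p := sin (phi - theta p); pose C p := cos (phi - theta p).
have [NS hNS] := choice label_potential.
have [NS' hNS'] := choice hNS; have [bf hbf] := choice hNS'.
(* The shift makes every exponent at the boundary 0 or 1. *)
pose c (p : 'I_n) : int := (p < src p)%N%:R.
pose F (M : 'I_n -> E -> int) e : R := \prod_p X p ^ (M p e + c p).
pose Y e : R := \prod_p X p ^ (corner_exp (NS p) p e + c p).
have hshift (M : 'I_n -> E -> int) (l : E -> 'I_n) e :
   (forall p, corner_exp (NS p) p e = M p e - (l e == p)%:R) -> F M e = Y e * X (l e).
  move=> h; rewrite /F /Y (bigD1 (l e)) //= [in RHS](bigD1 (l e)) //= mulrAC; congr (_ * _).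
    by rewrite h eqxx addrAC (expfzDr _ (-1)) ?hX // -mulrA exprN1 mulVf ?hX // mulr1.
  by apply: eq_bigr => p hp; rewrite h eq_sym (negbTE hp) subr0.
have hN e : F NS e = Y e * X (b e) by apply: hshift.
have hS e : F NS' e = Y e * X (w e).
  by apply: hshift => p; have [_ hm _] := hbf p; rewrite (corner_exponentS hm).
pose y (x : pV G) : R := if [pick e | peW e == x] is Some e then Y e else 0.
have hy e : y (peW e) = Y e.
  rewrite /y; case: pickP => [e' /eqP he'|/(_ e)]; last by rewrite eqxx.
  apply: eq_bigr => p _; have [hf hm _] := hbf p.
  by rewrite (corner_exponent_white hf hm he').
exists y; split=> [x hx1 hx2|i].
  transitivity (\sum_(g | peB g == x) (F NS' g * C (b g) - F NS g * C (w g))).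
    apply: eq_bigr => g _; rewrite hy hN hS.
    have -> : theta (b g) - theta (w g) = (phi - theta (w g)) - (phi - theta (b g)) by ring.
    by rewrite sinB /X /C; ring.
  rewrite sumrB; apply/eqP; rewrite subr_eq0; apply/eqP.
  rewrite -[RHS](sum_prB HG); apply: eq_bigr => g /eqP hg.
  case: HL => [[_ k2 _ _] _]; rewrite k2 ?hg //; congr (_ * _); apply: eq_bigr => p _.
  by have [[_ h2 _ _] _ _] := hbf p; rewrite h2 ?hg.
rewrite hy; apply: eq_bigr => p _; have [hf hm hb] := hbf p.
rewrite (corner_exponent_be hf hb) /c /boundary_exponent.
have := hsrc p; rewrite -val_eqE /=.
case: (ltngtP (src p) p) => //= h1 _; rewrite ?addr0.
  case: (ltnP (src p) i) => h2; case: (leqP p i) => h3 /=; rewrite ?subrr ?subr0 ?expr0z ?expr1z //.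
  by exfalso; lia.
case: (ltnP (src p) i) => h2; case: (leqP p i) => h3 /=; rewrite ?subrr ?add0r ?sub0r ?addNr ?expr0z ?expr1z //.
by exfalso; lia.
Qed.

End LabelPotential.

(** * Edges of the plabic graph as angles; positivity of the weights *)

Section Angles.
Variables (n : nat) (G : plabic n).
Hypothesis HG : plabic_ok G.
Local Notation E := (pE G).
Local Notation be := (pbedge G).
Variables (f : 'I_n -> 'I_n) (b w : E -> 'I_n).
Hypotheses (finj : injective f) (HL : reduced_labelling f b w).
Local Notation src := (invF finj).
Variable R : realType.

(** The term with [pi] brings the angle into the interval from 0 to pi when the parameters increase
    within an interval of length pi. *)
Definition label_angle (th : 'I_n -> R) (p q : 'I_n) : R := th p - th q + pi * (p < q)%N%:R.
Definition eangle (th : 'I_n -> R) (e : E) : R := label_angle th (b e) (w e).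
(** The signed number of crossings of two strands at interior edges, expressed by the endpoints
    alone; see [interior_pair_count]. *)
Definition cross_index (p q : 'I_n) : int :=
  (src p < q)%N%:R - (p < q)%N%:R - (src p < src q)%N%:R + (p <= src q)%N%:R.
Lemma sum1_intE (P : pred E) : \sum_(e | P e) (1 : int) = #|[set e | P e]|%:Z.
Proof. by rewrite sumr_const natz cardsE. Qed.

Lemma interior_pair_count p q : q != p ->
  \sum_(e | [&& b e == p, w e == q & ~~ bnde e]) (1 : int)
  - \sum_(e | [&& b e == q, w e == p & ~~ bnde e]) 1 = cross_index p q.
Proof.
move=> hqp; have [N [S [bf [Hf Hm Hbf]]]] := label_potential HG finj HL p.
have := pair_count HG HL Hf Hm Hbf hqp.
have hb (p' q' : 'I_n) : \sum_(e | (b e == p') && (w e == q')) (1 : int) =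
    (src p' == q')%:R + \sum_(e | [&& b e == p', w e == q' & ~~ bnde e]) 1.
  rewrite (bigID (fun e => bnde e)) /=; congr (_ + _); last by apply: eq_bigl => e; rewrite andbA.
  case: (HL) => [[_ _ h3 h4] _].
  case: eqP => [h|h]; last first.
    apply: big_pred0 => e; apply/negP => /andP[/andP[/eqP h1 /eqP h2] /(bndeP HG)[i hi]].
    by apply: h; apply: finj; rewrite f_invF -h1 -h2 hi h3 h4.
  apply: (big_pred1 (be q')) => e /=; apply/andP/eqP => [[/andP[/eqP h1 /eqP h2] /(bndeP HG)[i hi]]|->].
    by rewrite hi -h2 hi h3.
  by rewrite h3 h4 -h f_invF !eqxx (bnde_be HG).
rewrite !hb => h.
have hh (x y u v t : int) : x + u - (y + v) = t -> u - v = t - x + y by move=> <-; ring.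
rewrite (hh _ _ _ _ _ h) /cross_index -!val_eqE /=.
have hpq : (p : nat) != q by rewrite eq_sym.
by case: (ltngtP (src p) q); case: (ltngtP p q) hpq; case: (ltngtP (src q) p); case: (src p < src q)%N => //=; ring.
Qed.

Lemma vertex_angle_sum th (x : pV G) : ~~ is_bnd x -> \sum_(e | incident x e) eangle th e = pi.
Proof.
move=> hx; rewrite /eangle /label_angle big_split /= -mulr_sumr sumrB !(sum_incident_at HG).
rewrite (sum_lab_white HG HL) (sum_lab_black HG HL) // subrr add0r.
have := sum_dsc HL hx; rewrite (sum_incident_at HG) /dsc => /(congr1 (fun z : int => z%:~R : R)).
by rewrite rmorphD /= !rmorph_sum /= => ->; rewrite mulr1.
Qed.

(** At a black vertex of degree 2 the two angles sum to pi whatever their signs, so the crossing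
    count gives no control there; such edges are treated separately from [deg3]. *)
Definition deg2 (e : E) := ~~ bnde e && (prB (prB e) == e).
Definition deg3 (e : E) := ~~ bnde e && (prB (prB e) != e).

Lemma deg2_orbit e k : prB (prB e) = e -> iter k (@prB n G) e = e \/ iter k (@prB n G) e = prB e.
Proof.
move=> h; elim: k => [|k IH]; first by left.
by rewrite iterS; case: IH => ->; [right|left].
Qed.

Lemma label_angle_sym th p q : p != q -> label_angle th q p = pi - label_angle th p q.
Proof.
rewrite -val_eqE /label_angle /=; case: (ltngtP p q) => //= _ _; ring.
Qed.

Lemma deg2_labels e : deg2 e -> [/\ deg2 (prB e), b (prB e) = w e & w (prB e) = b e].
Proof.
move=> /andP[h1 /eqP h2]; case: (HL) => [[_ k _ _] _].
have h3 : ~~ bnde (prB e) by rewrite (bnde_prB HG).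
by rewrite /deg2 h3 h2 eqxx k // -[in w e]h2 k.
Qed.

Lemma deg2_angle th e : deg2 e -> eangle th (prB e) = pi - eangle th e.
Proof.
move=> /deg2_labels[_ h1 h2]; rewrite /eangle h1 h2 label_angle_sym //.
by case: (HL) => _ [_ _ h _].
Qed.

Lemma deg3_prB e : deg3 (prB e) = deg3 e.
Proof. by rewrite /deg3 (bnde_prB HG) (inj_eq (prB_inj HG)). Qed.
Lemma deg2_prB e : deg2 (prB e) = deg2 e.
Proof. by rewrite /deg2 (bnde_prB HG) (inj_eq (prB_inj HG)). Qed.
Lemma edge_kind e : [|| bnde e, deg2 e | deg3 e].
Proof. by rewrite /deg2 /deg3; case: (bnde e) => //=; case: eqP. Qed.

Lemma antisym_sum0 (P : pred E) (s : E -> E) (F : E -> int) : injective s ->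
  (forall e, P (s e) = P e) -> (forall e, P e -> F (s e) = - F e) -> \sum_(e | P e) F e = 0.
Proof.
move=> hs hP hF; have h : \sum_(e | P e) F e = - \sum_(e | P e) F e.
  rewrite -sumrN [LHS](reindex_inj hs) /=; apply: eq_big => [e|e]; first exact: hP.
  by rewrite hP => /hF.
by move: h; set S := \sum_(e | _) _; clearbody S; lia.
Qed.

(** The inequalities of admissibility for the pairs of strands whose signed crossing number is
    nonzero. *)
Definition compatible (th : 'I_n -> R) := forall p q : 'I_n, (p < q)%N ->
  cross_index p q != 0 -> th p < th q < th p + pi.
Lemma crossing_index_sym p q : p != q -> cross_index q p = - cross_index p q.
Proof. by move=> h; rewrite -(@interior_pair_count q p h) -(@interior_pair_count p q) 1?eq_sym // opprB. Qed.

Lemma crossing_angle th p q : compatible th -> p != q -> cross_index p q != 0 ->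
  0 < label_angle th p q < pi.
Proof.
move=> hth hpq hc; rewrite /label_angle; move: (hpq); rewrite -val_eqE /=; case: (ltngtP p q) => //= h _.
  have /andP[h1 h2] := hth p q h hc; apply/andP; split; rewrite mulr1; lra.
have hc' : cross_index q p != 0 by rewrite crossing_index_sym // oppr_eq0.
have /andP[h1 h2] := hth q p h hc'; apply/andP; split; rewrite mulr0; lra.
Qed.

(** Strands with signed crossing number 0 cross equally often in both orders, and reversing the
    order exchanges the angles 0 and pi. All other pairs have angles strictly between, and black
    vertices of degree 2 are balanced by themselves. *)
Lemma balanced_extremes th : compatible th ->
  \sum_(e | deg3 e) ((eangle th e == 0)%:R - (eangle th e == pi)%:R : int) = 0.
Proof.
move=> hth; pose g p q : int := (label_angle th p q == 0)%:R - (label_angle th p q == pi)%:R.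
have gsym p q : p != q -> g q p = - g p q.
  move=> hpq; rewrite /g label_angle_sym // opprB subr_eq0 eq_sym; congr (_ - _).
  by rewrite -subr_eq0 addrAC subrr sub0r oppr_eq0.
have h2 : \sum_(e | deg2 e) g (b e) (w e) = 0.
  apply: (antisym_sum0 (prB_inj HG) deg2_prB) => e /deg2_labels[_ -> ->].
  by apply: gsym; case: (HL) => _ [_ _ h _].
have h1 : \sum_(e | ~~ bnde e) g (b e) (w e) = 0.
  pose N p q : int := \sum_(e | [&& b e == p, w e == q & ~~ bnde e]) 1.
  have hS : \sum_(e | ~~ bnde e) g (b e) (w e) = \sum_p \sum_q N p q * g p q.
    rewrite (partition_big b xpredT) //=; apply: eq_bigr => p _.
    rewrite (partition_big w xpredT) //=; apply: eq_bigr => q _.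
    rewrite mulr_suml; apply: eq_big => [e|e /andP[/andP[_ /eqP ->] /eqP ->]]; last by rewrite mul1r.
    by rewrite andbC [_ && (b e == p)]andbC andbCA.
  have hN p : N p p = 0.
    apply: big_pred0 => e; apply/negP => /and3P[/eqP h1 /eqP h3 _].
    by case: (HL) => _ [_ _ /(_ e) + _]; rewrite h1 h3 eqxx.
  have hS' : \sum_p \sum_q N p q * g p q = - \sum_p \sum_q N p q * g p q.
    rewrite -sumrN [LHS]exchange_big /=; apply: eq_bigr => p _; rewrite -sumrN; apply: eq_bigr => q _.
    have [->|hqp] := eqVneq q p; first by rewrite hN mul0r oppr0.
    rewrite (gsym p q) 1?eq_sym // mulrN; congr (- _).
    have [hc|hc] := eqVneq (cross_index p q) 0.
      congr (_ * _); apply/esym/eqP; rewrite -subr_eq0; apply/eqP; exact: etrans (interior_pair_count hqp) hc.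
    have hpq : p != q by rewrite eq_sym.
    have /andP[k1 k2] := crossing_angle hth hpq hc.
    by rewrite /g (gt_eqF k1) (lt_eqF k2) subrr !mulr0.
  by rewrite hS; move: hS'; set S := \sum_p _; clearbody S; lia.
move: h1; rewrite (bigID deg2) /= [X in X + _](_ : _ = 0) ?add0r; last first.
  by rewrite -[RHS]h2; apply: eq_bigl => e; rewrite /deg2; case: (bnde e).
move=> h; rewrite -[RHS]h; apply: eq_bigl => e; rewrite /deg2 /deg3.
by case: (bnde e).
Qed.

(** An edge of angle pi leaves angle 0 for the other edges at its black vertex, of which there are
    at least two. So there are at least twice as many zeros as pis, while [balanced_extremes] makes
    them equally many. *)
Lemma deg3_extreme_none th : compatible th -> (forall e, deg3 e -> 0 <= eangle th e <= pi) ->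
  forall e, deg3 e -> 0 < eangle th e < pi.
Proof.
move=> hth hge; have hbal := balanced_extremes hth.
pose Z0 := [set e | deg3 e && (eangle th e == 0)].
pose Z1 := [set e | deg3 e && (eangle th e == pi)].
have hc : #|Z0|%:Z = #|Z1|%:Z.
  apply/eqP; rewrite -subr_eq0 -hbal sumrB -!sum1_intE; apply/eqP; congr (_ - _).
    by rewrite big_mkcondr; apply: eq_bigr => e _; case: eqP.
  by rewrite big_mkcondr; apply: eq_bigr => e _; case: eqP.
have h1 e e' : e \in Z1 -> peB e' = peB e -> e' != e -> e' \in Z0.
  rewrite !inE => /andP[h3 /eqP hpi] hp hne.
  have h3' : forall g, peB g = peB e -> deg3 g.
    move=> g /esym/(prB_trans HG)[k <-]; elim: k => //= k; by rewrite deg3_prB.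
  rewrite h3' //=; have hx : ~~ bnde e by case/andP: h3.
  have := vertex_angle_sum th hx; rewrite (bigD1 e) ?incident_peB //= hpi => /eqP.
  rewrite -subr_eq0 addrAC subrr add0r psumr_eq0 => [/allP/(_ e')|g /andP[hg _]].
    by rewrite mem_index_enum /incident hp eqxx hne => /(_ isT).
  case/orP: hg => /eqP hg; first by have /andP[] := hge g (h3' g hg).
  by have := peW_white HG g; rewrite hg (peB_black HG).
have hprB e : deg3 e -> prB e != e by move=> /andP[h _]; case: (HL) => _ [_ k _ _]; exact: k.
have h2 : (2 * #|Z1| <= #|Z0|)%N.
  pose s e := prB (prB e : E).
  have hs : injective s by move=> x y /(prB_inj HG)/(prB_inj HG).
  rewrite mul2n -addnn -{1}(card_imset (mem Z1) (prB_inj HG)) -(card_imset (mem Z1) hs).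
  rewrite -cardsUI [X in (_ + X)%N](_ : _ = 0%N) ?addn0; last first.
    apply/eqP; rewrite cards_eq0; apply/eqP/setP => g; rewrite !inE; apply/negP.
    move=> /andP[/imsetP[e he ->] /imsetP[e' he' hee]].
    have hne : e' = e.
      apply/eqP/negPn/negP => hne; have hp : peB e' = peB e.
        by rewrite -(peB_prB HG e) hee /s !(peB_prB HG).
      have := h1 e e' he hp hne; rewrite inE; move: he'; rewrite inE => /andP[-> /eqP ->] /=.
      by rewrite gt_eqF ?pi_gt0.
    move: hee; rewrite hne /s => /(prB_inj HG) hh; have := hprB e.
    by rewrite -hh eqxx; move: he; rewrite inE => /andP[-> _] /(_ isT).
  apply: subset_leq_card; apply/fintype.subsetP => g; rewrite !inE => /orP[]/imsetP[e he ->].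
    have h3 : deg3 e by move: he; rewrite inE => /andP[].
    by have := h1 e (prB e) he (peB_prB HG e) (hprB e h3); rewrite inE.
  have h3 : deg3 e by move: he; rewrite inE => /andP[].
  have hne : s e != e by case/andP: h3.
  have hp : peB (s e) = peB e by rewrite /s !(peB_prB HG).
  by have := h1 e (s e) he hp hne; rewrite inE.
have [hz0 hz1] : #|Z0| = 0%N /\ #|Z1| = 0%N.
  by move: hc h2; set x := #|Z0|; set y := #|Z1|; clearbody x y; lia.
move=> e he; have /andP[k1 k2] := hge e he; rewrite !lt_neqAle k1 k2 !andbT; apply/andP; split.
  by apply/negP => /eqP h; have := card0_eq hz0 e; rewrite inE he -h eqxx.
by apply/negP => /eqP h; have := card0_eq hz1 e; rewrite inE he h eqxx.
Qed.

Lemma conv_gt0 (t x y : R) : 0 <= t -> t <= 1 -> 0 < x -> 0 < y -> 0 < (1 - t) * x + t * y.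
Proof.
move=> h0 h1 hx hy; have [->|ht] := eqVneq t 0; first by rewrite subr0 mul1r mul0r addr0.
by apply: ltr_wpDl; [apply: mulr_ge0; [rewrite subr_ge0|exact: ltW]|rewrite mulr_gt0 // lt_neqAle eq_sym ht].
Qed.

(* The equally spaced parameters have all angles in (0, pi); on the segment from them to [th] no angle at a
   black vertex of degree at least three can be the first to leave this interval. *)
Theorem deg3_angle th : compatible th -> forall e, deg3 e -> 0 < eangle th e < pi.
Proof.
move=> hth; have n0 := plabic_n_gt0 HG.
have hn : 0 < n%:R :> R by rewrite ltr0n.
pose th0 (p : 'I_n) : R := p%:R * (pi / n%:R).
have hpn : 0 < pi / n%:R :> R by rewrite divr_gt0 ?pi_gt0.
have h0step p q : label_angle th0 p q = (p%:R - q%:R + n%:R * (p < q)%N%:R) * (pi / n%:R).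
  have hpi : pi = n%:R * (pi / n%:R) :> R by rewrite [RHS]mulrC divfK // gt_eqF.
  transitivity (th0 p - th0 q + n%:R * (pi / n%:R) * (p < q)%N%:R); first by rewrite -hpi.
  by rewrite /th0; move: (pi / n%:R) => u; ring.
have h0 p q : p != q -> 0 < label_angle th0 p q < pi.
  rewrite -val_eqE /= => hpq; rewrite h0step.
  have hpi : pi = n%:R * (pi / n%:R) :> R by rewrite mulrC -mulrA mulVf ?mulr1 // gt_eqF.
  have hp : (p%:R < n%:R :> R) by rewrite ltr_nat.
  have hq : (q%:R < n%:R :> R) by rewrite ltr_nat.
  have hp0 : (0 <= p%:R :> R) by []. have hq0 : (0 <= q%:R :> R) by [].
  apply/andP; split; first rewrite mulr_gt0 //.
    case: (ltngtP p q) hpq => //= h _; rewrite ?mulr1 ?mulr0 ?addr0; first lra.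
    by rewrite subr_gt0 ltr_nat.
  rewrite [X in _ < X]hpi ltr_pM2r //; case: (ltngtP p q) hpq => //= h _; rewrite ?mulr1 ?mulr0.
    by have hlt : (p%:R < q%:R :> R); [rewrite ltr_nat|lra].
  lra.
have hth0 : compatible th0.
  move=> p q hpq _; have hne : p != q by rewrite -val_eqE /= ltn_eqF.
  by have /andP := h0 p q hne; rewrite /label_angle hpq mulr1 => -[k1 k2]; apply/andP; split; lra.
pose tht (t : R) (p : 'I_n) := (1 - t) * th0 p + t * th p.
have hlin t e : eangle (tht t) e = (1 - t) * eangle th0 e + t * eangle th e.
  by rewrite /eangle /label_angle /tht; ring.
have htht t : 0 <= t -> t <= 1 -> compatible (tht t).
  move=> t1 t2 p q hpq hc; have /andP[a1 a2] := hth p q hpq hc; have /andP[b1 b2] := hth0 p q hpq hc.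
  have c1 : 0 < th0 q - th0 p by lra.
  have c2 : 0 < th q - th p by lra.
  have c3 : 0 < th0 p + pi - th0 q by lra.
  have c4 : 0 < th p + pi - th q by lra.
  have d1 := conv_gt0 t1 t2 c1 c2; have d2 := conv_gt0 t1 t2 c3 c4.
  by rewrite /tht; apply/andP; split; move: (pi : R) d2 => P d2; lra.
have he0 e : 0 < eangle th0 e < pi by apply: h0; case: (HL) => _ [_ _ h _].
apply: contrapT => hbad.
pose bad e := deg3 e && ~~ (0 < eangle th e < pi).
have [e0 hb0] : exists e0, bad e0.
  apply: contrapT => hn'; apply: hbad => e he; apply: contrapT => /negP h; apply: hn'; exists e.
  by rewrite /bad he.
(* The time at which the linearly moving angle of [e] reaches 0 or pi, meaningful for edges that are
   bad at time 1. *)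
pose tt e : R := let a0 := eangle th0 e in let a := eangle th e in
   if a <= 0 then a0 / (a0 - a) else (pi - a0) / (a - a0).
have htt e : bad e -> 0 < tt e <= 1 /\ ((eangle th e <= 0 /\ tt e * (eangle th0 e - eangle th e) = eangle th0 e)
    \/ (pi <= eangle th e /\ tt e * (eangle th e - eangle th0 e) = pi - eangle th0 e)).
  move=> /andP[_]; have /andP[k1 k2] := he0 e; rewrite /tt negb_and -!leNgt.
  case: (leP (eangle th e) 0) => /= k3 k4.
    have kd : 0 < eangle th0 e - eangle th e by lra.
    split; last by left; split=> //; rewrite divfK // gt_eqF.
    by rewrite divr_gt0 //= ler_pdivrMr // mul1r; lra.
  have kd : 0 < eangle th e - eangle th0 e by lra.
  split; last by right; split=> //; rewrite divfK // gt_eqF.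
  by rewrite divr_gt0 //= ?ler_pdivrMr // ?mul1r; lra.
(* At the earliest of these times all angles lie in the closed interval and that of [e1] is extreme,
   against [deg3_extreme_none]. *)
have [e1 hb1 hmin] : exists2 e1, bad e1 & forall e, bad e -> tt e1 <= tt e.
  by case: (arg_minP tt hb0) => e1 h1 h2; exists e1.
have [/andP[t1 t2] hcase] := htt e1 hb1.
have hall e : deg3 e -> 0 <= eangle (tht (tt e1)) e <= pi.
  move=> he; rewrite hlin; have /andP[k1 k2] := he0 e.
  have t0 := ltW t1.
  have [/andP[k3 k4]|hb] := boolP (0 < eangle th e < pi).
    have c3 : 0 < pi - eangle th0 e by lra.
    have c4 : 0 < pi - eangle th e by lra.
    have d1 := conv_gt0 t0 t2 k1 k3; have d2 := conv_gt0 t0 t2 c3 c4.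
    by apply/andP; split; move: (pi : R) d2 => P d2; lra.
  have hbe : bad e by rewrite /bad he.
  have hle := hmin e hbe; have [/andP[s1 s2] hcs] := htt e hbe.
  move: hle s1 s2 t1 t2 t0 k1 k2 hcs; move: (tt e1) (tt e) (eangle th0 e) (eangle th e) (pi : R).
  move=> u v x y P hle s1 s2 t1 t2 t0 k1 k2 [[s3 s4]|[s3 s4]].
    have d1 : u * (x - y) <= v * (x - y) by rewrite ler_wpM2r //; lra.
    have d2 : u * y <= 0 by rewrite mulr_ge0_le0.
    have d3 : 0 <= u * x by rewrite mulr_ge0 // ltW.
    by apply/andP; split; lra.
  have d1 : u * (y - x) <= v * (y - x) by rewrite ler_wpM2r //; lra.
  have d2 : 0 <= u * y by rewrite mulr_ge0 //; lra.
  have d3 : 0 <= (1 - u) * x by rewrite mulr_ge0 //; lra.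
  by apply/andP; split; lra.
have hd1 : deg3 e1 by case/andP: hb1.
have /andP[] := deg3_extreme_none (htht _ (ltW t1) t2) hall hd1; rewrite hlin.
by case: hcase => -[s3 s4] s5 s6; lra.
Qed.

Section Classes.
Variables (th : 'I_n -> R) (D : pred (pV G)).
Definition linked (e : E) := deg2 e && D (peB e).
(** White vertices joined through black vertices of degree 2 in [D]. Contracting the classes hides
    the uncontrolled edges; the predicate [D] allows cutting a class at a chosen vertex. *)
Definition class_rel : rel (pV G) := fun u v => [exists e, [&& linked e, peW e == u & peW (prB e) == v]].

Lemma linked_prB e : linked (prB e) = linked e.
Proof. by rewrite /linked deg2_prB (peB_prB HG). Qed.
Lemma linked_prBK e : linked e -> prB (prB e) = e.
Proof. by move=> /andP[/andP[_ /eqP]]. Qed.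

Lemma class_rel_sym : connect_sym class_rel.
Proof.
apply: sym_connect_sym => u v.
apply/existsP/existsP => -[e /and3P[h1 /eqP h2 /eqP h3]]; exists (prB e);
  by rewrite linked_prB h1 linked_prBK // h2 h3 !eqxx.
Qed.

Variable u0 : pV G.
Hypothesis Hu0 : ~~ pblack u0.
Definition in_class (e : E) := connect class_rel u0 (peW e).

Lemma in_class_prB e : linked e -> in_class (prB e) = in_class e.
Proof.
move=> he; apply/idP/idP => h; apply: (connect_trans h); apply: connect1; apply/existsP.
  by exists (prB e); rewrite linked_prB he linked_prBK // !eqxx.
by exists e; rewrite he !eqxx.
Qed.

Lemma class_white v : connect class_rel u0 v -> ~~ pblack v.
Proof.
move=> /connectP[p + ->]; elim/last_ind: p => //= p v' IH.
by rewrite rcons_path last_rcons => /andP[_ /existsP[e /and3P[_ _ /eqP <-]]]; rewrite (peW_white HG).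
Qed.

Let whites := {v : pV G | connect class_rel u0 v}.
Let blacks := {x : pV G | [exists e, [&& linked e, peB e == x & in_class e]]}.

(** A class is connected, and each linked black vertex acts as one edge between two white
    vertices. *)
Lemma class_card : (#|[set v | connect class_rel u0 v]| <=
  #|[set x | [exists e, [&& linked e, peB e == x & in_class e]]]| + 1)%N.
Proof.
have hx (x : blacks) : exists e, [&& linked e, peB e == val x & in_class e] by apply/existsP; exact: (valP x).
pose ex x := xchoose (hx x).
have hex x : [&& linked (ex x), peB (ex x) == val x & in_class (ex x)] by exact: (xchooseP (hx x)).
have hs x : connect class_rel u0 (peW (ex x)) by have /and3P[] := hex x.
have ht x : connect class_rel u0 (peW (prB (ex x))).
  by have /and3P[h1 _ h2] := hex x; have := in_class_prB h1; rewrite /in_class => ->.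
have := @card_connected rat _ blacks (fun x => Sub (peW (ex x)) (hs x) : whites) (fun x => Sub (peW (prB (ex x))) (ht x)).
rewrite !card_sig => h; rewrite !cardsE; apply: h => F hF.
have H (v : whites) : F v = F (Sub u0 (connect0 class_rel u0)).
  case: v => v hv; have /connectP[p hp hl] := hv.
  elim/last_ind: p v hv hp hl => [|p v' IH] v hv /=.
    by move=> _ hl; congr F; apply: val_inj.
  rewrite rcons_path last_rcons => /andP[hp /existsP[e /and3P[h1 /eqP h2 /eqP h3]]] hl.
  have hv' : connect class_rel u0 (last u0 p) by apply/connectP; exists p.
  rewrite -(IH _ hv' hp (erefl _)).
  have hbx : [exists g, [&& linked g, peB g == peB e & in_class g]].
    by apply/existsP; exists e; rewrite h1 eqxx /in_class h2.
  pose x : blacks := Sub (peB e) hbx.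
  have /and3P[k1 /eqP k2 _] := hex x.
  have hee : ex x = e \/ ex x = prB e.
    have [k hk] := prB_trans HG (esym k2); rewrite -hk; apply: deg2_orbit; apply: linked_prBK; by case/and3P: (hex x).
  have hFx := hF x; case: hee => hee.
    transitivity (F (Sub (peW (prB (ex x))) (ht x))); first by congr F; apply: val_inj; rewrite /= hee h3.
    by rewrite -hFx; congr F; apply: val_inj; rewrite /= hee.
  transitivity (F (Sub (peW (ex x)) (hs x))); first by congr F; apply: val_inj; rewrite /= hee h3.
  by rewrite hFx; congr F; apply: val_inj; rewrite /= hee linked_prBK.
by move=> v v'; rewrite !H.
Qed.

Lemma class_sum (F : E -> R) : \sum_(v | connect class_rel u0 v) \sum_(e | peW e == v) F e =
  \sum_(e | in_class e) F e.
Proof.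
rewrite [RHS](partition_big (@peW n G) (connect class_rel u0)) //=; apply: eq_bigr => v hv.
by apply: eq_bigl => e; rewrite /in_class; case: eqP => [->|]; rewrite ?hv ?andbF.
Qed.

(** Each white vertex of the class contributes pi and each linked black vertex takes pi away; there
    is at most one white vertex more than linked black ones. *)
Lemma class_angle_le : \sum_(e | in_class e && ~~ linked e) eangle th e <= pi.
Proof.
pose m := #|[set v | connect class_rel u0 v]|.
pose x := #|[set x | [exists e, [&& linked e, peB e == x & in_class e]]]|.
have h1 : \sum_(e | in_class e) eangle th e = m%:R * pi.
  rewrite -class_sum (eq_bigr (fun=> pi)); last first.
    move=> v hv; have hw := class_white hv.
    have hv' : ~~ is_bnd v by apply/negP => /existsP[i /eqP h]; move: hw; rewrite -h (pbnd_black HG).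
    rewrite -[RHS](vertex_angle_sum th hv'); apply: eq_bigl => e; rewrite /incident.
    by case: (eqVneq (peB e) v) => //= h; have := peB_black HG e; rewrite h (negbTE hw).
  rewrite (eq_bigl (fun v => v \in [set v | connect class_rel u0 v])); last by move=> v; rewrite !inE.
  by rewrite sumr_const [RHS]mulr_natl.
have hx2 : (\sum_(e | in_class e && linked e) 1 = 2 * x)%N.
  rewrite (partition_big (@peB n G) (fun y => [exists e, [&& linked e, peB e == y & in_class e]])) /=; last first.
    by move=> e /andP[k1 k2]; apply/existsP; exists e; rewrite k1 k2 eqxx.
  transitivity (\sum_(y in [set y | [exists e, [&& linked e, peB e == y & in_class e]]]) 2)%N; last first.
    by rewrite sum_nat_const mulnC.
  apply: eq_big => [y|]; first by rewrite inE.
  move=> y /existsP[e /and3P[k1 /eqP k2 k3]].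
  have hne : prB e != e.
    by case/andP: k1 => /andP[hb _] _; case: (HL) => _ [_ k _ _]; exact: k.
  rewrite (bigD1 e) /=; last by rewrite k1 k2 k3 eqxx.
  rewrite (bigD1 (prB e)) /=; last by rewrite linked_prB k1 (peB_prB HG) k2 in_class_prB // k3 eqxx hne.
  rewrite big1 // => g /andP[/andP[/andP[/andP[_ _] /eqP hg] g1] g2]; exfalso.
  have [k hk] := prB_trans HG (etrans k2 (esym hg)).
  have : g = e \/ g = prB e.
    by rewrite -hk; apply: deg2_orbit; apply: linked_prBK.
  by case=> h; [move: g1|move: g2]; rewrite h eqxx.
have h2 : \sum_(e | in_class e && linked e) eangle th e = x%:R * pi.
  have hS : \sum_(e | in_class e && linked e) eangle th e =
      (2 * x)%:R * pi - \sum_(e | in_class e && linked e) eangle th e.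
    rewrite -hx2 natr_sum mulr_suml -sumrB [LHS](reindex_inj (prB_inj HG)) /=; apply: eq_big => [e|e].
      by rewrite linked_prB; case he: (linked e); rewrite ?andbF // in_class_prB.
    by rewrite linked_prB mul1r => /andP[_ /andP[he _]]; rewrite deg2_angle.
  move: hS; rewrite natrM; set S := \sum_(e | _) _; clearbody S; set X := x%:R; move: (pi : R) => P; clearbody X; lra.
have hm : m%:R <= x%:R + 1 :> R by rewrite natr1 ler_nat -addn1; exact: class_card.
have : m%:R * pi = x%:R * pi + \sum_(e | in_class e && ~~ linked e) eangle th e by rewrite -h1 (bigID linked) /= h2.
have := pi_gt0 R; set S := \sum_(e | _) _; move: (pi : R) => P hP hh; clearbody S; nra.
Qed.

Lemma class_exit_labels (F : 'I_n -> int) :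
  \sum_(e | in_class e && ~~ linked e) (F (b e) - F (w e)) = 0.
Proof.
have h1 : \sum_(e | in_class e) (F (b e) - F (w e)) = 0.
  rewrite (partition_big (@peW n G) (connect class_rel u0)) //=; apply: big1 => v hv.
  rewrite (eq_bigl (fun e => peW e == v)); last first.
    by move=> e; rewrite /in_class; case: eqP => [->|]; rewrite ?hv ?andbF.
  by rewrite sumrB (sum_lab_white HG HL) subrr.
move: h1; rewrite (bigID linked) /= [X in X + _](_ : _ = 0) ?add0r //.
apply: (antisym_sum0 (prB_inj HG)) => [e|e /andP[_ /andP[/deg2_labels[_ -> ->] _]]]; last by rewrite opprB.
by rewrite linked_prB; case he: (linked e); rewrite ?andbF // in_class_prB.
Qed.

(** Incoming and outgoing labels on the exits of a class agree as multisets, and no edge carries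
    equal labels, so a class cannot have a single exit. *)
Lemma class_exit_second e0 : in_class e0 -> ~~ linked e0 ->
  exists e1, [/\ e1 != e0, in_class e1 & ~~ linked e1].
Proof.
move=> h1 h2; apply: contrapT => hno.
have := class_exit_labels (fun p => (p == b e0)%:R); rewrite (bigD1 e0) ?h1 //= big1 ?addr0; last first.
  by move=> e /andP[/andP[k1 k2] k3]; exfalso; apply: hno; exists e.
rewrite eqxx eq_sym; case: (HL) => _ [_ _ h _]; by rewrite (negbTE (h e0)).
Qed.

Lemma class_exit_exists : exists e1, in_class e1 && ~~ linked e1.
Proof.
apply: contrapT => hno.
have hall e : in_class e -> linked e.
  by move=> he; apply/negPn/negP => hl; apply: hno; exists e; rewrite he hl.
pose P v := connect class_rel u0 v \/ exists2 e, peB e = v & linked e && in_class e.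
have [i [hi|[e he /andP[hl hc]]]] : exists i, P (pbnd G i).
  apply: (adjacent_closed HG (P := P) (x0 := u0)).
  - by left.
  - move=> e [h|[g hg /andP[g1 g2]]]; first by have := class_white h; rewrite (peB_black HG).
    left; have [k hk] := prB_trans HG hg; rewrite -hk.
    have : linked (iter k (@prB n G) g) && in_class (iter k (@prB n G) g).
      by elim: k {hk} => [|k /andP[IH1 IH2]] /=; rewrite ?g1 // linked_prB IH1 in_class_prB.
    by case/andP.
  - move=> e [h|[g hg _]]; last by have := peW_white HG e; rewrite -hg (peB_black HG).
    by right; exists e => //; rewrite hall.
- by have := class_white hi; rewrite (pbnd_black HG).
by case/andP: hl => /andP[+ _] _; rewrite he bnd_pbnd.
Qed.

End Classes.

(** Exponents do not change across a black vertex of degree 2. Hence two boundary edges leaving the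
    same class have equal exponents. *)
Lemma class_exponent D u0 p (N S : E -> int) (bf : 'I_n -> int) e0 e :
  face_function N S bf -> (forall e, N e - S e = (b e == p)%:R - (w e == p)%:R) ->
  peW e0 = u0 -> in_class D u0 e -> corner_exp b N p e = corner_exp b N p e0.
Proof.
move=> Hf Hm he0 /connectP[q hq hl].
elim/last_ind: q e hq hl => [|q v IH] e /=.
  by move=> _ h; apply: (corner_exponent_white HG HL Hf Hm); rewrite h he0.
rewrite rcons_path last_rcons => /andP[hq /existsP[g /and3P[/andP[/andP[h1 /eqP h2] _] /eqP h3 /eqP h4]]] hl.
rewrite -(IH g) ?h3 // -(corner_exponent_deg2 HG HL Hf Hm h1 h2).
by apply: (corner_exponent_white HG HL Hf Hm); rewrite h4 hl.
Qed.

(** The hypothesis on exponents keeps a second boundary edge from leaving the same class. The other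
    exits have positive angles by [deg3_angle], and [class_angle_le] bounds the sum. *)
Theorem boundary_angle_le th : compatible th ->
  (forall i j : 'I_n, (forall p : 'I_n, (src p < i)%N%:R - (p <= i)%N%:R = (src p < j)%N%:R - (p <= j)%N%:R :> int) -> i = j) ->
  forall i, eangle th (be i) <= pi.
Proof.
move=> hth hdist i; have := class_angle_le th xpredT (peW_white HG (be i)).
have hbl j : ~~ linked xpredT (be j) by rewrite /linked /deg2 (bnde_be HG).
rewrite (bigD1 (be i)) /=; last by rewrite /in_class connect0 hbl.
apply: le_trans; rewrite lerDl sumr_ge0 // => e /andP[/andP[h1 h2] h3].
have [/(bndeP HG)[j hj]|hb] := boolP (bnde e).
  exfalso; move/negP: h3; apply; apply/eqP; rewrite hj; congr be; apply: hdist => p.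
  have [N [S [bf [Hf Hm Hbf]]]] := label_potential HG finj HL p.
  rewrite -!(corner_exponent_be HL Hf Hbf).
  by apply: (class_exponent Hf Hm (erefl _)); rewrite -hj; exact: h1.
have := edge_kind e; rewrite (negbTE hb) /=; move: h2; rewrite /linked andbT => /negbTE -> /= h.
by have /andP[/ltW] := deg3_angle hth h.
Qed.

(** A class is cut at a black vertex of degree 2. If this separates its two edges, the part
    containing [e0] has another exit of positive angle, so [class_angle_le] is strict for [e0]. If
    not, both edges are exits with sum pi and a third, positive exit breaks the bound. *)
Theorem interior_angle th : compatible th -> (forall i, 0 < eangle th (be i)) ->
  forall e, ~~ bnde e -> 0 < eangle th e < pi.
Proof.
move=> hth hbd.
have hpos e : ~~ deg2 e -> 0 < eangle th e.
  move=> h; have := edge_kind e; rewrite (negbTE h) /= => /orP[/(bndeP HG)[i ->] //|h3].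
  by have /andP[] := deg3_angle hth h3.
have hlt e0 : deg2 e0 -> eangle th e0 < pi.
  move=> hd; pose D := predC1 (peB e0); pose K := in_class D (peW e0).
  have hK0 : K e0 by exact: connect0.
  have hl0 : ~~ linked D e0 by rewrite /linked /D /= eqxx andbF.
  have hnl e : K e -> ~~ linked D e -> e = e0 \/ e = prB e0 \/ 0 < eangle th e.
    move=> _; rewrite /linked /D /= negb_and negbK => /orP[/hpos|/eqP he]; first by right; right.
    have [k hk] := prB_trans HG (esym he); rewrite -hk.
    have : iter k (@prB n G) e0 = e0 \/ iter k (@prB n G) e0 = prB e0.
      by apply: deg2_orbit; case/andP: hd => _ /eqP.
    by case; [left|right; left].
  have := class_angle_le th D (peW_white HG e0); rewrite -/K.
  have hne : prB e0 != e0 by case: (HL) => _ [_ k _ _]; apply: k; case/andP: hd.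
  have [hK1|hK1] := boolP (K (prB e0)); last first.
    have [e1 [k1 k2 k3]] := class_exit_second hK0 hl0.
    rewrite (bigD1 e0) ?hK0 //= (bigD1 e1) /=; last by rewrite (k2 : K e1) k3 k1.
    have p1 : 0 < eangle th e1.
      case: (hnl e1 k2 k3) => [h|[h|//]]; first by rewrite h eqxx in k1.
      by move: hK1; rewrite -h /K k2.
    set S := \sum_(e | _) _; have : 0 <= S; last by move=> hS hle; lra.
    apply: sumr_ge0 => e /andP[/andP[/andP[g1 g2] g3] g4].
    case: (hnl e g1 g2) => [h|[h|/ltW //]]; first by rewrite h eqxx in g3.
    by move: hK1; rewrite -h g1.
  have [e1 /andP[k1 k2]] := class_exit_exists xpredT (peW_white HG e0).
  have hd1 : ~~ deg2 e1 by move: k2; rewrite /linked andbT.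
  have hKe1 : K e1.
    move: k1; rewrite /K /in_class; move: (peW e1) => v; apply: connect_sub => {}u {}v /existsP[g /and3P[g1 /eqP <- /eqP <-]].
    have [hg|hg] := boolP (linked D g); first by apply: connect1; apply/existsP; exists g; rewrite hg !eqxx.
    have hsym := class_rel_sym D.
    have hc : connect (class_rel D) (peW e0) (peW (prB e0)) by [].
    have hgd : deg2 g by case/andP: g1.
    move: hg; rewrite /linked hgd /D /= negbK => /eqP hg.
    have [k hk] := prB_trans HG (esym hg).
    have : g = e0 \/ g = prB e0.
      by rewrite -hk; apply: deg2_orbit; case/andP: hd => _ /eqP.
    case=> ->; first by [].
    have hpp : prB (prB e0) = e0 by case/andP: hd => _ /eqP.
    by rewrite hpp -/D hsym.
  have hl1 e : ~~ deg2 e -> ~~ linked D e by rewrite /linked => /negbTE ->.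
  have hlp : ~~ linked D (prB e0) by rewrite linked_prB.
  rewrite (bigD1 e0) ?hK0 //= (bigD1 (prB e0)) ?hK1 ?hlp ?hne //= (bigD1 e1) /=; last first.
    rewrite hKe1 hl1 //=; apply/andP; split; first by apply/negP => /eqP h; move: hd1; rewrite h hd.
    by apply/negP => /eqP h; move: hd1; rewrite h deg2_prB hd.
  rewrite (deg2_angle th hd); have p1 := hpos _ hd1.
  set S := \sum_(e | _) _; have : 0 <= S; last by move=> hS hle; lra.
  apply: sumr_ge0 => e /andP[/andP[/andP[/andP[g1 g2] g3] g4] g5].
  case: (hnl e g1 g2) => [h|[h|/ltW //]]; first by rewrite h eqxx in g3.
  by rewrite h eqxx in g4.
move=> e he; have := edge_kind e; rewrite (negbTE he) /= => /orP[hd|/(deg3_angle hth) //].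
have h1 := hlt e hd; have [hd' _ _] := deg2_labels hd; have := hlt _ hd'.
by rewrite (deg2_angle th hd) => h2; apply/andP; split; lra.
Qed.

Lemma weight_label (theta : nat -> R) (wt : E -> R) e : wt_theta theta wt ->
  through_bw e (b e) -> through_wb e (w e) -> ~~ bnde e ->
  (-1) ^+ (b e < w e)%N * wt e = sin (theta (b e).+1 - theta (w e).+1).
Proof.
move=> /(_ e)[_ h] h1 h2 hb; rewrite (h hb _ _ h1 h2).
case: (ltnP (b e) (w e)) => hlt.
  by rewrite expr1 mulN1r -sinN opprB.
by rewrite expr0 mul1r.
Qed.

Lemma weight_gt0 (theta : nat -> R) (wt : E -> R) : wt_theta theta wt ->
  (forall e, through_bw e (b e) /\ through_wb e (w e)) ->
  (forall e, ~~ bnde e -> 0 < eangle (fun p => theta p.+1) e < pi) -> forall e, 0 < wt e.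
Proof.
move=> hwt hth hpos e; have [hb|hb] := boolP (bnde e); first by have [->] := hwt e.
have [h1 h2] := hth e; have := weight_label hwt h1 h2 hb.
have := sin_gt0_pi (hpos e hb); rewrite /eangle /label_angle.
case: (ltnP (b e) (w e)) => hlt; rewrite ?mulr1 ?mulr0 ?addr0 ?expr0 ?mul1r.
  by rewrite sinDpi expr1 mulN1r => h h'; rewrite -[wt e]opprK h'.
by move=> h ->.
Qed.

Lemma Delta_gt0 (wt : E -> R) : (forall e, 0 < wt e) ->
  exists2 A, @almost_perfect n G A & 0 < Delta wt (used_bnd A).
Proof.
move=> hwt; have [A hA] := exists_matching HG; exists A => //.
rewrite /Delta (bigD1 A) ?hA ?eqxx //=; apply: ltr_wpDr.
  by apply: sumr_ge0 => B _; apply: prodr_ge0 => e _; exact: ltW.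
by apply: prodr_gt0 => e _.
Qed.

End Angles.

Import numFieldNormedType.Exports.


Lemma pt_eq (R : realType) (x y : R * R) : x.1 = y.1 -> x.2 = y.2 -> x = y.
Proof. by case: x y => [a b] [c d] /= -> ->. Qed.

Ltac point_ring := apply: pt_eq; rewrite /padd /psub /pscale /=; ring.

Lemma det_neq0C (R : comRingType) (a1 a2 b1 b2 : R) : a1 * b2 - a2 * b1 != 0 -> b1 * a2 - b2 * a1 != 0.
Proof. by rewrite -oppr_eq0 opprB mulrC [a1 * b2]mulrC. Qed.

(** * Affine coordinates of a rhombus *)

Section TileCoordinates.
Variable R : realType.
Local Notation pt := (R * R)%type.

Definition side_dir (t : tile R) (c : bool) : pt := if c then tb t else ta t.
(** The flag [c] selects a pair of parallel sides; the coordinate is 0 on one of them and 1 on the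
    other. *)
Definition tcoord (t : tile R) (c : bool) (z : pt) : R :=
  pcross (side_dir t c) (psub z (tP t)) / pcross (side_dir t c) (side_dir t (~~ c)).
Definition tile_slope (t : tile R) (c : bool) (v : pt) : R :=
  pcross (side_dir t c) v / pcross (side_dir t c) (side_dir t (~~ c)).
(** Zero on the line of the side [(c, o)] and positive on the inner side of it; the four heights cut
    out the tile. *)
Definition side_height (t : tile R) (c o : bool) (z : pt) : R :=
  if o then 1 - tcoord t c z else tcoord t c z.
Definition side_org (t : tile R) (c o : bool) : pt :=
  if o then padd (tP t) (side_dir t (~~ c)) else tP t.
Definition tile_side (t : tile R) (c o : bool) : pt * pt :=
  (side_org t c o, padd (side_org t c o) (side_dir t c)).

Lemma tile_coord_shift t c z h v :
  tcoord t c (padd z (pscale h v)) = tcoord t c z + h * tile_slope t c v.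
Proof.
rewrite /tcoord /tile_slope [h * _]mulrA -mulrDl; congr (_ / _).
by rewrite /pcross /psub /padd /pscale /=; ring.
Qed.

Lemma rhombusP t z : pcross (ta t) (tb t) != 0 ->
  rhombus_set t z <-> forall c o, 0 <= side_height t c o z.
Proof.
case: t z => [[[p1 p2] [a1 a2]] [b1 b2]] [z1 z2].
rewrite /pcross /= => hD.
have hD' := det_neq0C hD.
have cf s u : tcoord ((p1, p2), (a1, a2), (b1, b2)) false (p1 + (s * a1 + u * b1), p2 + (s * a2 + u * b2)) = u.
  by rewrite /tcoord /pcross /psub /tP /ta /tb /=; field.
have ct s u : tcoord ((p1, p2), (a1, a2), (b1, b2)) true (p1 + (s * a1 + u * b1), p2 + (s * a2 + u * b2)) = s.
  by rewrite /tcoord /pcross /psub /tP /ta /tb /=; field.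
split=> [[s [u [hs [hu]]]]|h].
  rewrite /padd /pscale /tP /ta /tb /= => -[-> ->].
  by move=> [] []; rewrite /side_height ?cf ?ct ?subr_ge0; case/andP: hs; case/andP: hu.
set t := ((p1, p2), (a1, a2), (b1, b2)) in h cf ct *.
exists (tcoord t true (z1, z2)), (tcoord t false (z1, z2)); split; first last.
- split.
    have := h false false; have := h false true; rewrite /side_height subr_ge0 => -> ->; by [].
  by rewrite /padd /pscale /tcoord /pcross /psub /tP /ta /tb /=; congr (_, _); field; rewrite ?hD ?hD'.
- by have := h true false; have := h true true; rewrite /side_height subr_ge0 => -> ->.
Qed.

Lemma tile_coord_affine t c : exists A B C : R, forall z, tcoord t c z = A * z.1 + B * z.2 + C.
Proof.
set D := (pcross (side_dir t c) (side_dir t (~~ c)))^-1.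
exists (- (side_dir t c).2 * D), ((side_dir t c).1 * D),
  (((side_dir t c).2 * (tP t).1 - (side_dir t c).1 * (tP t).2) * D) => z.
by rewrite /tcoord -/D /pcross /psub /=; ring.
Qed.

Lemma affine_near (A B C : R) (z : pt) : 0 < A * z.1 + B * z.2 + C ->
  \forall y \near z, 0 < A * y.1 + B * y.2 + C.
Proof.
move=> h; have hc : ((fun y : pt => A * y.1 + B * y.2 + C) @ z --> A * z.1 + B * z.2 + C)%classic.
  apply: cvgD; last exact: cvg_cst.
  by apply: cvgD; apply: cvgMr; [exact: cvg_fst|exact: cvg_snd].
exact: (cvgr_gt _ hc).
Qed.

Lemma side_height_near t c o (z : pt) : 0 < side_height t c o z ->
  \forall y \near z, 0 < side_height t c o y.
Proof.
have [A [B [C h]]] := tile_coord_affine t c; rewrite /side_height; case: o.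
  rewrite h => h0; have h1 : 0 < (- A) * z.1 + (- B) * z.2 + (1 - C) by move: h0; rewrite !mulNr; lra.
  by apply: filterS (affine_near h1) => y; rewrite h !mulNr => h2; lra.
by rewrite h => h0; apply: filterS (affine_near h0) => y; rewrite h.
Qed.

Lemma tile_interior t (z : pt) : pcross (ta t) (tb t) != 0 ->
  (forall c o, 0 < side_height t c o z) -> interior (rhombus_set t) z.
Proof.
move=> hD h; have h4 : \forall y \near z, [/\ 0 < side_height t true true y, 0 < side_height t true false y,
    0 < side_height t false true y & 0 < side_height t false false y].
  by apply: filterS (filterI (filterI (side_height_near (h true true)) (side_height_near (h true false)))
    (filterI (side_height_near (h false true)) (side_height_near (h false false)))) => y [[h1 h2] [h3 h5]]; split.
apply: filterS h4 => y [h1 h2 h3 h5]; apply/rhombusP => // -[] []; exact: ltW.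
Qed.

Lemma tile_side_segment t c o z : pcross (ta t) (tb t) != 0 ->
  segment (tile_side t c o).1 (tile_side t c o).2 z ->
  side_height t c o z = 0 /\ 0 <= tcoord t (~~ c) z <= 1.
Proof.
case: t z => [[[p1 p2] [a1 a2]] [b1 b2]] z; rewrite /pcross /= => hD.
have hD' := det_neq0C hD.
move=> [s [hs ->]]; set t := ((p1, p2), (a1, a2), (b1, b2)).
have -> : tcoord t (~~ c) (padd (tile_side t c o).1 (pscale s (psub (tile_side t c o).2 (tile_side t c o).1))) = s.
  by case: c; case: o; rewrite /tile_side /tcoord /side_org /pcross /psub /padd /pscale /tP /ta /tb /=; field.
split=> //; rewrite /side_height.
by case: c; case: o; rewrite /tile_side /tcoord /side_org /pcross /psub /padd /pscale /tP /ta /tb /=; field.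
Qed.

Lemma side_point t c o z : pcross (ta t) (tb t) != 0 -> side_height t c o z = 0 ->
  z = padd (tile_side t c o).1 (pscale (tcoord t (~~ c) z) (psub (tile_side t c o).2 (tile_side t c o).1)).
Proof.
case: t z => [[[p1 p2] [a1 a2]] [b1 b2]] [z1 z2]; rewrite /ta /tb /pcross /= => hD.
have hD' := det_neq0C hD.
set tl := ((p1, p2), (a1, a2), (b1, b2)) => hz0.
have hco : tcoord tl c (z1, z2) = (o : nat)%:R.
  by move: hz0; rewrite /side_height; case: (o) => /= hz0; lra.
have hz : (z1, z2) = padd (p1, p2) (padd (pscale (tcoord tl true (z1, z2)) (a1, a2)) (pscale (tcoord tl false (z1, z2)) (b1, b2))).
  by apply: pt_eq; rewrite /tl /padd /pscale /tcoord /pcross /psub /tP /ta /tb /=; field; rewrite ?hD ?hD'.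
rewrite [LHS]hz /tile_side /side_org.
by case: c hco {hz0}; case: o => /=; move: (tcoord tl false (z1, z2)) (tcoord tl true (z1, z2)) => u1 u2 ->;
  apply: pt_eq; rewrite /padd /pscale /psub /tP /ta /tb /=; ring.
Qed.

Lemma ray_cvg (z e : pt) : ((fun y : R => padd z (pscale y e)) @ (0 : R)^'+ --> padd z (pscale 0 e))%classic.
Proof.
have h1 : ((fun y : R => z.1 + y * e.1) @ (0:R)^'+ --> z.1 + 0 * e.1)%classic.
  by apply: cvg_at_right_filter; apply: cvgD; [exact: cvg_cst|apply: cvgMl; exact: cvg_id].
have h2 : ((fun y : R => z.2 + y * e.2) @ (0:R)^'+ --> z.2 + 0 * e.2)%classic.
  by apply: cvg_at_right_filter; apply: cvgD; [exact: cvg_cst|apply: cvgMl; exact: cvg_id].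
exact: (cvg_pair h1 h2).
Qed.

Lemma ray_meets (U : set (R * R)) (z e : pt) (h : R) : 0 < h -> interior U z ->
  exists2 y, 0 < y < h & U (padd z (pscale y e)).
Proof.
move=> h0 hint; have hc := @ray_cvg z e.
have hz0 : padd z (pscale 0 e) = z by apply: pt_eq; rewrite /padd /pscale /= mul0r addr0.
rewrite hz0 in hc.
have hnear : \forall y \near ((0 : R)^'+)%classic, U (padd z (pscale y e)) := hc _ hint.
near ((0 : R)^'+)%classic => y; exists y; last by near: y.
apply/andP; split; first by near: y; exact: nbhs_right_gt.
by near: y; exact: nbhs_right_lt.
Unshelve. all: by end_near. Qed.

Lemma parallel_cross (s d e t : pt) : pcross s d = 0 -> pcross d e * pcross s t = pcross s e * pcross d t.
Proof.
case: s t d e => [s1 s2] [t1 t2] [d1 d2] [e1 e2]; rewrite /pcross /= => h; apply/eqP; rewrite -subr_eq0; apply/eqP.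
by transitivity ((s1 * d2 - s2 * d1) * (e2 * t1 - e1 * t2)); [ring|rewrite h mul0r].
Qed.

Lemma parallel_trans (s d u e : pt) : pcross u d = 0 -> pcross s d = 0 -> pcross d e != 0 -> pcross u s = 0.
Proof.
case: s d u e => [s1 s2] [d1 d2] [u1 u2] [e1 e2]; rewrite /pcross /= => a1 a2 a3.
apply: contrapT => /eqP hx; move/negP: a3; apply.
suff : (d1 == 0) && (d2 == 0) by move=> /andP[/eqP -> /eqP ->]; rewrite !mul0r subrr.
apply/andP; split; apply/eqP; apply: (mulfI hx); rewrite mulr0.
  by transitivity (s1 * (u1 * d2 - u2 * d1) - u1 * (s1 * d2 - s2 * d1)); [ring|rewrite a1 a2; ring].
by transitivity (s2 * (u1 * d2 - u2 * d1) - u2 * (s1 * d2 - s2 * d1)); [ring|rewrite a1 a2; ring].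
Qed.

Lemma parallel_both (d u e : pt) : pcross u d = 0 -> pcross u e = 0 -> pcross d e != 0 -> u = (0, 0).
Proof.
case: d u e => [d1 d2] [u1 u2] [e1 e2]; rewrite /pcross /= => a1 a2 a3; congr (_, _);
  apply: (mulfI a3); rewrite mulr0.
  by transitivity (d1 * (u1 * e2 - u2 * e1) - e1 * (u1 * d2 - u2 * d1)); [ring|rewrite a1 a2; ring].
by transitivity (d2 * (u1 * e2 - u2 * e1) - e2 * (u1 * d2 - u2 * d1)); [ring|rewrite a1 a2; ring].
Qed.

Lemma seg_eq_dir (s s' : pt * pt) : seg_eq s s' -> pcross (psub s.2 s.1) (psub s'.2 s'.1) = 0.
Proof. by rewrite /seg_eq => /orP[]/eqP -> /=; rewrite /pcross /psub /=; ring. Qed.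
Lemma tile_side_dir t c o : psub (tile_side t c o).2 (tile_side t c o).1 = side_dir t c.
Proof. by apply: pt_eq; rewrite /tile_side /psub /padd /=; ring. Qed.

Lemma seg_eq_segment (s s' : pt * pt) z : seg_eq s s' -> segment s.1 s.2 z -> segment s'.1 s'.2 z.
Proof.
rewrite /seg_eq => /orP[/eqP -> //|/eqP ->] /= [u [hu ->]].
exists (1 - u); split; first by apply/andP; split; case/andP: hu; lra.
by point_ring.
Qed.

Lemma seg_eq_sym (s s' : pt * pt) : seg_eq s s' = seg_eq s' s.
Proof.
rewrite /seg_eq; congr (_ || _); first exact: eq_sym.
by case: s s' => [x y] [x' y'] /=; apply/eqP/eqP => -[-> ->].
Qed.

Lemma opp_sidesP t (s s' : pt * pt) : opp_sides t s s' <->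
  exists c o, seg_eq s (tile_side t c o) /\ seg_eq s' (tile_side t c (~~ o)).
Proof.
have e1 : (corner0 t, corner1 t) = tile_side t false false by [].
have e2 : (corner3 t, corner2 t) = tile_side t false true.
  rewrite /tile_side /side_org /corner2 /corner3 /=; congr (_, _).
  by point_ring.
have e3 : (corner0 t, corner3 t) = tile_side t true false by [].
have e4 : (corner1 t, corner2 t) = tile_side t true true.
  rewrite /tile_side /side_org /corner2 /corner1 /=; congr (_, _).
  by point_ring.
rewrite /opp_sides e1 e2 e3 e4; split.
  by case/or4P => /andP[h1 h2]; [exists false, false|exists false, true|exists true, false|exists true, true].
by move=> [[] [[] [h1 h2]]]; rewrite h1 h2 ?orbT.
Qed.

Lemma avoid_finite (l : seq R) : exists2 x, 0 < x < 1 & x \notin l.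
Proof.
apply: contrapT => hn.
pose s := [seq (k.+2%:R : R)^-1 | k <- iota 0 (size l).+1].
have hu : uniq s.
  rewrite map_inj_uniq ?iota_uniq // => i j /invr_inj/eqP; rewrite eqr_nat => /eqP []. by [].
have hsub : {subset s <= l}.
  move=> x /mapP[k _ ->]; apply/negPn/negP => hx; apply: hn; exists (k.+2%:R^-1) => //.
  by rewrite invr_gt0 ltr0n /= invf_lt1 ?ltr0n // ltr1n.
by have := uniq_leq_size hu hsub; rewrite size_map size_iota ltnn.
Qed.

(** A step so short that no nonzero value in a finite list of affine functions changes sign along
    it. *)
Lemma small_step (l : seq (R * R)) : exists2 h : R, 0 < h < 1 & forall x, x \in l -> x.1 != 0 -> h * `|x.2| < `|x.1|.
Proof.
elim: l => [|[u v] l [h /andP[h0 h1] IH]]; first by exists (1 / 2) => //; apply/andP; split; lra.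
have [u0|u0] := eqVneq u 0.
  by exists h; rewrite ?h0 // => x; rewrite inE => /orP[/eqP ->|/IH //] /=; rewrite u0 eqxx.
have hu : 0 < `|u| by rewrite normr_gt0.
have hv : 0 <= `|v| by [].
pose h' := Num.min h (`|u| / (2 * (`|v| + 1))).
have hq : 0 < `|u| / (2 * (`|v| + 1)) by rewrite divr_gt0 // mulr_gt0 //; lra.
have h'h : h' <= h by rewrite /h' ge_min lexx.
have h'q : h' <= `|u| / (2 * (`|v| + 1)) by rewrite /h' ge_min lexx orbT.
have h'0 : 0 < h' by rewrite /h' lt_min h0.
exists h'; first by rewrite h'0 /=; lra.
move=> x; rewrite inE => /orP[/eqP -> _ /=|hx hx0].
  have : h' * (2 * (`|v| + 1)) <= `|u| by move: h'q; rewrite ler_pdivlMr //; lra.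
  nra.
apply: le_lt_trans (IH x hx hx0); exact: ler_wpM2r.
Qed.

End TileCoordinates.

(** * Every pair of opposite tile sides lies on a chain between boundary sides *)

Section TilingChains.
Variables (R : realType) (N : nat) (z0 : R * R) (v : nat -> R * R) (nT : nat).
Variables (tiles : 'I_nT -> tile R) (col : R * R -> bool) (tau : nat -> nat).
Hypotheses (HT : rhombus_tiling N z0 v tiles col) (Htau : is_pairing N z0 v tiles tau).
Local Notation ht i := (side_height (tiles i)).
Local Notation slope i := (tile_slope (tiles i)).
Local Notation sdir i := (side_dir (tiles i)).
Local Notation sorg i := (side_org (tiles i)).
Local Notation pt := (R * R)%type.

Lemma tile_cross i : pcross (ta (tiles i)) (tb (tiles i)) != 0.
Proof. by case: HT => _ _ _ _ [/(_ i)[_ [_ ->]]]. Qed.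
Lemma sdir_cross k c : pcross (sdir k c) (sdir k (~~ c)) != 0.
Proof. by have := tile_cross k; case: c => //=; exact: det_neq0C. Qed.

Lemma tiles_disjoint i j (z : pt) : (forall c o, 0 < ht i c o z) ->
  (forall c o, 0 < ht j c o z) -> i = j.
Proof.
move=> hi hj; apply: contrapT => /eqP hij; case: HT => _ _ _ _ [_ /(_ i j hij) h _ _ _].
have : (interior (rhombus_set (tiles i)) `&` interior (rhombus_set (tiles j)))%classic z.
  by split; apply: tile_interior => //; exact: tile_cross.
by rewrite h.
Qed.

Definition is_chain (p q m : nat) (tt : nat -> 'I_nT) (ss : nat -> pt * pt) :=
  [/\ (1 <= p <= 2 * N)%N /\ (1 <= q <= 2 * N)%N, ss 0%N = side z0 v p,
     forall i, (i < m)%N -> opp_sides (tiles (tt i)) (ss i) (ss i.+1),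
     forall i, (i.+1 < m)%N -> tt i != tt i.+1 & seg_eq (ss m) (side z0 v q)].

Definition on_side (i : 'I_nT) (c : bool) (s : pt * pt) := exists o, seg_eq s (tile_side (tiles i) c o).
(** The definition of a tiling does not say that tiles meet along whole sides, while chains do; this
    is why both directions of every tile must first be placed on a chain. *)
Definition in_chain (i : 'I_nT) (c : bool) := exists p q m tt ss r,
  [/\ is_chain p q m tt ss, (r < m)%N, tt r = i & on_side i c (ss r)].

Lemma pairing_chain p : (1 <= p <= 2 * N)%N -> exists m tt ss, is_chain p (tau p) m tt ss /\ (0 < m)%N.
Proof.
move=> hp; have [hq [m [tt [ss [h1 h2 h3 h4 h5]]]]] := Htau hp.
by exists m, tt, ss.
Qed.

Lemma boundary_side (z : pt) p : (1 <= p <= 2 * N)%N -> segment (side z0 v p).1 (side z0 v p).2 z ->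
  tboundary (\bigcup_(i in [set: 'I_nT]%classic) rhombus_set (tiles i))%classic z.
Proof. by move=> hp hz; case: HT => _ _ _ _ [_ _ -> _ _]; exists p. Qed.

Lemma opp_sides_on_side i s s' : opp_sides (tiles i) s s' ->
  exists c, on_side i c s /\ on_side i c s'.
Proof.
move=> /opp_sidesP [c [ o [h1 h2]]]; exists c; split; first by exists o.
by exists (~~ o).
Qed.

(* A point of a side with this property lies on no other line through a tile side, except parallel ones. *)
Definition generic_point (d z : pt) := forall (j : 'I_nT) c o,
  ht j c o z = 0 -> slope j c d = 0.

Lemma generic_exists (q d : pt) : exists2 x, 0 < x < 1 & generic_point d (padd q (pscale x d)).
Proof.
pose bad := [seq (if jco.2 then 1 - tcoord (tiles jco.1.1) jco.1.2 q else - tcoord (tiles jco.1.1) jco.1.2 q)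
   / tile_slope (tiles jco.1.1) jco.1.2 d | jco : ('I_nT * bool) * bool].
have [x hx hb] := avoid_finite bad; exists x => // j c o h0.
apply: contrapT => /eqP hs; move/negP: hb; apply; apply/mapP; exists ((j, c), o); first by rewrite mem_enum.
apply: (mulIf hs); rewrite /= divfK //; move: h0; rewrite /side_height tile_coord_shift.
by case: o => /= h0; lra.
Qed.

Lemma slope_zero_cross j c (d : pt) : slope j c d = 0 -> pcross (sdir j c) d = 0.
Proof.
rewrite /tile_slope => /eqP; rewrite mulf_eq0 invr_eq0 => /orP[/eqP //|].
have := tile_cross j; case: c => /=; last by move=> /negbTE ->.
have -> : pcross (tb (tiles j)) (ta (tiles j)) = - pcross (ta (tiles j)) (tb (tiles j)).
  by rewrite /pcross; ring.
by rewrite oppr_eq0 => /negbTE ->.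
Qed.

Lemma cross_both_zero j (d : pt) : pcross (ta (tiles j)) d = 0 -> pcross (tb (tiles j)) d = 0 -> d = (0, 0).
Proof.
have := tile_cross j; case: (ta (tiles j)) (tb (tiles j)) d => [a1 a2] [b1 b2] [d1 d2].
rewrite /pcross /= => hD h1 h2; congr (_, _); apply: (mulfI hD); rewrite mulr0.
  by transitivity (b1 * (a1 * d2 - a2 * d1) - a1 * (b1 * d2 - b2 * d1)); [ring|rewrite h1 h2; ring].
by transitivity (b2 * (a1 * d2 - a2 * d1) - a2 * (b1 * d2 - b2 * d1)); [ring|rewrite h1 h2; ring].
Qed.

Section GenericSide.
Variables (d e z : pt) (h : R).
Hypotheses (Hd : d <> (0, 0)) (Hde : pcross d e != 0) (Hgen : generic_point d z).
Hypotheses (Hh : 0 < h < 1).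
Hypothesis Hstep : forall j c o, ht j c o z != 0 ->
  h * `|slope j c e| < `|ht j c o z|.

Let zs (x : R) := padd z (pscale x e).
Lemma height_zs j c o x :
  ht j c o (zs x) = ht j c o z + x * (if o then - slope j c e else slope j c e).
Proof. by rewrite /side_height /zs tile_coord_shift; case: o => //; ring. Qed.

Lemma height_sign j c o x : ht j c o z != 0 -> `|x| <= h ->
  (0 < ht j c o (zs x)) = (0 < ht j c o z) /\
  ht j c o (zs x) != 0.
Proof.
move=> h0 hx; rewrite height_zs; set k := if o then _ else _.
have hk : `|x * k| < `|ht j c o z|.
  apply: le_lt_trans (Hstep h0); rewrite normrM /k; case: (o); rewrite ?normrN; exact: ler_wpM2r.
move: h0 hk; move: (side_height _ _ _ _) (x * k) => s y.
case: (ltrgtP s 0) => // hs _; rewrite ?(gtr0_norm hs) ?(ltr0_norm hs) ltr_norml => /andP[h1 h2].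
  by split; [apply/negbTE; rewrite -leNgt; lra|rewrite lt_eqF //; lra].
by split; [lra|rewrite gt_eqF //; lra].
Qed.

Lemma cross_d_e j c : slope j c d = 0 -> slope j c e != 0.
Proof.
move=> h1; apply/negP => /eqP h2; have k1 := slope_zero_cross h1; have k2 := slope_zero_cross h2.
move: Hde; suff -> : pcross d e = 0 by rewrite eqxx.
have hs : sdir j c <> (0, 0).
  move=> h3; have := tile_cross j; rewrite /pcross; case: (c) h3 => /= ->; rewrite /= ?mulr0 ?mul0r subrr eqxx //.
move: k1 k2 hs; case: (side_dir _ _) d e => [x1 x2] [d1 d2] [e1 e2]; rewrite /pcross /= => k1 k2 hs.
apply: contrapT => /eqP hx; apply: hs; congr (_, _); apply: (mulfI hx); rewrite mulr0.
  by transitivity (d1 * (x1 * e2 - x2 * e1) - e1 * (x1 * d2 - x2 * d1)); [ring|rewrite k1 k2; ring].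
by transitivity (d2 * (x1 * e2 - x2 * e1) - e2 * (x1 * d2 - x2 * d1)); [ring|rewrite k1 k2; ring].
Qed.

Lemma height_nonzero j c o x : x != 0 -> `|x| <= h -> ht j c o (zs x) != 0.
Proof.
move=> hx0 hx; have [h0|h0] := eqVneq (ht j c o z) 0; last by have [] := height_sign h0 hx.
rewrite height_zs h0 add0r mulf_neq0 //.
by case: (o); rewrite ?oppr_eq0; apply: cross_d_e; exact: (Hgen h0).
Qed.

Lemma zero_unique j c o c' o' : ht j c o z = 0 -> ht j c' o' z = 0 ->
  c = c' /\ o = o'.
Proof.
move=> h1 h2; have hc : c = c'.
  apply: contrapT => hc; apply: Hd; have k1 := slope_zero_cross (Hgen h1); have k2 := slope_zero_cross (Hgen h2).
  by apply: (cross_both_zero (j := j)); case: c c' hc k1 k2 {h1 h2} => [] [].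
split=> //; rewrite -hc /side_height in h1 h2; case: o o' h1 h2 => [] [] // h1 h2; exfalso; lra.
Qed.

(** Near a generic point of a side the tile fills one of the two half-disks, so it contains one of
    the two nearby points on a transversal. *)
Lemma side_either j c o : ht j c o z = 0 -> 0 <= tcoord (tiles j) (~~ c) z <= 1 ->
  (forall c' o', 0 < ht j c' o' (zs h)) \/ (forall c' o', 0 < ht j c' o' (zs (- h))).
Proof.
move=> h0 /andP[h1 h2]; have /andP[hh _] := Hh; have hn : `|h| <= h by rewrite gtr0_norm.
have hn' : `|- h| <= h by rewrite normrN.
have hoth c' o' : (c', o') != (c, o) -> 0 < ht j c' o' z.
  move=> hne; have hne0 : ht j c' o' z != 0.
    by apply/negP => /eqP h3; have [h4 h5] := zero_unique h0 h3; move/negP: hne; rewrite h4 h5 eqxx.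
  rewrite lt_neqAle eq_sym hne0 /=; have [hc|hc] := eqVneq c' c.
    have ho : o' = ~~ o by move: hne; rewrite hc xpair_eqE eqxx /=; case: (o) (o') => [] [].
    by move: h0; rewrite /side_height hc ho; case: (o) => /= h0; lra.
  have -> : c' = ~~ c by move: hc; case: (c) (c') => [] [].
  by rewrite /side_height; case: (o'); lra.
have hk : (if o then - slope j c e else slope j c e) != 0.
  by case: (o); rewrite ?oppr_eq0; apply: cross_d_e; exact: (Hgen h0).
have hgo x : `|x| <= h -> 0 < x * (if o then - slope j c e else slope j c e) ->
    forall c' o', 0 < ht j c' o' (zs x).
  move=> hx hxk c' o'; have [[-> ->]|hne] := eqVneq (c', o') (c, o); first by rewrite height_zs h0 add0r.
  have h3 := hoth _ _ hne; have [-> _] := height_sign (lt0r_neq0 h3) hx; exact: h3.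
move: hk hgo; set k := if o then _ else _; case: (ltrgtP k 0) => // hk _ hgo.
  by right; apply: hgo => //; rewrite nmulr_lgt0 // oppr_lt0.
by left; apply: hgo => //; rewrite mulr_gt0.
Qed.

End GenericSide.
Lemma seg_eq_trans (s1 s2 s3 : pt * pt) : seg_eq s1 s2 -> seg_eq s2 s3 -> seg_eq s1 s3.
Proof.
rewrite /seg_eq => /orP[]/eqP -> /orP[]/eqP ->; rewrite ?eqxx ?orbT //=.
by case: s3 => x y /=; rewrite eqxx.
Qed.

Lemma side_on_tile i c s z : on_side i c s -> segment s.1 s.2 z ->
  exists o, [/\ ht i c o z = 0, 0 <= tcoord (tiles i) (~~ c) z <= 1 & seg_eq s (tile_side (tiles i) c o)].
Proof.
move=> [ o hs] hz; have [h1 h2] := tile_side_segment (tile_cross i) (seg_eq_segment hs hz).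
by exists o.
Qed.

Lemma on_side_class j c c' s : on_side j c s -> on_side j c' s -> c = c'.
Proof.
move=> [ o h1] [ o' h2]; have h : seg_eq (tile_side (tiles j) c o) (tile_side (tiles j) c' o').
  by apply: seg_eq_trans h2; rewrite seg_eq_sym.
have := seg_eq_dir h; rewrite !tile_side_dir; have := tile_cross j.
case: c c' {h h1 h2} => [] [] //= h1 h2; move/negP: h1; case; apply/eqP=> //.
by rewrite -[RHS]oppr0 -h2 /pcross; ring.
Qed.

Section UnchainedSide.
(* [i] is a tile whose sides of class [c] lie on no chain, the highest one in the direction [e]. *)
Variables (i : 'I_nT) (c o : bool) (d e : pt).
Hypothesis Hdir : d = sdir i c.
Hypothesis He : e = if o then sdir i (~~ c) else pscale (-1) (sdir i (~~ c)).
Hypothesis Hno : ~ in_chain i c.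
Hypothesis Htop : forall j c', pcross (sdir j c') d = 0 ->
  (exists o', pcross d (psub (sorg j c' o') (sorg i c o)) * pcross d e > 0) -> in_chain j c'.

Lemma unchained_dir_neq0 : d <> (0, 0).
Proof.
by rewrite Hdir => h3; have := tile_cross i; rewrite /pcross; case: (c) h3 => /= ->; rewrite /= ?mulr0 ?mul0r subrr eqxx.
Qed.

Lemma unchained_cross_neq0 : pcross d e != 0.
Proof.
have h := tile_cross i; rewrite Hdir He; move: h; case: (tiles i) => [[p [a1 a2]] [b1 b2]].
rewrite /ta /tb /pcross /=; case: (c); case: (o) => /= h; apply: contra h => /eqP h; apply/eqP.
- by rewrite -[RHS]oppr0 -h; ring.
- by rewrite -h; ring.
- by rewrite -h; ring.
- by rewrite -[RHS]oppr0 -h; ring.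
Qed.

(** A generic point of the highest side is pushed outwards. If it leaves the region, the side is on
    the boundary and the chain starting there uses [i]. If it enters a tile [j], that tile has a
    higher parallel side and lies on a chain by [Htop], and this chain continues through the common
    point into [i]. *)
Lemma unchained_absurd : False.
Proof.
have hd := unchained_dir_neq0; have hde := unchained_cross_neq0.
have [x hx hgen] := generic_exists (sorg i c o) d.
set z := padd _ _ in hgen.
pose l := [seq (side_height (tiles jco.1.1) jco.1.2 jco.2 z, tile_slope (tiles jco.1.1) jco.1.2 e) | jco : ('I_nT * bool) * bool].
have [h hh hl] := small_step l; have /andP[hh0 hh1] := hh.
have hstep j c' o' : ht j c' o' z != 0 ->
    h * `|slope j c' e| < `|ht j c' o' z|.
  move=> hne; apply: (hl (ht j c' o' z, slope j c' e)) => //.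
  by apply/mapP; exists ((j, c'), o'); rewrite ?mem_enum.
have hn : `|h| <= h by rewrite gtr0_norm.
have hn' : `|- h| <= h by rewrite normrN.
have hzi : ht i c o z = 0 /\ 0 <= tcoord (tiles i) (~~ c) z <= 1.
  apply: (tile_side_segment (tile_cross i)); exists x; split; first by case/andP: hx => /ltW -> /ltW ->.
  by rewrite /z /tile_side Hdir /=; point_ring.
have [hzi0 hzi1] := hzi.
have hslope : (if o then - slope i c e else slope i c e) = -1.
  rewrite He /tile_slope; have := tile_cross i; case: (tiles i) => [[p [a1 a2]] [b1 b2]].
  rewrite /ta /tb /pcross /= => hD.
  have hD' := det_neq0C hD.
  by case: (c); case: (o) => /=; field.
have hmin : forall c' o', 0 < ht i c' o' (padd z (pscale (- h) e)).
  case: (side_either hd hde hgen hh hstep hzi0 hzi1) => // hp.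
  by have := hp c o; rewrite height_zs hzi0 hslope add0r mulrN1 oppr_gt0 ltNge ltW.
have hiplus : ~ rhombus_set (tiles i) (padd z (pscale h e)).
  move/(rhombusP _ (tile_cross i))/(_ c o); rewrite height_zs hzi0 hslope add0r mulrN1 oppr_ge0.
  by rewrite leNgt hh0.
have hzU : rhombus_set (tiles i) z.
  apply/(rhombusP _ (tile_cross i)) => c' o'; have [hc|hc] := eqVneq c' c.
    rewrite hc; have [->|ho] := eqVneq o' o; first by rewrite hzi0.
    by move: hzi0 ho; rewrite /side_height; case: (o) (o') => [] [] //= h3 _; lra.
  have -> : c' = ~~ c by move: hc; case: (c) (c') => [] [].
  by rewrite /side_height; case/andP: hzi1 => k1 k2; case: (o'); lra.
have hself j c' s : on_side j c' s -> segment s.1 s.2 z ->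
    ~ (forall c'' o'', 0 < ht j c'' o'' (padd z (pscale h e))) -> j = i /\ c' = c.
  move=> hs hz hnp; have [ o' [h1 h2 h3]] := side_on_tile hs hz.
  have hji : j = i.
    case: (side_either hd hde hgen hh hstep h1 h2) => // hm; exact: tiles_disjoint hm hmin.
  split=> //; rewrite hji in h1; by have [] := zero_unique hd hgen h1 hzi0.
have [[j hj]|hnone] := pselect (exists j, rhombus_set (tiles j) (padd z (pscale h e))); last first.
  (* By the choice of [h], a tile containing a nearer point of the ray would also contain the pushed
     point; hence [z] is not interior. *)
  have hbd : tboundary (\bigcup_(k in [set: 'I_nT]%classic) rhombus_set (tiles k))%classic z.
    split; first by apply: subset_closure; exists i.
    move=> hint; have [y /andP[hy2 hy1] [k _ hk]] := ray_meets e hh0 hint.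
    apply: hnone; exists k; apply/(rhombusP _ (tile_cross k)) => c' o'.
    have hk0 := (rhombusP _ (tile_cross k)).1 hk c' o'.
    have hyn : `|y| <= h by rewrite gtr0_norm // ltW.
    have [hz|hz] := eqVneq (ht k c' o' z) 0.
      move: hk0; rewrite height_zs hz add0r pmulr_rge0 // => hk0.
      by rewrite height_zs hz add0r mulr_ge0 // ltW.
    have [h1 h2] := height_sign hstep hz hyn; have [h3 h4] := height_sign hstep hz hn.
    by apply: ltW; rewrite h3 -h1 lt_neqAle eq_sym h2.
  have [p hp hpz] : exists2 p, (1 <= p <= 2 * N)%N & segment (side z0 v p).1 (side z0 v p).2 z.
    by move: hbd; case: HT => _ _ _ _ [_ _ -> _ _] [p hp hz]; exists p.
  have [m [tt [ss [hch hm]]]] := pairing_chain hp; have [_ hs0 hopp _ _] := hch.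
  have [c' [hc1 _]] := opp_sides_on_side (hopp 0%N hm).
  have hz1 : segment (ss 0%N).1 (ss 0%N).2 z by rewrite hs0.
  have hnp : ~ (forall c'' o'', 0 < side_height (tiles (tt 0%N)) c'' o'' (padd z (pscale h e))).
    by move=> hp'; apply: hnone; exists (tt 0%N); apply/(rhombusP _ (tile_cross _)) => c'' o''; exact: ltW.
  have [h1 h2] := hself _ _ _ hc1 hz1 hnp.
  apply: Hno; exists p, (tau p), m, tt, ss, 0%N; split=> //.
  by rewrite -h2 -h1.
have hjpos c' o' : 0 < ht j c' o' (padd z (pscale h e)).
  have hne : ht j c' o' (padd z (pscale h e)) != 0.
    by apply: (height_nonzero hde hgen hstep) => //; rewrite gt_eqF.
  rewrite lt_neqAle eq_sym hne /=.
  exact: ((rhombusP _ (tile_cross j)).1 hj).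
have hji : j <> i.
  by move=> h1; apply: hiplus; rewrite -h1.
have [c' [ o' hz0]] : exists c' o', ht j c' o' z = 0.
  apply: contrapT => hno'; apply: hji; apply: tiles_disjoint hmin => c' o'.
  have hne : ht j c' o' z != 0 by apply/eqP => h1; apply: hno'; exists c', o'.
  have [h1 _] := height_sign hstep hne hn; have [h2 _] := height_sign hstep hne hn'.
  by rewrite h2 -h1.
have hjo : 0 <= tcoord (tiles j) (~~ c') z <= 1.
  have hnz o'' : ht j (~~ c') o'' z != 0.
    by apply/eqP => h1; have [h2 _] := zero_unique hd hgen hz0 h1; case: (c') h2.
  have [h1 h2] := height_sign hstep (hnz false) hn; have [h3 h4] := height_sign hstep (hnz true) hn.
  have k1 := hjpos (~~ c') false; have k2 := hjpos (~~ c') true.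
  by move: k1 k2; rewrite h1 h3 /side_height => k1 k2; apply/andP; split; lra.
have hzS : segment (tile_side (tiles j) c' o').1 (tile_side (tiles j) c' o').2 z.
  exists (tcoord (tiles j) (~~ c') z); split=> //.
  exact: (side_point (tile_cross j) hz0).
have hpar : pcross (sdir j c') d = 0 by exact: (slope_zero_cross (hgen _ _ _ hz0)).
(* The tiles [i] and [j], on the two sides of the line, together cover a neighbourhood of [z]. *)
have hzint : ~ tboundary (\bigcup_(k in [set: 'I_nT]%classic) rhombus_set (tiles k))%classic z.
  move=> [_]; apply.
  have hothers (k : 'I_nT) ck ok : ht k ck ok z = 0 -> 0 <= tcoord (tiles k) (~~ ck) z <= 1 ->
     \forall y \near z, forall c'' o'', (c'', o'') != (ck, ok) -> 0 < ht k c'' o'' y.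
    move=> hk0 /andP[hk1 hk2].
    have hp c'' o'' : (c'', o'') != (ck, ok) -> 0 < ht k c'' o'' z.
      move=> hne; have hne0 : ht k c'' o'' z != 0.
        by apply/negP => /eqP h3; have [h4 h5] := zero_unique hd hgen hk0 h3; move/negP: hne; rewrite h4 h5 eqxx.
      rewrite lt_neqAle eq_sym hne0 /=; have [hc|hc] := eqVneq c'' ck.
        have ho : o'' = ~~ ok by move: hne; rewrite hc xpair_eqE eqxx /=; case: (ok) (o'') => [] [].
        by move: hk0; rewrite /side_height hc ho; case: (ok) => /= hk0; lra.
      have -> : c'' = ~~ ck by move: hc; case: (ck) (c'') => [] [].
      by rewrite /side_height; case: (o''); lra.
    have hpn c'' o'' : \forall y \near z, (c'', o'') != (ck, ok) -> 0 < ht k c'' o'' y.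
      have [h1|h1] := boolP ((c'', o'') != (ck, ok)); last first.
        by apply: filterS (filterT : nbhs z setT) => y _.
      by apply: filterS (side_height_near (hp _ _ h1)).
    by apply: filterS (filterI (filterI (hpn true true) (hpn true false)) (filterI (hpn false true) (hpn false false)))
      => y [[h1 h2] [h3 h5]] [] [].
  apply: filterS (filterI (hothers i c o hzi0 hzi1) (hothers j c' o' hz0 hjo)) => y [hyi hyj].
  have hslj := hjpos c' o'; rewrite height_zs hz0 add0r pmulr_rgt0 // in hslj.
  have hval (k : 'I_nT) ck ok : ht k ck ok z = 0 ->
     pcross d e * ht k ck ok y = (if ok then - slope k ck e else slope k ck e) * pcross d (psub y z).
    move=> hk0; have hkp := slope_zero_cross (hgen _ _ _ hk0); move: hk0 hkp.
    have hDk := sdir_cross k ck.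
    have -> : ht k ck ok y = ht k ck ok z + (if ok then - slope k ck (psub y z) else slope k ck (psub y z)).
      have -> : y = padd z (pscale 1 (psub y z)) by point_ring.
      rewrite height_zs; congr (_ + _); have -> : psub (padd z (pscale 1 (psub y z))) z = psub y z by point_ring.
      by case: (ok); ring.
    move=> -> hkp; rewrite add0r /tile_slope.
    have hmain : pcross d e * pcross (sdir k ck) (psub y z) = pcross (sdir k ck) e * pcross d (psub y z).
      exact: parallel_cross.
    case: (ok); rewrite ?mulNr ?mulrN; [congr (- _)|]; rewrite mulrA hmain mulrAC //.
  have [hle|hlt] := leP (pcross d (psub y z) * pcross d e) 0.
    exists i => //; apply/(rhombusP _ (tile_cross i)) => c'' o''.
    have [[-> ->]|hne] := eqVneq (c'', o'') (c, o); last exact: ltW (hyi _ _ hne).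
    have := hval i c o hzi0; rewrite hslope mulN1r => hv.
    have hsq : 0 < pcross d e * pcross d e by rewrite -expr2 exprn_even_gt0.
    have : 0 <= (pcross d e * pcross d e) * ht i c o y by rewrite -mulrA hv mulrN mulrC oppr_ge0.
    by rewrite pmulr_rge0.
  exists j => //; apply/(rhombusP _ (tile_cross j)) => c'' o''.
  have [[-> ->]|hne] := eqVneq (c'', o'') (c', o'); last exact: ltW (hyj _ _ hne).
  have hv := hval j c' o' hz0.
  have hsq : 0 < pcross d e * pcross d e by rewrite -expr2 exprn_even_gt0.
  have : 0 <= (pcross d e * pcross d e) * ht j c' o' y by rewrite -mulrA hv mulrCA mulr_ge0 // ?ltW // mulrC.
  by rewrite pmulr_rge0.
have hbdy s q : (1 <= q <= 2 * N)%N -> seg_eq s (side z0 v q) -> segment s.1 s.2 z -> False.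
  by move=> hq hs hz; apply: hzint; apply: (boundary_side hq); apply: seg_eq_segment hs hz.
have [p [q [m [tt [ss [r [hch hr hrj hon]]]]]]] : in_chain j c'.
  apply: (Htop hpar); exists (~~ o').
  have hpz : pcross d (psub (sorg j c' o') (sorg i c o)) = 0.
    move: hzS => [y [_]]; rewrite /z; move: hpar; rewrite /tile_side /=.
    move: (sorg j c' o') (sorg i c o) (sdir j c') d => [q1 q2] [r1 r2] [s1 s2] [d1 d2].
    rewrite /pcross /padd /psub /pscale /= => hsd [e1 e2].
    have f1 : q1 - r1 = x * d1 - y * s1 by lra.
    have f2 : q2 - r2 = x * d2 - y * s2 by lra.
    rewrite f1 f2; transitivity (y * (s1 * d2 - s2 * d1)); first by ring.
    by rewrite hsd mulr0.
  have hsl := hjpos c' o'; rewrite height_zs hz0 add0r pmulr_rgt0 // in hsl.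
  have -> : psub (sorg j c' (~~ o')) (sorg i c o) =
     padd (psub (sorg j c' o') (sorg i c o)) (pscale (if o' then -1 else 1) (sdir j (~~ c'))).
    by case: (o'); rewrite /side_org; apply: pt_eq; rewrite /padd /psub /pscale /=; ring.
  have -> : forall u w : pt, pcross d (padd u w) = pcross d u + pcross d w.
    by move=> u w; rewrite /pcross /padd /=; ring.
  rewrite hpz add0r; move: hsl hpar; rewrite /tile_slope.
  have hDk := sdir_cross j c'.
  move: hDk; move: (sdir j c') (sdir j (~~ c')) => s t hDk hsl hpar'.
  have hsq : 0 < pcross s t * pcross s t by rewrite -expr2 exprn_even_gt0.
  have hkey : pcross d (pscale (if o' then -1 else 1) t) * pcross d e * (pcross s t * pcross s t)  =
     (if o' then - (pcross s e / pcross s t) else pcross s e / pcross s t) * (pcross d t * pcross d t) * (pcross s t * pcross s t).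
    have hk2 : pcross d e * pcross s t = pcross s e * pcross d t.
      exact: parallel_cross.
    have -> : pcross d (pscale (if o' then -1 else 1) t) = (if o' then -1 else 1) * pcross d t.
      by rewrite /pcross /pscale /=; ring.
    transitivity ((if o' then -1 else 1) * pcross d t * (pcross d e * pcross s t) * pcross s t); first by ring.
    rewrite hk2; case: (o'); first by field.
    by field.
  rewrite -(pmulr_lgt0 _ hsq) hkey mulrC pmulr_rgt0 // mulr_gt0 // -expr2 exprn_even_gt0 //.
  apply/negP => /eqP h0; have hdd : pcross d e * pcross s t = 0.
    rewrite (parallel_cross _ _ hpar').
    by rewrite h0 mulr0.
  by move/eqP: hdd; rewrite mulf_eq0 (negbTE hde) (negbTE hDk).
have [[hp hq] hs0 hopp hnext hend] := hch.
have hnotplus k : k <> j -> ~ (forall c'' o'', 0 < ht k c'' o'' (padd z (pscale h e))).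
  by move=> hk hpk; apply: hk; exact: tiles_disjoint hpk hjpos.
have [c1 [ o1 [k1 k2]]] := (opp_sidesP _ _ _).1 (hopp r hr); rewrite hrj in k1 k2.
have hcc : c1 = c' by exact: on_side_class (ex_intro _ o1 k1) hon.
rewrite {c1}hcc in k1 k2.
(* The chain meets the common side at [ss r] or at [ss r.+1]; in both cases the neighbouring tile in
   the chain can only be [i]. *)
have [ho|ho] := eqVneq o1 o'.
  rewrite ho in k1; have hzr : segment (ss r).1 (ss r).2 z by apply: seg_eq_segment hzS; rewrite seg_eq_sym.
  case: r hr hrj hon k1 k2 hzr => [|r'] hr hrj hon k1 k2 hzr.
    by apply: (hbdy _ _ hp _ hzr); rewrite hs0 /seg_eq eqxx.
  have [c2 [q1 q2]] := opp_sides_on_side (hopp r' (ltnW hr)).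
  have hne : tt r' <> j by move=> h1; have := hnext r' hr; rewrite hrj h1 eqxx.
  have [h1 h2] := hself _ _ _ q2 hzr (hnotplus _ hne).
  by apply: Hno; exists p, q, m, tt, ss, r'; split=> //; [exact: ltnW|rewrite -h1 -h2].
have ho2 : ~~ o1 = o' by move: ho; case: (o1) (o') => [] [].
rewrite ho2 in k2; have hzr : segment (ss r.+1).1 (ss r.+1).2 z by apply: seg_eq_segment hzS; rewrite seg_eq_sym.
have [hm|hm] := eqVneq r.+1 m; first by apply: (hbdy _ _ hq _ hzr); rewrite hm.
have hr1 : (r.+1 < m)%N by rewrite ltn_neqAle hm.
have [c2 [q1 q2]] := opp_sides_on_side (hopp r.+1 hr1).
have hne : tt r.+1 <> j by move=> h1; have := hnext r hr1; rewrite hrj h1 eqxx.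
have [h1 h2] := hself _ _ _ q1 hzr (hnotplus _ hne).
by apply: Hno; exists p, q, m, tt, ss, r.+1; split=> //; rewrite -h1 -h2.
Qed.

End UnchainedSide.

(** Among the finitely many unchained sides parallel to a given one there is a highest, which
    contradicts [unchained_absurd]. *)
Theorem all_in_chain i c : in_chain i c.
Proof.
apply: contrapT => Hno; set d0 := sdir i c.
have hd0 : d0 <> (0, 0) by exact: (unchained_dir_neq0 (erefl d0)).
pose B (x : ('I_nT * bool) * bool) := `[< ~ in_chain x.1.1 x.1.2 /\ pcross d0 (side_dir (tiles x.1.1) x.1.2) = 0 >].
pose H (x : ('I_nT * bool) * bool) : R := pcross d0 (side_org (tiles x.1.1) x.1.2 x.2).
have hB0 : B ((i, c), true) by apply/asboolP; split=> //=; rewrite -/d0 /pcross; ring.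
case: (arg_maxP H hB0) => -[[j k] o] /asboolP /= [hno hpar] hmax.
set d := sdir j k in hpar.
set e := if o then sdir j (~~ k) else pscale (-1) (sdir j (~~ k)).
have hde := unchained_cross_neq0 (erefl d) (erefl e).
apply: (unchained_absurd (erefl d) (erefl e) hno) => j' k' hpar' [ o' ho'].
apply: contrapT => hno'.
have hB' : B ((j', k'), o').
  by apply/asboolP; split=> //=; exact: (parallel_trans hpar hpar' hde).
have hB1 : B ((j, k), ~~ o) by apply/asboolP.
have h1 := hmax _ hB'; have h2 := hmax _ hB1; rewrite /H /= in h1 h2.
have he0 : 0 <= pcross d0 e.
  have -> : pcross d0 e = pcross d0 (sorg j k o) - pcross d0 (sorg j k (~~ o)).
    by rewrite /e /side_org; case: (o); rewrite /pcross /padd /pscale /=; ring.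
  by rewrite subr_ge0.
have hD0 : pcross d0 (psub (side_org (tiles j') k' o') (sorg j k o)) <= 0.
  have -> : pcross d0 (psub (side_org (tiles j') k' o') (sorg j k o)) =
    pcross d0 (side_org (tiles j') k' o') - pcross d0 (sorg j k o).
    by rewrite /pcross /psub /=; ring.
  by rewrite subr_le0.
have hid := parallel_cross e (psub (side_org (tiles j') k' o') (sorg j k o)) hpar.
have hB00 : pcross d0 e != 0.
  by apply/negP => /eqP h3; apply: hd0; exact: (parallel_both hpar h3 hde).
have hB0p : 0 < pcross d0 e by rewrite lt_neqAle eq_sym hB00.
move: ho' hid hD0 hB0p; rewrite -/d.
move: (pcross d _) (pcross d e) (pcross d0 _) (pcross d0 e) => A Bq A0 B0 hAB hid hA0 hB0p.
have h5 : A * Bq * B0 = A0 * Bq ^+ 2 by rewrite -mulrA [Bq * B0]mulrC mulrA mulrC [A * B0]mulrC -hid; ring.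
have h6 : 0 < A * Bq * B0 by exact: mulr_gt0.
have : A0 * Bq ^+ 2 <= 0 by rewrite mulr_le0_ge0 // sqr_ge0.
by rewrite -h5 leNgt h6.
Qed.

End TilingChains.

(** * Oriented tile sides and their gluing *)

Section TileDarts.
Variables (R : realType) (N : nat) (z0 : R * R) (v : nat -> R * R) (nT : nat).
Variables (tiles : 'I_nT -> tile R) (col : R * R -> bool) (tau : nat -> nat).
Hypotheses (HT : rhombus_tiling N z0 v tiles col) (Htau : is_pairing N z0 v tiles tau).
Local Notation pt := (R * R)%type.

(* The dart (i, (c, o)) is the side (c, o) of the tile i, directed so that the tile lies on its left. *)
Definition tdart := ('I_nT * (bool * bool))%type.
Definition ccw (i : 'I_nT) := 0 < pcross (ta (tiles i)) (tb (tiles i)).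
Definition forward (d : tdart) := (d.2.2 == d.2.1) == ccw d.1.
Definition tdir (d : tdart) : pt :=
  let u := side_dir (tiles d.1) d.2.1 in if forward d then u else pscale (-1) u.
Definition tends (d : tdart) := tile_side (tiles d.1) d.2.1 d.2.2.
Definition tfrom (d : tdart) : pt := if forward d then (tends d).1 else (tends d).2.
Definition tto (d : tdart) : pt := if forward d then (tends d).2 else (tends d).1.
Definition topp (d : tdart) : tdart := (d.1, (d.2.1, ~~ d.2.2)).
(** The case split on [ccw] makes this the next side counterclockwise, since the code [(c, o)] of a
    side depends on the orientation of the pair [ta], [tb]. *)
Definition tnext (d : tdart) : tdart :=
  (d.1, (~~ d.2.1, if d.2.1 == ccw d.1 then d.2.2 else ~~ d.2.2)).
Definition tarea (i : 'I_nT) : R := `|pcross (ta (tiles i)) (tb (tiles i))|.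

Lemma toppK : involutive topp.
Proof. by move=> [i [c o]]; rewrite /topp /= negbK. Qed.
Lemma forward_topp d : forward (topp d) = ~~ forward d.
Proof. by case: d => i [[] []]; rewrite /forward /=; case: ccw. Qed.
Lemma tnext2 d : tnext (tnext d) = topp d.
Proof. by case: d => i [[] []]; rewrite /tnext /topp /=; case: ccw. Qed.
Lemma tnext_topp d : tnext (topp d) = topp (tnext d).
Proof. by rewrite -!tnext2. Qed.
Lemma tnext_inj : injective tnext.
Proof. by move=> d d' /(congr1 (fun x => topp (tnext x))); rewrite !tnext2 !toppK. Qed.
Lemma tto_dir d : tto d = padd (tfrom d) (tdir d).
Proof.
rewrite /tto /tfrom /tdir /tends /tile_side; case: forward => //=.
by point_ring.
Qed.

Lemma tdir_topp d : tdir (topp d) = pscale (-1) (tdir d).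
Proof.
by rewrite /tdir forward_topp /=; case: forward => //=; apply: pt_eq; rewrite /pscale /=; ring.
Qed.

Lemma tail_next d : tfrom (tnext d) = tto d.
Proof.
case: d => i [c o]; rewrite /tfrom /tto /tends /forward /tnext /tile_side /side_org /=.
by case: ccw; case: c; case: o => //=; apply: pt_eq; rewrite /padd /=; ring.
Qed.

Lemma tarea_gt0 i : 0 < tarea i.
Proof. by rewrite normr_gt0; exact: (tile_cross HT). Qed.

Lemma tareaE i : tarea i = if ccw i then pcross (ta (tiles i)) (tb (tiles i)) else - pcross (ta (tiles i)) (tb (tiles i)).
Proof.
rewrite /tarea /ccw; case: ltP => h; first by rewrite gtr0_norm.
by rewrite ler0_norm.
Qed.

Lemma cross_next d : pcross (tdir d) (tdir (tnext d)) = tarea d.1.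
Proof.
rewrite tareaE; case: d => i [c o]; rewrite /tdir /forward /tnext /=.
by case: ccw; case: c; case: o => //=; rewrite /pcross /pscale /=; ring.
Qed.

Lemma height_dart d z : side_height (tiles d.1) d.2.1 d.2.2 z * tarea d.1 = pcross (tdir d) (psub z (tfrom d)).
Proof.
have hD := tile_cross HT d.1; rewrite tareaE; case: d hD => i [c o] /=.
rewrite /tdir /tfrom /tends /forward /= /tile_side /side_org /side_height /tcoord.
case: (tiles i) z => [[[p1 p2] [a1 a2]] [b1 b2]] [z1 z2]; rewrite /pcross /= => hD.
have hD' := det_neq0C hD.
by case: ccw; case: c; case: o => /=; rewrite /padd /psub /pscale /tP /ta /tb /=; field; rewrite ?hD ?hD'.
Qed.

Lemma tile_dart_cases d d' : d.1 = d'.1 -> [\/ d' = d, d' = tnext d, d' = topp d | d' = topp (tnext d)].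
Proof.
case: d d' => i [c o] [i' [c' o']] /= <-; rewrite /tnext /topp /=.
by case: ccw; case: c; case: o; case: c'; case: o' => /=;
  do [by constructor 1|by constructor 2|by constructor 3|by constructor 4].
Qed.

Lemma pcrossDr (x y z : pt) : pcross x (padd y z) = pcross x y + pcross x z.
Proof. by rewrite /pcross /padd /=; ring. Qed.
Lemma pcrossZr (x y : pt) k : pcross x (pscale k y) = k * pcross x y.
Proof. by rewrite /pcross /pscale /=; ring. Qed.
Lemma pcrossZl (x y : pt) k : pcross (pscale k x) y = k * pcross x y.
Proof. by rewrite /pcross /pscale /=; ring. Qed.
Lemma pcrossC (x y : pt) : pcross x y = - pcross y x.
Proof. by rewrite /pcross; ring. Qed.
Lemma pcrossxx (x : pt) : pcross x x = 0.
Proof. by rewrite /pcross; ring. Qed.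

(** The ray from [z] in direction [u] starts inside the tile [i]. Disjointness of interiors is used
    in the form [enters_unique]. *)
Definition enters (i : 'I_nT) (z u : pt) := forall d : tdart, d.1 = i ->
  0 <= pcross (tdir d) (psub z (tfrom d)) /\ (pcross (tdir d) (psub z (tfrom d)) = 0 -> 0 < pcross (tdir d) u).

Lemma enters_interior i z u : enters i z u -> exists2 h, 0 < h & forall x, 0 < x <= h ->
  forall c o, 0 < side_height (tiles i) c o (padd z (pscale x u)).
Proof.
move=> he; pose Z (d : tdart) := pcross (tdir d) (psub z (tfrom d)).
pose l := [seq (Z (i, co), pcross (tdir (i, co)) u) | co : bool * bool].
have [h /andP[h0 _] hl] := small_step l; exists h => // x /andP[hx0 hx] c o.
rewrite -(pmulr_lgt0 _ (tarea_gt0 i)) (height_dart (i, (c, o))).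
have -> : psub (padd z (pscale x u)) (tfrom (i, (c, o))) = padd (psub z (tfrom (i, (c, o)))) (pscale x u) by point_ring.
rewrite pcrossDr pcrossZr -/(Z _).
have [h1 h2] := he (i, (c, o)) (erefl _); rewrite -/(Z _) in h1 h2.
have [hz|hz] := eqVneq (Z (i, (c, o))) 0; first by rewrite hz add0r mulr_gt0 // h2.
have hlt : h * `|pcross (tdir (i, (c, o))) u| < `|Z (i, (c, o))|.
  by apply: (hl (Z (i, (c, o)), pcross (tdir (i, (c, o))) u)) => //; apply/mapP; exists (c, o); rewrite ?mem_enum.
move: hlt; rewrite (ger0_norm h1) => hlt.
have : - (h * `|pcross (tdir (i, (c, o))) u|) <= x * pcross (tdir (i, (c, o))) u.
  have := ler_norm (- pcross (tdir (i, (c, o))) u); rewrite normrN.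
  have := normr_ge0 (pcross (tdir (i, (c, o))) u).
  move: (pcross (tdir (i, (c, o))) u) => q hp hq.
  have k1 : x * `|q| <= h * `|q| by apply: ler_wpM2r => //; case/andP: hx.
  by have k2 : x * - q <= x * `|q| by [apply: ler_wpM2l => //; exact: ltW]; rewrite mulrN in k2; lra.
rewrite -/(Z _); move: hlt; move: (x * _) (h * _) (Z _) => a b e hlt hle; lra.
Qed.

Lemma enters_unique i j z u : enters i z u -> enters j z u -> i = j.
Proof.
move=> /enters_interior[h h0 hi] /enters_interior[h' h0' hj].
pose x := Num.min h h'; have hx : 0 < x by rewrite lt_min h0.
apply: (tiles_disjoint HT (z := padd z (pscale x u))) => c o.
  by apply: hi; rewrite hx /x ge_min lexx.
by apply: hj; rewrite hx /x ge_min lexx orbT.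
Qed.

Lemma tail_topp d : tfrom (topp d) = padd (tto d) (tdir (tnext d)).
Proof. by rewrite -tnext2 tail_next tto_dir tail_next. Qed.

Lemma side_values d (x : R) (z := padd (tfrom d) (pscale x (tdir d))) :
  [/\ pcross (tdir d) (psub z (tfrom d)) = 0,
      pcross (tdir (tnext d)) (psub z (tfrom (tnext d))) = (1 - x) * tarea d.1,
      pcross (tdir (topp d)) (psub z (tfrom (topp d))) = tarea d.1
    & pcross (tdir (topp (tnext d))) (psub z (tfrom (topp (tnext d)))) = x * tarea d.1].
Proof.
rewrite -cross_next !tail_topp !tail_next !tto_dir tail_next tnext2 !tdir_topp tto_dir /z.
by split; rewrite /pcross /psub /padd /pscale /=; ring.
Qed.

Lemma pos_enters (k : R) (P : Prop) : 0 < k -> 0 <= k /\ (k = 0 -> P).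
Proof. by move=> hk; split; [exact: ltW|move=> e; move: hk; rewrite e ltxx]. Qed.

Lemma enters_side d (x : R) u : 0 < x < 1 -> 0 < pcross (tdir d) u ->
  enters d.1 (padd (tfrom d) (pscale x (tdir d))) u.
Proof.
move=> /andP[x0 x1] hu d' hd'; have hA := tarea_gt0 d.1; have [v1 v2 v3 v4] := side_values d x.
case: (tile_dart_cases (esym hd')) => ->; rewrite ?v1 ?v2 ?v3 ?v4; [by []| | |];
  by apply: pos_enters; rewrite ?mulr_gt0 ?subr_gt0.
Qed.

Lemma tdir_neq0 d : 0 < (tdir d).1 ^+ 2 + (tdir d).2 ^+ 2.
Proof.
have := tarea_gt0 d.1; rewrite -cross_next; case: (tdir d) (tdir _) => [x y] [x' y'] /=; rewrite /pcross /= => h.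
rewrite lt_neqAle addr_ge0 ?sqr_ge0 // andbT eq_sym paddr_eq0 ?sqr_ge0 // !sqrf_eq0.
by apply/negP => /andP[/eqP hx /eqP hy]; move: h; rewrite hx hy !mul0r subrr ltxx.
Qed.

(** Two tiles to the left of the same directed side overlap near its midpoint. *)
Lemma tdart_inj d d' : tfrom d = tfrom d' -> tdir d = tdir d' -> d = d'.
Proof.
move=> h1 h2; pose u : pt := (- (tdir d).2, (tdir d).1).
have hu : 0 < pcross (tdir d) u by rewrite /pcross /u /= mulrN opprK -!expr2 tdir_neq0.
have hx : ((0:R) < (2:R)^-1) && ((2:R)^-1 < 1) by apply/andP; split; lra.
have e1 := enters_side hx hu; have hu' : 0 < pcross (tdir d') u by rewrite -h2.
have e2 := enters_side hx hu'; rewrite -h1 -h2 in e2.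
have hi := enters_unique e1 e2; have hA := tarea_gt0 d.1; have hc := cross_next d.
case: (tile_dart_cases hi) => // hd'; exfalso; rewrite hd' in h2.
- by move: hA; rewrite -hc -h2 pcrossxx ltxx.
- by move: hA; rewrite -hc h2 tdir_topp pcrossZl hc => h3; have := tarea_gt0 d.1; clear h1 h2; lra.
by move: hA; rewrite -hc h2 tdir_topp pcrossZl pcrossxx mulr0 ltxx.
Qed.

Definition mate (d : tdart) : option tdart :=
  [pick d' | (tfrom d' == tto d) && (tto d' == tfrom d)].

Lemma mate_dir d d' : tfrom d' = tto d -> tto d' = tfrom d -> tdir d' = pscale (-1) (tdir d).
Proof.
move=> h1 h2; have k1 := tto_dir d; have k2 := tto_dir d'; rewrite h1 h2 k1 in k2.
have e1 := congr1 fst k2; have e2 := congr1 snd k2; move: e1 e2; rewrite /padd /pscale /= => e1 e2.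
by apply: pt_eq => /=; lra.
Qed.

Lemma mateP d d' : mate d = Some d' <-> tfrom d' = tto d /\ tto d' = tfrom d.
Proof.
rewrite /mate; split; first by case: pickP => // x /andP[/eqP h1 /eqP h2] [<-].
move=> [h1 h2]; case: pickP => [x /andP[/eqP k1 /eqP k2]|/(_ d')]; last by rewrite h1 h2 !eqxx.
congr Some; apply: tdart_inj; first by rewrite k1 h1.
by rewrite (mate_dir k1 k2) (mate_dir h1 h2).
Qed.

Lemma mate_sym d d' : mate d = Some d' -> mate d' = Some d.
Proof. by move=> /mateP[h1 h2]; apply/mateP. Qed.

Lemma seg_eq_dart (s : pt * pt) d : seg_eq s (tends d) = seg_eq s (tfrom d, tto d).
Proof.
rewrite /tfrom /tto; move: (tends d) => [t1 t2]; case: (forward d) => //=.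
by rewrite /seg_eq orbC.
Qed.

Lemma common_side d d' s : seg_eq s (tends d) -> seg_eq s (tends d') -> d != d' -> mate d = Some d'.
Proof.
rewrite !seg_eq_dart => h1 h2 hne.
have : seg_eq (tfrom d, tto d) (tfrom d', tto d') by apply: seg_eq_trans h2; rewrite seg_eq_sym.
rewrite /seg_eq => /orP[]/eqP /= [e1 e2]; last by apply/mateP; rewrite e1 e2.
move/negP: hne; case; apply/eqP/tdart_inj => //.
move: e2; rewrite !tto_dir e1 /padd => -[f1 f2].
by apply: pt_eq; [move: f1|move: f2]; lra.
Qed.

(** Consecutive tiles of a chain share a whole side, so a side on a chain is either glued to the
    neighbouring tile of the chain or is one of the two ends. *)
Lemma mate_or_boundary d : mate d = None -> exists k, [/\ (1 <= k <= 2 * N)%N & seg_eq (side z0 v k) (tends d)].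
Proof.
move=> hm; case: d hm => i [c o] hm.
have [p [q [m [tt [ss [r [[[hp hq] hs0 hopp hnext hend] hr hri hon]]]]]]] := all_in_chain HT Htau i c.
have [c1 [ o1 [k1 k2]]] := (opp_sidesP _ _ _).1 (hopp r hr); rewrite hri in k1 k2.
have hc1 : c1 = c by apply: (on_side_class HT _ hon); exists o1.
rewrite {c1}hc1 in k1 k2.
have hoth j s : j != i -> (exists c2, on_side tiles j c2 s) -> seg_eq s (tends (i, (c, o))) -> False.
  move=> hji [c2 [ o2 hs]] hs'; have := common_side (d := (i, (c, o))) (d' := (j, (c2, o2))) hs' hs.
  by rewrite hm => /(_ _) h; have := h; rewrite xpair_eqE eq_sym (negbTE hji) => /(_ isT).
have [ho|ho] := eqVneq o1 o.
  rewrite ho in k1; case: r hr hri hon k1 k2 => [|r] hr hri hon k1 k2; first by exists p; rewrite -hs0.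
  have hne : tt r != i by rewrite -hri; exact: hnext.
  have [c2 [_ q2]] := opp_sides_on_side (hopp r (ltnW hr)).
  by case: (hoth _ (ss r.+1) hne) => //; exists c2.
have ho2 : ~~ o1 = o by move: ho; case: (o1) (o) => [] [].
rewrite ho2 in k2; have [hrm|hrm] := eqVneq r.+1 m.
  by exists q; split=> //; apply: seg_eq_trans k2; rewrite seg_eq_sym hrm.
have hr1 : (r.+1 < m)%N by rewrite ltn_neqAle hrm.
have hne : tt r.+1 != i by rewrite -hri eq_sym; exact: hnext.
have [c2 [q1 _]] := opp_sides_on_side (hopp r.+1 hr1).
by case: (hoth _ (ss r.+1) hne) => //; exists c2.
Qed.

(** Two tiles glued along a side cover a neighbourhood of its midpoint, which is then no boundary
    point. *)
Lemma mate_not_boundary d d' k : mate d = Some d' -> (1 <= k <= 2 * N)%N -> seg_eq (side z0 v k) (tends d) -> False.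
Proof.
move=> /mateP[h1 h2] hk hs.
pose z := padd (tfrom d) (pscale 2^-1 (tdir d)).
have hz : segment (side z0 v k).1 (side z0 v k).2 z.
  apply: (seg_eq_segment (s := (tfrom d, tto d))); first by rewrite seg_eq_sym -seg_eq_dart.
  exists 2^-1; split; first by apply/andP; split; lra.
  by rewrite /z tto_dir /=; apply: pt_eq; rewrite /padd /pscale /psub /=; ring.
have [_] := boundary_side HT hk hz; apply.
have hhalf : ((0:R) < (2:R)^-1) && ((2:R)^-1 < 1) by apply/andP; split; lra.
have hoth (e : tdart) x : 0 < x < 1 -> \forall y \near padd (tfrom e) (pscale x (tdir e)),
    forall c o, (e.1, (c, o)) != e -> 0 < side_height (tiles e.1) c o y.
  move=> hx; have hp c o : (e.1, (c, o)) != e -> 0 < side_height (tiles e.1) c o (padd (tfrom e) (pscale x (tdir e))).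
    move=> hne; pose u : pt := (- (tdir e).2, (tdir e).1).
    have hu : 0 < pcross (tdir e) u by rewrite /pcross /u /= mulrN opprK -!expr2 tdir_neq0.
    have hu' : 0 < pcross (tdir e) (padd u (tdir e)) by rewrite pcrossDr pcrossxx addr0.
    have hu'' : 0 < pcross (tdir e) (padd u (pscale (-1) (tdir e))) by rewrite pcrossDr pcrossZr pcrossxx mulr0 addr0.
    rewrite -(pmulr_lgt0 _ (tarea_gt0 e.1)) (height_dart (e.1, (c, o))).
    have hA := tarea_gt0 e.1; case/andP: hx => x0 x1; have [_ v2 v3 v4] := side_values e x.
    case: (tile_dart_cases (d := e) (d' := (e.1, (c, o))) (erefl _)) => he; rewrite he ?v2 ?v3 ?v4 ?mulr_gt0 ?subr_gt0 //.
    by rewrite he eqxx in hne.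
  have hpn c o : \forall y \near padd (tfrom e) (pscale x (tdir e)), (e.1, (c, o)) != e -> 0 < side_height (tiles e.1) c o y.
    have [h3|h3] := boolP ((e.1, (c, o)) != e); last by apply: filterS (filterT : nbhs (padd (tfrom e) (pscale x (tdir e))) setT) => y _.
    by apply: filterS (side_height_near (hp _ _ h3)).
  by apply: filterS (filterI (filterI (hpn true true) (hpn true false)) (filterI (hpn false true) (hpn false false)))
      => y [[q1 q2] [q3 q4]] [] [].
have hz' : z = padd (tfrom d') (pscale 2^-1 (tdir d')).
  rewrite (mate_dir h1 h2) h1 tto_dir /z; by apply: pt_eq; rewrite /padd /pscale /=; field.
have n1 := hoth d _ hhalf; have n2 := hoth d' _ hhalf; rewrite -/z in n1; rewrite -hz' in n2.
apply: filterS (filterI n1 n2) => y [y1 y2].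
have hsum : pcross (tdir d') (psub y (tfrom d')) = - pcross (tdir d) (psub y (tfrom d)).
  rewrite (mate_dir h1 h2) h1 tto_dir /pcross /psub /padd /pscale /=; ring.
have hin (e : tdart) : (forall c o, (e.1, (c, o)) != e -> 0 < side_height (tiles e.1) c o y) ->
    0 <= pcross (tdir e) (psub y (tfrom e)) -> rhombus_set (tiles e.1) y.
  move=> hy he; apply/(rhombusP _ (tile_cross HT _)) => c o.
  have [hco|hco] := eqVneq (e.1, (c, o)) e; last exact: ltW (hy _ _ hco).
  by rewrite -(pmulr_lge0 _ (tarea_gt0 e.1)) (height_dart (e.1, (c, o))) hco.
have [hle|hlt] := leP 0 (pcross (tdir d) (psub y (tfrom d))); first by exists d.1 => //; exact: hin.
by exists d'.1 => //; apply: hin => //; rewrite hsum oppr_ge0 ltW.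
Qed.

End TileDarts.

(** * Boundary darts, their orientation, and the chain labels of darts *)

Section TilingLabels.
Variables (R : realType) (N : nat) (z0 : R * R) (v : nat -> R * R) (nT : nat).
Variables (tiles : 'I_nT -> tile R) (col : R * R -> bool) (tau : nat -> nat).
Hypotheses (HT : rhombus_tiling N z0 v tiles col) (Htau : is_pairing N z0 v tiles tau).
Local Notation pt := (R * R)%type.
Local Notation wp := (wpt z0 v).
Local Notation n := (2 * N)%N.
Local Notation D := (tdart nT).
Local Notation tdir := (tdir tiles).
Local Notation tfrom := (tfrom tiles).
Local Notation tto := (tto tiles).
Local Notation tends := (tends tiles).
Local Notation mate := (mate tiles).

Lemma segment_left (x y : pt) : segment x y x.
Proof. by exists 0; rewrite lexx ler01; split=> //; apply: pt_eq; rewrite /padd /pscale /=; ring. Qed.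
Lemma segment_right (x y : pt) : segment x y y.
Proof. by exists 1; rewrite lexx ler01; split=> //; apply: pt_eq; rewrite /padd /pscale /psub /=; ring. Qed.

Lemma wp_closed : wp n = z0. Proof. by case: HT. Qed.

Lemma wp_step k : (k < n)%N -> wp k.+1 <> wp k.
Proof.
move=> hk; case: HT => /(_ k.+1) hv _ _ _ _; have := hv hk.
move=> h1 h2; have hz : v k.+1 = (0, 0).
  move: h2 => /= h2; have e1 := congr1 fst h2; have e2 := congr1 snd h2; move: e1 e2; rewrite /padd /= => e1 e2.
  by apply: pt_eq => /=; [move: e1|move: e2] => e; lra.
by move: h1; rewrite hz /pnorm /= expr0n addr0 sqrtr0 => /eqP; rewrite eq_sym oner_eq0.
Qed.

Lemma sides_gt0 : (0 < n)%N.
Proof.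
case: HT => _ _ _ hs _; case: posnP => // h0; move: hs; rewrite h0 big_geq //.
by rewrite ltxx.
Qed.

Lemma side_meet k l z : (1 <= k)%N -> (k < l)%N -> (l <= n)%N ->
  segment (wp k.-1) (wp k) z -> segment (wp l.-1) (wp l) z ->
  if l == k.+1 then z = wp k else [/\ k = 1%N, l = n & z = wp 0].
Proof.
move=> h1 h2 h3 hk hl; case: HT => _ _ /(_ k l h1 h2 h3) hm _ _; move: hm.
have hz : (segment (wp k.-1) (wp k) `&` segment (wp l.-1) (wp l))%classic z by split.
case: eqP => _; first by move=> hm; rewrite hm in hz.
case: ifP => [/andP[/eqP e1 /eqP e2]|_] hm; rewrite hm in hz => //.
Qed.

Definition wv (i : 'I_n) : pt := wp i.
Definition vv (i : 'I_n) : pt := v i.+1.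

Lemma wv_ordS (i : 'I_n) : wv (ordS i) = wp i.+1.
Proof.
rewrite /wv; have -> : nat_of_ord (ordS i) = (i.+1 %% n)%N by [].
have := ltn_ord i; rewrite leq_eqVlt => /orP[/eqP h|h]; last by rewrite modn_small.
by rewrite h modnn wp_closed.
Qed.

Lemma wv_next (i : 'I_n) : wv (ordS i) = padd (wv i) (vv i).
Proof. by rewrite wv_ordS. Qed.

Lemma wv_inj : injective wv.
Proof.
suff H (i j : 'I_n) : (i < j)%N -> wv i <> wv j.
  move=> i j hij; apply/val_inj/eqP; case: (ltngtP i j) => // h; first by case: (H _ _ h).
  by case: (H _ _ h).
move=> hij he; have hj := ltn_ord j.
have h1 : segment (wp i.+1.-1) (wp i.+1) (wp i) by exact: segment_left.
have h2 : segment (wp j.+1.-1) (wp j.+1) (wp i) by rewrite -/(wv i) he; exact: segment_left.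
have := side_meet (k := i.+1) (l := j.+1) isT hij hj h1 h2.
case: eqP => [_|_ [hi hjn hw]]; first by move=> h; apply: (@wp_step i); rewrite ?ltn_ord.
by apply: (@wp_step j) => //; rewrite -/(wv j) -he /wv hw hjn wp_closed.
Qed.

Lemma side_inj (i j : 'I_n) : seg_eq (side z0 v i.+1) (side z0 v j.+1) -> i = j.
Proof.
suff H (a b : 'I_n) : (a < b)%N -> seg_eq (side z0 v a.+1) (side z0 v b.+1) -> False.
  move=> h; apply/val_inj/eqP; case: (ltngtP i j) => // hij; first by case: (H _ _ hij h).
  by case: (H _ _ hij); rewrite seg_eq_sym.
move=> hab hs; have hb := ltn_ord b.
have m1 z : segment (wp a) (wp a.+1) z -> segment (wp b) (wp b.+1) z by move=> hz; exact: (seg_eq_segment hs).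
have l1 := segment_left (wp a) (wp a.+1); have r1 := segment_right (wp a) (wp a.+1).
have c1 := side_meet (k := a.+1) (l := b.+1) isT hab hb l1 (m1 _ l1).
have c2 := side_meet (k := a.+1) (l := b.+1) isT hab hb r1 (m1 _ r1).
apply: (@wp_step a); first exact: ltn_ord.
by move: c1 c2; case: eqP => _; [move=> h _; exact: esym h|move=> [_ _ h1] [_ _ h2]; rewrite h1 h2].
Qed.

Lemma tiling_n_gt1 : (1 < n)%N.
Proof. by have := sides_gt0; lia. Qed.

Lemma ordS_neq (i : 'I_n) : ordS i != i.
Proof.
apply/negP => /eqP/(congr1 val) /=; have := ltn_ord i; have hn := tiling_n_gt1.
rewrite leq_eqVlt => /orP[/eqP h|h]; first by rewrite h modnn; lia.
by rewrite modn_small //; lia.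
Qed.

Lemma vv_turn (i : 'I_n) : vv (ordS i) <> pscale (-1) (vv i).
Proof.
move=> h; have := ordS_neq i; move/negP; apply; apply/eqP/esym/side_inj.
have e1 : side z0 v i.+1 = (wv i, wv (ordS i)) by rewrite wv_ordS.
have e2 : side z0 v (ordS i).+1 = (wv (ordS i), wv (ordS (ordS i))) by rewrite (wv_ordS (ordS i)).
rewrite e1 e2 /seg_eq /=; apply/orP; right; apply/eqP; congr pair.
rewrite wv_next h wv_next; apply: pt_eq; rewrite /padd /pscale /=; ring.
Qed.

Lemma unmated_exists (i : 'I_n) : exists d : D, mate d = None /\ seg_eq (side z0 v i.+1) (tends d).
Proof.
have hi : (1 <= i.+1 <= n)%N by rewrite ltn_ord.
have [m [tt [ss [[_ hs0 hopp _ _] hm]]]] := pairing_chain Htau hi.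
have [c [[ o ho] _]] := opp_sides_on_side (hopp 0%N hm); rewrite hs0 in ho.
exists (tt 0%N, (c, o)); split=> //; case hmt: (mate _) => [d'|] //.
by case: (mate_not_boundary HT hmt hi ho).
Qed.

Definition sdart (i : 'I_n) : D := projT1 (cid (unmated_exists i)).

Lemma sdart_unmated i : mate (sdart i) = None.
Proof. by rewrite /sdart; case: cid => d []. Qed.
Lemma sdart_side (i : 'I_n) : seg_eq (side z0 v i.+1) (tends (sdart i)).
Proof. by rewrite /sdart; case: cid => d []. Qed.

Lemma side_dart_unmated (i : 'I_n) d : seg_eq (side z0 v i.+1) (tends d) -> mate d = None.
Proof.
move=> hd; case hmt: (mate _) => [d'|] //.
by case: (mate_not_boundary HT hmt _ hd); rewrite ltn_ord.
Qed.

Lemma sdart_unique (i : 'I_n) d : seg_eq (side z0 v i.+1) (tends d) -> d = sdart i.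
Proof.
move=> hd; apply/eqP/negPn/negP => hne.
by have := common_side HT hd (sdart_side i) hne; rewrite (side_dart_unmated hd).
Qed.

Lemma unmatedP d : mate d = None -> exists i, d = sdart i.
Proof.
move=> /(mate_or_boundary HT Htau)[[|k] [hk hs]] //.
by exists (Ordinal (hk : (k < n)%N)); exact: sdart_unique.
Qed.

Lemma sdart_inj : injective sdart.
Proof.
move=> i j h; apply: side_inj; apply: seg_eq_trans (sdart_side i) _.
by rewrite h seg_eq_sym; exact: sdart_side.
Qed.

Definition mate_total (d : D) : D := odflt d (mate d).
Lemma mate_totalK : involutive mate_total.
Proof.
rewrite /mate_total => d; case h: (mate d) => [d'|] /=; last by rewrite h.
by rewrite (mate_sym HT h).
Qed.

(** Discrete Stokes formula: the terms of glued sides cancel. *)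
Lemma sum_unmated (V : numDomainType) (F : D -> V) : (forall d d', mate d = Some d' -> F d' = - F d) ->
  \sum_d F d = \sum_i F (sdart i).
Proof.
move=> hF; rewrite (bigID (fun d => mate d == None)) /= [X in _ + X = _](_ : _ = 0) ?addr0.
  rewrite [RHS](partition_big sdart predT) //= big_mkcond /=; apply: eq_bigr => d _.
  case: eqP => [/unmatedP[j ->]|hd].
    by rewrite (big_pred1 j) // => i; rewrite /= (inj_eq sdart_inj).
  by rewrite big_pred0 // => i; apply/eqP => h; apply: hd; rewrite -h sdart_unmated.
set S := (\sum_(_ | _) _).
have hS : S = - S.
  rewrite {1}/S (reindex_inj (inv_inj mate_totalK)) /= -sumrN; apply: eq_big => d.
    by rewrite /mate_total; case h: (mate d) => [d'|] /=; rewrite ?h // (mate_sym HT h).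
  by rewrite /mate_total; case h: (mate d) => [d'|] /=; rewrite ?h // (hF _ _ h).
have : S *+ 2 = 0 by rewrite mulr2n {1}hS addNr.
by move/eqP; rewrite mulrn_eq0 /= => /eqP.
Qed.

Lemma sdart_ends i : (tfrom (sdart i) = wv (ordS i) /\ tto (sdart i) = wv i) \/
  (tfrom (sdart i) = wv i /\ tto (sdart i) = wv (ordS i)).
Proof.
have := sdart_side i; rewrite seg_eq_dart.
have -> : side z0 v i.+1 = (wv i, wv (ordS i)) by rewrite wv_ordS.
by rewrite /seg_eq => /orP[]/eqP [h1 h2]; [right|left]; rewrite -?h1 -?h2.
Qed.

Definition inward (i : 'I_n) := tfrom (sdart i) == wv (ordS i).

Lemma sdart_tail i : tfrom (sdart i) = if inward i then wv (ordS i) else wv i.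
Proof.
rewrite /inward; case: eqP => //; case: (sdart_ends i) => [[-> _]|[-> _]] //.
Qed.
Lemma sdart_head i : tto (sdart i) = if inward i then wv i else wv (ordS i).
Proof.
rewrite /inward; case: (sdart_ends i) => [[-> ->]|[-> ->]]; first by rewrite eqxx.
by rewrite (inj_eq wv_inj) eq_sym (negbTE (ordS_neq i)).
Qed.

Lemma sum_tail_head (V : zmodType) (F : pt -> V) : \sum_d F (tfrom d) = \sum_d F (tto d).
Proof. by rewrite (reindex_inj (@tnext_inj R nT tiles)) /=; apply: eq_bigr => d _; rewrite tail_next. Qed.

(** At a boundary vertex the heads and tails of all darts balance, so the two boundary darts there
    cannot both start or both end at it. *)
Lemma inward_const i j : inward i = inward j.
Proof.
suff hS l : inward (ordS l) = inward l.
  suff H k (hk : (k < n)%N) : inward (Ordinal hk) = inward (Ordinal sides_gt0).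
    by case: i j => [i hi] [j hj]; rewrite !H.
  elim: k hk => [|k IH] hk; first by congr inward; exact: val_inj.
  rewrite -(IH (ltnW hk)) -(hS (Ordinal (ltnW hk))); congr inward; apply: val_inj => /=; by rewrite modn_small.
clear i j; rename l into i; pose j := ordS i; pose F (d : D) : int := (tfrom d == wv j)%:R - (tto d == wv j)%:R.
have h1 : \sum_d F d = 0 by rewrite sumrB (sum_tail_head (fun x => (x == wv j)%:R)) subrr.
have h2 d d' : mate d = Some d' -> F d' = - F d.
  by move=> /(mateP HT)[e1 e2]; rewrite /F e1 e2 opprB.
have h3 (k : 'I_n) : F (sdart k) = (if k == i then (-1) ^+ (~~ inward i) else 0) - (if k == j then (-1) ^+ (~~ inward j) else 0).
  rewrite /F sdart_tail sdart_head.
  have k1 : (wv k == wv j) = (k == j) by rewrite (inj_eq wv_inj).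
  have k2 : (wv (ordS k) == wv j) = (k == i) by rewrite (inj_eq wv_inj) (inj_eq (@ordS_inj _)).
  have hij : (i == j) = false by apply/negbTE; rewrite eq_sym ordS_neq.
  case hk: (inward k); rewrite k1 k2; case: (eqVneq k i) => [hki|hki]; case: (eqVneq k j) => [hkj|hkj].
  - by move: hij; rewrite -hkj -hki eqxx.
  - by rewrite -hki hk.
  - by rewrite -hkj hk.
  - by [].
  - by move: hij; rewrite -hkj -hki eqxx.
  - by rewrite -hki hk.
  - by rewrite -hkj hk.
  - by [].
move: h1; rewrite (sum_unmated h2); under eq_bigr do rewrite h3.
rewrite sumrB -!big_mkcond /= !big_pred1_eq.
by rewrite -/j; case: (inward i); case: (inward j).
Qed.

Lemma sum_darts (V : zmodType) (F : D -> V) : \sum_d F d = \sum_i (\sum_(c : bool) \sum_(o : bool) F (i, (c, o))).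
Proof.
rewrite (eq_bigr (fun d : D => F (d.1, d.2))); last by case.
rewrite -(pair_big predT predT (fun i (co : bool * bool) => F (i, co))) /=; apply: eq_bigr => i _.
rewrite (eq_bigr (fun co : bool * bool => F (i, (co.1, co.2)))); last by case.
by rewrite -(pair_big predT predT (fun c o => F (i, (c, o)))).
Qed.

Lemma sum_cross_gt0 : 0 < \sum_d pcross (tfrom d) (tto d).
Proof.
rewrite sum_darts.
have h i : \sum_(c : bool) \sum_(o : bool) pcross (tfrom (i, (c, o))) (tto (i, (c, o))) = 2 * tarea tiles i.
  rewrite !big_bool /= /tfrom /tto /forward /= tareaE /tends /tile_side /side_org /=.
  by case: ccw; rewrite /pcross /padd /=; ring.
rewrite (eq_bigr _ (fun i _ => h i)); pose i0 := (sdart (Ordinal sides_gt0)).1.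
rewrite (bigD1 i0) //= ltr_pwDl //; first by rewrite mulr_gt0 // (tarea_gt0 HT).
by apply: sumr_ge0 => i _; apply: mulr_ge0 => //; exact: normr_ge0.
Qed.

(** The area of the tiles, counted counterclockwise, is positive and reduces by [sum_unmated] to the
    boundary; the polygon is clockwise, so boundary darts run against it. *)
Lemma inwardT i : inward i.
Proof.
apply/negPn/negP => hi; have := sum_cross_gt0; rewrite sum_unmated; last first.
  by move=> d d' /(mateP HT)[-> ->]; rewrite pcrossC.
have h k : pcross (tfrom (sdart k)) (tto (sdart k)) = pcross (wp k) (wp k.+1) by rewrite sdart_tail sdart_head (inward_const k i) (negbTE hi) wv_ordS.
rewrite (eq_bigr _ (fun k _ => h k)); case: HT => _ _ _ hs _.
by move: hs; rewrite big_add1 /= big_mkord => /lt_trans h1 /h1; rewrite ltxx.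
Qed.

Lemma tail_sdart i : tfrom (sdart i) = wv (ordS i).
Proof. by rewrite sdart_tail inwardT. Qed.
Lemma head_sdart i : tto (sdart i) = wv i.
Proof. by rewrite sdart_head inwardT. Qed.
Lemma dir_sdart i : tdir (sdart i) = pscale (-1) (vv i).
Proof.
have h := tto_dir tiles (sdart i); rewrite tail_sdart head_sdart wv_next in h.
have e1 := congr1 fst h; have e2 := congr1 snd h; move: e1 e2; rewrite /padd /= => e1 e2.
by apply: pt_eq; rewrite /pscale /=; [move: e1|move: e2] => e; lra.
Qed.

(** At a boundary side [mate_total] returns the side itself, so that [advance] is a bijection and
    the lemmas on stopping orbits apply. *)
Definition advance (d : D) : D := mate_total (topp d).
Definition exit_side (d : D) : option 'I_n := [pick i | sdart i == topp d].

Lemma exit_sideP d i : exit_side d = Some i <-> topp d = sdart i.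
Proof.
rewrite /exit_side; split; first by case: pickP => // j /eqP h [<-].
by move=> h; case: pickP => [j|/(_ i)]; rewrite h ?eqxx // => /eqP/sdart_inj ->.
Qed.

Lemma exit_side_none d d' : mate (topp d) = Some d' -> exit_side d = None /\ advance d = d'.
Proof.
move=> h; split; last by rewrite /advance /mate_total h.
by case he: (exit_side d) => [i|] //; move/exit_sideP: he h => ->; rewrite sdart_unmated.
Qed.

Lemma exit_side_noneP d : exit_side d = None -> mate (topp d) = Some (advance d).
Proof.
move=> h; rewrite /advance /mate_total; case hm: (mate _) => [d'|] //.
by have [i /exit_sideP] := unmatedP hm; rewrite h.
Qed.

Lemma advance_inj : injective advance.
Proof. by apply: inj_comp; [exact: inv_inj mate_totalK|exact: inv_inj (@toppK nT)]. Qed.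

Local Notation ends := (ends_at advance exit_side).

Lemma chain_darts p q m tt ss : is_chain N z0 v tiles p q m tt ss -> (0 < m)%N ->
  exists (p0 q0 : 'I_n) (e : nat -> D), [/\ p = p0.+1, q = q0.+1,
    forall r, (r < m)%N -> (e r).1 = tt r /\ seg_eq (ss r) (tends (e r)),
    forall r, (r.+1 < m)%N -> mate (topp (e r)) = Some (e r.+1)
    & e 0%N = sdart p0 /\ topp (e m.-1) = sdart q0].
Proof.
move=> [[hp hq] hs0 hopp hne hend] h0; case: p hp hs0 => // p hp hs0; case: q hq hend => // q hq hend.
exists (Ordinal (hp : (p < n)%N)), (Ordinal (hq : (q < n)%N)).
have /choice[e he] : forall r, exists e : D, (r < m)%N ->
   [/\ e.1 = tt r, seg_eq (ss r) (tends e) & seg_eq (ss r.+1) (tends (topp e))].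
  move=> r; case: (ltnP r m) => hr; last by exists (sdart (Ordinal sides_gt0)).
  by have [c [ o [k1 k2]]] := (opp_sidesP _ _ _).1 (hopp r hr); exists (tt r, (c, o)).
exists e; split=> //; first by move=> r /he[].
  move=> r hr; have [f1 f2 f3] := he _ (ltnW hr); have [g1 g2 g3] := he _ hr.
  apply: (common_side HT f3 g2); apply/negP => /eqP h; have := hne _ hr.
  by rewrite -f1 -g1 -h eqxx.
split; first by have [_ f2 _] := he _ h0; apply: sdart_unique; rewrite -hs0.
have hm1 : (m.-1 < m)%N by rewrite prednK.
have [_ _ f3] := he _ hm1; rewrite prednK // in f3; apply: sdart_unique.
by apply: seg_eq_trans f3; rewrite seg_eq_sym.
Qed.

(** By [all_in_chain] every dart lies on a chain, so the walks from it in both directions stop at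
    the two ends of that chain. *)
Lemma chain_ends d : exists p q : 'I_n, [/\ ends d q, ends (topp d) p, ends (sdart p) q & ends (sdart q) p].
Proof.
case: d => i [c o].
have [p [q [m [tt [ss [r [hc hr hri hon]]]]]]] := all_in_chain HT Htau i c.
have h0 : (0 < m)%N by exact: leq_ltn_trans hr.
have [p0 [q0 [e [_ _ he hstep [hd0 hdm]]]]] := chain_darts hc h0.
have hup k : (k < m)%N -> ends (e (m.-1 - k)%N) q0.
  elim: k => [|k IH] hk.
    by rewrite subn0; apply: ends_at_stop; apply/exit_sideP.
  have hlt : ((m.-1 - k.+1).+1 < m)%N by lia.
  have [s1 s2] := exit_side_none (hstep _ hlt).
  apply/(ends_at_next _ _ s1); rewrite s2; have -> : (m.-1 - k.+1).+1 = (m.-1 - k)%N by lia.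
  by apply: IH; exact: ltnW.
have hdn k : (k < m)%N -> ends (topp (e k)) p0.
  elim: k => [|k IH] hk; first by apply: ends_at_stop; apply/exit_sideP; rewrite toppK.
  have hm' : mate (topp (topp (e k.+1))) = Some (topp (e k)) by rewrite toppK; exact: (mate_sym HT (hstep _ hk)).
  have [s1 s2] := exit_side_none hm'.
  by apply/(ends_at_next _ _ s1); rewrite s2; apply: IH; exact: ltnW.
have hall k : (k < m)%N -> ends (e k) q0.
  move=> hk; have hk' : (k <= m.-1)%N by rewrite -ltnS prednK.
  have := hup (m.-1 - k)%N; rewrite subKn //; apply; apply: leq_ltn_trans (leq_subr _ _) _; by rewrite prednK.
have hpq : ends (sdart p0) q0 by rewrite -hd0; exact: hall.
have hqp : ends (sdart q0) p0 by rewrite -hdm; apply: hdn; rewrite prednK.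
have [f1 f2] := he _ hr; have hcr : (e r).2.1 = c.
  apply: (on_side_class HT (s := ss r)) hon; rewrite -hri.
  by move: f1 f2; case: (e r) => [i1 [c1 o1]] /= -> h; exists o1.
have : (i, (c, o)) = e r \/ (i, (c, o)) = topp (e r).
  move: hcr f1; rewrite hri; case: (e r) => [i1 [c1 o1]] /= -> ->; rewrite /topp /=.
  by case: (o); case: (o1); [left|right|right|left].
by case=> ->; [exists p0, q0|exists q0, p0]; rewrite ?toppK; split=> //; [exact: hall|exact: hdn|exact: hdn|exact: hall].
Qed.

Definition lab (d : D) : 'I_n := odflt (Ordinal sides_gt0) (end_of advance exit_side d).
Lemma labP d q : ends d q -> lab d = q.
Proof. by move=> /end_ofP; rewrite /lab => ->. Qed.
Lemma lab_ends d : ends d (lab d).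
Proof. by have [p [q [h _ _ _]]] := chain_ends d; rewrite (labP h). Qed.

Definition partner (i : 'I_n) : 'I_n := lab (sdart i).

Lemma lab_topp d : lab (topp d) = partner (lab d).
Proof.
by have [p [q [h1 h2 h3 h4]]] := chain_ends d; rewrite (labP h1) (labP h2) /partner (labP h4).
Qed.

Lemma partnerK : involutive partner.
Proof.
move=> i; have [p [q [h1 h2 h3 h4]]] := chain_ends (sdart i).
have hx : ends (topp (sdart i)) i by apply: ends_at_stop; apply/exit_sideP; rewrite toppK.
by rewrite {2}/partner (labP h1) /partner (labP h4) -(labP h2) (labP hx).
Qed.

Lemma lab_advance d : exit_side d = None -> lab (advance d) = lab d.
Proof. by move=> h; apply: labP; apply/(ends_at_next _ _ h); exact: lab_ends. Qed.

Lemma lab_mate d d' : mate d = Some d' -> lab d' = partner (lab d).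
Proof.
move=> /(mate_sym HT); rewrite -[d' in mate d']toppK => h.
by have [s1 s2] := exit_side_none h; rewrite -s2 lab_advance // lab_topp partnerK.
Qed.

Lemma partnerE i : (partner i).+1 = tau i.+1.
Proof.
have hi : (1 <= i.+1 <= n)%N by rewrite ltn_ord.
have [m [tt [ss [hc h0]]]] := pairing_chain Htau hi.
have [p0 [q0 [e [[hp0] -> _ hstep [hd0 hdm]]]]] := chain_darts hc h0.
have {hp0}e0 : p0 = i by apply: val_inj.
rewrite {p0}e0 in hd0.
have hconst k : (k < m)%N -> lab (e k) = partner i.
  elim: k => [|k IH] hk; first by rewrite hd0.
  have [s1 s2] := exit_side_none (hstep _ hk); rewrite -s2 lab_advance //; apply: IH; exact: ltnW.
have hm1 : (m.-1 < m)%N by rewrite prednK.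
by rewrite -(hconst _ hm1) (labP (q := q0)) //; apply: ends_at_stop; apply/exit_sideP.
Qed.

Lemma pscaleN1K (x : pt) : pscale (-1) (pscale (-1) x) = x.
Proof. by point_ring. Qed.

Lemma tdir_lab d : tdir d = vv (lab d).
Proof.
have [j [hj hq]] := lab_ends d.
have hi k : (k <= j)%N -> tdir (iter k advance d) = tdir d.
  elim: k => // k IH hk; have /exit_side_noneP/(mateP HT)[e1 e2] := hj _ hk.
  by rewrite iterS (mate_dir e1 e2) tdir_topp pscaleN1K IH // ltnW.
by move/exit_sideP: hq => hq; rewrite -(hi j) // -[iter j _ _]toppK tdir_topp hq dir_sdart pscaleN1K.
Qed.

Lemma vv_partner i : vv (partner i) = pscale (-1) (vv i).
Proof. by rewrite /partner -tdir_lab dir_sdart. Qed.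

Lemma chain_start d : exists i j, [/\ d = iter j advance (sdart i), lab d = partner i
  & forall k, (k < j)%N -> exit_side (iter k advance (sdart i)) = None].
Proof.
have [d0 [s [j [h1 h2 h3]]]] := previous_stop advance_inj (lab_ends d).
have e : advance d0 = sdart s by move/exit_sideP: h1 => h1; rewrite /advance h1 /mate_total sdart_unmated.
rewrite e in h2 h3; exists s, j; split=> //.
have hl k : (k <= j)%N -> lab (iter k advance (sdart s)) = partner s.
  by elim: k => // k IH hk; rewrite iterS lab_advance ?IH ?h3 // ltnW.
by rewrite h2 hl.
Qed.

End TilingLabels.

Local Notation side1 HT := (Ordinal (sides_gt0 HT)).

(** * Angles measured in full turns *)

Section FractionalParts.
Variable R : realType.
Implicit Types (x y : R).

Definition fpart x : R := x - (Num.floor x)%:~R.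
Lemma fpart_itv x : 0 <= fpart x < 1.
Proof. by have := floor_itv x; rewrite /fpart intrD; move: ((Num.floor x)%:~R : R) => m; lra. Qed.

Lemma int_small (m : int) : -1 < (m%:~R : R) < 1 -> m = 0.
Proof.
move=> /andP[h1 h2]; have k1 : (-1 < m)%R by rewrite -(ltr_int R) rmorphN1.
by have k2 : (m < 1)%R by [rewrite -(ltr_int R)]; lia.
Qed.

Lemma fpart_unique x y (m : int) : x = y + m%:~R -> 0 <= y < 1 -> fpart x = y.
Proof.
move=> h hy; have hx := fpart_itv x; have e : fpart x = y + (m - Num.floor x)%:~R by rewrite /fpart h intrB; ring.
have : (m - Num.floor x)%R = 0 by apply: int_small; move: e hx; move: ((m - _)%:~R : R) => k e hx; lra.
by move=> h0; rewrite e h0 addr0.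
Qed.

Lemma fpart_sub x y : fpart (x - y) = fpart x - fpart y + (fpart x < fpart y)%R%:R.
Proof.
have hx := fpart_itv x; have hy := fpart_itv y.
apply: (fpart_unique (m := Num.floor x - Num.floor y - (fpart x < fpart y)%R%:R)).
  by rewrite !intrB /fpart; case: (_ < _) => /=; ring.
by case: ltP => /=; lra.
Qed.

Lemma sincos_turns (m : int) : sin (m%:~R * (pi *+ 2)) = 0 :> R /\ cos (m%:~R * (pi *+ 2)) = 1 :> R.
Proof.
have H (k : nat) : sin (k%:R * (pi *+ 2)) = 0 :> R /\ cos (k%:R * (pi *+ 2)) = 1 :> R.
  elim: k => [|k [IH1 IH2]]; first by rewrite mul0r sin0 cos0.
  by rewrite -natr1 mulrDl mul1r (sinD (k%:R * _)) (cosD (k%:R * _)) IH1 IH2 sin2pi cos2pi; split; ring.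
case: m => k; first exact: H.
by rewrite NegzE mulrNz mulNr sinN cosN; have [-> ->] := H k.+1; rewrite oppr0.
Qed.

Lemma sin_turns x (m : int) : sin (x + m%:~R * (pi *+ 2)) = sin x.
Proof. by rewrite sinD; have [-> ->] := sincos_turns m; rewrite mulr0 mulr1 addr0. Qed.
Lemma cos_turns x (m : int) : cos (x + m%:~R * (pi *+ 2)) = cos x.
Proof. by rewrite cosD; have [-> ->] := sincos_turns m; rewrite mulr0 mulr1 subr0. Qed.

Lemma fpart_turns x : x * (pi *+ 2) = fpart x * (pi *+ 2) + (Num.floor x)%:~R * (pi *+ 2).
Proof. by rewrite -mulrDl /fpart subrK. Qed.

Lemma sin_pos_fpart x : 0 < sin (x * (pi *+ 2)) -> 0 < fpart x < 2^-1.
Proof.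
rewrite fpart_turns sin_turns => hs; have /andP[h0 h1] := fpart_itv x; have hp := pi_gt0 R.
apply/andP; split.
  by rewrite lt_neqAle h0 andbT; apply/eqP => e; move: hs; rewrite -e mul0r sin0 ltxx.
rewrite ltNge; apply/negP => h2; move: hs.
have -> : fpart x * (pi *+ 2) = (fpart x * 2 - 1) * pi + pi by rewrite -mulr_natr; ring.
rewrite sinDpi oppr_gt0 ltNge sin_ge0_pi // ?in_itv /=.
by apply/andP; split; [apply: mulr_ge0; lra|rewrite ger_pMl //; lra].
Qed.

Lemma fpart_sin_pos x : 0 < fpart x < 2^-1 -> 0 < sin (x * (pi *+ 2)).
Proof.
move=> hx; have hp := pi_gt0 R; rewrite fpart_turns sin_turns sin_gt0_pi //.
move: (pi : R) hp => p hp; rewrite -mulr_natr; apply/andP; split; [apply: mulr_gt0; lra|].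
by have : (1 - fpart x * 2) * p > 0 by [apply: mulr_gt0; lra]; move=> h; lra.
Qed.

Lemma turnE x : x / pi * (pi *+ 2) = 2 * x.
Proof. by rewrite -(mulr_natr pi) mulrA divfK ?gt_eqF ?pi_gt0 // mulrC. Qed.

Lemma same_direction a b : cos a = cos b -> sin a = sin b -> exists m : int, a - b = m%:~R * (pi *+ 2) :> R.
Proof.
move=> hc hs; have hp := pi_gt0 R; have hp2 : (pi *+ 2 : R) != 0 by rewrite mulrn_eq0 /= gt_eqF.
pose x := (a - b) / (pi *+ 2); have hx : a - b = x * (pi *+ 2) by rewrite /x divfK.
have hcos : cos (fpart x * (pi *+ 2)) = 1 by rewrite -(cos_turns _ (Num.floor x)) -fpart_turns -hx cosB hc hs -!expr2 cos2Dsin2.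
have /andP[h0 h1] := fpart_itv x.
suff hf : fpart x = 0 by exists (Num.floor x); rewrite hx fpart_turns hf mul0r add0r.
have hin y : 0 <= y <= 2^-1 -> cos (y * (pi *+ 2)) = 1 -> y = 0.
  move=> hy h; have : y * (pi *+ 2) = 0.
    apply: cos_inj; rewrite ?cos0 // ?in_itv /= ?lexx ?(ltW hp) //.
    move: (pi : R) hp => p hp; rewrite -mulr_natr; apply/andP; split; first by apply: mulr_ge0; lra.
    by have : 0 <= (1 - y * 2) * p by [apply: mulr_ge0; lra]; move=> h'; lra.
  by move/eqP; rewrite mulf_eq0 (negbTE hp2) orbF => /eqP.
case: (leP (fpart x) 2^-1) => h2; first by apply: hin => //; rewrite h0.
have : 1 - fpart x = 0.
  apply: hin; first by apply/andP; split; lra.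
  have -> : (1 - fpart x) * (pi *+ 2) = - (fpart x * (pi *+ 2) + (-1)%:~R * (pi *+ 2)) by rewrite rmorphN1; ring.
  by rewrite cosN cos_turns.
by move=> e; lra.
Qed.

End FractionalParts.

(** * Corner angles of tiles and angle sums at vertices *)

Section CornerAngles.
Variables (R : realType) (N : nat) (z0 : R * R) (v : nat -> R * R) (nT : nat).
Variables (tiles : 'I_nT -> tile R) (col : R * R -> bool) (tau : nat -> nat).
Hypotheses (HT : rhombus_tiling N z0 v tiles col) (Htau : is_pairing N z0 v tiles tau).
Local Notation n := (2 * N)%N.
Local Notation pt := (R * R)%type.
Local Notation D := (tdart nT).
Local Notation tdir := (tdir tiles).
Local Notation tfrom := (tfrom tiles).
Local Notation tto := (tto tiles).
Local Notation mate := (mate tiles).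
Local Notation tnext := (tnext tiles).
Local Notation lab := (lab HT Htau).
Local Notation partner := (partner HT Htau).
Local Notation sdart := (sdart HT Htau).
Local Notation wv := (@wv R N z0 v).
Local Notation vv := (@vv R N v).

Variable th : 'I_n -> R.
Hypothesis Hv : forall i, vv i = (cos (2 * th i), - sin (2 * th i)).

Lemma cross_vv i j : pcross (vv i) (vv j) = sin ((th i - th j) / pi * (pi *+ 2)).
Proof.
by rewrite turnE mulrBr !Hv /pcross /= sinB; ring.
Qed.

Lemma partner_angle i : exists m : int, (th (partner i) - th i) / pi = m%:~R + 2^-1.
Proof.
have hp : (pi : R) != 0 by rewrite gt_eqF ?pi_gt0.
have : vv (partner i) = pscale (-1) (vv i) by exact: vv_partner.
rewrite !Hv /pscale /= => -[h1 h2].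
have h1' : cos (2 * th (partner i)) = cos (2 * th i + pi) by rewrite cosDpi h1 mulN1r.
have h2' : sin (2 * th (partner i)) = sin (2 * th i + pi) by rewrite sinDpi; move: h2; rewrite mulN1r opprK => <-; rewrite opprK.
have [m hm] := same_direction h1' h2'; exists m.
by apply: (mulIf hp); rewrite divfK //; move: hm; rewrite -mulr_natr => hm; move: hm hp; move: (pi : R) => p hm hp; lra.
Qed.

(** The interior angle of the tile at the tail of [d], in full turns; in a rhombus it equals the
    turning angle at the head. *)
Definition corner (d : D) : R := fpart ((th (lab d) - th (lab (tnext d))) / pi).

Lemma corner_itv d : 0 < corner d < 2^-1.
Proof.
by apply: sin_pos_fpart; rewrite -cross_vv -!(tdir_lab HT Htau) cross_next; exact: (tarea_gt0 HT).
Qed.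

Lemma tnext_lab2 d : lab (tnext (tnext d)) = partner (lab d).
Proof. by rewrite tnext2 lab_topp. Qed.

Lemma corner_pair d : corner d + corner (tnext d) = 2^-1.
Proof.
have h1 := corner_itv d; have h2 := corner_itv (tnext d).
have [m hm] := partner_angle (lab d).
have [k hk] : exists k : int, corner d + corner (tnext d) = k%:~R - 2^-1.
  exists (- m - Num.floor ((th (lab d) - th (lab (tnext d))) / pi) - Num.floor ((th (lab (tnext d)) - th (lab (tnext (tnext d)))) / pi)).
  rewrite /corner /fpart !intrB intrN tnext_lab2; move: hm; rewrite !mulrBl; move: (Num.floor _) (Num.floor _) => a b hm; lra.
have : (k - 1 = 0)%R by apply: (@int_small R); rewrite intrB; lra.
by move=> e; have e1 : k = 1 by [lia]; rewrite hk e1 mulr1z; lra.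
Qed.

Lemma sum_tnext (V : zmodType) (F : D -> V) : \sum_d F (tnext d) = \sum_d F d.
Proof. by rewrite [RHS](reindex_inj (@tnext_inj R nT tiles)). Qed.
Lemma card_tdart : #|{: D}| = (4 * nT)%N.
Proof. by rewrite !card_prod card_bool card_ord mulnC. Qed.

Lemma sum_corner : \sum_d corner d = nT%:R.
Proof.
have h : \sum_d corner d + \sum_d corner d = 2 * nT%:R.
  rewrite -{2}(sum_tnext corner) -big_split /= (eq_bigr (fun=> 2^-1)); last by move=> d _; exact: corner_pair.
  by rewrite sumr_const card_tdart -[LHS]mulr_natr natrM; field.
by lra.
Qed.

Section Base.
Variable phi : R.
Definition offset i : R := fpart ((th i - phi) / pi).
(** True when the direction of parameter [phi] lies in the corner at the tail of [d], the edge [d]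
    included and the other edge excluded. *)
Definition wraps (d : D) : bool := offset (lab d) < offset (lab (tnext d)).

Lemma corner_offset d : corner d = offset (lab d) - offset (lab (tnext d)) + (wraps d)%:R.
Proof. by rewrite /corner /wraps /offset -fpart_sub; congr fpart; rewrite -mulrBl; congr (_ / _); ring. Qed.
Let u : pt := (cos (2 * phi), - sin (2 * phi)).
Let ro : pt := (sin (2 * phi), cos (2 * phi)).

Lemma cross_base i : pcross (vv i) u = sin ((th i - phi) / pi * (pi *+ 2)).
Proof.
by rewrite turnE mulrBr Hv /pcross /u /= sinB; ring.
Qed.

(** Two corners at one vertex that contain a common direction belong to overlapping tiles. The
    direction is turned slightly, to [u'], so that it is interior to both even when it was an
    edge. *)
Lemma wraps_enter d d' : wraps d -> wraps d' -> tfrom d = tfrom d' -> d = d'.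
Proof.
move=> hd hd' hx.
pose l := [seq (pcross (vv i) u, pcross (vv i) ro) | i : 'I_n].
have [h /andP[h0 _] hl] := small_step l; pose u' := padd u (pscale h ro).
have hcross i : pcross (vv i) u' = pcross (vv i) u + h * pcross (vv i) ro by rewrite pcrossDr pcrossZr.
have hsmall i : pcross (vv i) u != 0 -> h * `|pcross (vv i) ro| < `|pcross (vv i) u|.
  by apply: (hl (pcross (vv i) u, pcross (vv i) ro)); apply/mapP; exists i; rewrite ?mem_enum.
have hpos i : 0 < pcross (vv i) u -> 0 < pcross (vv i) u'.
  move=> hi; have := hsmall i (lt0r_neq0 hi); rewrite (gtr0_norm hi) hcross.
  have : - (h * `|pcross (vv i) ro|) <= h * pcross (vv i) ro by rewrite -mulrN ler_pM2l // lerNl -normrN ler_norm.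
  by move: (h * _) (h * _) (pcross (vv i) u) => a b e; lra.
have hneg i : pcross (vv i) u < 0 -> pcross (vv i) u' < 0.
  move=> hi; have := hsmall i (ltr0_neq0 hi); rewrite (ltr0_norm hi) hcross.
  have : h * pcross (vv i) ro <= h * `|pcross (vv i) ro| by rewrite ler_pM2l // ler_norm.
  by move: (h * _) (h * _) (pcross (vv i) u) => a b e; lra.
have hent e : wraps e -> enters tiles e.1 (tfrom e) u'.
  move=> he; have hc := corner_itv e; have := corner_offset e; rewrite he => hoff.
  have hp := fpart_itv ((th (lab e) - phi) / pi); have hq := fpart_itv ((th (lab (tnext e)) - phi) / pi).
  have hA := tarea_gt0 HT e.1; have hX := cross_next tiles e.
  have c1 : 0 < pcross (tdir e) u'.
    rewrite (tdir_lab HT Htau); have [hz|hz] := eqVneq (offset (lab e)) 0.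
      have hvu : vv (lab e) = u.
        rewrite Hv; have e1 : 2 * th (lab e) = 2 * phi + (Num.floor ((th (lab e) - phi) / pi))%:~R * (pi *+ 2).
          by move: hz; rewrite /offset /fpart => /eqP; rewrite subr_eq0 => /eqP <-; rewrite turnE; ring.
        by rewrite e1 cos_turns sin_turns.
      rewrite hcross hvu pcrossxx add0r mulr_gt0 // /pcross /u /ro /= mulNr opprK -!expr2 cos2Dsin2 //.
    apply: hpos; rewrite cross_base; apply: fpart_sin_pos.
    have hz' : 0 < fpart ((th (lab e) - phi) / pi) by rewrite lt_neqAle eq_sym hz; case/andP: hp.
    move: hz' hoff hc hp hq; rewrite /offset /=.
    by move: (fpart _) (fpart _) (corner e) => a b k; lra.
  have c2 : pcross (tdir (tnext e)) u' < 0.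
    rewrite (tdir_lab HT Htau); apply: hneg; rewrite -oppr_gt0 cross_base -sinN -mulNr; apply: fpart_sin_pos.
    rewrite (@fpart_unique R _ (1 - offset (lab (tnext e))) (- Num.floor ((th (lab (tnext e)) - phi) / pi) - 1)).
    - by move: hoff hc hp hq; rewrite /offset /=; move: (fpart _) (fpart _) (corner e) => a b k; lra.
    - by rewrite /offset /fpart intrB intrN; ring.
    - by move: hoff hc hp hq; rewrite /offset /=; move: (fpart _) (fpart _) (corner e) => a b k; lra.
  have ez : tfrom e = padd (tfrom e) (pscale 0 (tdir e)) by point_ring.
  move=> e' he'; have [v1 v2 v3 v4] := side_values tiles e 0; rewrite -ez in v1 v2 v3 v4.
  case: (tile_dart_cases tiles (esym he')) => ->; rewrite ?v1 ?v2 ?v3 ?v4; [by []| | |].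
  - by apply: pos_enters; rewrite subr0 mul1r.
  - exact: pos_enters.
  - by rewrite mul0r tdir_topp pcrossZl; split; [|move=> _; lra].
have hi : d.1 = d'.1 by apply: (enters_unique HT (hent _ hd)); rewrite hx; exact: hent.
have hA := tarea_gt0 HT d.1; have hX := cross_next tiles d.
have hzero (y : pt) : tfrom d = padd (tfrom d) y -> y = (0, 0).
  by rewrite /padd => h'; have := congr1 fst h'; have := congr1 snd h' => /= k1 k2; apply: pt_eq => /=; lra.
case: (tile_dart_cases tiles hi) => // e; exfalso; move: hx; rewrite e.
- rewrite tail_next tto_dir => /hzero h'; move: hX; rewrite h' /pcross /= !mul0r subrr => h''; lra.
- rewrite tail_topp tto_dir => h'.
  have h2 : padd (tdir d) (tdir (tnext d)) = (0, 0).
    by apply: hzero; rewrite {1}h'; apply: pt_eq; rewrite /padd /=; ring.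
  have : pcross (tdir d) (padd (tdir d) (tdir (tnext d))) = 0 by rewrite h2 /pcross /=; ring.
  by rewrite pcrossDr pcrossxx hX; lra.
- rewrite tail_topp tto_dir !tail_next tnext2 !tdir_topp tto_dir => h'.
  have h2 : tdir (tnext d) = (0, 0).
    by apply: hzero; rewrite {1}h'; apply: pt_eq; rewrite /padd /pscale /=; ring.
  by move: hX; rewrite h2 /pcross /= !mulr0 subrr => h''; lra.
Qed.

Lemma wraps_le1 x : \sum_(d | tfrom d == x) (wraps d)%:R <= 1 :> R.
Proof.
case: (pickP (fun d => (tfrom d == x) && wraps d)) => [d0 /andP[/eqP h0 hw]|h].
  rewrite (bigD1 d0) ?h0 //= hw big1 ?addr0 // => d /andP[/eqP hd hne].
  case hwd: (wraps d) => //; move/negP: hne; case; apply/eqP/wraps_enter => //; by rewrite hd.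
by rewrite big1 ?ler01 // => d hd; have := h d; rewrite hd /= => ->.
Qed.

(** A corner is a difference of offsets plus [wraps]; around a vertex the offsets cancel across
    glued sides, and boundary sides at [x] remain. *)
Lemma vertex_angle x : \sum_(d | tfrom d == x) corner d = \sum_(d | tfrom d == x) (wraps d)%:R +
  \sum_i ((if wv (ordS i) == x then offset (partner i) else 0) - (if wv i == x then offset i else 0)).
Proof.
pose F (d : D) : R := (if tfrom d == x then offset (lab d) else 0) - (if tto d == x then offset (partner (lab d)) else 0).
have hF d d' : mate d = Some d' -> F d' = - F d.
  by move=> h; have /(mateP HT)[e1 e2] := h; rewrite /F e1 e2 (lab_mate HT Htau h) partnerK opprB.
have := sum_unmated HT Htau hF.
rewrite [RHS](eq_bigr (fun i => (if wv (ordS i) == x then offset (partner i) else 0) - (if wv i == x then offset i else 0))); last first.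
  by move=> i _; rewrite /F tail_sdart head_sdart -/(partner i) partnerK.
move=> <-; rewrite /F [X in _ = _ + X]sumrB.
have -> : \sum_d (if tto d == x then offset (partner (lab d)) else 0) = \sum_d (if tfrom d == x then offset (lab (tnext d)) else 0).
  rewrite -[RHS]sum_tnext; apply: eq_bigr => d _; by rewrite tail_next tnext_lab2.
rewrite -!big_mkcond -sumrB -big_split /=; apply: eq_bigr => d _; rewrite corner_offset; ring.
Qed.

Lemma vertex_angle_wv i : \sum_(d | tfrom d == wv (ordS i)) corner d =
  \sum_(d | tfrom d == wv (ordS i)) (wraps d)%:R + (offset (partner i) - offset (ordS i)).
Proof.
rewrite vertex_angle; congr (_ + _); rewrite [LHS]sumrB -!big_mkcond /=; congr (_ - _).
  by rewrite (big_pred1 i) // => j; rewrite /= (inj_eq (wv_inj HT)) (inj_eq (@ordS_inj _)).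
by rewrite (big_pred1 (ordS i)) // => j; rewrite /= (inj_eq (wv_inj HT)).
Qed.

End Base.

Lemma vertex_angle_gt0 d0 : 0 < \sum_(d | tfrom d == tfrom d0) corner d.
Proof.
rewrite (bigD1 d0) //= ltr_pwDl //; first by case/andP: (corner_itv d0).
by apply: sumr_ge0 => d _; case/andP: (corner_itv d) => /ltW.
Qed.

(** By [vertex_angle] the sum is an integer; it is positive, and at most 1 by [wraps_le1]. *)
Lemma interior_vertex_angle d0 : (forall i, wv i <> tfrom d0) -> \sum_(d | tfrom d == tfrom d0) corner d = 1.
Proof.
move=> hb; have := vertex_angle 0 (tfrom d0); rewrite [X in _ + X]big1 ?addr0; last first.
  by move=> i _; do 2 (case: eqP => [/hb|_] //); rewrite subr0.
move=> e; have := vertex_angle_gt0 d0; have := wraps_le1 0 (tfrom d0); rewrite e.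
rewrite -natr_sum; case: (\sum_(_ | _) _)%N => [|[|k]] //; first by rewrite ltxx.
by rewrite (ler_nat R k.+2 1).
Qed.

(** With [phi] the parameter of [partner i], whose offset then vanishes, the sum is at most 1 minus
    the offset of the next side. That offset is not 0 because consecutive sides do not double
    back. *)
Lemma boundary_vertex_angle i : 0 < \sum_(d | tfrom d == wv (ordS i)) corner d < 1.
Proof.
have h0 := vertex_angle_gt0 (sdart i); rewrite tail_sdart in h0; rewrite h0 /=.
rewrite (vertex_angle_wv (th (partner i))).
have hw := wraps_le1 (th (partner i)) (wv (ordS i)).
have -> : offset (th (partner i)) (partner i) = 0 by rewrite /offset subrr mul0r /fpart floor0 subr0.
have /andP[h1 _] := fpart_itv ((th (ordS i) - th (partner i)) / pi).
have h2 : offset (th (partner i)) (ordS i) != 0.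
  apply/negP => /eqP h; apply: (vv_turn HT (i := i)); rewrite -(vv_partner HT Htau) -/(vv _).
  have e1 : 2 * th (ordS i) = 2 * th (partner i) + (Num.floor ((th (ordS i) - th (partner i)) / pi))%:~R * (pi *+ 2).
    by move: h; rewrite /offset /fpart => /eqP; rewrite subr_eq0 => /eqP <-; rewrite turnE; ring.
  by rewrite [LHS]Hv [RHS]Hv e1 cos_turns sin_turns.
have h3 : 0 < offset (th (partner i)) (ordS i) by rewrite lt_neqAle eq_sym h2.
by move: hw h3; move: (\sum_(_ | _) _) (offset _ _) => a b; lra.
Qed.

End CornerAngles.

(** * Euler's formula for the tiling, obtained from angle sums *)

Section TilingEuler.
Variables (R : realType) (N : nat) (z0 : R * R) (v : nat -> R * R) (nT : nat).
Variables (tiles : 'I_nT -> tile R) (col : R * R -> bool) (tau : nat -> nat).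
Hypotheses (HT : rhombus_tiling N z0 v tiles col) (Htau : is_pairing N z0 v tiles tau).
Local Notation pt := (R * R)%type.
Local Notation n := (2 * N)%N.
Local Notation D := (tdart nT).
Local Notation tdir := (tdir tiles).
Local Notation tfrom := (tfrom tiles).
Local Notation tto := (tto tiles).
Local Notation mate := (mate tiles).
Local Notation tnext := (tnext tiles).
Local Notation lab := (lab HT Htau).
Local Notation partner := (partner HT Htau).
Local Notation sdart := (sdart HT Htau).
Local Notation wv := (@wv R N z0 v).
Local Notation vv := (@vv R N v).

(** Selects one dart from each glued pair, so that sides can be counted and oriented. *)
Definition mate_last (d : D) : bool := if mate d is Some d' then (enum_rank d < enum_rank d')%N else true.
Definition tedge := {d : D | d \in mate_last}.
Definition tvertex := seq_sub [seq tfrom d | d : D].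
Lemma tvertex_subproof d : tfrom d \in [seq tfrom d | d : D].
Proof. by apply/mapP; exists d; rewrite ?mem_enum. Qed.
Definition tv (d : D) : tvertex := SeqSub (tvertex_subproof d).
Lemma tvP (x : tvertex) : exists d, x = tv d.
Proof. by case: x => x hx; have /mapP[d _ e] := hx; exists d; apply: val_inj. Qed.
Lemma tv_eq d d' : (tv d == tv d') = (tfrom d == tfrom d').
Proof. by []. Qed.

Definition edge_from (e : tedge) := tv (val e).
Definition edge_to (e : tedge) := tv (tnext (val e)).
Definition edge_left (e : tedge) : option 'I_nT := Some (val e).1.
Definition edge_right (e : tedge) : option 'I_nT := omap fst (mate (val e)).

Lemma mate_neq d d' : mate d = Some d' -> d != d'.
Proof.
move=> /(mateP HT)[h1 h2]; apply/negP => /eqP e; rewrite -e tto_dir in h1.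
have := tdir_neq0 HT d; have k1 := congr1 fst h1; have k2 := congr1 snd h1; move: k1 k2; rewrite /padd /= => k1 k2.
have -> : (tdir d).1 = 0 by move: k1; move: (tfrom d).1 (tdir d).1 => a b; lra.
have -> : (tdir d).2 = 0 by move: k2; move: (tfrom d).2 (tdir d).2 => a b; lra.
by rewrite expr0n addr0 ltxx.
Qed.

Lemma mate_last_mate d d' : mate d = Some d' -> mate_last d' = ~~ mate_last d.
Proof.
move=> h; rewrite /mate_last h (mate_sym HT h) -leqNgt ltn_neqAle; case: eqP => // /val_inj /enum_rank_inj e.
by have := mate_neq h; rewrite e eqxx.
Qed.

Lemma mate_lastE d : (d \in mate_last) = mate_last d. Proof. by []. Qed.

Lemma sum_edges (V : zmodType) (F : D -> V) :
  \sum_(e : tedge) (F (val e) + (if mate (val e) is Some d' then F d' else 0)) = \sum_d F d.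
Proof.
rewrite -(big_sub mate_last (fun d => F d + (if mate d is Some d' then F d' else 0))) big_split /=.
rewrite [RHS](bigID (fun d => d \in mate_last)) /=; congr (_ + _).
rewrite (bigID (fun d => mate d == None)) /= big1 ?add0r; last by move=> d /andP[_ /eqP ->].
rewrite [RHS](reindex_inj (inv_inj (mate_totalK HT))) /=; apply: eq_big => d.
  rewrite /mate_total !mate_lastE; case h: (mate d) => [d'|] /=; first by rewrite (mate_last_mate h) negbK andbT.
  by rewrite /mate_last h.
by move=> /andP[_]; rewrite /mate_total; case: (mate d).
Qed.

(** There are four darts per tile; a glued dart counts half a side and a boundary dart a whole
    one. *)
Lemma card_tedge : #|{: tedge}| = (2 * nT + N)%N.
Proof.
have h : \sum_d (2 * (mate_last d)%:R - 1 : R) = \sum_(i < n) 1.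
  rewrite (sum_unmated HT Htau); last first.
    by move=> d d' h; rewrite (mate_last_mate h); case: mate_last => /=; ring.
  by apply: eq_bigr => i _; rewrite /mate_last sdart_unmated /=; ring.
have hc : #|{: tedge}|%:R = \sum_d (mate_last d)%:R :> R.
  by rewrite card_sig -sum1_card natr_sum big_mkcond /=; apply: eq_bigr => d _; rewrite mate_lastE; case: (mate_last d).
move: h; rewrite sumrB -mulr_sumr -hc !sumr_const card_ord card_tdart => h.
have : (2 * #|{: tedge}|)%:R = (4 * nT + 2 * N)%:R :> R by rewrite natrM natrD; lra.
by move/eqP; rewrite eqr_nat => /eqP; lia.
Qed.

Lemma tile_sum_tails (K : zmodType) (F : pt -> K) i :
  \sum_(d : D | d.1 == i) F (tfrom d) = \sum_(d : D | d.1 == i) F (tto d).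
Proof.
rewrite (reindex_inj (@tnext_inj R nT tiles)) /=; apply: eq_bigr => d _; by rewrite tail_next.
Qed.

Lemma tiling_is_complex : is_complex R edge_from edge_to edge_left edge_right.
Proof.
move=> c x; have [d0 ->] := tvP x; pose X := tfrom d0.
pose H (d : D) : R := (tto d == X)%:R - (tfrom d == X)%:R.
have hH e : (edge_to e == tv d0)%:R - (edge_from e == tv d0)%:R = H (val e) by rewrite /edge_to /edge_from !tv_eq tail_next.
have hm d d' : mate d = Some d' -> H d' = - H d.
  by move=> /(mateP HT)[e1 e2]; rewrite /H e1 e2 opprB.
rewrite (eq_bigr (fun e => ((edge_left e == c)%:R - (edge_right e == c)%:R) * H (val e))); last by move=> e _; rewrite hH.
case: c => [i|].
  pose F (d : D) := (d.1 == i)%:R * H d.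
  transitivity (\sum_d F d).
    rewrite -sum_edges; apply: eq_bigr => e _; rewrite /F /edge_left /edge_right.
    have -> : (Some (val e).1 == Some i) = ((val e).1 == i) by [].
    case h: (mate (val e)) => [d'|] /=; last by rewrite subr0 addr0.
    by rewrite (hm _ _ h) mulrBl mulrN.
  transitivity (\sum_(d : D | d.1 == i) H d).
    by rewrite [RHS]big_mkcond; apply: eq_bigr => d _; rewrite /F; case: eqP; rewrite ?mul1r ?mul0r.
  by rewrite sumrB (tile_sum_tails (fun y => (y == X)%:R)) subrr.
pose F (d : D) := - ((mate d == None)%:R * H d).
transitivity (\sum_d F d).
  rewrite -sum_edges; apply: eq_bigr => e _; rewrite /F /edge_left /edge_right.
  case h: (mate (val e)) => [d'|] /=; last by rewrite sub0r mulNr addr0.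
  by rewrite (mate_sym HT h) /= !mul0r subr0 mul0r oppr0 addr0.
rewrite (sum_unmated HT Htau); last first.
  by move=> d d' h; rewrite /F h (mate_sym HT h) /= !mul0r !oppr0.
rewrite /F (eq_bigr (fun i => (wv (ordS i) == X)%:R - (wv i == X)%:R)); last first.
  by move=> i _; rewrite sdart_unmated eqxx mul1r /H tail_sdart head_sdart opprB.
rewrite sumrB [X in X - _](_ : _ = \sum_i (wv i == X)%:R) ?subrr //.
by rewrite [RHS](reindex_inj (@ordS_inj _)).
Qed.

(** Induction on the number of tiles that remain along the chain up to the boundary. *)
Lemma dart_induction (P : D -> Prop) : (forall d i, topp d = sdart i -> P d) ->
  (forall d d', mate (topp d) = Some d' -> P d' -> P d) -> forall d, P d.
Proof.
move=> h0 hS d; have [j] := lab_ends HT Htau d; elim: j d => [|j IH] d [hj hq].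
  by apply: (h0 d (lab d)); move/exit_sideP: hq.
have hd := hj 0%N isT; apply: (hS _ _ (exit_side_noneP (HT := HT) (Htau := Htau) hd)); apply: IH.
have hl : lab (advance tiles d) = lab d by exact: lab_advance.
split; first by move=> i hi; rewrite -iterSr; apply: hj.
by rewrite -iterSr hl.
Qed.

Lemma wv_const (T : Type) (f : pt -> T) : (forall d, f (tfrom d) = f (tto d)) -> forall i j, f (wv i) = f (wv j).
Proof.
move=> h; suff hS l : f (wv (ordS l)) = f (wv l).
  suff H k (hk : (k < n)%N) : f (wv (Ordinal hk)) = f (wv (side1 HT)).
    by case=> i hi [j hj]; rewrite !H.
  elim: k hk => [|k IH] hk; first by congr (f (wv _)); exact: val_inj.
  rewrite -(IH (ltnW hk)) -(hS (Ordinal (ltnW hk))); congr (f (wv _)); apply: val_inj => /=; by rewrite modn_small.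
by have := h (sdart l); rewrite tail_sdart head_sdart.
Qed.

Lemma tail_const (T : Type) (f : pt -> T) : (forall d, f (tfrom d) = f (tto d)) -> forall d d', f (tfrom d) = f (tfrom d').
Proof.
move=> h; pose w0 := wv (side1 HT).
suff H d : f (tfrom d) = f w0 by move=> d d'; rewrite !H.
have hopp d1 : f (tfrom d1) = f (tto (topp d1)).
  have := h (tnext (topp d1)); rewrite tail_next => ->.
  by rewrite -tail_next tnext2 toppK.
apply: (dart_induction (P := fun d => f (tfrom d) = f w0)) => {d} [d i e|d d' e IH].
  by rewrite hopp e head_sdart; exact: wv_const.
by have /(mateP HT)[e1 _] := e; rewrite hopp -e1.
Qed.

Lemma tiling_connected : connected_by R edge_from edge_to.
Proof.
move=> f hf x y; have [dx ->] := tvP x; have [dy ->] := tvP y.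
pose g (z : pt) : R := if insub z is Some u then f u else 0.
have hg d : g (tfrom d) = f (tv d) by rewrite /g insubT ?tvertex_subproof // => h; congr f; exact: val_inj.
rewrite -!hg; apply: tail_const => d; rewrite -tail_next !hg.
have hl (d1 : D) : d1 \in mate_last -> f (tv d1) = f (tv (tnext d1)).
  by move=> h; exact: (hf (exist _ d1 h)).
case h: (mate_last d); first exact: hl.
case hm: (mate d) => [d'|]; last by move: h; rewrite /mate_last hm.
have h' := mate_last_mate hm; rewrite h in h'; have := hl d' h'.
have /(mateP HT)[e1 e2] := hm.
by rewrite -!hg !tail_next e1 e2 => ->.
Qed.

Lemma tiling_dual_connected : connected_by R edge_left edge_right.
Proof.
move=> f hf; suff H x : f x = f None by move=> x y; rewrite !H.
have hm d : f (Some d.1) = f (omap fst (mate d)).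
  case h: (mate_last d); first exact: (hf (exist _ d h)).
  case hm: (mate d) => [d'|]; last by move: h; rewrite /mate_last hm.
  have h' := mate_last_mate hm; rewrite h in h'; have := hf (exist _ d' h').
  by rewrite /edge_left /edge_right /= (mate_sym HT hm) => ->.
case: x => [i|] //; suff H (d : D) : f (Some d.1) = f None by exact: (H (i, (true, true))).
apply: (dart_induction (P := fun d : D => f (Some d.1) = f None)) => {d} [d j e|d d' e IH].
  by have := hm (topp d); rewrite e sdart_unmated /= -e.
by have := hm (topp d); rewrite e /= IH.
Qed.

Lemma tiling_euler_le : (#|{: tvertex}| <= nT + N + 1)%N.
Proof.
have : (#|{: tvertex}| + #|{: option 'I_nT}| <= #|{: tedge}| + 2)%N := euler_le tiling_is_complex tiling_connected tiling_dual_connected.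
by rewrite card_tedge card_option card_ord; lia.
Qed.

Variable th : 'I_n -> R.
Hypothesis Hv : forall i, vv i = (cos (2 * th i), - sin (2 * th i)).
Local Notation corner := (corner HT Htau th).
Local Notation f i := (partner (ordS i)).
(** The angle of the boundary edge [i] of the plabic graph. By [euler_and_angles], the interior
    angle of the region at the end of side [i] is 2 pi minus twice this. *)
Definition bangle i : R := th (f i) - th i + pi * (f i < i)%N%:R.
Hypothesis Hangle : forall i, bangle i <= pi.
Hypothesis Hcount : (\sum_(i < n) (f i < i) = N.+1)%N.

Lemma boundary_perm_inj : injective (fun i => f i).
Proof. by move=> i j /(inv_inj (partnerK HT Htau))/ordS_inj. Qed.

Lemma sum_bangle : \sum_i bangle i / pi = N.+1%:R.
Proof.
have hp : (pi : R) != 0 by rewrite gt_eqF ?pi_gt0.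
rewrite -mulr_suml big_split /= sumrB -mulr_sumr -natr_sum Hcount.
by rewrite [X in _ - X](reindex_inj boundary_perm_inj) /= subrr add0r mulrC mulrA mulVf ?mul1r.
Qed.

Local Notation A i := (\sum_(d | tfrom d == wv (ordS i)) corner d).

Lemma vertex_angle_int i : exists K : int, A i = K%:~R - bangle i / pi.
Proof.
have hp : (pi : R) != 0 by rewrite gt_eqF ?pi_gt0.
rewrite (vertex_angle_wv HT Htau th 0) -natr_sum.
have [m hm] := partner_angle HT Htau Hv i; have [m' hm'] := partner_angle HT Htau Hv (ordS i).
move: (\sum_(_ | _) _)%N => W.
exists (W%:Z + m + m' + 1 + (f i < i)%N%:Z - Num.floor ((th (partner i) - 0) / pi) + Num.floor ((th (ordS i) - 0) / pi)).
rewrite /offset /fpart !subr0 /bangle mulrDl [pi * _]mulrC mulfK // intrD intrB !intrD -!pmulrn.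
move: hm hm'; rewrite !mulrBl; move: (Num.floor _) (Num.floor _) => a b.
by move: (th _ / pi) (th _ / pi) (th _ / pi) (th _ / pi) => x1 x2 x3 x4; case: (_ < _)%N => /=; lra.
Qed.

(** Interior vertices have defect 0, and the corners of each tile sum to one turn. *)
Lemma sum_vertex_defect : \sum_i (A i - 1) = nT%:R - #|{: tvertex}|%:R.
Proof.
pose G (x : tvertex) : R := \sum_(d | tv d == x) corner d - 1.
have hG : \sum_x G x = nT%:R - #|{: tvertex}|%:R.
  rewrite sumrB sumr_const; congr (_ - _); rewrite -(sum_corner HT Htau Hv).
  by rewrite [RHS](partition_big tv predT).
pose B i := tv (sdart i).
have hB i : A i - 1 = G (B i) by rewrite /G /B; congr (_ - _); apply: eq_bigl => d; rewrite tv_eq tail_sdart.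
rewrite -hG (eq_bigr _ (fun i _ => hB i)) (partition_big B predT) //=; apply: eq_bigr => x _.
have [d hd] := tvP x; have [[i hi]|hx] := pselect (exists i, B i = x).
  rewrite (big_pred1 i) ?hi // => j; rewrite /= -hi /B tv_eq !tail_sdart (inj_eq (wv_inj HT)) (inj_eq (@ordS_inj _)) //.
rewrite big_pred0; last by move=> i; apply/eqP => h; apply: hx; exists i.
rewrite /G hd (eq_bigl (fun d1 => tfrom d1 == tfrom d)) ?(interior_vertex_angle HT Htau Hv) ?subrr //.
move=> i hi; apply: hx; exists (ord_pred i); apply/eqP; rewrite hd /B tv_eq tail_sdart ord_predK; exact/eqP.
Qed.

(** The integers [K i - 1] are at most 0 because the angles of the plabic graph are at most pi,
    while Euler's inequality makes their sum at least 0. So all of them vanish, and Euler's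
    inequality is an equality: the tiling is simply connected. *)
Lemma euler_and_angles : #|{: tvertex}| = (nT + N + 1)%N /\ forall i, A i = 1 - bangle i / pi.
Proof.
have /choice[K hK] := vertex_angle_int; have hp := pi_gt0 R.
have hK1 i : K i <= 1.
  have /andP[_ h] := boundary_vertex_angle HT Htau Hv i; rewrite hK in h.
  have hb : bangle i / pi <= 1 by rewrite ler_pdivrMr // mul1r.
  have : (K i)%:~R < 2%:~R :> R by move: (bangle i / pi) h hb => b; lra.
  by rewrite ltr_int; lia.
have hs := sum_vertex_defect.
have hs' : \sum_i ((K i)%:~R - 1 : R) = nT%:R + N.+1%:R - #|{: tvertex}|%:R.
  rewrite -[in RHS]sum_bangle addrAC -hs -big_split /=; apply: eq_bigr => i _; rewrite hK; lra.
have hle i : (K i)%:~R - 1 <= 0 :> R by rewrite subr_le0 -[1](mulr1z 1) ler_int.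
have hV : #|{: tvertex}| = (nT + N + 1)%N.
  apply/eqP; rewrite eqn_leq tiling_euler_le /= -(ler_nat R) !natrD -natr1 in hs' *.
  by have := sumr_le0 _ (fun i _ => hle i) : \sum_i _ <= 0; rewrite hs'; lra.
split=> // i; have h0 : \sum_i ((K i)%:~R - 1 : R) = 0 by rewrite hs' hV !natrD -natr1; lra.
have : (K i)%:~R - 1 = 0 :> R.
  apply/eqP; rewrite -oppr_eq0; apply/eqP; apply: (psumr_eq0P (P := predT) (F := fun i => - ((K i)%:~R - 1))) => //.
    by move=> j _; rewrite oppr_ge0.
  by rewrite sumrN h0 oppr0.
by rewrite hK => /eqP; rewrite subr_eq0 => /eqP ->.
Qed.

Lemma bangle_itv i : 0 < bangle i < pi.
Proof.
have [_ /(_ i) h] := euler_and_angles; have := boundary_vertex_angle HT Htau Hv i; rewrite h => hA.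
have hp := pi_gt0 R; have /andP[h1 h2] : (0 < bangle i / pi) && (bangle i / pi < 1) by move: (bangle i / pi) hA => b; lra.
by move: h1 h2; rewrite ltr_pdivrMr // mul1r pmulr_lgt0 ?invr_gt0 // => -> ->.
Qed.

(** On each tile the contributions of opposite sides cancel, so crossing the chain of [p] is a
    cocycle. Euler's formula integrates it over the corners, and the floor makes the values
    integral. *)
Theorem side_function p : exists sg : pt -> int, sg (wv (side1 HT)) = 0 /\
  forall d, sg (tto d) - sg (tfrom d) = (lab d == p)%:R - (lab d == partner p)%:R.
Proof.
pose w (d : D) : R := (lab d == p)%:R - (lab d == partner p)%:R.
have inj := inv_inj (partnerK HT Htau).
have hpart (i : 'I_n) : (partner i == p) = (i == partner p) by rewrite -(inj_eq inj) partnerK.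
have hm d d' : mate d = Some d' -> w d' = - w d.
  by move=> h; rewrite /w (lab_mate HT Htau h) hpart (inj_eq inj) opprB.
have hopp d : w (topp d) = - w d by rewrite /w lab_topp hpart (inj_eq inj) opprB.
have euler : (#|{: tvertex}| + #|{: option 'I_nT}| = #|{: tedge}| + 2)%N.
  by rewrite euler_and_angles.1 card_tedge card_option card_ord; lia.
have hcyc c : \sum_(e | edge_left e == c) w (val e) = \sum_(e | edge_right e == c) w (val e).
  apply/eqP; rewrite -subr_eq0; apply/eqP.
  rewrite big_mkcond [X in _ - X]big_mkcond -sumrB.
  case: c => [i|].
    transitivity (\sum_d (if d.1 == i then w d else 0)).
      rewrite -sum_edges; apply: eq_bigr => e _; rewrite /edge_left /edge_right.
      have -> : (Some (val e).1 == Some i) = ((val e).1 == i) by [].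
      case h: (mate (val e)) => [d'|] /=; last by rewrite subr0 addr0.
      have -> : (Some d'.1 == Some i) = (d'.1 == i) by [].
      by rewrite (hm _ _ h); case: (d'.1 == i) => //; rewrite oppr0.
    have e : \sum_(d : D) (if d.1 == i then w d else 0) = - \sum_(d : D) (if d.1 == i then w d else 0).
      rewrite {1}(reindex_inj (inv_inj (@toppK nT))) /= -sumrN; apply: eq_bigr => d _.
      by rewrite hopp; case: ifP => //; rewrite oppr0.
    by move: e; move: (\sum_(_ | _) _) => S; lra.
  transitivity (- \sum_d (if mate d == None then w d else 0)).
    rewrite -sum_edges -sumrN; apply: eq_bigr => e _; rewrite /edge_left /edge_right /=.
    case h: (mate (val e)) => [d'|] /=; last by rewrite sub0r addr0.
    by rewrite (mate_sym HT h) /= subr0 addr0 oppr0.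
  rewrite (sum_unmated HT Htau); last by move=> d d' h; rewrite h (mate_sym HT h) /= oppr0.
  rewrite (eq_bigr (fun i => (partner i == p)%:R - (partner i == partner p)%:R)); last first.
    by move=> i _; rewrite sdart_unmated eqxx /w.
  rewrite sumrB [X in X - _](_ : _ = \sum_i (partner i == partner p)%:R) ?subrr ?oppr0 //.
  by rewrite [RHS](reindex_inj inj) /=; apply: eq_bigr => i _; rewrite partnerK hpart.
have [g hg] := face_cocycle_is_coboundary tiling_is_complex tiling_connected tiling_dual_connected euler hcyc.
have hall d : w d = g (tv (tnext d)) - g (tv d).
  case h: (mate_last d); first exact: (hg (exist _ d h)).
  case hmd: (mate d) => [d'|]; last by move: h; rewrite /mate_last hmd.
  have h' := mate_last_mate hmd; rewrite h in h'; have := hg (exist _ d' h'); rewrite /edge_to /edge_from /=.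
  have /(mateP HT)[e1 e2] := hmd.
  have -> : tv (tnext d') = tv d by apply: val_inj; rewrite /= tail_next e2.
  have -> : tv d' = tv (tnext d) by apply: val_inj; rewrite /= tail_next e1.
  by rewrite (hm _ _ hmd) => h2; lra.
pose w0 := wv (side1 HT).
pose G (z : pt) : R := if insub z is Some u then g u else 0.
have hG d : G (tfrom d) = g (tv d) by rewrite /G insubT ?tvertex_subproof // => h; congr g; exact: val_inj.
exists (fun z => Num.floor (G z - G w0)); split; first by rewrite subrr floor0.
move=> d; rewrite -tail_next.
have -> : G (tfrom (tnext d)) - G w0 = (G (tfrom d) - G w0) + ((lab d == p)%:R - (lab d == partner p)%:R : int)%:~R.
  have nz (b : bool) : ((b%:R : int)%:~R : R) = b%:R by case: b.
  by have := hall d; rewrite -!hG /w intrB !nz; lra.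
by rewrite floorDrz ?intr_int // intrKfloor addrC addKr.
Qed.

End TilingEuler.

(** * Signed crossing numbers and f-crossings *)

Section FCrossing.
Variable n : nat.

Lemma modn_shift M x a : (x < M)%N -> (a < M)%N ->
  ((x + M - a) %% M = if (a <= x)%N then x - a else x + M - a)%N.
Proof.
move=> hx ha; case: leqP => h.
  have -> : (x + M - a = (x - a) + M)%N by lia.
  by rewrite modnDr modn_small //; lia.
by rewrite modn_small //; lia.
Qed.

Lemma cbetweenE a b x : (a < 3 * n)%N -> (b < 3 * n)%N -> (x < 3 * n)%N ->
  cbetween n a b x = if (a <= b)%N then (a <= x < b)%N else (a <= x)%N || (x < b)%N.
Proof.
by move=> ha hb hx; rewrite /cbetween !modn_shift //; case: (leqP a b); case: (leqP a x); lia.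
Qed.

Variables (f : 'I_n -> 'I_n) (finj : injective f) (g : nat -> nat).
Hypothesis Hg : forall s : 'I_n, g s.+1 = (f s).+1.
Local Notation src := (invF finj).

Lemma f_crossing_src (p q : 'I_n) :
  chords_cross n (pos_plus n (src p).+1) (3 * p + 2) (pos_plus n (src q).+1) (3 * q + 2) ->
  f_crossing n g p.+1 q.+1.
Proof.
move=> h; exists (src p).+1, (src q).+1; rewrite !Hg !f_invF !ltn_ord; split=> //.
have e (i : 'I_n) : pos_minus n i.+1 = (3 * i + 2)%N by rewrite /pos_minus; lia.
by rewrite !e.
Qed.

(** Both notions depend on the cyclic order of four endpoints. The case of an index equal to [n - 1]
    is separate because [pos_plus] wraps round to 1 there. *)
Lemma crossing_index_f_crossing (p q : 'I_n) : (p < q)%N -> src p != p -> src q != q ->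
  cross_index finj p q != 0 -> f_crossing n g p.+1 q.+1.
Proof.
move=> hpq hp hq hc; apply: f_crossing_src; move: hc; rewrite /cross_index.
have hne : src p != src q by rewrite (inj_eq (can_inj (f_invF finj))) neq_ltn hpq.
have := ltn_ord (src p); have := ltn_ord (src q); have := ltn_ord p; have := ltn_ord q.
move: hp hq hne; rewrite -!val_eqE /=.
move: (nat_of_ord (src p)) (nat_of_ord (src q)) (nat_of_ord p) (nat_of_ord q) hpq => a b {p}p {q}q hpq hp hq hne hq1 hp1 hb ha.
have e k : (k < n)%N -> pos_plus n k.+1 = (if k.+1 == n then 1 else 3 * k + 4)%N.
  move=> hk; rewrite /pos_plus; case: eqP => hkn.
    have -> : ((3 * k.+1).+1 = 1 + 3 * n)%N by lia.
    by rewrite modnDr modn_small //; lia.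
  by rewrite modn_small; lia.
have [A [eA hA]] : exists A, pos_plus n a.+1 = A /\ (a.+1 = n /\ A = 1 \/ a.+1 < n /\ A = 3 * a + 4)%N.
  by exists (pos_plus n a.+1); rewrite e //; case: eqP => h; split=> //; [left|right; split=> //; lia].
have [B [eB hB]] : exists B, pos_plus n b.+1 = B /\ (b.+1 = n /\ B = 1 \/ b.+1 < n /\ B = 3 * b + 4)%N.
  by exists (pos_plus n b.+1); rewrite e //; case: eqP => h; split=> //; [left|right; split=> //; lia].
rewrite eA eB => hc; rewrite /chords_cross !cbetweenE; try lia.
move: hc hA hB; case: (leqP A (3 * p + 2)) => h1 hc hA hB;
 move: hc; case: (ltnP a q); case: (ltnP p q); case: (ltnP a b); case: (leqP p b); rewrite /= => h2 h3 h4 h5 hc;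
 move: hc; rewrite ?addr0 ?subr0 ?sub0r ?subrr ?addNr ?eqxx // => _; case: hA => [[k1 k2]|[k1 k2]]; case: hB => [[k3 k4]|[k3 k4]]; lia.
Qed.

End FCrossing.

(** * Crossing chains interlace on the boundary; exact differences of parameters *)

Section Interlacing.
Variables (R : realType) (N : nat) (z0 : R * R) (v : nat -> R * R) (nT : nat).
Variables (tiles : 'I_nT -> tile R) (col : R * R -> bool) (tau : nat -> nat).
Hypotheses (HT : rhombus_tiling N z0 v tiles col) (Htau : is_pairing N z0 v tiles tau).
Local Notation pt := (R * R)%type.
Local Notation n := (2 * N)%N.
Local Notation tfrom := (tfrom tiles).
Local Notation tto := (tto tiles).
Local Notation mate := (mate tiles).
Local Notation tnext := (tnext tiles).
Local Notation lab := (lab HT Htau).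
Local Notation partner := (partner HT Htau).
Local Notation sdart := (sdart HT Htau).
Local Notation wv := (@wv R N z0 v).
Local Notation vv := (@vv R N v).

Definition side_exponent (p : 'I_n) (sg : pt -> int) := sg (wv (side1 HT)) = 0 /\
  forall d, sg (tto d) - sg (tfrom d) = (lab d == p)%:R - (lab d == partner p)%:R.

Lemma partner_vv_neq (r : 'I_n) : r = partner r -> False.
Proof.
move=> h; have := vv_partner HT Htau r; rewrite -h => e.
have := tdir_neq0 HT (sdart r); rewrite (tdir_lab HT Htau) -/(partner r) -h.
have e1 := congr1 fst e; have e2 := congr1 snd e; move: e1 e2; rewrite /pscale /=; case: (vv r) => x y /= e1 e2.
have -> : x = 0 by lra.
have -> : y = 0 by lra.
by rewrite expr0n addr0 ltxx.
Qed.

Section OneSide.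
Variables (r : 'I_n) (sg : pt -> int).
Hypothesis Hsg : side_exponent r sg.

Lemma side_exponent_step (i : 'I_n) : sg (wv (ordS i)) - sg (wv i) = (i == r)%:R - (i == partner r)%:R.
Proof.
have [_ /(_ (sdart i))] := Hsg; rewrite tail_sdart head_sdart -/(partner i).
have inj := inv_inj (partnerK HT Htau).
by rewrite -{1}[r](partnerK HT Htau) !(inj_eq inj) => h; rewrite -opprB h opprB.
Qed.

Lemma side_exponent_wv (k : 'I_n) : sg (wv k) = (r < k)%N%:R - (partner r < k)%N%:R.
Proof.
case: k => k hk; elim: k hk => [|k IH] hk.
  transitivity (sg (wv (side1 HT))); first by congr (sg (wv _)); exact: val_inj.
  by case: Hsg => -> _; rewrite /= ?ltn0 ?subrr.
have hk' : (k < n)%N by exact: ltnW.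
have := side_exponent_step (Ordinal hk'); rewrite (IH hk').
have -> : ordS (Ordinal hk') = Ordinal hk by apply: val_inj => /=; rewrite modn_small.
move/eqP; rewrite subr_eq => /eqP ->; rewrite -!val_eqE /=.
have E (x : nat) : ((x < k.+1)%N%:R : int) = (k == x)%:R + (x < k)%N%:R by rewrite ltnS; case: ltngtP.
by rewrite !E; ring.
Qed.

Lemma across d : sg (tto (topp d)) - sg (tfrom d) = (lab (tnext d) == r)%:R - (lab (tnext d) == partner r)%:R.
Proof.
have [_ /(_ (tnext (topp d)))] := Hsg; rewrite tail_next.
have -> : tto (tnext (topp d)) = tfrom d by rewrite -tail_next tnext2 toppK.
rewrite tnext_topp.
have inj := inv_inj (partnerK HT Htau).
rewrite lab_topp -{1}[r](partnerK HT Htau) !(inj_eq inj) => h; by rewrite -opprB h opprB.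
Qed.

Lemma cross_lab d : 0 < pcross (vv (lab d)) (vv (lab (tnext d))).
Proof. by rewrite -!(tdir_lab HT Htau) cross_next; exact: (tarea_gt0 HT). Qed.

(** Both chains keep their directions, so all crossings of one with the other have the same
    orientation, fixed by a cross product. The function [sg] of [r] therefore never decreases along
    the chain of [d], and it increases at [d]. *)
Lemma chain_crossed d : lab (tnext d) = r -> sg (wv (ordS (partner (lab d)))) < sg (wv (lab d)).
Proof.
move=> hr; pose q0 := lab d.
have hpos e : lab e = q0 -> sg (tfrom e) <= sg (tto (topp e)).
  move=> he; rewrite -subr_ge0 across.
  have [h|h] := eqVneq (lab (tnext e)) (partner r); last by rewrite subr0.
  exfalso; have := cross_lab e; rewrite h he (vv_partner HT Htau) pcrossZr.
  by have := cross_lab d; rewrite hr -/q0; move: (pcross _ _) => c; lra.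
have hfw e : lab e = q0 -> sg (tfrom e) <= sg (wv q0).
  apply: (dart_induction (HT := HT) (Htau := Htau) (P := fun e => lab e = q0 -> sg (tfrom e) <= sg (wv q0))) => {e} [e i he hl|e e' he IH hl].
    have hi : i = q0 by rewrite -hl; apply/esym/labP/ends_at_stop; apply/exit_sideP.
    by apply: le_trans (hpos e hl) _; rewrite he head_sdart hi.
  have [s1 s2] := exit_side_none HT Htau he; have /(mateP HT)[e1 e2] := he.
  apply: le_trans (hpos e hl) _; rewrite -e1; apply: IH.
  by rewrite -s2 lab_advance.
have hlt : sg (tfrom d) < sg (wv q0).
  have h1 : sg (tto (topp d)) - sg (tfrom d) = 1.
    rewrite across hr eqxx; case: eqP => // h; exfalso.
    exact: (partner_vv_neq h).
  have [i [he|[e' he]]] : exists i, topp d = sdart i \/ exists e', mate (topp d) = Some e'.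
    case he: (mate (topp d)) => [e'|]; first by exists q0; right; exists e'.
    by have [i hi] := unmatedP HT Htau he; exists i; left.
    have hi : i = q0 by apply/esym/labP/ends_at_stop; apply/exit_sideP.
    by move: h1; rewrite he head_sdart hi; lia.
  have [s1 s2] := exit_side_none HT Htau he; have /(mateP HT)[e1 e2] := he.
  have := hfw e'; rewrite e1 -s2 lab_advance // => /(_ (erefl _)); lia.
apply: le_lt_trans hlt; have [s [j [hd hl hj]]] := chain_start HT Htau d.
have -> : partner (lab d) = s by rewrite hl partnerK.
have hq k : (k <= j)%N -> sg (wv (ordS s)) <= sg (tfrom (iter k (advance tiles) (sdart s))) /\ lab (iter k (advance tiles) (sdart s)) = q0.
  elim: k => [|k IH] hk; first by rewrite /= tail_sdart /q0 hl.
  have [h1 h2] := IH (ltnW hk); have hex := hj k hk.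
  have /(mateP HT)[e1 e2] := exit_side_noneP hex.
  by split; [rewrite iterS e1; apply: le_trans h1 _; apply: hpos|rewrite iterS lab_advance].
by have [h _] := hq j (leqnn _); rewrite hd.
Qed.

End OneSide.

Local Notation bperm := (@boundary_perm_inj _ _ _ _ _ _ _ _ HT Htau).

Lemma src_boundary p : invF bperm p = ord_pred (partner p).
Proof. by apply: (bperm); transitivity p; [exact: (f_invF bperm p)|rewrite ord_predK partnerK]. Qed.

Lemma src_val p : (0 < partner p)%N -> invF bperm p = (partner p).-1 :> nat.
Proof.
rewrite src_boundary => h; have := ltn_ord (partner p); move: h => /=; case: (nat_of_ord (partner p)) => // k _ hk.
by rewrite addSn /= modnDr modn_small //; exact: ltnW.
Qed.

Lemma src_val0 p : (partner p = 0 :> nat) -> invF bperm p = n.-1 :> nat.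
Proof.
by rewrite src_boundary /= => ->; rewrite add0n modn_small // prednK // (sides_gt0 HT).
Qed.

Variable th : 'I_n -> R.
Hypothesis Hv : forall i, vv i = (cos (2 * th i), - sin (2 * th i)).
Hypothesis Hcomp : compatible bperm th.

(** Each cyclically adjacent pair of the four sides has a nonzero signed crossing number; the four
    corresponding inequalities form the chain. *)
Lemma interlaced_angles (a c : 'I_n) : (a < c)%N -> (c < partner a)%N -> (partner a < partner c)%N ->
  [/\ th a < th c, th c < th (partner a), th (partner a) < th (partner c) & th (partner c) < th a + pi].
Proof.
move=> h1 h2 h3; pose b := partner a; pose e := partner c.
have hb : partner b = a by rewrite /b partnerK.
have he : partner e = c by rewrite /e partnerK.
have sa : invF bperm a = b.-1 :> nat by apply: src_val; apply: leq_ltn_trans h2.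
have sc : invF bperm c = e.-1 :> nat by apply: src_val; apply: leq_ltn_trans h3.
have se : invF bperm e = c.-1 :> nat by rewrite (src_val (p := e)) he //; apply: leq_ltn_trans h1.
have sb : invF bperm b = (if nat_of_ord a == 0 then n.-1 else a.-1)%N :> nat.
  case: eqP => h; first by rewrite src_val0 ?hb.
  by rewrite (src_val (p := b)) hb // lt0n; exact/eqP.
have he1 := ltn_ord e; rewrite -/b -/e in h2 h3 *.
have E (p q : 'I_n) (k l : nat) : invF bperm p = k :> nat -> invF bperm q = l :> nat ->
    cross_index bperm p q = (k < q)%N%:R - (p < q)%N%:R - (k < l)%N%:R + (p <= l)%N%:R.
  by move=> k1 k2; rewrite /cross_index k1 k2.
have c1 : cross_index bperm a c != 0.
  by rewrite (E _ _ _ _ sa sc) h1; have -> : (b.-1 < c)%N = false by [lia]; have -> : (b.-1 < e.-1)%N by [lia]; have -> : (a <= e.-1)%N by [lia].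
have c2 : cross_index bperm c b != 0.
  rewrite (E _ _ _ _ sc sb) h2; have -> : (e.-1 < b)%N = false by [lia].
  have [h0|h0] := eqVneq (nat_of_ord a) 0%N; first by have -> : (e.-1 < n.-1)%N by [lia]; have -> : (c <= n.-1)%N by [lia].
  by have -> : (e.-1 < a.-1)%N = false by [lia]; have -> : (c <= a.-1)%N = false by [lia].
have c3 : cross_index bperm b e != 0.
  rewrite (E _ _ _ _ sb se) h3; have -> : (b <= c.-1)%N = false by [lia].
  have [h0|h0] := eqVneq (nat_of_ord a) 0%N; first by have -> : (n.-1 < e)%N = false by [lia]; have -> : (n.-1 < c.-1)%N = false by [lia].
  by have -> : (a.-1 < e)%N by [lia]; have -> : (a.-1 < c.-1)%N by [lia].
have c4 : cross_index bperm a e != 0.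
  rewrite (E _ _ _ _ sa se); have -> : (a < e)%N by [lia].
  by have -> : (b.-1 < e)%N by [lia]; have -> : (b.-1 < c.-1)%N = false by [lia]; have -> : (a <= c.-1)%N by [lia].
have hae : (a < e)%N by lia.
have /andP[q1 q2] := Hcomp h1 c1; have /andP[q3 q4] := Hcomp h2 c2.
have /andP[q5 q6] := Hcomp h3 c3; have /andP[q7 q8] := Hcomp hae c4.
by split.
Qed.

Hypothesis Hangle : forall i, bangle HT Htau th i <= pi.
Hypothesis Hcount : (\sum_(i < n) (partner (ordS i) < i) = N.+1)%N.

(** The chain from [p] crosses another chain in its first tile, and the two interlace on the
    boundary, so the two parameters differ by less than pi. Opposite directions fix the difference
    as pi/2 modulo pi. *)
Lemma opener_angle (p : 'I_n) : (p < partner p)%N -> th (partner p) = th p + pi / 2.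
Proof.
move=> hp; pose d := topp (sdart p); pose r := lab (tnext d); pose s := partner p.
have hd : lab d = p by rewrite /d lab_topp -/(partner p) partnerK.
have [sg hsg] := side_function Hv Hangle Hcount r.
have hsg' : side_exponent r sg by exact: hsg.
have hc := chain_crossed hsg' (erefl r : lab (tnext d) = r); rewrite hd in hc.
have := side_exponent_step hsg' s; rewrite -/s in hc.
rewrite !(side_exponent_wv hsg') in hc *.
have hX := cross_lab d; rewrite hd -/r in hX.
have hrp : r != p by apply/eqP => h; move: hX; rewrite h pcrossxx ltxx.
have hrs : r != s by apply/eqP => h; move: hX; rewrite h (vv_partner HT Htau) pcrossZr pcrossxx mulr0 ltxx.
have inj := inv_inj (partnerK HT Htau).
have hrp' : partner r != s by rewrite (inj_eq inj).
have hrs' : partner r != p by rewrite -[p](partnerK HT Htau) (inj_eq inj).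
rewrite [s == r]eq_sym (negbTE hrs) [s == partner r]eq_sym (negbTE hrp') subrr => /eqP; rewrite subr_eq0 => /eqP hs.
rewrite hs in hc.
have hhalf : th p < th s < th p + pi.
  (* The function [sg] of [r] takes different values at the two ends of the chain, so [p] and [s]
     separate [r] from [partner r] on the boundary. *)
  have hx : ((r < p) && (p < partner r) && (partner r < s))%N || ((p < partner r) && (partner r < s) && (s < r))%N.
    move: hc hrp hrs hrp' hrs' hp; rewrite -/s -!val_eqE /=.
    move: (nat_of_ord r) (nat_of_ord p) (nat_of_ord s) (nat_of_ord (partner r)) => r1 p1 s1 r2.
    by case: (ltngtP r1 p1); case: (ltngtP r2 p1); case: (ltngtP r1 s1); case: (ltngtP r2 s1); rewrite //=; lia.
  case/orP: hx => /andP[/andP[k1 k2] k3].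
    have [q1 q2 q3 q4] := interlaced_angles (a := r) (c := p) k1 k2 k3.
    by apply/andP; split; rewrite -/s in q3 q4; move: q1 q2 q3 q4; move: (pi : R) => P; lra.
  have [] := interlaced_angles (a := p) (c := partner r) k1 k2; first by rewrite partnerK.
  by rewrite partnerK -/s => q1 q2 q3 q4; apply/andP; split; move: q1 q2 q3 q4; move: (pi : R) => P; lra.
have [m hm] := partner_angle HT Htau Hv p.
have hpi := pi_gt0 R; have hp0 : (pi : R) != 0 by rewrite gt_eqF.
have hdiv : th s - th p = (m%:~R + 2^-1) * pi by rewrite -hm divfK.
have : m = 0.
  apply: (@int_small R); case/andP: hhalf => k1 k2.
  have l1 : 0 < (m%:~R + 2^-1) * pi :> R by rewrite -hdiv; lra.
  have l2 : (m%:~R + 2^-1) * pi < 1 * pi :> R by rewrite -hdiv mul1r; move: k2; move: (pi : R) => P; lra.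
  by move: l1 l2; rewrite pmulr_lgt0 // ltr_pM2r //; lra.
move=> h0; move: hdiv; rewrite h0 add0r -/s; move: (pi : R) => P; lra.
Qed.

End Interlacing.

(** * Harmonic functions on a network and the comparison of two networks *)

Section ResistorNetwork.
Variables (R : realType) (T : choiceType) (D M : finType) (tl : D -> T) (op : D -> D) (b : M -> T).
Hypotheses (opK : involutive op) (binj : injective b).
Implicit Types (c : D -> R) (u w : T -> R).

Definition flow c u d := c d * (u (tl (op d)) - u (tl d)).
Definition current c u x := \sum_(d | tl d == x) flow c u d.
Definition harmonic c u := forall d, (forall q, b q <> tl d) -> current c u (tl d) = 0.
(** The Dirichlet form; each edge is counted in both directions, which is the origin of the factors
    2 below. *)
Definition form c u w := \sum_d flow c u d * (w (tl (op d)) - w (tl d)).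

Lemma sum_by_points (F : D -> R) (w : T -> R) :
  (forall d0, w (tl d0) * \sum_(d | tl d == tl d0) F d = 0) -> \sum_d F d * w (tl d) = 0.
Proof.
move=> h; have hin d : tl d \in [seq tl d | d : D] by apply/mapP; exists d; rewrite ?mem_enum.
pose pv d : seq_sub [seq tl d | d : D] := SeqSub (hin d).
rewrite (partition_big pv predT) //= big1 // => -[x hx] _; have /mapP[d0 _ e] := hx.
rewrite -[RHS](h d0) mulr_sumr; apply: eq_big => d; first by rewrite -e.
by move=> /eqP/(congr1 val) /= hd; rewrite hd e mulrC.
Qed.

(** Summation by parts under [op]; points off the boundary drop out by harmonicity. *)
Lemma green c u w : (forall d, c (op d) = c d) -> harmonic c u ->
  form c u w = - 2 * \sum_q w (b q) * current c u (b q).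
Proof.
move=> hc hu; pose S := \sum_d flow c u d * w (tl d).
have h1 : form c u w = - 2 * S.
  rewrite /form; under eq_bigr do rewrite mulrBr.
  rewrite sumrB -/S (reindex_inj (inv_inj opK)) /=.
  have -> : \sum_d flow c u (op d) * w (tl (op (op d))) = - S.
    by rewrite -sumrN; apply: eq_bigr => d _; rewrite /flow opK hc; ring.
  by ring.
rewrite h1; congr (_ * _).
pose beta x : R := \sum_q (x == b q)%:R.
have -> : \sum_q w (b q) * current c u (b q) = \sum_d flow c u d * (beta (tl d) * w (tl d)).
  rewrite /current (eq_bigr (fun q => \sum_d (tl d == b q)%:R * (flow c u d * w (tl d)))); last first.
    move=> q _; rewrite mulr_sumr big_mkcond; apply: eq_bigr => d _.
    by case: eqP => [->|_]; rewrite ?mul1r ?mul0r // mulrC.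
  rewrite exchange_big; apply: eq_bigr => d _ /=; rewrite -mulr_suml -/(beta _); ring.
apply/eqP; rewrite -subr_eq0 -sumrB; apply/eqP.
rewrite (eq_bigr (fun d => flow c u d * ((1 - beta (tl d)) * w (tl d)))); last by move=> d _; ring.
apply: (sum_by_points (w := fun x => (1 - beta x) * w x)) => d0.
have [[q hq]|hq] := pselect (exists q, b q = tl d0).
  have -> : beta (tl d0) = 1.
    rewrite /beta (bigD1 q) //= hq eqxx big1 ?addr0 // => q' hne.
    by case: eqP => // e; move/negP: hne; case; apply/eqP/binj; rewrite hq.
  by rewrite subrr !mul0r.
have -> : \sum_(d | tl d == tl d0) flow c u d = 0 by apply: hu => q e; apply: hq; exists q.
by rewrite mulr0.
Qed.

(** Green's identity with [w = u] makes the energy vanish, hence each of its terms. *)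
Lemma harmonic_zero c u : (forall d, 0 <= c d) -> (forall d, c (op d) = c d) -> harmonic c u ->
  (forall q, u (b q) = 0) -> forall d, flow c u d = 0.
Proof.
move=> h0 hc hu hb; have := green u hc hu; rewrite big1 ?mulr0; last by move=> q _; rewrite hb mul0r.
rewrite /form /flow => h d.
have := psumr_eq0P (F := fun d => c d * (u (tl (op d)) - u (tl d)) * (u (tl (op d)) - u (tl d))) (P := predT) _ h.
move=> /(_ _ d isT); rewrite -mulrA -expr2 => h'; have {h'} : c d * (u (tl (op d)) - u (tl d)) ^+ 2 = 0.
  by apply: h' => e _; rewrite -mulrA -expr2 mulr_ge0 // sqr_ge0.
by move/eqP; rewrite mulf_eq0 expf_eq0 /= => /orP[]/eqP ->; rewrite ?mul0r ?mulr0.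
Qed.

Section Comparison.
Variables (c c' : D -> R) (u h : T -> R) (p q : M) (c0 S : R).
Hypotheses (hc : forall d, c (op d) = c d) (hc' : forall d, c' (op d) = c' d).
Hypotheses (hu : harmonic c u) (hh : harmonic c' h).
Hypotheses (up : forall r, u (b r) = (r == p)%:R) (hq : forall r, h (b r) = (r == q)%:R).
Hypotheses (c0_gt0 : 0 < c0) (c'_ge0 : forall d, 0 <= c' d) (c'S : \sum_d c' d <= S).

Lemma sum_delta (F : M -> R) r : \sum_s (s == r)%:R * F s = F r.
Proof. by rewrite (bigD1 r) //= eqxx mul1r big1 ?addr0 // => s /negbTE ->; rewrite mul0r. Qed.

(** Dirichlet's principle: the harmonic function has no more energy than the indicator [chi] of the
    point [b q], whose energy is at most the total conductance. *)
Lemma energy_le : \sum_d c' d * (h (tl (op d)) - h (tl d)) ^+ 2 <= S.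
Proof.
pose chi x : R := (x == b q)%:R.
have e1 : form c' h h = - 2 * current c' h (b q).
  by rewrite green //; congr (_ * _); under eq_bigr do rewrite hq; rewrite sum_delta.
have e2 : form c' h chi = - 2 * current c' h (b q).
  rewrite green //; congr (_ * _); under eq_bigr do rewrite /chi (inj_eq binj); by rewrite sum_delta.
have e3 : form c' h h = \sum_d c' d * (h (tl (op d)) - h (tl d)) ^+ 2.
  by apply: eq_bigr => d _; rewrite /flow -mulrA -expr2.
have e4 : 2 * form c' h chi <= form c' h h + form c' chi chi.
  rewrite /form mulr_sumr -big_split /=; apply: ler_sum => d _; rewrite /flow.
  move: (h (tl (op d)) - h (tl d)) (chi (tl (op d)) - chi (tl d)) => x y.
  have := mulr_ge0 (c'_ge0 d) (sqr_ge0 (x - y)); move: (c' d) => k; rewrite expr2; lra.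
have e5 : form c' chi chi <= \sum_d c' d.
  apply: ler_sum => d _; rewrite /flow -mulrA ler_piMr // /chi.
  by case: (_ == _); case: (_ == _); rewrite /=; lra.
rewrite -e3; apply: le_trans c'S; apply: le_trans e5; move: e4; rewrite e2 -e1.
by move: (form c' h h) (form c' chi chi) => x y; lra.
Qed.

(** Reciprocity across two networks: both currents come from Dirichlet forms of the same pair of
    functions, and these forms differ by [c' - c]. The differences of [u] are bounded by [B], those
    of [h] by the energy wherever the conductances differ. *)
Lemma current_compare (B : R) : (forall d, c d != c' d -> c0 <= c' d) ->
  (forall d, `|u (tl (op d)) - u (tl d)| <= B) ->
  2 * `|current c' h (b p) - current c u (b q)| <= (1 + S / c0) * B * \sum_d `|c' d - c d|.
Proof.
move=> hc0 hB.
have e1 : form c' h u = - 2 * current c' h (b p).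
  by rewrite green //; congr (_ * _); under eq_bigr do rewrite up; rewrite sum_delta.
have e2 : form c u h = - 2 * current c u (b q).
  by rewrite green //; congr (_ * _); under eq_bigr do rewrite hq; rewrite sum_delta.
have -> : 2 * `|current c' h (b p) - current c u (b q)| = `|form c' h u - form c u h|.
  rewrite e1 e2 -mulrBr normrM; congr (_ * _); by rewrite normrN ger0_norm.
rewrite /form -sumrB mulr_sumr; apply: le_trans (ler_norm_sum _ _ _) _; apply: ler_sum => d _.
have -> : flow c' h d * (u (tl (op d)) - u (tl d)) - flow c u d * (h (tl (op d)) - h (tl d)) =
   (h (tl (op d)) - h (tl d)) * (u (tl (op d)) - u (tl d)) * (c' d - c d) by rewrite /flow; ring.
rewrite !normrM; have [->|hd] := eqVneq (c d) (c' d); first by rewrite subrr normr0 !mulr0.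
apply: ler_wpM2r => //; apply: ler_pM => //.
have hc1 := hc0 _ hd; set x := h (tl (op d)) - h (tl d).
have hx : c0 * x ^+ 2 <= S.
  apply: le_trans energy_le; apply: le_trans (_ : c' d * x ^+ 2 <= _); first by apply: ler_wpM2r => //; exact: sqr_ge0.
  by rewrite (bigD1 d) //= lerDl sumr_ge0 // => e _; rewrite mulr_ge0 // sqr_ge0.
have hx2 : x ^+ 2 <= S / c0 by rewrite ler_pdivlMr // mulrC.
(* The inequality [|x| <= 1 + x ^+ 2] avoids a square root and is the origin of the factor
   [1 + S / c0]. *)
apply: le_trans (_ : 1 + x ^+ 2 <= _); last by rewrite lerD2l.
rewrite -real_normK ?num_real //; have := sqr_ge0 (`|x| - 1); have := normr_ge0 x; move: `|x| => y; rewrite !expr2; nra.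
Qed.

End Comparison.
End ResistorNetwork.

(** * The black network of the tiling and discrete holomorphic functions *)

Section TilingNetwork.
Variables (R : realType) (N : nat) (z0 : R * R) (v : nat -> R * R) (nT : nat).
Variables (tiles : 'I_nT -> tile R) (col : R * R -> bool) (tau : nat -> nat).
Hypotheses (HT : rhombus_tiling N z0 v tiles col) (Htau : is_pairing N z0 v tiles tau).
Local Notation pt := (R * R)%type.
Local Notation n := (2 * N)%N.
Local Notation D := (tdart nT).
Local Notation tdir := (tdir tiles).
Local Notation tfrom := (tfrom tiles).
Local Notation tto := (tto tiles).
Local Notation mate := (mate tiles).
Local Notation tnext := (tnext tiles).
Local Notation sdart := (sdart HT Htau).
Local Notation wv := (@wv R N z0 v).

Definition dart_corner (t : tile R) (pos c o : bool) : pt :=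
  if pos then (if c then (if o then corner1 t else corner3 t) else (if o then corner2 t else corner0 t))
  else (if c then (if o then corner2 t else corner0 t) else (if o then corner3 t else corner1 t)).

Lemma tfromE i c o : tfrom (i, (c, o)) = dart_corner (tiles i) (ccw tiles i) c o.
Proof.
rewrite /tfrom /tends /forward /tile_side /side_org /dart_corner /=.
by case: ccw; case: c; case: o; rewrite //=; apply: pt_eq; rewrite /padd /=; ring.
Qed.

Lemma col_alternates d : col (tto d) = ~~ col (tfrom d).
Proof.
case: d => i [c o]; rewrite -tail_next /tnext /= !tfromE.
have [_ _ _ _ [_ _ _ /(_ i)[h1 h2 h3] _]] := HT; move: h1 h2 h3.
rewrite /dart_corner; case: ccw; case: c; case: o => /= -> ->;
  by case: (col (corner2 _)); case: (col (corner3 _)).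
Qed.

Lemma col_topp d : col (tfrom (topp d)) = col (tfrom d).
Proof. by rewrite -(tnext2 tiles) tail_next col_alternates tail_next col_alternates negbK. Qed.

Lemma conductance_dart d : col (tfrom d) -> conductance col (tiles d.1) =
  pnorm (psub (tdir d) (tdir (tnext d))) / pnorm (padd (tdir d) (tdir (tnext d))).
Proof.
case: d => i [c o]; rewrite tfromE /conductance /tdir /tnext /forward /side_dir /dart_corner /=.
have [_ _ _ _ [_ _ _ /(_ i)[h1 h2 h3] _]] := HT; move: h1 h2 h3.
case: ccw; case: c; case: o => /= -> -> h3 hb; rewrite ?hb ?(negbTE h3) ?h3 ?(esym h3) //;
 try (move: h3; rewrite hb; case: (col _) => //= _);
 congr (_ / _); rewrite /pnorm; congr (Num.sqrt _); rewrite /psub /padd /pscale /=; ring.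
Qed.

Lemma inflow_darts (c : D -> R) (u : pt -> R) x : col x ->
  (forall d, col (tfrom d) -> c d = conductance col (tiles d.1)) ->
  inflow tiles col u x = current tfrom (@topp nT) c u x.
Proof.
move=> hx hc; rewrite /inflow /current big_mkcond [X in _ + X]big_mkcond -big_split [RHS]big_mkcond [RHS]sum_darts.
apply: eq_bigr => i _; rewrite !big_bool /=.
have e c1 o1 : (if tfrom (i, (c1, o1)) == x then flow tfrom (@topp nT) c u (i, (c1, o1)) else 0) =
   if tfrom (i, (c1, o1)) == x then conductance col (tiles i) * (u (tfrom (i, (c1, ~~ o1))) - u x) else 0.
  by case: eqP => // h; rewrite /flow hc ?h.
rewrite !e !tfromE /dart_corner /bdiag; have [_ _ _ _ [_ _ _ /(_ i)[h1 h2 h3] _]] := HT.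
have hw y : col y = false -> (y == x) = false by move=> hy; apply/eqP => h; move: hy; rewrite h hx.
case hb: (col (corner0 (tiles i))) => /=.
  have h1' : col (corner1 (tiles i)) = false by move: h3; rewrite hb; case: (col _).
  have h3' : col (corner3 (tiles i)) = false by rewrite -h2.
  by case: ccw => /=; rewrite (hw _ h1') (hw _ h3') ?addr0 ?add0r // addrC.
have h2' : col (corner2 (tiles i)) = false by rewrite -h1.
by case: ccw => /=; rewrite (hw _ hb) (hw _ h2') ?addr0 ?add0r // addrC.
Qed.

Lemma col_wv_step i : col (wv (ordS i)) = ~~ col (wv i).
Proof. by have := col_alternates (sdart i); rewrite tail_sdart head_sdart => ->; rewrite negbK. Qed.

Lemma col_wv (j : 'I_n) : col (wv j) = odd j.
Proof.
have hn := tiling_n_gt1 HT.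
have h1 : col (wv (Ordinal hn)).
  by have [_ _ _ _ [_ _ _ _ /(_ 1%N)]] := HT; apply; lia.
have h0 : col (wv (side1 HT)) = false.
  have := col_wv_step (side1 HT).
  have -> : ordS (side1 HT) = Ordinal hn by apply: val_inj; rewrite /= modn_small.
  by rewrite h1; case: (col _).
case: j => k hk /=; elim: k hk => [|k IH] hk.
  by transitivity (col (wv (side1 HT))); [congr (col (wv _)); exact: val_inj|exact: h0].
have hk' : (k < n)%N by exact: ltnW.
by rewrite /= -(IH hk') -col_wv_step; congr (col (wv _)); apply: val_inj; rewrite /= modn_small.
Qed.

Definition bvert (q : 'I_N) : pt := Bvert z0 v q.+1.

Lemma bvert_subproof (q : 'I_N) : ((2 * q).+1 < n)%N. Proof. by have := ltn_ord q; lia. Qed.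
Lemma bvertE q : bvert q = wv (Ordinal (bvert_subproof q)).
Proof.
have e : (2 * q.+1).-1 = (2 * q).+1 by lia.
by rewrite /bvert /Bvert e.
Qed.
Lemma bvert_inj : injective bvert.
Proof.
move=> p q; rewrite !bvertE => /(wv_inj HT)/(congr1 val) /= h; apply: val_inj => /=; lia.
Qed.

Lemma black_boundary (j : 'I_n) : odd j -> exists q, wv j = bvert q.
Proof.
move=> hj; have hq : (j./2 < N)%N by have := ltn_ord j; have := odd_double_half j; rewrite hj; lia.
exists (Ordinal hq); rewrite bvertE; congr wv; apply: val_inj => /=.
by have := odd_double_half j; rewrite hj; lia.
Qed.

Section Holomorphic.
Variable c : D -> R.
Hypothesis c_white : forall d, ~~ col (tfrom d) -> c d = 0.

(* Discrete Cauchy-Riemann equations. *)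
Definition holomorphic (H : pt -> R) := forall d, col (tfrom d) ->
  flow tfrom (@topp nT) c H d = H (tto (topp d)) - H (tto d).

(** Around a black vertex the Cauchy-Riemann differences cancel across glued sides, so the current
    involves white values at the boundary only. *)
Lemma holomorphic_current H x : holomorphic H -> col x -> current tfrom (@topp nT) c H x =
  \sum_i ((if wv i == x then H (wv (ordS i)) else 0) - (if wv (ordS i) == x then H (wv i) else 0)).
Proof.
move=> hH hx; rewrite /current (eq_bigr (fun d => H (tto (topp d)) - H (tto d))); last first.
  by move=> d /eqP hd; apply: hH; rewrite hd.
pose F (d : D) : R := (if tto d == x then H (tfrom d) else 0) - (if tfrom d == x then H (tto d) else 0).
have hF d d' : mate d = Some d' -> F d' = - F d.
  by move=> /(mateP HT)[e1 e2]; rewrite /F e1 e2 opprB.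
have := sum_unmated HT Htau hF.
rewrite [RHS](eq_bigr (fun i => (if wv i == x then H (wv (ordS i)) else 0) - (if wv (ordS i) == x then H (wv i) else 0))); last first.
  by move=> i _; rewrite /F tail_sdart head_sdart.
move=> <-; rewrite /F sumrB [RHS]sumrB; congr (_ - _); last by rewrite big_mkcond.
rewrite big_mkcond /= -(sum_tnext tiles (fun d => if tfrom d == x then H (tto (topp d)) else 0)); apply: eq_bigr => d _.
have -> : tto (topp (tnext d)) = tfrom d by rewrite -tail_next -(tnext2 tiles (tnext d)) tnext2 -(tnext2 tiles) !tnext2 toppK.
by rewrite tail_next.
Qed.

Lemma holomorphic_boundary H (j : 'I_n) : holomorphic H -> odd j ->
  current tfrom (@topp nT) c H (wv j) = H (wv (ordS j)) - H (wv (ord_pred j)).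
Proof.
move=> hH hj; rewrite holomorphic_current ?col_wv // sumrB -!big_mkcond /=; congr (_ - _).
  by rewrite (big_pred1 j) // => i; rewrite /= (inj_eq (wv_inj HT)).
rewrite (big_pred1 (ord_pred j)) // => i; rewrite /= (inj_eq (wv_inj HT)).
by rewrite -{1}[j]ord_predK (inj_eq (@ordS_inj _)).
Qed.

Lemma holomorphic_harmonic H : holomorphic H -> harmonic tfrom (@topp nT) bvert c H.
Proof.
move=> hH d hd; have [hb|hw] := boolP (col (tfrom d)); last first.
  by rewrite /current big1 // => e /eqP he; rewrite /flow c_white ?mul0r // he.
rewrite holomorphic_current // big1 // => i _.
have hne (j : 'I_n) : (wv j == tfrom d) = false.
  apply/eqP => e; have hj : odd j by rewrite -col_wv e.
  by have [q hq] := black_boundary hj; apply: (hd q); rewrite -hq.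
by rewrite !hne subrr.
Qed.

End Holomorphic.
End TilingNetwork.

(** The pattern +, +, -, - of period 4. A unit step multiplies it by a sign that depends on parity,
    hence on colour; this supplies the alternating sign in [expo_step]. *)
Definition qsign (R : pzRingType) (m : int) : R := if ((m %% 4)%Z < 2) then 1 else -1.

Lemma quarter_sign_up (R : pzRingType) m : qsign R (m + 1) = (if (m %% 2)%Z == 0 then 1 else -1) * qsign R m.
Proof.
rewrite /qsign; case: ifP => h1; case: eqP => h2; case: ifP => h3; rewrite ?mul1r ?mulN1r ?opprK //; exfalso; lia.
Qed.
Lemma quarter_sign_down (R : pzRingType) m : qsign R (m - 1) = (if (m %% 2)%Z == 0 then -1 else 1) * qsign R m.
Proof.
rewrite /qsign; case: ifP => h1; case: eqP => h2; case: ifP => h3; rewrite ?mul1r ?mulN1r ?opprK //; exfalso; lia.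
Qed.
Lemma quarter_sign_down2 (R : pzRingType) m : qsign R (m - 2) = - qsign R m.
Proof.
rewrite /qsign; case: ifP => h1; case: ifP => h3; rewrite ?opprK //; exfalso; lia.
Qed.
Lemma quarter_sign_nat (R : pzRingType) (k : nat) : qsign R k = (-1) ^+ k./2.
Proof.
rewrite /qsign -signr_odd; case ho: (odd k./2); case: ifP => h //=; exfalso; lia.
Qed.

(** * Discrete exponentials on the tiling *)

Section Exponentials.
Variables (R : realType) (N : nat) (z0 : R * R) (v : nat -> R * R) (nT : nat).
Variables (tiles : 'I_nT -> tile R) (col : R * R -> bool) (tau : nat -> nat).
Hypotheses (HT : rhombus_tiling N z0 v tiles col) (Htau : is_pairing N z0 v tiles tau).
Local Notation n := (2 * N)%N.
Local Notation pt := (R * R)%type.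
Local Notation D := (tdart nT).
Local Notation tfrom := (tfrom tiles).
Local Notation tto := (tto tiles).
Local Notation tnext := (tnext tiles).
Local Notation lab := (lab HT Htau).
Local Notation partner := (partner HT Htau).
Local Notation wv := (@wv R N z0 v).
Local Notation bperm := (@boundary_perm_inj _ _ _ _ _ _ _ _ HT Htau).

Definition opener (p : 'I_n) := (p < partner p)%N.

Lemma opener_partner p : opener (partner p) = ~~ opener p.
Proof.
rewrite /opener partnerK -leqNgt ltn_neqAle; case: eqP => // /val_inj h.
by case: (partner_vv_neq (esym h)).
Qed.

Lemma prod_openers (F : 'I_n -> R) : \prod_p F p = \prod_(p | opener p) (F p * F (partner p)).
Proof.
rewrite (bigID opener) big_split /=; congr (_ * _).
rewrite (reindex_inj (inv_inj (partnerK HT Htau))) /=; apply: eq_bigl => p; by rewrite opener_partner negbK.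
Qed.

Variable thp : 'I_n -> R.
Hypothesis Hop : forall p, opener p -> thp (partner p) = thp p + pi / 2.
Variable sg : 'I_n -> pt -> int.
Hypothesis Hsg : forall p, side_exponent HT Htau p (sg p).

(** Set to 0 on darts that start at white vertices, so that the network on all darts is the black
    network. *)
Definition conduct (d : D) : R := if col (tfrom d) then tan (thp (lab d) - thp (lab (tnext d))) else 0.

Lemma partner_shift p : exists e : bool, thp (partner p) = thp p + (-1) ^+ e * (pi / 2).
Proof.
have [h|h] := boolP (opener p); first by exists false; rewrite expr0 mul1r Hop.
exists true; have := Hop (p := partner p); rewrite opener_partner h => /(_ isT); rewrite partnerK expr1 => ->; ring.
Qed.

Lemma tan_pi (x : R) : tan (x + pi) = tan x.
Proof. by rewrite /tan sinDpi cosDpi invrN mulrNN. Qed.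

Lemma tan_partner p q : tan (thp (partner p) - thp (partner q)) = tan (thp p - thp q).
Proof.
have [e1 ->] := partner_shift p; have [e2 ->] := partner_shift q.
case: e1; case: e2; rewrite ?expr0 ?expr1.
- by congr tan; ring.
- by rewrite -[LHS]tan_pi; congr tan; move: (pi : R) => P; lra.
- by rewrite -[RHS]tan_pi; congr tan; move: (pi : R) => P; lra.
- by congr tan; ring.
Qed.

Lemma conduct_topp d : conduct (topp d) = conduct d.
Proof.
rewrite /conduct (col_topp HT); case: col => //.
rewrite tnext_topp.
by rewrite !lab_topp tan_partner.
Qed.

(** A height function of the tiling: each side changes it by 1, so that its parity is the colour. *)
Definition height (x : pt) : int := \sum_(p | opener p) sg p x.
Definition edge_sign (d : D) : int := if opener (lab d) then 1 else -1.
Definition edge_opener (d : D) := if opener (lab d) then lab d else partner (lab d).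
Lemma edge_openerP d : opener (edge_opener d).
Proof. by rewrite /edge_opener; case: ifP => // h; rewrite opener_partner h. Qed.

Lemma sg_step d p : opener p -> sg p (tto d) = sg p (tfrom d) + (if p == edge_opener d then edge_sign d else 0).
Proof.
move=> hp; have [_ /(_ d)/eqP] := Hsg p; rewrite subr_eq addrC => /eqP ->; congr (_ + _).
have inj := inv_inj (partnerK HT Htau).
rewrite /edge_opener /edge_sign; have [ho|ho] := boolP (opener (lab d)).
  have -> : (lab d == partner p) = false by apply/eqP => h; move: ho; rewrite h opener_partner hp.
  by rewrite eq_sym subr0; case: (_ == _).
have -> : (lab d == p) = false by apply/eqP => h; move: ho; rewrite h hp.
have -> : (p == partner (lab d)) = (lab d == partner p) by rewrite -(inj_eq inj) partnerK eq_sym.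
by case: (_ == _).
Qed.

Lemma height_step d : height (tto d) = height (tfrom d) + edge_sign d.
Proof.
rewrite /height (eq_bigr (fun p => sg p (tfrom d) + (if p == edge_opener d then edge_sign d else 0))); last first.
  by move=> p hp; rewrite sg_step.
rewrite big_split /=; congr (_ + _); rewrite (bigD1 (edge_opener d)) ?edge_openerP //= eqxx big1 ?addr0 //.
by move=> p /andP[_ /negbTE ->].
Qed.

Lemma height_wv (i : 'I_n) : height (wv (ordS i)) = \sum_(p | opener p) ((p <= i)%N%:R - (partner p <= i)%N%:R).
Proof.
apply: eq_bigr => p _; have := side_exponent_step (Hsg p) i; rewrite (side_exponent_wv (Hsg p) i) => /eqP.
rewrite subr_eq => /eqP ->; rewrite -!val_eqE /=.
have E (x y : nat) : ((x <= y)%N%:R : int) = (y == x)%:R + (x < y)%N%:R by case: ltngtP.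
by rewrite (E p) (E (partner p)) opprD addrACA.
Qed.

(** Colour and parity both alternate along sides, so their agreement is constant; it is checked at
    the end of side 0. *)
Lemma black_height d : col (tfrom d) = ((height (tfrom d) %% 2)%Z == 1).
Proof.
pose P x := col x (+) ((height x %% 2)%Z == 1).
have h e : P (tfrom e) = P (tto e).
  rewrite /P (col_alternates HT) height_step /edge_sign; move: (height _) => m.
  by case: (opener _); case: (col _); rewrite /=; do 2 (case: eqP => ? //); exfalso; lia.
pose i0 := side1 HT.
have : P (tfrom d) = P (wv (ordS i0)).
  by rewrite -(tail_sdart HT Htau); apply: (tail_const HT Htau).
have hh : height (wv (ordS i0)) = 1.
  have ho : opener i0 by rewrite /opener lt0n; apply/eqP => h00; apply: (@partner_vv_neq _ _ _ _ _ _ _ _ HT Htau i0); exact: val_inj.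
  rewrite height_wv (bigD1 i0) //= big1 ?addr0.
    by have -> : (partner i0 <= 0)%N = false by move: ho; rewrite /opener /= ltnNge => /negbTE.
  move=> p /andP[hp hne]; have k1 : (p <= 0)%N = false.
    by apply/negbTE; rewrite -ltnNge lt0n; apply: contra hne => /eqP e; apply/eqP; exact: val_inj.
  have k2 : (partner p <= 0)%N = false by apply/negbTE; rewrite -ltnNge; apply: leq_ltn_trans hp.
  by rewrite k1 k2 subrr.
have hc : col (wv (ordS i0)) by rewrite (col_wv HT Htau) /= modn_small // (tiling_n_gt1 HT).
rewrite /P hh hc /=; by case: (col _); case: eqP.
Qed.

Section Point.
Variable phi : R.
Local Notation X p := (sin (phi - thp p)).
Hypothesis HX : forall p, X p != 0.

(** The discrete exponential with parameter [phi]. By [Hop] the factors of a pair of sides are a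
    sine and minus a cosine, so that crossing a chain multiplies by a cotangent up to sign. *)
Definition expo (x : pt) : R := qsign R (height x) * \prod_(p | opener p) (X p ^ (1 - sg p x) * X (partner p) ^ (sg p x)).
Definition cot_at (p : 'I_n) : R := cos (phi - thp p) / X p.

Lemma opener_ratio p : opener p -> X (partner p) / X p = - cot_at p.
Proof.
move=> h; rewrite Hop // /cot_at -mulNr; congr (_ / _).
have -> : phi - (thp p + pi / 2) = - (pi / 2 - (phi - thp p)) by ring.
by rewrite sinN sinB sin_pihalf cos_pihalf; ring.
Qed.

Lemma closer_ratio p : opener p -> X p / X (partner p) = cot_at (partner p).
Proof.
move=> h; rewrite /cot_at; congr (_ / _); rewrite Hop //.
have -> : phi - (thp p + pi / 2) = - (pi / 2 - (phi - thp p)) by ring.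
by rewrite cosN cosB sin_pihalf cos_pihalf; ring.
Qed.

Lemma expo_step d : expo (tto d) = (if col (tfrom d) then cot_at (lab d) else - cot_at (lab d)) * expo (tfrom d).
Proof.
rewrite /expo height_step black_height; set m := height _; set o := edge_opener d.
have ho : opener o := edge_openerP d.
rewrite (bigD1 o) //= [in RHS](bigD1 o) //= (eq_bigr (fun p => X p ^ (1 - sg p (tfrom d)) * X (partner p) ^ sg p (tfrom d))); last first.
  by move=> p /andP[hp hne]; rewrite sg_step // (negbTE hne) addr0.
move: (\prod_(_ | _) _) => Q.
rewrite (sg_step d ho) eqxx; set s := sg o _.
have hx := HX o; have hy := HX (partner o).
rewrite /edge_sign; case: ifP => hl.
  have e : o = lab d by rewrite /o /edge_opener hl.
  have -> : X o ^ (1 - (s + 1)) = X o ^ (1 - s) / X o.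
    by have -> : 1 - (s + 1) = (1 - s) - 1 by [ring]; rewrite expfzDr // expr1z_inv.
  have -> : X (partner o) ^ (s + 1) = X (partner o) ^ s * X (partner o) by rewrite expfzDr.
  rewrite quarter_sign_up -e; have := opener_ratio ho; rewrite /cot_at.
  have -> : (m %% 2)%Z == 0 = ~~ ((m %% 2)%Z == 1) by case: eqP; case: eqP => //= *; lia.
  move=> hr; have eA (A B x y : R) : A / x * (B * y) = A * B * (y / x) by ring.
  rewrite eA hr; move: (cos _ / _) (X o ^ _) (X (partner o) ^ _) (qsign R m) => r A B S.
  by case: eqP => _ /=; ring.
have e : lab d = partner o by rewrite /o /edge_opener hl partnerK.
have -> : X o ^ (1 - (s + -1)) = X o ^ (1 - s) * X o.
  by have -> : 1 - (s + -1) = (1 - s) + 1 by [ring]; rewrite expfzDr.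
have -> : X (partner o) ^ (s + -1) = X (partner o) ^ s / X (partner o) by rewrite expfzDr // expr1z_inv.
rewrite quarter_sign_down e -(closer_ratio ho).
have eA (A B x y : R) : A * x * (B / y) = A * B * (x / y) by ring.
rewrite eA; move: (X o / _) (X o ^ _) (X (partner o) ^ _) (qsign R m) => r A B S.
have -> : (m %% 2)%Z == 0 = ~~ ((m %% 2)%Z == 1) by case: eqP; case: eqP => //= *; lia.
by case: eqP => _ /=; ring.
Qed.

Lemma cot_partner p : cot_at (partner p) * cot_at p = -1.
Proof.
have [h|h] := boolP (opener p).
  by rewrite -closer_ratio // -[cot_at p]opprK -opener_ratio // mulrN; congr (- _); field; rewrite !HX.
have h' : opener (partner p) by rewrite opener_partner h.
have := opener_ratio h'; have := closer_ratio h'; rewrite partnerK => <- e.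
by rewrite -[cot_at (partner p)]opprK -e mulNr; congr (- _); field; rewrite !HX.
Qed.

Hypothesis Hcos : forall d, col (tfrom d) -> cos (thp (lab d) - thp (lab (tnext d))) != 0.

(** On a tile all values are multiples of one of them by the cotangents of its two labels, and the
    equation becomes the subtraction formula for the tangent. *)
Lemma expo_holomorphic : @holomorphic R nT tiles col conduct expo.
Proof.
move=> d hd; rewrite /flow /conduct hd; set a := expo (tfrom d).
set P := cot_at (lab d); set Q := cot_at (lab (tnext d)).
have h1 : expo (tto d) = P * a by rewrite expo_step hd.
have h2 : expo (tfrom (topp d)) = - Q * (P * a) by rewrite -(tnext2 tiles) tail_next expo_step tail_next (col_alternates HT) hd /= -/Q h1.
have h3 : expo (tto (topp d)) = Q * a.
  have := expo_step (tnext (topp d)); rewrite tail_next (col_alternates HT) (col_topp HT) hd /=.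
  have -> : tto (tnext (topp d)) = tfrom d by rewrite -tail_next tnext2 toppK.
  rewrite tnext_topp.
  rewrite lab_topp -/a => ->; rewrite mulrA mulrN [Q * _]mulrC cot_partner opprK mul1r //.
rewrite h1 h2 h3.
have hu := HX (lab d); have hw := HX (lab (tnext d)); have hc := Hcos hd.
have e : thp (lab d) - thp (lab (tnext d)) = (phi - thp (lab (tnext d))) - (phi - thp (lab d)) by ring.
move: hc; rewrite /tan e sinB cosB /P /Q /cot_at; move: hu hw.
move: (sin (phi - thp (lab d))) (cos (phi - thp (lab d))) (sin (phi - thp (lab (tnext d)))) (cos (phi - thp (lab (tnext d)))).
by move=> s1 c1 s2 c2 hs1 hs2 hc; field; rewrite hs1 hs2 hc.
Qed.

Lemma boundary_exponent_opener (p i : 'I_n) : opener p -> boundary_exponent bperm p i = ~~ (p <= i < partner p)%N.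
Proof.
move=> h; have h0 : (0 < partner p)%N by apply: leq_ltn_trans h.
rewrite /boundary_exponent (src_val h0); move: h h0; rewrite /opener.
by move: (nat_of_ord p) (nat_of_ord (partner p)) (nat_of_ord i) => a b k; case: ifP; lia.
Qed.

Lemma boundary_exponent_closer (p i : 'I_n) : opener p -> boundary_exponent bperm (partner p) i = (p <= i < partner p)%N.
Proof.
move=> h; rewrite /boundary_exponent; have hi := ltn_ord i; have hb := ltn_ord (partner p).
have [h0|h0] := posnP p.
  rewrite src_val0 ?partnerK // h0.
  by case: ifP; lia.
by rewrite (src_val (p := partner p)) partnerK //; move: h h0; rewrite /opener; case: ifP; lia.
Qed.

(** Here the two constructions meet: the exponents of the chains at the boundary are those of the
    strands, so up to sign the values are those of the kernel vector of the plabic graph. *)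
Lemma expo_boundary (i : 'I_n) : expo (wv (ordS i)) =
  qsign R (height (wv (ordS i))) * \prod_p (if boundary_exponent bperm p i then X p else 1).
Proof.
rewrite /expo prod_openers; congr (_ * _); apply: eq_bigr => p hp.
rewrite boundary_exponent_opener // boundary_exponent_closer //.
have -> : sg p (wv (ordS i)) = (p <= i < partner p)%N%:R.
  have := side_exponent_step (Hsg p) i; rewrite (side_exponent_wv (Hsg p) i) => /eqP; rewrite subr_eq => /eqP ->.
  rewrite -!val_eqE /=; move: hp; rewrite /opener; move: (nat_of_ord p) (nat_of_ord (partner p)) (nat_of_ord i) => a b k hab.
  by case: (ltngtP k a) => h1; case: (ltngtP k b) => h2; rewrite /=; lia.
by case: (_ <= _ < _)%N; rewrite /= ?subrr ?subr0 ?expr0z ?expr1z ?mul1r ?mulr1.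
Qed.

End Point.
End Exponentials.

(** * Descents of the boundary permutation and the signs they give *)

Section BoundaryPermutation.
Variables (R : realType) (N : nat) (z0 : R * R) (v : nat -> R * R) (nT : nat).
Variables (tiles : 'I_nT -> tile R) (col : R * R -> bool) (tau : nat -> nat).
Hypotheses (HT : rhombus_tiling N z0 v tiles col) (Htau : is_pairing N z0 v tiles tau).
Local Notation pt := (R * R)%type.
Local Notation n := (2 * N)%N.
Local Notation partner := (partner HT Htau).
Local Notation sdart := (sdart HT Htau).
Local Notation wv := (@wv R N z0 v).
Local Notation opener := (opener HT Htau).

Definition boundary_perm (i : 'I_n) : 'I_n := partner (ordS i).

Lemma boundary_perm_nofix i : boundary_perm i != i.
Proof.
apply/negP => /eqP h; apply: (vv_turn HT (i := i)).
by rewrite -(vv_partner HT Htau) -{2}h /boundary_perm partnerK.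
Qed.

Lemma partner_pred_neq (j : 'I_n) : (0 < j)%N -> partner j != j.-1 :> nat.
Proof.
move=> hj; have := boundary_perm_nofix (ord_pred j); rewrite /boundary_perm ord_predK -val_eqE /=.
have := ltn_ord j; move: hj; case: (nat_of_ord j) => // k _ hk.
by rewrite addSn /= modnDr modn_small //; exact: ltnW.
Qed.

Lemma partner_neq_id (j : 'I_n) : partner j != j.
Proof. by apply/eqP => h; exact: (@partner_vv_neq _ _ _ _ _ _ _ _ HT Htau j (esym h)). Qed.

Lemma perm_desc (j : 'I_n) : (boundary_perm (ord_pred j) < ord_pred j)%N = (nat_of_ord j == 0%N) || ~~ opener j.
Proof.
rewrite /boundary_perm ord_predK; have [h0|h0] := posnP j.
  have hn := sides_gt0 HT; have e : ord_pred j = n.-1 :> nat.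
    by rewrite /= h0 add0n modn_small // prednK.
  have hne : (partner j : nat) != n.-1.
    by rewrite -e val_eqE; have := boundary_perm_nofix (ord_pred j); rewrite /boundary_perm ord_predK.
  rewrite e /=; have := ltn_ord (partner j); move: hne hn; move: (nat_of_ord (partner j)) => k; move: (n) => m; lia.
have e : ord_pred j = j.-1 :> nat.
  have := ltn_ord j; move: h0 => /=; case: (nat_of_ord j) => // k _ hk.
  by rewrite addSn /= modnDr modn_small //; exact: ltnW.
rewrite e /opener -leqNgt; have := partner_pred_neq h0; have := partner_neq_id j; rewrite -val_eqE /=.
by move: (nat_of_ord j) (nat_of_ord (partner j)) h0 => a b; lia.
Qed.

Lemma count_openers : (\sum_(j < n) opener j = N)%N.
Proof.
have h1 : (\sum_(j < n) opener j + \sum_(j < n) ~~ opener j = n)%N.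
  rewrite -big_split /= -[RHS]card_ord -sum1_card; apply: eq_bigr => j _; by case: (opener j).
have h2 : (\sum_(j < n) ~~ opener j = \sum_(j < n) opener j)%N.
  rewrite (reindex_inj (inv_inj (partnerK HT Htau))) /=; apply: eq_bigr => j _; by rewrite opener_partner negbK.
by move: h1; rewrite h2; lia.
Qed.

Lemma opener0 (j : 'I_n) : nat_of_ord j = 0%N -> opener j.
Proof. by move=> h; have := partner_neq_id j; rewrite /opener -val_eqE /= h; lia. Qed.

(** Each of the N pairs is closed once, and index 0 adds one more; hence the rank N + 1. *)
Lemma count_descents : (\sum_(i < n) (boundary_perm i < i) = N.+1)%N.
Proof.
rewrite (reindex_inj (can_inj (@ord_predK _))) /=.
have i0 := side1 HT.
have h : (\sum_(j < n) (boundary_perm (ord_pred j) < ord_pred j) = \sum_(j < n) ((nat_of_ord j == 0%N) + ~~ opener j))%N.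
  apply: eq_bigr => j _; rewrite perm_desc; case: eqP => [h0|_] /=; last by [].
  by rewrite opener0.
have h2 : (\sum_(j < n) ~~ opener j = \sum_(j < n) opener j)%N.
  rewrite (reindex_inj (inv_inj (partnerK HT Htau))) /=; apply: eq_bigr => j _; by rewrite opener_partner negbK.
transitivity (\sum_(j < n) (boundary_perm (ord_pred j) < ord_pred j))%N; first by [].
rewrite h big_split /= h2 count_openers (bigD1 (side1 HT)) //= big1 ?addn0 ?add1n // => j hj.
by case: eqP => // e; case/negP: hj; apply/eqP; exact: val_inj.
Qed.

Variable sg : 'I_n -> pt -> int.
Hypothesis Hsg : forall p, side_exponent HT Htau p (sg p).
Local Notation height := (height HT Htau sg).

Definition descents_below (j : nat) : nat := \sum_(i < n | (i < j)%N) (boundary_perm i < i)%N.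

Lemma height_boundary (k : nat) (hk : (k < n)%N) :
  height (wv (ordS (Ordinal hk))) = k.+1%:Z - 2 * (descents_below k)%:Z.
Proof.
have hstep (i : 'I_n) : height (wv (ordS i)) = height (wv i) + (if opener i then 1 else -1).
  have := height_step Hsg (sdart i); rewrite tail_sdart head_sdart /edge_sign.
  have -> : opener (lab HT Htau (sdart i)) = ~~ opener i by rewrite -opener_partner.
  by move=> ->; case: (opener i); rewrite /= ?addrNK ?addrK.
elim: k hk => [|k IH] hk.
  rewrite hstep opener0 // /descents_below big_pred0 // mulr0 subr0.
  have -> : height (wv (Ordinal hk)) = 0.
    apply: big1 => p _; have [h0 _] := Hsg p; rewrite -[RHS]h0; congr (sg p (wv _)); exact: val_inj.
  by [].
have hk' : (k < n)%N by exact: ltnW.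
have e : ordS (Ordinal hk') = Ordinal hk by apply: val_inj; rewrite /= modn_small.
have e' : ord_pred (Ordinal hk) = Ordinal hk' by rewrite -e ordSK.
rewrite hstep -e (IH hk') e.
have -> : descents_below k.+1 = (descents_below k + ~~ opener (Ordinal hk))%N.
  rewrite /descents_below (bigD1 (Ordinal hk')) //= addnC; congr (_ + _)%N.
    by apply: eq_bigl => i; rewrite -val_eqE /= ltnS; case: ltngtP.
  by have := perm_desc (Ordinal hk); rewrite e' /= => ->.
by case: (opener _); rewrite /=; lia.
Qed.

Lemma quarter_sign_shift (m : int) (k : nat) : qsign R (m - 2 * k%:Z) = (-1) ^+ k * qsign R m.
Proof.
elim: k => [|k IH]; first by rewrite mulr0 subr0 expr0 mul1r.
have -> : m - 2 * k.+1%:Z = (m - 2 * k%:Z) - 2 by lia.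
by rewrite quarter_sign_down2 IH exprS mulN1r mulNr.
Qed.

(** The factor with [descents_below] will cancel the descents in the sign of [plucker_relation]; the
    other factor is the one kept in [rel_sign]. *)
Lemma quarter_sign_height (j : 'I_n) : qsign R (height (wv (ordS j))) = (-1) ^+ (descents_below j) * (-1) ^+ (j.+1)./2.
Proof. by case: j => k hk; rewrite height_boundary quarter_sign_shift quarter_sign_nat. Qed.

End BoundaryPermutation.

(** * Consequences of linear relations between coordinates *)

Section Relations.
Variables (R : realType) (n : nat) (Dl : {set 'I_n} -> R).

Definition rel_sign (J : {set 'I_n}) (j : 'I_n) : R := (-1) ^+ (#|[set i in J | (i < j)%N]| + (j.+1)./2).
Definition relation (g : 'I_n -> R) := forall J : {set 'I_n}, \sum_(j in J) rel_sign J j * g j * Dl (J :\ j) = 0.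

Lemma relation_lin (I : finType) (x : I -> R) (g : I -> 'I_n -> R) :
  (forall i, relation (g i)) -> relation (fun j => \sum_i x i * g i j).
Proof.
move=> h J; rewrite (eq_bigr (fun j => \sum_i x i * (rel_sign J j * g i j * Dl (J :\ j)))); last first.
  by move=> j _; rewrite mulr_sumr mulr_suml; apply: eq_bigr => i _; ring.
by rewrite exchange_big big1 // => i _; rewrite -mulr_sumr h mulr0.
Qed.

Lemma rel_sign_norm J j : `|rel_sign J j| = 1.
Proof. by rewrite normrX normrN1 expr1n. Qed.

Variables (O : {set 'I_n}) (C : R) (g : 'I_n -> 'I_n -> R).
Hypotheses (C0 : 0 <= C) (gC : forall o j, o \in O -> `|g o j| <= C).
Hypotheses (gO : forall o o', o \in O -> o' \in O -> g o o' = (o' == o)%:R) (grel : forall o, o \in O -> relation (g o)).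

(** For [o] in [O] but not in [I], the relation of [g o] on [I] with [o] added expresses the
    coordinate at [I] by those where an element of [I] is replaced by [o]. By [gO] elements of [O]
    are never replaced, so every step comes one element closer to [O]. *)
Lemma exchange_bound m (I : {set 'I_n}) : #|I| = #|O| -> #|I :\: O| = m -> `|Dl I| <= (n%:R * C) ^+ m * `|Dl O|.
Proof.
elim: m I => [|m IH] I hI hm.
  have hs : I \subset O by rewrite -finset.setD_eq0 -cards_eq0 hm.
  have -> : I = O by apply/eqP; rewrite eqEcard hs hI leqnn.
  by rewrite expr0 mul1r.
have [ o ho] : exists o, o \in O :\: I.
  have : (0 < #|O :\: I|)%N.
    have := cardsID O I; have := cardsID I O; rewrite finset.setIC hI hm => h1 h2.
    by rewrite -(ltn_add2l #|I :&: O|) addn0 h1 -h2; lia.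
  by rewrite card_gt0 => /set0Pn.
move: ho; rewrite finset.in_setD => /andP[hoI hoO].
pose J := o |: I; have hJo : J :\ o = I.
  apply/setP => x; rewrite !inE; case: eqP => [->|_] //=; by rewrite (negbTE hoI).
have := grel hoO J; rewrite (bigD1 o) /=; last by rewrite !inE eqxx.
rewrite hJo gO // eqxx mulr1 => /eqP; rewrite addr_eq0 => /eqP h.
have hD : `|Dl I| = `|\sum_(j in J | j != o) rel_sign J j * g o j * Dl (J :\ j)| by rewrite -[RHS]normrN -h normrM rel_sign_norm mul1r.
rewrite hD; apply: le_trans (ler_norm_sum _ _ _) _.
have hb j : (j \in J) && (j != o) -> `|rel_sign J j * g o j * Dl (J :\ j)| <= C * ((n%:R * C) ^+ m * `|Dl O|).
  move=> /andP[hj hjo]; have hjI : j \in I by move: hj; rewrite !inE (negbTE hjo).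
  rewrite !normrM rel_sign_norm mul1r; have [hjO|hjO] := boolP (j \in O).
    by rewrite gO // (negbTE hjo) normr0 mul0r !mulr_ge0 ?exprn_ge0 ?mulr_ge0.
  apply: ler_pM => //; first exact: gC.
  apply: IH.
    apply/eqP; rewrite -hI -(eqn_add2l 1); have := cardsD1 j J; rewrite hj => <-.
    by rewrite cardsU1 hoI.
  have e : (J :\ j) :\: O = (I :\: O) :\ j.
    apply/setP => x; rewrite !inE; case: (eqVneq x o) => [->|_]; rewrite ?hoO /= ?andbF //; by case: (_ \in O); rewrite ?andbF ?andbT.
  rewrite e; have := cardsD1 j (I :\: O); rewrite hm finset.in_setD hjO hjI /=; lia.
apply: le_trans (ler_sum _ hb) _; rewrite sumr_const exprS -!mulrA -[C * _ *+ _]mulr_natl.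
apply: ler_wpM2r; first by rewrite !mulr_ge0 ?exprn_ge0 ?mulr_ge0.
rewrite ler_nat; apply: leq_trans (max_card _) _; by rewrite card_ord.
Qed.

End Relations.

(** * The three-term relations *)

Section ThreeTerms.
Variables (R : realType) (N : nat) (Dl : {set 'I_(2 * N)} -> R) (g : 'I_(2 * N) -> R).
Local Notation n := (2 * N)%N.
Hypothesis Hg : relation Dl g.

Definition prev_even (p : nat) := if p == 1%N then (2 * N)%N else (2 * p - 2)%N.
Definition set_one (p : nat) := lset n (fun j => odd j || (j == 2 * p)%N).
Definition set_two (p q : nat) := lset n (fun j => [|| odd j && (j != (2 * q).-1)%N, (j == 2 * p)%N | (j == prev_even p)%N]).
Definition previous_index (p : nat) := if p == 1%N then N else p.-1.

Lemma count_even (m : nat) : (m <= n)%N -> (\sum_(i < n | (i < m)%N) ~~ odd i = m.+1./2)%N.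
Proof.
elim: m => [|m IH] hm; first by rewrite big_pred0.
rewrite (bigD1 (Ordinal hm)) //= (eq_bigl (fun i : 'I_n => (i < m)%N)); last first.
  by move=> i; rewrite -val_eqE /= ltnS; case: ltngtP.
by rewrite IH ?(ltnW hm) //; lia.
Qed.

(** The relation is taken on [J], all odd labels with two even ones added. At odd labels [g]
    vanishes except at [x], so three terms remain. Signs depend on whether [p = 1], when the
    preceding even label wraps to 2N. *)
Lemma three_terms (p q : nat) (x y z : 'I_n) : (1 <= p <= N)%N -> (1 <= q <= N)%N -> p <> q ->
  x = (2 * q).-2 :> nat -> y = (2 * p).-1 :> nat -> z = (prev_even p).-1 :> nat ->
  (forall r : 'I_n, ~~ odd r -> r != x -> g r = 0) ->
  g x * Dl (set_two p q) = g y * Dl (set_one (previous_index p)) - g z * Dl (set_one p).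
Proof.
move=> hp hq hpq hx hy hz h0.
pose J := lset n (fun j => [|| odd j, (j == 2 * p)%N | (j == prev_even p)%N]).
have hprev : (1 < prev_even p <= n)%N /\ ~~ odd (prev_even p) /\ prev_even p <> (2 * p)%N.
  by rewrite /prev_even; case: eqP => h; rewrite ?oddM ?oddB //; lia.
have inJ (i : 'I_n) : (i \in J) = [|| ~~ odd i, i == y | i == z].
  rewrite inE /= -!val_eqE /= hy hz; congr [|| _, _ | _]; apply/eqP/eqP; lia.
have hodd (i : 'I_n) : odd (2 * i) = false by rewrite oddM.
have xe : ~~ odd x by rewrite hx; case: (q) hq => // k _; rewrite mulnS /= oddM.
have yo : odd y by rewrite hy; case: (p) hp => // k _; rewrite mulnS /= oddM.
have zo : odd z by rewrite hz; move: hprev; move: (prev_even p) => k; lia.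
have xy : x != y by apply/eqP => h; move: xe; rewrite h yo.
have xz : x != z by apply/eqP => h; move: xe; rewrite h zo.
have yz : y != z by rewrite -val_eqE /= hy hz; apply/eqP; lia.
have hcard (j : 'I_n) : (#|[set i in J | (i < j)%N]| = j.+1./2 + ((y < j) + (z < j)))%N.
  rewrite -sum1_card -(count_even (ltnW (ltn_ord j))) big_mkcond /= [in RHS]big_mkcond /=.
  have e (u : 'I_n) : ((u < j) = \sum_(i < n) (i == u) * (i < j) :> nat)%N by rewrite (bigD1 u) //= eqxx mul1n big1 ?addn0 // => i /negbTE ->.
  rewrite (e y) (e z) -!big_split /=; apply: eq_bigr => i _; rewrite inE inJ.
  case: (eqVneq i y) => [->|_]; first by rewrite yo (negbTE yz) /=; case: (_ < _)%N.
  case: (eqVneq i z) => [->|_]; first by rewrite zo /=; case: (_ < _)%N.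
  by case: (odd i); case: (_ < _)%N.
have hsign j : rel_sign R J j = (-1) ^+ ((y < j) + (z < j))%N by rewrite /rel_sign hcard addnAC addnn exprD -signr_odd odd_double mul1r.
have := Hg J; rewrite (bigD1 x) ?inJ ?xe //= (bigD1 y) ?inJ ?eqxx ?orbT ?(eq_sym y) ?xy //=.
rewrite (bigD1 z) ?inJ ?eqxx ?orbT ?(eq_sym z) ?xz ?yz //= big1 ?addr0; last first.
  move=> r /andP[/andP[/andP[hr r1] r2] r3]; move: hr; rewrite inJ (negbTE r2) (negbTE r3) !orbF => hr.
  by rewrite h0 // mulr0 mul0r.
have -> : J :\ x = set_two p q.
  apply/setP => i; rewrite !inE -!val_eqE /= hx.
  have -> : (i.+1 != (2 * q).-1) = (nat_of_ord i != (2 * q).-2) by lia.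
  case: eqP => //= h; rewrite ?andbT //; apply/esym/negbTE; rewrite negb_or; apply/andP; split; apply/eqP; lia.
have -> : J :\ y = set_one (previous_index p).
  apply/setP => i; rewrite !inE -!val_eqE /= hy.
  have -> : (2 * previous_index p)%N = prev_even p by rewrite /previous_index /prev_even; case: eqP => //; lia.
  have -> : (nat_of_ord i != (2 * p).-1) = (i.+1 != 2 * p)%N by lia.
  case: (eqVneq i.+1 (2 * p)%N) => //= h; apply/esym/negbTE; rewrite negb_or.
  have -> : ~~ ~~ odd i by have : odd i.+1 = false by [rewrite h oddM]; move=> /= ->.
  by apply/eqP => h'; case: hprev => _ [_]; rewrite -h' h.
have -> : J :\ z = set_one p.
  apply/setP => i; rewrite !inE -!val_eqE /= hz.
  have -> : (nat_of_ord i != (prev_even p).-1) = (i.+1 != prev_even p)%N by lia.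
  case: (eqVneq i.+1 (prev_even p)) => //= h; rewrite ?orbF //; apply/esym/negbTE; rewrite negb_or.
  case: hprev => _ []; rewrite -h /= => -> h'; rewrite /=; by apply/eqP.
rewrite !hsign !ltnn.
have e1 : ((y < x) + (z < x) = if p == 1%N then 1 else (z < x).*2)%N /\ (z < y)%N = (p != 1%N) /\ (y < z)%N = (p == 1%N).
  rewrite hx hy hz /prev_even; case: eqP => h; split; try lia.
have [-> [-> ->]] := e1.
case: (p == 1%N) => /=; rewrite ?addn0 ?add0n -?[(-1) ^+ _.*2]signr_odd ?odd_double ?expr1 ?expr0; lra.
Qed.

End ThreeTerms.

(** * Right limits at 0 in the perturbation parameter *)

Section RightLimits.
Variable R : realType.
Local Open Scope classical_set_scope.

Definition cont0 (f : R -> R) := f x @[x --> (0 : R)^'+] --> f 0.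

Lemma cont0_cst (k : R) : cont0 (fun=> k). Proof. exact: cvg_cst. Qed.
Lemma cont0_id : cont0 id. Proof. by apply: cvg_at_right_filter; exact: cvg_id. Qed.
Lemma cont0D f g : cont0 f -> cont0 g -> cont0 (fun x => f x + g x). Proof. exact: cvgD. Qed.
Lemma cont0B f g : cont0 f -> cont0 g -> cont0 (fun x => f x - g x). Proof. exact: cvgB. Qed.
Lemma cont0M f g : cont0 f -> cont0 g -> cont0 (fun x => f x * g x). Proof. exact: cvgM. Qed.
Lemma cont0_norm f : cont0 f -> cont0 (fun x => `|f x|). Proof. exact: cvg_norm. Qed.
Lemma cont0_comp f g : cont0 f -> {for f 0, continuous g} -> cont0 (fun x => g (f x)).
Proof. by move=> hf hg; apply: (cvg_comp f g) hf _; exact: hg. Qed.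
Lemma cont0_sin f : cont0 f -> cont0 (fun x => sin (f x)).
Proof. by move=> h; apply: cont0_comp h _; exact: continuous_sin. Qed.

Lemma cont0_sum (I : Type) (r : seq I) (P : pred I) (F : I -> R -> R) :
  (forall i, cont0 (F i)) -> cont0 (fun x => \sum_(i <- r | P i) F i x).
Proof.
move=> h; elim: r => [|i r IH].
  have -> : (fun x => \sum_(i <- [::] | P i) F i x) = fun=> 0 by apply: funext => x; rewrite big_nil.
  exact: cont0_cst.
have -> : (fun x => \sum_(i <- i :: r | P i) F i x) =
    (fun x => (if P i then F i x else 0) + \sum_(i <- r | P i) F i x).
  by apply: funext => x; rewrite big_cons; case: (P i); rewrite ?add0r.
by apply: cont0D => //; case: (P i) => //; exact: cont0_cst.
Qed.

Lemma cont0_prod (I : Type) (r : seq I) (P : pred I) (F : I -> R -> R) :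
  (forall i, cont0 (F i)) -> cont0 (fun x => \prod_(i <- r | P i) F i x).
Proof.
move=> h; elim: r => [|i r IH].
  have -> : (fun x => \prod_(i <- [::] | P i) F i x) = fun=> 1 by apply: funext => x; rewrite big_nil.
  exact: cont0_cst.
have -> : (fun x => \prod_(i <- i :: r | P i) F i x) =
    (fun x => (if P i then F i x else 1) * \prod_(i <- r | P i) F i x).
  by apply: funext => x; rewrite big_cons; case: (P i); rewrite ?mul1r.
by apply: cont0M => //; case: (P i) => //; exact: cont0_cst.
Qed.

Lemma cont0_le f g : cont0 f -> cont0 g -> (\forall x \near (0 : R)^'+, f x <= g x) -> f 0 <= g 0.
Proof. by move=> hf hg h; exact: (ler_cvg_to hf hg h). Qed.

Lemma near_right_ex (P : R -> Prop) : (\forall x \near (0 : R)^'+, P x) -> exists2 x, 0 < x & P x.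
Proof.
move=> h; have hp : \forall x \near (0 : R)^'+, 0 < x by exact: nbhs_right_gt.
by have [x [h1 h2]] := filter_ex (filterI hp h); exists x.
Qed.

Lemma near_lt f k : cont0 f -> f 0 < k -> \forall x \near (0 : R)^'+, f x < k.
Proof. move=> hf h; exact: (@cvgr_lt R R ((0 : R)^'+) _ f (f 0) hf k h). Qed.
Lemma near_gt f k : cont0 f -> k < f 0 -> \forall x \near (0 : R)^'+, k < f x.
Proof. move=> hf h; exact: (@cvgr_gt R R ((0 : R)^'+) _ f (f 0) hf k h). Qed.
Lemma near_neq0 f : cont0 f -> f 0 != 0 -> \forall x \near (0 : R)^'+, f x != 0.
Proof.
move=> hf h; have h0 : 0 < `|f 0| by rewrite normr_gt0.
by apply: filterS (near_gt (cont0_norm hf) h0) => x; rewrite normr_gt0.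
Qed.

(** If [sin a] is nonzero this is continuity. Otherwise [cos a] is nonzero, and [sin (k * x)] has no
    zero for [x] between 0 and [pi / |k|]. *)
Lemma near_sin_neq0 (a k : R) : k != 0 -> \forall x \near (0 : R)^'+, sin (a + k * x) != 0.
Proof.
move=> hk; have [h|h] := eqVneq (sin a) 0; last first.
  apply: (near_neq0 (f := fun x => sin (a + k * x))); last by rewrite mulr0 addr0.
  by apply: cont0_sin; apply: cont0D; [exact: cont0_cst|apply: cont0M; [exact: cont0_cst|exact: cont0_id]].
have hp : 0 < pi / `|k| by rewrite divr_gt0 ?pi_gt0 ?normr_gt0.
have h1 : \forall x \near (0 : R)^'+, x < pi / `|k| by exact: nbhs_right_lt.
have h2 : \forall x \near (0 : R)^'+, 0 < x by exact: nbhs_right_gt.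
apply: filterS (filterI h1 h2) => x [hx1 hx2]; rewrite sinD h mul0r add0r mulf_neq0 //.
  by apply/eqP => hc; have := cos2Dsin2 a; rewrite h hc expr0n addr0 => /eqP; rewrite eq_sym oner_eq0.
have hs : 0 < sin (`|k| * x).
  by apply: sin_gt0_pi; rewrite mulr_gt0 ?normr_gt0 //= mulrC -ltr_pdivlMr ?normr_gt0.
by case: (ler0P k) hs => _; [rewrite mulNr sinN oppr_gt0 => /ltr0_neq0|move=> /lt0r_neq0].
Qed.

End RightLimits.

(** * The perturbed problem: solutions with prescribed boundary values *)

Section PerturbedNetwork.
Variables (R : realType) (N : nat) (z0 : R * R) (v : nat -> R * R) (nT : nat).
Variables (tiles : 'I_nT -> tile R) (col : R * R -> bool) (tau : nat -> nat).
Hypotheses (HT : rhombus_tiling N z0 v tiles col) (Htau : is_pairing N z0 v tiles tau).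
Local Notation pt := (R * R)%type.
Local Notation n := (2 * N)%N.
Local Notation tfrom := (tfrom tiles).
Local Notation partner := (partner HT Htau).
Local Notation wv := (@wv R N z0 v).
Local Notation bvert := (@bvert R N z0 v).
Local Notation opener := (opener HT Htau).
Local Notation bperm := (@boundary_perm_inj _ _ _ _ _ _ _ _ HT Htau).

Variable sg : 'I_n -> pt -> int.
Hypothesis Hsg : forall p, side_exponent HT Htau p (sg p).
Variables (G : plabic n) (b w : pE G -> 'I_n).
Hypotheses (HG : plabic_ok G) (HL : reduced_labelling (boundary_perm HT Htau) b w).
Variable thp : 'I_n -> R.
Hypothesis Hop : forall p, opener p -> thp (partner p) = thp p + pi / 2.

(** The weights [wt_theta] written through the labels [b] and [w], hence defined for all parameters,
    including perturbed ones that are not known to be admissible. *)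
Definition weight (th : 'I_n -> R) (e : pE G) : R :=
  if is_bnd (peB e) then 1 else (-1) ^+ (b e < w e)%N * sin (th (b e) - th (w e)).
Local Notation Dl := (Delta (weight thp)).
Local Notation conduct := (conduct HT Htau thp).
Local Notation expo := (expo HT Htau thp sg).
(** Boundary vertex [j] of the plabic graph, counted from 0, corresponds to the end of side [j];
    hence [ordS]. *)
Definition trace (H : pt -> R) (j : 'I_n) : R := H (wv (ordS j)).

(** This is [plucker_relation] for the kernel vector of parameter [phi]; [expo_boundary] identifies
    the boundary values and [quarter_sign_height] the signs. *)
Lemma expo_relation phi : (forall p, sin (phi - thp p) != 0) -> relation Dl (trace (expo phi)).
Proof.
move=> HX J.
have hsrc p : invF bperm p != p.
  apply/negP => /eqP h; have := boundary_perm_nofix HT Htau p; move/negP; apply; apply/eqP.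
  by rewrite -{2}(f_invF bperm p) h.
have [y [hy hb]] := kernel_vector HG (finj := bperm) HL HX hsrc.
have hK x : pblack x -> ~~ is_bnd x ->
    \sum_(g | peB g == x) (-1) ^+ (b g < w g)%N * weight thp g * y (peW g) = 0.
  move=> hx hnb; rewrite -[RHS](hy x hx hnb); apply: eq_bigr => g /eqP hg.
  by rewrite /weight hg (negbTE hnb) mulrA -signr_addb addbb mul1r.
have := plucker_relation HG J HL hK => h; rewrite -[RHS]h; apply: eq_bigr => j _.
have -> : weight thp (pbedge G j) = 1 by rewrite /weight peB_be // bnd_pbnd.
rewrite /trace expo_boundary // hb (quarter_sign_height Hsg) /rel_sign mulr1 !exprD.
move: (\prod_(_ | _) _) (Delta _ _) => Y Z.
have hs k : (-1) ^+ k * (-1) ^+ k = 1 :> R by rewrite -exprD addnn -signr_odd odd_double.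
rewrite -/(descents_below HT Htau j); move: (hs (j.+1)./2).
by move: ((-1) ^+ (j.+1)./2) ((-1) ^+ descents_below _ _ _) ((-1) ^+ #|_|) => s1 s2 s3 h1; ring: h1.
Qed.

Definition good (H : pt -> R) := @holomorphic R nT tiles col conduct H /\ relation Dl (trace H).

Lemma good_lin (I : finType) (x : I -> R) (H : I -> pt -> R) :
  (forall i, good (H i)) -> good (fun z => \sum_i x i * H i z).
Proof.
move=> h; split; last by apply: (@relation_lin R n Dl I x (fun i => trace (H i))) => i; case: (h i).
move=> d hd; rewrite /flow -!sumrB mulr_sumr; apply: eq_bigr => i _.
have [/(_ d hd) h1 _] := h i; rewrite -!mulrBr -h1 /flow; ring.
Qed.

Definition first_label : 'I_n := side1 HT.
(** The labels whose parameters serve as values of [phi]. There a sine vanishes, and this makes the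
    matrix of boundary values triangular. *)
Definition spectrum : {set 'I_n} := [set p | opener p || (p == partner first_label)].
Lemma opener_first : opener first_label. Proof. exact: opener0. Qed.

Lemma card_spectrum : #|spectrum| = N.+1.
Proof.
have -> : spectrum = partner first_label |: [set p | opener p] by apply/setP => p; rewrite !inE orbC.
rewrite cardsU1 inE opener_partner opener_first /= add1n -sum1_card; congr S.
by rewrite -[RHS](count_openers HT Htau) big_mkcond /=; apply: eq_bigr => p _; rewrite inE; case: (opener p).
Qed.

(** The boundary values of the exponentials as plain products, which stay meaningful where a sine
    vanishes. *)
Definition bvalue phi (i : 'I_n) : R :=
  \prod_(p | opener p) (if (p <= i < partner p)%N then sin (phi - thp (partner p)) else sin (phi - thp p)).

Lemma expo_bvalue phi i : (forall p, sin (phi - thp p) != 0) -> trace (expo phi) i =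
  qsign R (height HT Htau sg (wv (ordS i))) * bvalue phi i.
Proof.
move=> HX; rewrite /trace expo_boundary // (prod_openers HT Htau); congr (_ * _); apply: eq_bigr => p hp.
by rewrite boundary_exponent_opener // boundary_exponent_closer //; case: (_ <= _ < _)%N; rewrite ?mul1r ?mulr1.
Qed.

Hypothesis Hgen : forall p r, opener p -> opener r -> p != r -> sin (2 * (thp p - thp r)) != 0.

Lemma bvalue_zero (r i : 'I_n) : r \in spectrum -> (i < r)%N -> bvalue (thp r) i = 0.
Proof.
rewrite inE => /orP[hr|/eqP ->] hi.
  rewrite /bvalue (bigD1 r) //=; have -> : (r <= i)%N = false by rewrite leqNgt hi.
  by rewrite subrr sin0 mul0r.
rewrite /bvalue (bigD1 first_label) ?opener_first //= hi subrr sin0 mul0r //.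
Qed.

Lemma sin_cos_neq0 (x : R) : sin (2 * x) != 0 -> sin x != 0 /\ cos x != 0.
Proof.
have -> : 2 * x = x + x by ring.
by rewrite sinD => h; split; apply/eqP => e; move/eqP: h; apply; rewrite e; ring.
Qed.

Lemma bvalue_diag r : r \in spectrum -> bvalue (thp r) r != 0.
Proof.
have hsh (x : R) : sin (x - pi / 2) = - cos x by rewrite sinB sin_pihalf cos_pihalf; ring.
have hsh' (x : R) : sin (x + pi / 2) = cos x by rewrite sinD sin_pihalf cos_pihalf; ring.
rewrite inE => /orP[hr|/eqP ->]; apply/prodf_neq0 => p hp.
  have [->|hne] := eqVneq p r.
    have hr' : (r < partner r)%N by exact: hr.
    rewrite leqnn hr' /= Hop // opprD addrA subrr add0r sinN sin_pihalf oppr_eq0 oner_eq0 //.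
  have hne' : r != p by rewrite eq_sym.
  have [h1 h2] := sin_cos_neq0 (Hgen hr hp hne'); case: ifP => _ //.
  by rewrite Hop // opprD addrA hsh oppr_eq0.
have [->|hne] := eqVneq p first_label.
  by rewrite ltnn andbF Hop ?opener_first // addrAC subrr add0r sin_pihalf oner_eq0.
have hne' : first_label != p by rewrite eq_sym.
have [h1 h2] := sin_cos_neq0 (Hgen opener_first hp hne').
rewrite (Hop opener_first); case: ifP => _; last by rewrite addrAC hsh'.
rewrite (Hop hp); have -> : thp first_label + pi / 2 - (thp p + pi / 2) = thp first_label - thp p by ring.
by [].
Qed.

Definition sp (i : 'I_N.+1) : 'I_n := enum_val (cast_ord (esym card_spectrum) i).
Lemma sp_in i : sp i \in spectrum. Proof. exact: enum_valP. Qed.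
Lemma sp_inj : injective sp. Proof. by move=> i j /enum_val_inj/cast_ord_inj. Qed.
Definition value_mx (x : R) : 'M[R]_N.+1 := \matrix_(i, k) bvalue (thp (sp i) + x) (sp k).

(** The matrix is triangular by [bvalue_zero] with nonzero diagonal by [bvalue_diag]; a kernel
    vector is tested at its nonzero entry of least label. *)
Lemma value_mx0 : \det (value_mx 0) != 0.
Proof.
apply/negP => /eqP/eqP/det0P[u hu hz]; have [i0 hi0] : exists i, u 0 i != 0.
  apply/existsP; rewrite -negb_forall; apply/negP => /forallP h; move/negP: hu; apply; apply/eqP/rowP => i.
  by rewrite mxE; apply/eqP; exact: h.
have [i hi hmin] := @arg_minnP _ i0 (fun i => u 0 i != 0) (fun i => nat_of_ord (sp i)) hi0.
have := congr1 (fun M : 'rV_N.+1 => M 0 i) hz; rewrite !mxE (bigD1 i) //= big1 ?addr0.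
  rewrite mxE addr0 => /eqP; rewrite mulf_eq0 (negbTE hi) /=; apply/negP/bvalue_diag; exact: sp_in.
move=> k hk; have [h|h] := eqVneq (u 0 k) 0; first by rewrite h mul0r.
rewrite mxE addr0 bvalue_zero ?mulr0 ?sp_in // ltn_neqAle hmin // andbT.
by rewrite val_eqE (inj_eq sp_inj) eq_sym.
Qed.

Lemma cont0_det m (A : R -> 'M[R]_m) : (forall i j, cont0 (fun x => A x i j)) -> cont0 (fun x => \det (A x)).
Proof.
move=> h; rewrite /determinant; apply: cont0_sum => s; apply: cont0M; first exact: cont0_cst.
by apply: cont0_prod => i; exact: h.
Qed.

(** At shift 0 the exponentials are singular. A small positive shift makes all sines nonzero and
    keeps the determinant nonzero. *)
Lemma good_shift : exists x, \det (value_mx x) != 0 /\ forall i p, sin (thp (sp i) + x - thp p) != 0.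
Proof.
have h1 : \forall x \near ((0 : R)^'+)%classic, \det (value_mx x) != 0.
  apply: near_neq0; last exact: value_mx0.
  apply: cont0_det => i j.
  have -> : (fun x => value_mx x i j) = (fun x => bvalue (thp (sp i) + x) (sp j)) by apply: funext => x; rewrite mxE.
  apply: cont0_prod => p; case: (p <= sp j < partner p)%N; apply: cont0_sin; (apply: cont0B; last exact: cont0_cst);
    (apply: cont0D; [exact: cont0_cst|exact: cont0_id]).
have h2 : \forall x \near ((0 : R)^'+)%classic, forall i p, sin (thp (sp i) + x - thp p) != 0.
  apply: filter_forall => i; apply: filter_forall => p.
  apply: filterS (near_sin_neq0 (thp (sp i) - thp p) (oner_neq0 R)) => x.
  by have -> : thp (sp i) - thp p + 1 * x = thp (sp i) + x - thp p by ring.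
by have [x _ [h3 h4]] := near_right_ex (filterI h1 h2); exists x.
Qed.

Hypothesis Hpos : forall d, col (tfrom d) -> 0 < conduct d.
Local Notation holo := (@holomorphic R nT tiles col conduct).
Local Notation cur := (current tfrom (@topp nT) conduct).

Lemma conduct_ge0 d : 0 <= conduct d.
Proof. by have [/Hpos/ltW|h] := boolP (col (tfrom d)) => //; rewrite /conduct (negbTE h). Qed.
Lemma conduct_white d : ~~ col (tfrom d) -> conduct d = 0.
Proof. by rewrite /conduct => /negbTE ->. Qed.

Lemma expo_good phi : (forall p, sin (phi - thp p) != 0) -> good (expo phi).
Proof.
move=> HX; split; last exact: expo_relation.
apply: expo_holomorphic => // d hd; have := Hpos hd; rewrite /conduct hd /tan.
by case: eqP => // ->; rewrite invr0 mulr0 ltxx.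
Qed.

Lemma bk_subproof (q : 'I_N) : (2 * q < n)%N. Proof. by have := ltn_ord q; lia. Qed.
Definition bk q : 'I_n := Ordinal (bk_subproof q).
Lemma trace_bk H q : trace H (bk q) = H (bvert q).
Proof.
rewrite /trace bvertE; congr (H (wv _)); apply: val_inj; rewrite /= modn_small //; by have := ltn_ord q; lia.
Qed.
Lemma even_bk (j : 'I_n) : ~~ odd j -> exists q, j = bk q.
Proof.
move=> hj; have hq : (j./2 < N)%N by have := ltn_ord j; lia.
by exists (Ordinal hq); apply: val_inj => /=; lia.
Qed.
Lemma bk_inj : injective bk.
Proof. by move=> p q /(congr1 val) /= h; apply: val_inj => /=; lia. Qed.
Lemma odd_bk q : odd (bk q) = false. Proof. by rewrite /= oddM. Qed.

(** Passing a black boundary vertex changes the white value by the current there, and at most N of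
    them are passed. *)
Lemma white_bound H K : holo H -> (forall x, `|cur H x| <= K) ->
  forall j : 'I_n, odd j -> `|trace H j - H (wv first_label)| <= n%:R * K.
Proof.
move=> hH hK; have K0 : 0 <= K by exact: le_trans (normr_ge0 _) (hK (0, 0)).
have hm m (hm : (2 * m < n)%N) : `|H (wv (Ordinal hm)) - H (wv first_label)| <= m%:R * K.
  elim: m hm => [|m IH] hm.
    have -> : Ordinal hm = first_label by exact: val_inj.
    by rewrite subrr normr0 mul0r.
  have h1 : (2 * m < n)%N by lia.
  have h2 : ((2 * m).+1 < n)%N by lia.
  have := holomorphic_boundary HT Htau (c := conduct) (j := Ordinal h2) hH.
  have -> : ordS (Ordinal h2) = Ordinal hm by apply: val_inj; rewrite /= modn_small; lia.
  have -> : ord_pred (Ordinal h2) = Ordinal h1 by apply: val_inj; rewrite /= ?addSn /= modnDr modn_small.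
  rewrite /= oddM => /(_ isT) e; rewrite -natr1 mulrDl mul1r.
  have -> : H (wv (Ordinal hm)) - H (wv first_label) = (H (wv (Ordinal h1)) - H (wv first_label)) + cur H (wv (Ordinal h2)).
    by rewrite e; ring.
  apply: le_trans (ler_normD _ _) _; apply: lerD; [exact: IH|exact: hK].
move=> j hj; rewrite /trace.
have h1 : (2 * ((j.+1 %% n)./2) < n)%N by have := ltn_pmod j.+1 (sides_gt0 HT); lia.
have e : ordS j = Ordinal h1.
  apply: val_inj; have := ltn_ord j; rewrite leq_eqVlt => /orP[/eqP h|h] /=; first by rewrite h modnn.
  by rewrite modn_small //; lia.
rewrite e; apply: le_trans (hm _ h1) _; apply: ler_wpM2r => //; rewrite ler_nat; lia.
Qed.

(** Zero boundary voltages force zero flow, and the currents are the differences of consecutive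
    white values. *)
Lemma white_const H : holo H -> (forall q, H (bvert q) = 0) ->
  forall j : 'I_n, odd j -> trace H j = H (wv first_label).
Proof.
move=> hH h0 j hj.
have hz := harmonic_zero (@toppK nT) (bvert_inj HT) conduct_ge0 (conduct_topp Hop)
  (holomorphic_harmonic HT Htau conduct_white hH) h0.
have := white_bound hH (K := 0) _ hj; rewrite mulr0 normr_le0 subr_eq0 => /(_ _)/eqP -> //.
by move=> x; rewrite /current big1 ?normr0.
Qed.

(** The exponentials span N + 1 dimensions of boundary values. By [white_const] restriction to the N
    black vertices has a kernel of dimension at most 1; so it is onto, and its kernel is spanned by
    the values 0 on black and 1 on white. *)
Lemma good_solutions : (forall q, exists H, good H /\ forall r, H (bvert r) = (r == q)%:R) /\
  exists H, [/\ good H, forall r, H (bvert r) = 0 & forall j : 'I_n, odd j -> trace H j = 1].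
Proof.
have [x [hdet hX]] := good_shift.
pose E i := expo (thp (sp i) + x).
have hE i : good (E i) by apply: expo_good => p; exact: hX.
pose Ga : 'M[R]_(N.+1, n) := \matrix_(i, j) trace (E i) j.
pose comb (u : 'rV[R]_N.+1) := fun z => \sum_i u 0 i * E i z.
have hcomb u : good (comb u) by exact: good_lin.
have htr u j : trace (comb u) j = (u *m Ga) 0 j.
  by rewrite !mxE; apply: eq_bigr => i _; rewrite mxE.
pose s k := qsign R (height HT Htau sg (wv (ordS k))).
have hs k : s k * s k = 1 by rewrite /s /qsign; case: ifP; rewrite ?mulr1 ?mulrNN ?mulr1.
(* Selects the columns of the spectrum and removes the sign [s], so that the product is
   [value_mx]. *)
pose Sel : 'M[R]_(n, N.+1) := \matrix_(j, k) ((j == sp k)%:R * s (sp k)).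
have hSel : Ga *m Sel = value_mx x.
  apply/matrixP => i k; rewrite !mxE (bigD1 (sp k)) //= big1 ?addr0; last first.
    by move=> j /negbTE hj; rewrite !mxE hj mul0r mulr0.
  by rewrite !mxE eqxx mul1r expo_bvalue //; rewrite -/(s _) mulrAC hs mul1r.
have hfree : row_free Ga.
  apply/row_freeP; exists (Sel *m invmx (value_mx x)); rewrite mulmxA hSel mulmxV //.
  by rewrite unitmxE unitfE.
pose P : 'M[R]_(n, N) := \matrix_(j, q) (j == bk q)%:R.
have hP u q : (u *m Ga *m P) 0 q = comb u (bvert q).
  rewrite -trace_bk htr [LHS]mxE (bigD1 (bk q)) //= [P _ _]mxE eqxx mulr1 big1 ?addr0 // => j /negbTE hj.
  by rewrite [P _ _]mxE hj mulr0.
pose rho : 'rV[R]_n := \row_j (odd j)%:R.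
have hker u : u *m Ga *m P = 0 -> u *m Ga = comb u (wv first_label) *: rho.
  move=> h0; have hb q : comb u (bvert q) = 0 by rewrite -hP h0 mxE.
  apply/rowP => j; rewrite -htr !mxE; have [hj|hj] := boolP (odd j).
    by rewrite mulr1; apply: white_const => //; case: (hcomb u).
  by have [q ->] := even_bk hj; rewrite trace_bk hb mulr0.
have hcap : (Ga :&: kermx P <= rho)%MS.
  apply/rV_subP => y; rewrite sub_capmx => /andP[/submxP[u ->] /sub_kermxP hy].
  by rewrite (hker _ hy) scalemx_sub.
have hr := mxrank_mul_ker Ga P; have hG1 : \rank Ga = N.+1 by apply/eqP.
have hr1 := leq_trans (mxrankS hcap) (rank_leq_row _); have hr2 := rank_leq_col (Ga *m P).
have hrk : \rank (Ga *m P) = N /\ \rank (Ga :&: kermx P)%MS = 1%N.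
  by move: hr hr1 hr2; rewrite hG1; move: (\rank _) (\rank _) => a1 a2; lia.
split.
  move=> q; have hfull : row_full (Ga *m P) by rewrite /row_full hrk.1.
  have /submxP[u hu] := submx_full (delta_mx 0 q : 'rV[R]_N) hfull.
  by exists (comb u); split=> // r; rewrite -hP -mulmxA -hu mxE eqxx.
have hne : (Ga :&: kermx P)%MS != 0 by rewrite -mxrank_eq0 hrk.2.
have /rowV0Pn[y] := hne; rewrite sub_capmx => /andP[/submxP[u ->] /sub_kermxP hy] hy0.
have he := hker _ hy; set t := comb u _ in he.
have ht : t != 0 by apply/eqP => t0; move/eqP: hy0; apply; rewrite he t0 scale0r.
pose u' := t^-1 *: u; have he' : u' *m Ga = rho by rewrite -scalemxAl he scalerA mulVf // scale1r.
exists (comb u'); split=> // [r|j hj].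
  by rewrite -trace_bk htr he' mxE odd_bk.
by rewrite htr he' mxE hj.
Qed.

Lemma current_bound H q S : holo H -> (forall r, H (bvert r) = (r == q)%:R) -> \sum_d conduct d <= S ->
  forall x, `|cur H x| <= 2 * S.
Proof.
move=> hH hq hS x.
have he := energy_le (@toppK nT) (bvert_inj HT) (conduct_topp Hop)
  (holomorphic_harmonic HT Htau conduct_white hH) hq conduct_ge0 hS.
have hterm d : `|flow tfrom (@topp nT) conduct H d| <= conduct d + conduct d * (H (tfrom (topp d)) - H (tfrom d)) ^+ 2.
  rewrite /flow normrM (ger0_norm (conduct_ge0 d)); move: (H _ - H _) => y.
  suff hy : `|y| <= 1 + y ^+ 2 by have := ler_wpM2l (conduct_ge0 d) hy; rewrite mulrDr mulr1.
  rewrite -(real_normK (num_real y)); have := sqr_ge0 (`|y| - 1); have := normr_ge0 y.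
  by move: `|y| => k; rewrite !expr2; nra.
apply: le_trans (ler_norm_sum _ _ _) _.
apply: le_trans (_ : \sum_d (conduct d + conduct d * (H (tfrom (topp d)) - H (tfrom d)) ^+ 2) <= _).
  rewrite big_mkcond; apply: ler_sum => d _; case: ifP => _; first exact: hterm.
  by apply: addr_ge0; [exact: conduct_ge0|apply: mulr_ge0; [exact: conduct_ge0|exact: sqr_ge0]].
by rewrite big_split /=; move: hS he; move: (\sum_d conduct d) (\sum_d _) => a1 a2; lra.
Qed.

Hypothesis HN : (1 < N)%N.

(** The three-term relation for the function that is 0 on black and 1 on white; [q] is any index
    other than [p], available because N exceeds 1. *)
Lemma set_one_previous p : (1 <= p <= N)%N -> Dl (set_one N (previous_index N p)) = Dl (set_one N p).
Proof.
move=> hp; have [_ [H [[_ hr] h0 h1]]] := good_solutions.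
pose q := if p == 1%N then 2%N else 1%N.
have hq : (1 <= q <= N)%N /\ p <> q by rewrite /q; case: eqP; lia.
have hx : ((2 * q).-2 < n)%N by lia.
have hy : ((2 * p).-1 < n)%N by lia.
have hz : ((prev_even N p).-1 < n)%N by rewrite /prev_even; case: eqP; lia.
have := three_terms hr (p := p) (q := q) (x := Ordinal hx) (y := Ordinal hy) (z := Ordinal hz) hp hq.1 hq.2 erefl erefl erefl.
have hb (r : 'I_n) : ~~ odd r -> trace H r = 0 by move=> /even_bk[q' ->]; rewrite trace_bk h0.
have e1 : odd (Ordinal hy) by rewrite /=; lia.
have e2 : odd (Ordinal hz) by rewrite /= /prev_even; case: eqP; lia.
have e3 : ~~ odd (Ordinal hx) by rewrite /=; lia.
rewrite (h1 _ e1) (h1 _ e2) (hb _ e3) mul0r !mul1r => /(_ (fun r h _ => hb r h))/esym/eqP; rewrite subr_eq0 => /eqP //.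
Qed.

Lemma set_one_const p : (1 <= p <= N)%N -> Dl (set_one N p) = Dl (set_one N N).
Proof.
elim: p => // p IH hp; have [h0|h0] := posnP p.
  by rewrite -(set_one_previous hp) h0.
rewrite -(set_one_previous hp) /previous_index; case: eqP => h; first lia.
by apply: IH; lia.
Qed.

(** The three-term relation for the solution with voltage 1 at [q]: its right side is a difference
    of the white values next to [B_p], that is, the current at [p]. Compared with the response
    matrix, [p] and [q] are exchanged; [current_compare] undoes this by reciprocity. *)
Lemma set_two_current (p q : 'I_N) : p != q -> exists H, [/\ holo H, forall r, H (bvert r) = (r == q)%:R
  & Dl (set_two N p.+1 q.+1) = Dl (set_one N N) * cur H (bvert p)].
Proof.
move=> hpq; have [/(_ q)[H [[hH hr] hq]] _] := good_solutions; exists H; split=> //.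
have hp1 : (1 <= p.+1 <= N)%N by rewrite ltn_ord.
have hq1 : (1 <= q.+1 <= N)%N by rewrite ltn_ord.
have hne : p.+1 <> q.+1 by move=> [] /val_inj e; rewrite e eqxx in hpq.
have hy : ((2 * p.+1).-1 < n)%N by lia.
have hz : ((prev_even N p.+1).-1 < n)%N by rewrite /prev_even; case: eqP; lia.
have hx : bk q = (2 * q.+1).-2 :> nat by rewrite /=; lia.
have := three_terms hr (p := p.+1) (q := q.+1) (x := bk q) (y := Ordinal hy) (z := Ordinal hz) hp1 hq1 hne hx erefl erefl.
rewrite trace_bk hq eqxx mul1r => ->; last first.
  move=> r /even_bk[q' ->]; rewrite trace_bk hq (inj_eq bk_inj) => /negbTE -> //.
rewrite (set_one_const hp1) (set_one_const (p := previous_index N p.+1)); last first.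
  by rewrite /previous_index; case: eqP; lia.
have := holomorphic_boundary HT Htau (c := conduct) (j := Ordinal (bvert_subproof p)) hH.
rewrite -bvertE /= oddM => /(_ isT) ->; rewrite /trace.
have -> : ordS (Ordinal hy) = ordS (Ordinal (bvert_subproof p)).
  by congr ordS; apply: val_inj => /=; lia.
have -> : ordS (Ordinal hz) = ord_pred (Ordinal (bvert_subproof p)).
  apply: (can_inj (@ord_predK _)); rewrite ?ordSK; apply: (can_inj (@ordSK _)); rewrite ?ord_predK.
  apply: val_inj => /=; rewrite /prev_even; have := ltn_ord p; case: eqP => h hp.
    have -> : nat_of_ord p = 0%N by lia.
    by rewrite prednK ?(sides_gt0 HT) // modnn modn_small //; lia.
  by have -> : ((2 * p.+1 - 2).-1.+1 = 2 * p)%N by [lia]; rewrite modnDr.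
ring.
Qed.

Lemma mem_set_one (i : 'I_n) : (i \in set_one N N) = ~~ odd i || (i == n.-1 :> nat).
Proof. by rewrite inE /=; congr orb; apply/eqP/eqP; have := sides_gt0 HT; lia. Qed.

Lemma card_set_one : #|set_one N N| = N.+1.
Proof.
have hn := sides_gt0 HT; have hl : (n.-1 < n)%N by lia.
rewrite -sum1_card big_mkcond /=.
have e (i : 'I_n) : (if i \in set_one N N then 1 else 0)%N = ((if (i < n)%N then ~~ odd i : nat else 0) + (i == Ordinal hl))%N.
  rewrite mem_set_one ltn_ord -val_eqE /=; case: eqP => [->|_]; rewrite ?orbT ?orbF ?addn0; last by case: (odd i).
  by have -> : odd n.-1 by lia.
rewrite (eq_bigr _ (fun i _ => e i)) big_split /= -big_mkcond (count_even (leqnn _)).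
rewrite (bigD1 (Ordinal hl)) //= eqxx big1 ?addn0; last by move=> i /negbTE ->.
lia.
Qed.

(** The solutions of [good_solutions], corrected by a multiple of the second kind to vanish at the
    last index, are dual to the elements of [set_one N N] and bounded in terms of [S]. The resulting
    constant is uniform in the perturbation. *)
Lemma exchange S (I : {set 'I_n}) : \sum_d conduct d <= S -> #|I| = N.+1 ->
  `|Dl I| <= (n%:R * (1 + n%:R * (2 * S))) ^+ #|I :\: set_one N N| * `|Dl (set_one N N)|.
Proof.
move=> hS hI; have hS0 : 0 <= S by apply: le_trans hS; apply: sumr_ge0 => d _; exact: conduct_ge0.
have hC : 0 <= n%:R * (2 * S) by rewrite !mulr_ge0.
have [hsol [H1 [g1 z1 w1]]] := good_solutions.
have hb1 (r : 'I_n) : ~~ odd r -> trace H1 r = 0 by move=> /even_bk[q' ->]; rewrite trace_bk z1.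
have hex o : exists H, o \in set_one N N -> [/\ relation Dl (trace H), forall j, `|trace H j| <= 1 + n%:R * (2 * S)
    & forall o', o' \in set_one N N -> trace H o' = (o' == o)%:R].
  have [ho|ho] := boolP (odd o).
    exists H1 => hin; split; first by case: g1.
      by move=> j; have [hj|hj] := boolP (odd j); [rewrite w1 // normr1; lra|rewrite hb1 // normr0; lra].
    move=> o'; move: hin; rewrite !mem_set_one ho /= => /eqP hin; have [hj|hj] := boolP (odd o') => /=.
      by move/eqP => e; rewrite w1 //; have -> : o' = o by [apply: val_inj; rewrite /= e hin]; rewrite eqxx.
    by rewrite hb1 //; case: eqP => // e; rewrite e ho in hj.
  have [q hq] := even_bk ho; have [H [gH hH]] := hsol q.
  (* The polygon closes at its first vertex, so [t] is the value of [trace H] at the last index. *)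
  pose t := H (wv first_label).
  pose K z := \sum_(i : bool) (if i then 1 else - t) * (if i then H else H1) z.
  have hK : good K by apply: (@good_lin _ (fun i : bool => if i then 1 else - t) (fun i : bool => if i then H else H1)) => -[].
  have eK j : trace K j = trace H j - t * trace H1 j by rewrite /trace /K big_bool /=; ring.
  have hwb := white_bound gH.1 (current_bound gH.1 hH hS).
  have hlast (j : 'I_n) : j = n.-1 :> nat -> trace H j = t.
    move=> e; rewrite /trace /t; congr (H (wv _)); apply: val_inj; rewrite /= e prednK ?modnn //; exact: (sides_gt0 HT).
  exists K => _; split; first by case: hK.
    move=> j; rewrite eK; have [hj|hj] := boolP (odd j).
      by rewrite w1 // mulr1; apply: le_trans (hwb _ hj) _; lra.
    rewrite hb1 // mulr0 subr0; have [r ->] := even_bk hj; rewrite trace_bk hH.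
    by case: (_ == _); rewrite ?normr1 ?normr0; lra.
  move=> o'; rewrite mem_set_one eK; have [hj|hj] := boolP (odd o') => /=.
    move/eqP => e; rewrite hlast // w1 // mulr1 subrr; case: eqP => // e'; by rewrite e' (negbTE ho) in hj.
  by move=> _; rewrite hb1 // mulr0 subr0; have [r ->] := even_bk hj; rewrite trace_bk hH hq (inj_eq bk_inj).
have /choice[Hf hf] := hex.
have gC : 0 <= 1 + n%:R * (2 * S) by lra.
apply: (exchange_bound (g := fun o => trace (Hf o)) gC) => //.
- by move=> o j ho; have [_ h _] := hf o ho; exact: h.
- by move=> o o' ho ho'; have [_ _ h] := hf o ho; exact: h.
- by move=> o ho; have [h _ _] := hf o ho.
- by rewrite hI card_set_one.
Qed.

End PerturbedNetwork.

(** * Geometric conductances as tangents, and the choice of perturbation *)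

Section Conductances.
Variables (R : realType) (N : nat) (z0 : R * R) (v : nat -> R * R) (nT : nat).
Variables (tiles : 'I_nT -> tile R) (col : R * R -> bool) (tau : nat -> nat).
Hypotheses (HT : rhombus_tiling N z0 v tiles col) (Htau : is_pairing N z0 v tiles tau).
Local Notation pt := (R * R)%type.
Local Notation n := (2 * N)%N.
Local Notation tfrom := (tfrom tiles).
Local Notation lab := (lab HT Htau).
Local Notation partner := (partner HT Htau).
Local Notation wv := (@wv R N z0 v).
Local Notation vv := (@vv R N v).
Local Notation f := (boundary_perm HT Htau).
Local Notation bperm := (@boundary_perm_inj _ _ _ _ _ _ _ _ HT Htau).
(** From one vertex to the next, the exponents paired with the side vectors change by minus twice
    the side, since [partner] reverses vectors; adding twice the position gives a constant. *)
Lemma chord_vector (c : pt -> R) : (forall x y, c (padd x y) = c x + c y) -> (forall x, c (pscale (-1) x) = - c x) ->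
  forall i : 'I_n, \sum_p ((invF bperm p < i)%N%:R - (p <= i)%N%:R : int)%:~R * c (vv p) + 2 * c (wv (ordS i)) =
   2 * c (wv (side1 HT)) + c (vv (side1 HT)).
Proof.
move=> hD hN i.
have hsum (p0 : 'I_n) : \sum_p (p == p0)%:R * c (vv p) = c (vv p0).
  by rewrite (bigD1 p0) //= eqxx mul1r big1 ?addr0 // => p /negbTE ->; rewrite mul0r.
have nz (bb : bool) : ((bb%:R : int)%:~R : R) = bb%:R by case: bb.
have eB (b1 b2 : bool) : ((b1%:R - b2%:R : int)%:~R : R) = b1%:R - b2%:R by rewrite intrB !nz.
case: i => k hk; elim: k hk => [|k IH] hk.
  have e : Ordinal hk = side1 HT by exact: val_inj.
  rewrite (wv_next HT) hD e mulrDr addrCA; congr (_ + _).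
  rewrite (eq_bigr (fun p => - ((p == side1 HT)%:R * c (vv p)))); last first.
    by move=> p _; rewrite eB ltn0 sub0r mulNr leqn0 -val_eqE.
  by rewrite sumrN hsum; ring.
have hk' : (k < n)%N by exact: ltnW.
have e : ordS (Ordinal hk') = Ordinal hk by apply: val_inj; rewrite /= modn_small.
rewrite -(IH hk') (wv_next HT) hD -e mulrDr addrA addrAC [in RHS]addrC [LHS]addrC; congr (_ + _); rewrite e.
rewrite (eq_bigr (fun p => ((invF bperm p < k)%N%:R - (p <= k)%N%:R : int)%:~R * c (vv p) +
   ((p == f (Ordinal hk'))%:R * c (vv p) - (p == Ordinal hk)%:R * c (vv p)))); last first.
  move=> p _; rewrite !eB -mulrBl -mulrDl; congr (_ * _).
  have e1 : (p == f (Ordinal hk')) = (invF bperm p == Ordinal hk').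
    by apply/eqP/eqP => [->|<-]; [exact: (invF_f bperm)|exact: (esym (f_invF bperm p))].
  rewrite e1 -!val_eqE /= ltnS.
  have E (x y : nat) : ((x <= y)%N%:R : R) = (x == y)%:R + (x < y)%N%:R by case: ltngtP => //; rewrite ?addr0 ?add0r.
  by rewrite (E (invF bperm p)) (E p k.+1) ltnS; ring.
rewrite big_split sumrB !hsum /= /boundary_perm e (vv_partner HT Htau) hN; ring.
Qed.

(** The boundary polygon is simple, and by [chord_vector] the exponents determine the vertex. This
    supplies the hypothesis of [boundary_angle_le]. *)
Lemma chord_distinct (i j : 'I_n) :
  (forall p : 'I_n, (invF bperm p < i)%N%:R - (p <= i)%N%:R = (invF bperm p < j)%N%:R - (p <= j)%N%:R :> int) -> i = j.
Proof.
move=> h; apply: (@ordS_inj n); apply: (wv_inj HT).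
have hc (c : pt -> R) : (forall x y, c (padd x y) = c x + c y) -> (forall x, c (pscale (-1) x) = - c x) -> c (wv (ordS i)) = c (wv (ordS j)).
  move=> h1 h2; have := chord_vector h1 h2 i; rewrite -(chord_vector h1 h2 j).
  rewrite (eq_bigr (fun p => ((invF bperm p < j)%N%:R - (p <= j)%N%:R : int)%:~R * c (vv p))); last by move=> p _; rewrite h.
  by move/addrI/(mulfI _) => -> //; rewrite pnatr_eq0.
by apply: pt_eq; apply: hc => *; rewrite /= ?mulN1r.
Qed.

Lemma corner_tfrom d : is_corner (tiles d.1) (tfrom d).
Proof.
case: d => i [c o]; rewrite (tfromE tiles) /dart_corner /is_corner /=.
by case: ccw; case: c; case: o; rewrite eqxx ?orbT.
Qed.

Variable th : 'I_n -> R.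
Hypothesis Hv : forall i, vv i = (cos (2 * th i), - sin (2 * th i)).
Local Notation conduct0 := (conduct HT Htau th).

(** The diagonals of a rhombus with side parameters [x] and [y] have lengths [|2 * sin (x - y)|] and
    [|2 * cos (x - y)|]. *)
Lemma conduct_conductance d : col (tfrom d) -> conduct0 d = conductance col (tiles d.1) /\ 0 < conduct0 d.
Proof.
move=> hd; rewrite (conductance_dart HT hd) !(tdir_lab HT Htau) /conduct hd.
have := cross_lab HT Htau d; rewrite !Hv.
move: (th (lab d)) (th (lab (tnext tiles d))) => x y.
have hX : pcross (cos (2 * x), - sin (2 * x)) (cos (2 * y), - sin (2 * y)) = 2 * (sin (x - y) * cos (x - y)).
  have -> : 2 * (sin (x - y) * cos (x - y)) = sin ((x - y) + (x - y)) by rewrite (sinD (x - y)); ring.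
  have -> : (x - y) + (x - y) = 2 * x - 2 * y by ring.
  by rewrite sinB /pcross /=; ring.
have hc2 : cos (2 * x) * cos (2 * y) + sin (2 * x) * sin (2 * y) = cos (x - y) ^+ 2 - sin (x - y) ^+ 2.
  rewrite -cosB; have -> : 2 * x - 2 * y = (x - y) + (x - y) by ring.
  by rewrite (cosD (x - y)) !expr2.
have px := cos2Dsin2 (2 * x); have py := cos2Dsin2 (2 * y); have pd := cos2Dsin2 (x - y).
have h1 : pnorm (psub (cos (2 * x), - sin (2 * x)) (cos (2 * y), - sin (2 * y))) = `|2 * sin (x - y)|.
  rewrite /pnorm -sqrtr_sqr; congr Num.sqrt; rewrite /psub /=.
  move: px py pd hc2; rewrite !expr2; lra.
have h2 : pnorm (padd (cos (2 * x), - sin (2 * x)) (cos (2 * y), - sin (2 * y))) = `|2 * cos (x - y)|.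
  rewrite /pnorm -sqrtr_sqr; congr Num.sqrt; rewrite /padd /=.
  move: px py pd hc2; rewrite !expr2; lra.
rewrite hX h1 h2 pmulr_rgt0 // => hpos; rewrite /tan.
have hcn : cos (x - y) != 0 by apply/eqP => e; move: hpos; rewrite e mulr0 ltxx.
have ht : 0 < sin (x - y) / cos (x - y).
  have -> : sin (x - y) / cos (x - y) = sin (x - y) * cos (x - y) / cos (x - y) ^+ 2 by field.
  by rewrite divr_gt0 // lt_neqAle sqr_ge0 andbT eq_sym expf_eq0.
split=> //; rewrite !normrM -mulf_div divff ?normr_eq0 ?pnatr_eq0 // mul1r.
by rewrite -{1}(gtr0_norm ht) normrM normfV.
Qed.

Lemma potential_harmonic (p : 'I_N) u : potential N z0 v tiles col p.+1 u ->
  harmonic tfrom (@topp nT) (@bvert R N z0 v) conduct0 u /\ forall r, u (@bvert R N z0 v r) = (r == p)%:R.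
Proof.
move=> [hb hi]; split; last by move=> r; rewrite /bvert hb // ltn_ord.
move=> d hd; have [hc|hc] := boolP (col (tfrom d)); last first.
  by rewrite /current big1 // => e /eqP he; rewrite /flow /conduct he (negbTE hc) mul0r.
rewrite -(inflow_darts HT u hc (c := conduct0)); last by move=> e /conduct_conductance[].
apply: hi => //; first by exists d.1; exact: corner_tfrom.
by case=> [|q] // hq; apply/eqP => e; apply: (hd (Ordinal (hq : (q < N)%N))); rewrite e.
Qed.

(** Equal on paired sides, which preserves their difference pi/2, and distinct for distinct pairs,
    which makes the perturbed parameters generic. *)
Definition label_rank (i : 'I_n) : R := (minn i (partner i))%:R.
Definition perturb (x : R) (i : 'I_n) : R := th i + x * label_rank i.
Lemma perturb0 i : perturb 0 i = th i.
Proof. by rewrite /perturb mul0r addr0. Qed.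
Lemma perturb_opener x : (forall p, opener HT Htau p -> th (partner p) = th p + pi / 2) ->
  forall p, opener HT Htau p -> perturb x (partner p) = perturb x p + pi / 2.
Proof. by move=> h p hp; rewrite /perturb h // /label_rank partnerK minnC; ring. Qed.

Lemma cont0_perturb i j : cont0 (fun x => perturb x i - perturb x j).
Proof.
by apply: cont0B; (apply: cont0D; [exact: cont0_cst|apply: cont0M; [exact: cont0_id|exact: cont0_cst]]).
Qed.

Lemma cont0_conduct d : cont0 (fun x => conduct HT Htau (perturb x) d).
Proof.
rewrite /conduct; have [hd|hd] := boolP (col (tfrom d)); last exact: cont0_cst.
apply: cont0_comp; first exact: cont0_perturb.
have [_] := conduct_conductance hd; rewrite /conduct hd /tan => h.
by apply: continuous_tan; rewrite !perturb0; apply/eqP => e; move: h; rewrite e invr0 mulr0 ltxx.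
Qed.

Lemma conduct_perturb0 d : conduct HT Htau (perturb 0) d = conduct0 d.
Proof. by rewrite /conduct !perturb0. Qed.

Lemma perturb_generic : \forall x \near ((0 : R)^'+)%classic, forall p r, opener HT Htau p -> opener HT Htau r -> p != r ->
  sin (2 * (perturb x p - perturb x r)) != 0.
Proof.
apply: filter_forall => p; apply: filter_forall => r.
have [hp|hp] := boolP (opener HT Htau p); last by apply: filterE => x.
have [hr|hr] := boolP (opener HT Htau r); last by apply: filterE => x.
have [he|hne] := eqVneq p r; first by apply: filterE => x.
have hk : 2 * (p%:R - r%:R) != 0 :> R by rewrite mulf_neq0 ?pnatr_eq0 // subr_eq0 eqr_nat.
apply: filterS (near_sin_neq0 (2 * (th p - th r)) hk) => x hx _ _ _.
suff -> : 2 * (perturb x p - perturb x r) = 2 * (th p - th r) + 2 * (p%:R - r%:R) * x by [].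
rewrite /perturb /label_rank (minn_idPl (ltnW hp)) (minn_idPl (ltnW hr)); ring.
Qed.

Variables (G : plabic n) (b w : pE G -> 'I_n).

Lemma cont0_Delta (I : {set 'I_n}) : cont0 (fun x => Delta (weight b w (perturb x)) I).
Proof.
apply: cont0_sum => A; apply: cont0_prod => e; rewrite /weight; case: (is_bnd (peB e)); first exact: cont0_cst.
by apply: cont0M; [exact: cont0_cst|apply: cont0_sin; exact: cont0_perturb].
Qed.

End Conductances.

Lemma cont0_eq (R : realType) (f g : R -> R) : cont0 f -> cont0 g ->
  (\forall x \near ((0 : R)^'+)%classic, f x = g x) -> f 0 = g 0.
Proof.
move=> hf hg h; apply/eqP; rewrite eq_le; apply/andP; split; apply: cont0_le => //.
  by apply: filterS h => x ->.
by apply: filterS h => x ->.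
Qed.

Theorem mainTheorem5
  (R : realType)
  (* the region and its rhombus tiling, with the bipartite colouring *)
  (N : nat) (z0 : R * R) (v : nat -> R * R)
  (nT : nat) (tiles : 'I_nT -> tile R) (col : R * R -> bool)
  (Htiling : rhombus_tiling N z0 v tiles col)
  (* the pairing tau_R *)
  (tau : nat -> nat) (Htau : is_pairing N z0 v tiles tau)
  (* theta, f^elec_R-admissible, with v_p = exp(-2 i theta_p) *)
  (theta : nat -> R)
  (Hadm : admissible (2 * N) (fun p => tau ((p %% (2 * N)).+1)) theta)
  (Hv : forall p, (1 <= p <= 2 * N)%N ->
          v p = (cos (2 * theta p), - sin (2 * theta p)))
  (* a reduced graph G with f_G = f^elec_R, weighted by wt_theta *)
  (G : plabic (2 * N)) (HG : plabic_ok G)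
  (Hstrands : forall s q : 'I_(2 * N),
      strand_end G s q <-> q.+1 = tau ((s.+1 %% (2 * N)).+1))
  (Hred : reduced G (N.+1) (aff_of (2 * N) (fun p => tau ((p %% (2 * N)).+1))))
  (wt : pE G -> R) (Hwt : wt_theta theta wt) :
  exists c : R, c != 0 /\
    forall p q : nat, (1 <= p <= N)%N -> (1 <= q <= N)%N -> p <> q ->
      Delta wt (lset (2 * N) (fun j => odd j || (j == 2 * p)%N)) = c /\
      (forall u : R * R -> R, potential N z0 v tiles col p u ->
        Delta wt (lset (2 * N) (fun j =>
             [|| odd j && (j != (2 * q).-1)%N, (j == 2 * p)%N |
                 (j == (if p == 1%N then 2 * N else 2 * p - 2))%N]))
        = c * current_out z0 v tiles col u q).
Proof.
(* For N at most 1 there are no two distinct indices, and any nonzero constant will do. *)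
have [hN|HN] := leqP N 1; first by exists 1; split; [exact: oner_neq0|move=> p q; lia].
pose th (i : 'I_(2 * N)) := theta i.+1.
have Hv' i : @vv R N v i = (cos (2 * th i), - sin (2 * th i)) by rewrite /vv Hv // ltn_ord.
pose f := boundary_perm Htiling Htau.
pose finj := @boundary_perm_inj _ _ _ _ _ _ _ _ Htiling Htau : injective f.
have Hg (s : 'I_(2 * N)) : tau ((s.+1 %% (2 * N)).+1) = (f s).+1 by rewrite (partnerE Htiling Htau).
have Hf s : strand_end G s (f s) by apply/Hstrands; rewrite Hg.
have fnofix s : f s != s by exact: boundary_perm_nofix.
have [b [w [HL Hth]]] := reduced_labelling_exists HG finj fnofix Hf Hg Hred (esym (count_descents Htiling Htau)).
have hsrc p : invF finj p != p.
  by apply/negP => /eqP h; have := fnofix p; rewrite -{2}(f_invF finj p) h eqxx.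
have Hcomp : compatible finj th.
  move=> p q hpq hc; apply: (Hadm p.+1 q.+1 isT hpq (ltn_ord q)).
  exact: (crossing_index_f_crossing (finj := finj) Hg).
(* The graph bounds the angles on the boundary; with this the tiling satisfies Euler's formula, and
   the strict bounds that result return to the graph in [hint]. *)
have Hangle i : bangle Htiling Htau th i <= pi.
  have := boundary_angle_le HG HL Hcomp (@chord_distinct _ _ _ _ _ _ _ _ Htiling Htau) i.
  by have [[_ _ hw hb] _] := HL; rewrite /eangle hw hb.
have Hcount := count_descents Htiling Htau.
have hint i : 0 < eangle b w th (pbedge G i).
  have /andP[h _] := bangle_itv Hv' Hangle Hcount i.
  by have [[_ _ hw hb] _] := HL; rewrite /eangle hw hb.
have hwt := weight_gt0 Hwt Hth (fun e => interior_angle HG HL Hcomp hint (e := e)).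
(* All weights are positive, so the coordinate at the boundary set of any almost perfect matching is
   positive. *)
have [A hA hD] := Delta_gt0 HG hwt.
have hcard : #|used_bnd A| = N.+1 by case: Hred => h _; exact: h.
have Hop := opener_angle Hv' Hcomp Hangle Hcount.
have /choice[sg Hsg] : forall p, exists s, side_exponent Htiling Htau p s by move=> p; exact: (side_function Hv' Hangle Hcount p).
pose thp := perturb Htiling Htau th.
pose c' x := @conduct _ _ _ _ _ _ _ _ Htiling Htau (thp x).
pose c0 := @conduct _ _ _ _ _ _ _ _ Htiling Htau th.
have hw0 : weight b w (thp 0) = wt.
  apply: funext => e; rewrite /weight /thp !perturb0; have [he1 he2] := Hwt e.
  case: ifP => hb; first by rewrite he1.
  have [t1 t2] := Hth e; rewrite -(weight_label Hwt t1 t2) ?hb // mulrA -signr_addb addbb mul1r //.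
pose Dx x := Delta (weight b w (thp x)).
have hDx I : Dx 0 I = Delta wt I by rewrite /Dx hw0.
have hcD I : cont0 (fun x => Dx x I) by exact: cont0_Delta.
pose black d := col (tfrom tiles d).
(* A strict lower bound for the black conductances, so that it persists under small
   perturbations. *)
have [k0 hk0 hk] : exists2 k0, 0 < k0 & forall d, black d -> k0 < c0 d.
  apply: near_right_ex; apply: filter_forall => d; have [hd|hd] := boolP (black d); last by apply: filterE.
  by apply: filterS (nbhs_right_lt (conduct_conductance Htiling Htau Hv' hd).2).
have hc'0 d : c' 0 d = c0 d by exact: conduct_perturb0.
have hcc d : cont0 (fun x => c' x d) by exact: cont0_conduct.
have near1 : \forall x \near ((0 : R)^'+)%classic, forall d, black d -> k0 < c' x d.
  apply: filter_forall => d; have [hd|hd] := boolP (black d); last by apply: filterE.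
  by apply: filterS (near_gt (hcc d) (_ : k0 < c' 0 d)) => //; rewrite hc'0; exact: hk.
(* The extra 1 leaves room for the perturbation. *)
pose S := \sum_d c0 d + 1.
have near2 : \forall x \near ((0 : R)^'+)%classic, \sum_d c' x d < S.
  apply: (near_lt (f := fun x => \sum_d c' x d)); first exact: cont0_sum.
  by rewrite (eq_bigr _ (fun d _ => hc'0 d)) ltrDl.
have near3 := perturb_generic Htiling Htau th.
have near4 : \forall x \near ((0 : R)^'+)%classic, (forall d, black d -> k0 < c' x d) /\ \sum_d c' x d < S /\
    (forall p r, opener Htiling Htau p -> opener Htiling Htau r -> p != r -> sin (2 * (thp x p - thp x r)) != 0) by apply: filterS (filterI near1 (filterI near2 near3)).
have hopx x := perturb_opener x Hop.
have hposx x : (forall d, black d -> k0 < c' x d) -> forall d, col (tfrom tiles d) -> 0 < c' x d.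
  by move=> h d hd; apply: lt_trans hk0 _; exact: h.
pose cc := Delta wt (set_one N N).
(* The positive coordinate at [used_bnd A] is at most a fixed multiple of the one at [set_one N N]
   for all small perturbations, and this bound passes to the limit. *)
have hcc0 : cc != 0.
  pose m := #|used_bnd A :\: set_one N N|; pose K := ((2 * N)%:R * (1 + (2 * N)%:R * (2 * S)) : R) ^+ m.
  have hrf : cont0 (fun x => K * `|Dx x (set_one N N)|) by apply: cont0M; [exact: cont0_cst|exact: cont0_norm].
  have h5 : \forall x \near ((0 : R)^'+)%classic, Dx x (used_bnd A) <= K * `|Dx x (set_one N N)|.
    apply: filterS near4 => x [n1 [n2 n3]].
    apply: le_trans (ler_norm _) _.
    exact: (exchange Hsg HG HL (hopx x) n3 (hposx x n1) HN (ltW n2) hcard).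
  have hle : Delta wt (used_bnd A) <= K * `|cc|.
    by rewrite -!hDx /cc -hDx; exact: (cont0_le (hcD (used_bnd A)) hrf h5).
  by apply/eqP => e; move: hle; rewrite e normr0 mulr0 leNgt hD.
exists cc; split=> // p q hp hq hpq; split.
  rewrite -/(set_one N p) /cc -!hDx.
  apply: (cont0_eq (f := fun x => Dx x (set_one N p)) (g := fun x => Dx x (set_one N N))) => //.
  apply: filterS near4 => x [n1 [n2 n3]].
  exact: (set_one_const Hsg HG HL (hopx x) n3 (hposx x n1) HN hp).
case: p hp hpq => // p hp hpq; case: q hq hpq => // q hq hpq u hu.
pose P : 'I_N := Ordinal (hp : (p < N)%N); pose Q : 'I_N := Ordinal (hq : (q < N)%N).
have hPQ : P != Q by apply/negP => /eqP/(congr1 val) /= e; apply: hpq; rewrite e.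
have [hharm hbd] := potential_harmonic Htiling Htau Hv' (p := P) hu.
have hcur : current_out z0 v tiles col u q.+1 = current (tfrom tiles) (@topp nT) c0 u (@bvert R N z0 v Q).
  rewrite /current_out (inflow_darts Htiling (c := c0)) //.
    by have [_ _ _ _ [_ _ _ _ /(_ q.+1)]] := Htiling; apply.
  by move=> d /(conduct_conductance Htiling Htau Hv')[].
pose B := \sum_d `|u (tfrom tiles (topp d)) - u (tfrom tiles d)|.
have hB d : `|u (tfrom tiles (topp d)) - u (tfrom tiles d)| <= B by rewrite /B (bigD1 d) //= lerDl sumr_ge0.
rewrite -/(set_two N p.+1 q.+1) hcur; set I0 := current _ _ _ _ _.
(* The right side vanishes because the conductances agree at shift 0. Only coordinates and
   conductances pass to the limit here, not the perturbed voltages [H]. *)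
have hlim : 2 * `|Dx 0 (set_two N p.+1 q.+1) - Dx 0 (set_one N N) * I0| <=
    `|Dx 0 (set_one N N)| * ((1 + S / k0) * B * \sum_d `|c' 0 d - c0 d|).
  apply: (cont0_le (f := fun x => 2 * `|Dx x (set_two N p.+1 q.+1) - Dx x (set_one N N) * I0|)
     (g := fun x => `|Dx x (set_one N N)| * ((1 + S / k0) * B * \sum_d `|c' x d - c0 d|))).
  - apply: cont0M; first exact: cont0_cst.
    by apply: cont0_norm; apply: cont0B => //; apply: cont0M => //; exact: cont0_cst.
  - apply: cont0M; first exact: cont0_norm.
    apply: cont0M; first exact: cont0_cst.
    by apply: cont0_sum => d; apply: cont0_norm; apply: cont0B => //; exact: cont0_cst.
  apply: filterS near4 => x [n1 [n2 n3]].
  have [H [hH hHq hE]] := set_two_current Hsg HG HL (hopx x) n3 (hposx x n1) HN hPQ.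
  have {hE}-> : Dx x (set_two N p.+1 q.+1) = Dx x (set_one N N) * current (tfrom tiles) (@topp nT) (c' x) H (@bvert R N z0 v P) by exact: hE.
  rewrite -mulrBr normrM mulrCA; apply: ler_wpM2l => //.
  apply: (current_compare (@toppK nT) (bvert_inj Htiling) (conduct_topp Hop) (conduct_topp (hopx x)) hharm
    (holomorphic_harmonic Htiling Htau (conduct_white Htiling Htau (thp x)) hH) hbd hHq hk0) => //.
  - by move=> d; apply: conduct_ge0; exact: hposx.
  - exact: ltW.
  move=> d hne; have [hd|hd] := boolP (black d); first by apply/ltW/n1.
  by move: hne hd; rewrite /c0 /c' /conduct /black => + /negbTE hd; rewrite hd eqxx.
move: hlim; rewrite [X in _ * (_ * X)]big1 ?mulr0; last by move=> d _; rewrite hc'0 subrr normr0.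
rewrite pmulr_rle0 // normr_le0 subr_eq0 !hDx => /eqP //.
Qed.
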